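(* Let $\Sigma^k\subset(M^n,g)$ be a submanifold of a Riemannian manifold, $n\ge3$, $1\le k\le n-1$, with induced metric $h$ (for the statements about $P_4$, $T$ and $Q_4$ assume $n\neq4$). The first two minimal submanifold extrinsic GJMS operators $P_2$, $P_4$ are given by $$P_2=-\Delta+\frac{k-2}{2}Q_2,\qquad P_4=\Delta^2+\nabla^\alpha(T_{\alpha\beta}\nabla^\beta)+\frac{k-4}{2}Q_4,$$ where $$Q_2=\mathsf P_\alpha{}^\alpha+\frac k2|H|^2,$$ $$T_{\alpha\beta}=4\mathsf P_{\alpha\beta}+4H^{\alpha'}L_{\alpha\beta\alpha'}-\Big[(k-2)\mathsf P_\gamma{}^\gamma+\frac12(k^2-2k+4)|H|^2\Big]h_{\alpha\beta},$$ $$\begin{aligned}Q_4&=-\Delta\Big(\mathsf P_\alpha{}^\alpha+\frac k2|H|^2\Big)-2\Big|\mathsf P_{\alpha\beta}+H^{\alpha'}L_{\alpha\beta\alpha'}-\frac12|H|^2h_{\alpha\beta}\Big|^2+2\Big|\mathsf P_{\alpha\alpha'}-\nabla_\alpha H_{\alpha'}\Big|^2\\&\quad+\frac k2\Big(\mathsf P_\alpha{}^\alpha+\frac k2|H|^2\Big)^2-2W^\alpha{}_{\alpha'\alpha\beta'}H^{\alpha'}H^{\beta'}-4C^\alpha{}_{\alpha\alpha'}H^{\alpha'}-\frac{2}{n-4}B^\alpha{}_\alpha,\end{aligned}$$ and $Q_2$, $Q_4$ are the corresponding extrinsic $Q$-curvatures. Here $L$ and $H$ denote the second fundamental form and mean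 curvature vector of $\Sigma\subset M$, all curvature quantities are of the background metric $g$, $\nabla_\alpha$ denotes the induced connection on $T\Sigma$ and $N\Sigma$, and $\Delta=\nabla^\alpha\nabla_\alpha$.
   Context: **Curvature conventions for $(M^n,g)$.** Indices $i,j,k,l$ refer to $TM$. $R_{ij}=R^k{}_{ikj}$, $R=R^i{}_i$, with sign such that spheres have positive scalar curvature. Schouten tensor: $\mathsf P_{ij}=\frac1{n-2}\big(R_{ij}-\frac{R}{2(n-1)}g_{ij}\big)$. Weyl tensor: $R_{ijkl}=W_{ijkl}+\mathsf P_{ik}g_{jl}-\mathsf P_{jk}g_{il}-\mathsf P_{il}g_{jk}+\mathsf P_{jl}g_{ik}$. Cotton: $C_{ijk}={}^g\nabla_k\mathsf P_{ij}-{}^g\nabla_j\mathsf P_{ik}$. Bach: $B_{ij}={}^g\nabla^kC_{ijk}-\mathsf P^{kl}W_{kijl}$. ($^g\nabla$ is the Levi-Civita connection of $g$.) **Submanifold conventions.** Indices $\alpha,\beta,\gamma$ refer to $T\Sigma$ and $\alpha',\beta'$ to the normal bundle $N\Sigma$; a tensor on $M$ restricted to $\Sigma$ splits into tangential, mixed and normal components. Indices are raised/lowered with the induced metrics $g_{\alpha\beta}=h_{\alpha\beta}$ and $g_{\alpha'\beta'}$; repeated tangential indices are traced over $T\Sigma$ only. $L(X,Y)=({}^g\nabla_XY)^\perp$, components $L_{\alpha\beta}^{\alpha'}$; $H^{\alpha'}=\frac1kL_\alpha{}^{\alpha\alpha'}$. Norms are with respect to the induced metrics. $\nabla^\alpha(T_{\alpha\beta}\nabla^\beta)$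 is the operator $f\mapsto\nabla^\alpha(T_{\alpha\beta}\nabla^\beta f)$. Laplacians have the sign $\Delta=\sum\partial_i^2$ on Euclidean space. **Even Poincaré metric.** Let $X=M\times[0,\epsilon_0)_r$, $\mathring X=M\times(0,\epsilon_0)$. An even Poincaré metric in normal form relative to $g$ is a metric $g_+=r^{-2}(dr^2+g_r)$ on $\mathring X$, with $g_r$ a smooth family of metrics on $M$, $g_0=g$, even Taylor expansion at $r=0$, such that $\mathrm{Ric}(g_+)+ng_+$ vanishes to infinite order at $r=0$ if $n$ is odd, and $|\mathrm{Ric}(g_+)+ng_+|_{g_+}=O(r^n)$ if $n$ is even. It exists, and $g_r$ is unique to infinite order ($n$ odd) or mod $O(r^n)$ ($n$ even). Put $\bar g=r^2g_+$. **Even asymptotically minimal extension.** $Y=\{(\exp_\Sigma U_r(p),r):p\in\Sigma,r\ge0\}\subset X$, with $\exp_\Sigma$ the $g$-normal exponential map of $\Sigma$ and $U_r$ a smooth family of sections of $N\Sigma$, $U_0=0$, with even Taylor expansion in $r$, such that the mean curvature vector $H_Y$ of $Y$ with respect to $g_+$ vanishes to infinite order if $k$ is odd, and $|H_Y|_{\bar g}=O(r^{k+2})$ if $k$ is even. Such $U_r$ exists; it is unique to infinite order (given $g_+$) if $k$ is odd, modulo $O(r^{k+2})$ if $k$ is even. $h_+$ denotes the metric induced on $\mathring Y=Y\cap\mathring X$ by $g_+$; it is asymptotically hyperbolic with conformal infinity $(\Sigma,[h])$. **GJMS construction.** For an asymptotically hyperbolic metric $h_+$ on the interior of $Y^{k+1}$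 with $\partial Y=\Sigma$, a representative $h$ of its conformal infinity, a defining function $r$ with $r^2h_+|_{T\Sigma}=h$, and $\ell\in\mathbb N$: given $f\in C^\infty(\Sigma)$ there is $F\in C^\infty(Y)$, unique modulo $O(r^{2\ell})$, with $F|_\Sigma=f$ and such that $u:=r^{k/2-\ell}F$ satisfies $(\Delta_{h_+}+((k/2)^2-\ell^2))u=O(r^{k/2+\ell})$; then $\big(r^{-k/2-\ell}(\Delta_{h_+}+((k/2)^2-\ell^2))u\big)\big|_\Sigma=:a_\ell P_{2\ell}f$ with $a_\ell^{-1}=(-1)^\ell2^{2(\ell-1)}((\ell-1)!)^2$ is independent of choices. $Q_{2\ell}$ is defined by $P_{2\ell}1=(k/2-\ell)Q_{2\ell}$ if $2\ell\ne k$; if $2\ell=k$, by analytic continuation in $k$, equivalently: there is $A\in C^\infty(Y)$, $A|_\Sigma=0$, unique modulo $O(r^k)$, with $\Delta_{h_+}(\log r+A)+k=O(r^k)$, and $\big(r^{-k}(\Delta_{h_+}(\log r+A)+k)\big)\big|_\Sigma=a_{k/2}Q_k$. **Minimal submanifold extrinsic GJMS operators / $Q$-curvatures** are the $P_{2\ell}$, $Q_{2\ell}$ obtained by applying the GJMS construction, with representative $h$ (the metric induced on $\Sigma$ by $g$), to the asymptotically hyperbolic metric $h_+$ induced on $\mathring Y$ by $g_+$, where $g_+$ is an even Poincaré metric in normal form relative to $g$ and $Y=\{(\exp_\Sigma U_r(p),r):p\in\Sigma,r\ge0\}\subset X$ is an even asymptotically minimal extension of $\Sigma$ with respect to $g_+$.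 They are known to be independent of the choices of $g_r$, $U_r$ when $\ell\ge1$ is arbitrary ($n,k$ odd), $\ell<n/2$ ($n$ even, $k$ odd), $\ell\le k/2+1$ ($k$ even, with $n>k+2$ if also $n$ is even and $\ell=k/2+1$). Thus $P_2$ is always defined, and $P_4$ is defined exactly when $n\ne4$. *)

(* Defs.v *)
(* Smooth manifolds are given by atlases; a tensor field on a manifold is
   represented by its components in each chart, and the tensor calculus is done
   on these components, which are functions on ['rV[R]_d]. *)
From HB Require Import structures.
From mathcomp Require Import all_boot all_order all_algebra.
From mathcomp Require Import all_classical all_reals all_analysis.

Set Implicit Arguments.
Unset Strict Implicit.
Unset Printing Implicit Defensive.

Import Order.TTheory GRing.Theory Num.Theory.
Import numFieldNormedType.Exports.

Local Open Scope classical_set_scope.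
Local Open Scope ring_scope.

Section smooth_functions.
Context {R : realType} {d : nat}.
Implicit Types (A V : set 'rV[R]_d) (f : 'rV[R]_d -> R).

Definition pd (i : 'I_d) f (x : 'rV[R]_d) : R := 'D_(delta_mx 0 i) f x.

Fixpoint class_C (N : nat) V f : Prop :=
  (forall x, V x -> {for x, continuous f}) /\
  (if N is N'.+1 then
     forall i, (forall x, V x -> derivable f x (delta_mx 0 i)) /\
               class_C N' V (pd i f)
   else True).

(* [smooth_ext A a V F f]: F is a C^oo extension of f|_A to the open
   neighbourhood V of a. *)
Definition smooth_ext A a V F f : Prop :=
  [/\ open V, V a, forall N, class_C N V F &
      forall y, A y -> V y -> f y = F y].

(* C^oo on an arbitrary subset (used for half-open sets U x [0, e)): local
   restriction of C^oo functions on open sets. *)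
Definition smooth_on A f : Prop :=
  forall a, A a -> exists V F, smooth_ext A a V F f.

End smooth_functions.

Section coordinate_tensors.
Context {R : realType} {d : nat}.
Variable G : 'rV[R]_d -> 'M[R]_d.
Implicit Types (x : 'rV[R]_d) (a b c e i j k l m s : 'I_d).

Definition christoffel c a b x : R :=
  2^-1 * \sum_e invmx (G x) c e *
    (pd a (fun y => G y e b) x + pd b (fun y => G y e a) x
     - pd e (fun y => G y a b) x).

(* R^m_{jkl}, with the sign for which R_{ij} = R^k_{ikj} is positive on
   spheres. *)
Definition riemann_up m j k l x : R :=
  pd k (christoffel m l j) x - pd l (christoffel m k j) x
  + \sum_s (christoffel m k s x * christoffel s l j x
            - christoffel m l s x * christoffel s k j x).

Definition riemann i j k l x : R := \sum_m G x i m * riemann_up m j k l x.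

Definition ricci i j x : R := \sum_k riemann_up k i k j x.

Definition scalar_curv x : R := \sum_i \sum_j invmx (G x) i j * ricci i j x.

Definition schouten i j x : R :=
  (d%:R - 2)^-1 *
  (ricci i j x - scalar_curv x / (2 * (d%:R - 1)) * G x i j).

Definition weyl i j k l x : R :=
  riemann i j k l x
  - (schouten i k x * G x j l - schouten j k x * G x i l
     - schouten i l x * G x j k + schouten j l x * G x i k).

(* nabla_k T_{ij} *)
Definition nabla2 (T : 'I_d -> 'I_d -> 'rV[R]_d -> R) i j k x : R :=
  pd k (T i j) x
  - \sum_m (christoffel m k i x * T m j x + christoffel m k j x * T i m x).

(* nabla_l T_{ijk} *)
Definition nabla3 (T : 'I_d -> 'I_d -> 'I_d -> 'rV[R]_d -> R) i j k l x : R :=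
  pd l (T i j k) x
  - \sum_m (christoffel m l i x * T m j k x + christoffel m l j x * T i m k x
            + christoffel m l k x * T i j m x).

Definition cotton i j k x : R := nabla2 schouten i j k x - nabla2 schouten i k j x.

Definition bach i j x : R :=
  \sum_k \sum_l invmx (G x) k l * nabla3 cotton i j k l x
  - \sum_k \sum_l
      (\sum_a \sum_b invmx (G x) k a * invmx (G x) l b * schouten a b x)
      * weyl k i j l x.

(* nabla^a w_a *)
Definition divergence (w : 'I_d -> 'rV[R]_d -> R) x : R :=
  \sum_a \sum_b invmx (G x) a b *
    (pd b (w a) x - \sum_c christoffel c b a x * w c x).

Definition laplacian (f : 'rV[R]_d -> R) : 'rV[R]_d -> R :=
  divergence (fun a => pd a f).

(* nabla^a (T_{ab} nabla^b f) *)
Definition div_T_grad (T : 'rV[R]_d -> 'M[R]_d) (f : 'rV[R]_d -> R) x : R :=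
  divergence
    (fun a y => \sum_b \sum_c T y a b * invmx (G y) b c * pd c f y) x.

Definition inner x (v w : 'rV[R]_d) : R := (v *m G x *m w^T) 0 0.

(* |T|^2 = T_{ab} T_{ce} g^{ac} g^{be} *)
Definition tensor_normsq x (T : 'M[R]_d) : R :=
  \tr (invmx (G x) *m T *m invmx (G x) *m T^T).

End coordinate_tensors.

Section coordinate_submanifolds.
Context {R : realType} {k n : nat}.

(* Row a is the image of the a-th coordinate vector field. *)
Definition jac (phi : 'rV[R]_k -> 'rV[R]_n) x : 'M[R]_(k, n) :=
  \matrix_(a, i) pd a (fun y => phi y 0 i) x.

Variables (G : 'rV[R]_n -> 'M[R]_n) (phi : 'rV[R]_k -> 'rV[R]_n).
Implicit Types (x : 'rV[R]_k) (v : 'rV[R]_n) (a b : 'I_k).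

Definition pullback x : 'M[R]_k := jac phi x *m G (phi x) *m (jac phi x)^T.

Definition normal_part x v : 'rV[R]_n :=
  v - v *m G (phi x) *m (jac phi x)^T *m invmx (pullback x) *m jac phi x.

(* Covariant derivative, for the ambient connection, of a vector field V along
   phi in the direction of the a-th coordinate vector field. *)
Definition cov_along a (V : 'rV[R]_k -> 'rV[R]_n) x : 'rV[R]_n :=
  \row_i (pd a (fun y => V y 0 i) x
          + \sum_j \sum_l christoffel G i j l (phi x) * jac phi x a j * V x 0 l).

Definition second_ff a b x : 'rV[R]_n :=
  normal_part x (cov_along a (fun y => row b (jac phi y)) x).

Definition mean_curv x : 'rV[R]_n :=
  k%:R^-1 *: \sum_a \sum_b invmx (pullback x) a b *: second_ff a b x.

Definition normal_nabla a (V : 'rV[R]_k -> 'rV[R]_n) x : 'rV[R]_n :=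
  normal_part x (cov_along a V x).

Definition schouten_mx (y : 'rV[R]_n) : 'M[R]_n :=
  \matrix_(i, j) schouten G i j y.
Definition bach_mx (y : 'rV[R]_n) : 'M[R]_n := \matrix_(i, j) bach G i j y.

(* P_{alpha beta} *)
Definition schouten_tan x : 'M[R]_k :=
  jac phi x *m schouten_mx (phi x) *m (jac phi x)^T.

(* P_alpha^alpha *)
Definition tr_schouten x : R := \tr (invmx (pullback x) *m schouten_tan x).

(* |H|^2 *)
Definition H_normsq x : R := inner G (phi x) (mean_curv x) (mean_curv x).

(* H^{alpha'} L_{alpha beta alpha'} *)
Definition HL x : 'M[R]_k :=
  \matrix_(a, b) inner G (phi x) (mean_curv x) (second_ff a b x).

(* P_{alpha alpha'} - nabla_alpha H_{alpha'}, with alpha' raised: for each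
   alpha a normal vector. *)
Definition mixed_term a x : 'rV[R]_n :=
  normal_part x (row a (jac phi x) *m schouten_mx (phi x) *m invmx (G (phi x)))
  - normal_nabla a mean_curv x.

Definition mixed_term_normsq x : R :=
  \sum_a \sum_b invmx (pullback x) a b *
    inner G (phi x) (mixed_term a x) (mixed_term b x).

(* W^alpha_{alpha' alpha beta'} H^{alpha'} H^{beta'} *)
Definition weyl_HH x : R :=
  \sum_a \sum_b invmx (pullback x) a b *
    \sum_i \sum_j \sum_l \sum_m weyl G i j l m (phi x) *
      jac phi x a i * mean_curv x 0 j * jac phi x b l * mean_curv x 0 m.

(* C^alpha_{alpha alpha'} H^{alpha'} *)
Definition cotton_H x : R :=
  \sum_a \sum_b invmx (pullback x) a b *
    \sum_i \sum_j \sum_l cotton G i j l (phi x) *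
      jac phi x a i * jac phi x b j * mean_curv x 0 l.

(* B^alpha_alpha *)
Definition tr_bach x : R :=
  \tr (invmx (pullback x) *m (jac phi x *m bach_mx (phi x) *m (jac phi x)^T)).

Definition Q2_formula x : R := tr_schouten x + k%:R / 2 * H_normsq x.

Definition T_formula x : 'M[R]_k :=
  4 *: schouten_tan x + 4 *: HL x
  - ((k%:R - 2) * tr_schouten x
     + 2^-1 * (k%:R ^+ 2 - 2 * k%:R + 4) * H_normsq x) *: pullback x.

Definition Q4_formula x : R :=
  - laplacian pullback Q2_formula x
  - 2 * tensor_normsq pullback x
          (schouten_tan x + HL x - (2^-1 * H_normsq x) *: pullback x)
  + 2 * mixed_term_normsq x
  + k%:R / 2 * Q2_formula x ^+ 2
  - 2 * weyl_HH x
  - 4 * cotton_H x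
  - 2 / (n%:R - 4) * tr_bach x.

End coordinate_submanifolds.

Section manifolds.
Context {R : realType}.

Record chart (M : topologicalType) (n : nat) := Chart {
  cdom : set M;
  ccod : set 'rV[R]_n;
  cto : M -> 'rV[R]_n;
  cof : 'rV[R]_n -> M;
  cdom_open : open cdom;
  ccod_open : open ccod;
  cto_cod : forall p, cdom p -> ccod (cto p);
  cof_dom : forall x, ccod x -> cdom (cof x);
  ctoK : forall p, cdom p -> cof (cto p) = p;
  cofK : forall x, ccod x -> cto (cof x) = x;
  cto_cont : forall p, cdom p -> {for p, continuous cto};
  cof_cont : forall x, ccod x -> {for x, continuous cof} }.

Record manifold (n : nat) := Manifold {
  mcarrier :> topologicalType;
  mhausdorff : hausdorff_space mcarrier;
  msecond_countable : @second_countable mcarrier;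
  atlas : set (chart mcarrier n);
  atlas_cover : forall p, exists2 phi, atlas phi & cdom phi p;
  atlas_compat : forall phi phi', atlas phi -> atlas phi' -> forall j,
    smooth_on [set x | ccod phi x /\ cdom phi' (cof phi x)]
              (fun x => cto phi' (cof phi x) 0 j) }.

Definition transition (n : nat) (M : manifold n) (phi phi' : chart M n)
  (x : 'rV[R]_n) : 'rV[R]_n := cto phi' (cof phi x).

Definition smooth_fun (n : nat) (M : manifold n) (f : M -> R) : Prop :=
  forall phi, @atlas n M phi -> smooth_on (ccod phi) (fun x => f (cof phi x)).

Definition smooth_map_on (d n : nat) (M : manifold n) (A : set 'rV[R]_d)
    (F : 'rV[R]_d -> M) : Prop :=
  forall a phi, A a -> @atlas n M phi -> cdom phi (F a) ->
  exists V, [/\ open V, V a, forall y, A y -> V y -> cdom phi (F y) &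
    forall j, smooth_on (A `&` V) (fun y => cto phi (F y) 0 j)].

Record riemannian_metric (n : nat) (M : manifold n) := RiemannianMetric {
  rmet :> chart M n -> 'rV[R]_n -> 'M[R]_n;
  rmet_sym : forall phi x, @atlas n M phi -> ccod phi x ->
    (rmet phi x)^T = rmet phi x;
  rmet_pos : forall phi x, @atlas n M phi -> ccod phi x ->
    forall v : 'rV[R]_n, v != 0 -> 0 < (v *m rmet phi x *m v^T) 0 0;
  rmet_smooth : forall phi, @atlas n M phi -> forall i j,
    smooth_on (ccod phi) (fun x => rmet phi x i j);
  rmet_change : forall phi phi' x, @atlas n M phi -> @atlas n M phi' ->
    ccod phi x -> cdom phi' (cof phi x) ->
    rmet phi x = pullback (rmet phi') (transition phi phi') x }.

(* gamma is a geodesic on an open interval containing [0, 1]. *)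
Definition geodesic01 (n : nat) (M : manifold n) (g : riemannian_metric M)
    (gamma : R -> M) : Prop :=
  exists2 e : R, 0 < e & forall t : R, - e < t < 1 + e ->
    {for t, continuous gamma} /\
    forall phi, @atlas n M phi -> cdom phi (gamma t) ->
      let c := fun s : R => cto phi (gamma s) in
      [/\ \forall s \near t, derivable c s 1,
          derivable (derive1 c) t 1 &
          forall i, derive1 (derive1 c) t 0 i
            + \sum_j \sum_l christoffel (g phi) i j l (c t)
                              * derive1 c t 0 j * derive1 c t 0 l = 0].

(* q = exp_p(v), where v phi are the components of v in the chart phi. *)
Definition is_exp (n : nat) (M : manifold n) (g : riemannian_metric M)
    (p : M) (v : chart M n -> 'rV[R]_n) (q : M) : Prop :=
  exists gamma : R -> M,
    [/\ geodesic01 g gamma, gamma 0 = p, gamma 1 = q &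
        forall phi, @atlas n M phi -> cdom phi p ->
          derive1 (fun s => cto phi (gamma s)) 0 = v phi].

Section submanifold.
Context {k n : nat} {S : manifold k} {M : manifold n}.
Variable iota : S -> M.

(* Domain and local expression of iota in charts psi of S and phi of M. *)
Definition ldom (psi : chart S k) (phi : chart M n) : set 'rV[R]_k :=
  [set x | ccod psi x /\ cdom phi (iota (cof psi x))].

Definition lmap (psi : chart S k) (phi : chart M n) (x : 'rV[R]_k) : 'rV[R]_n :=
  cto phi (iota (cof psi x)).

Definition embedding : Prop :=
  [/\ forall psi, @atlas k S psi ->
        smooth_map_on (ccod psi) (fun x => iota (cof psi x)),
      forall psi phi x, @atlas k S psi -> @atlas n M phi -> ldom psi phi x ->
        row_free (jac (lmap psi phi) x),
      injective iota &
      forall W : set S, open W -> exists2 V : set M, open V & W = iota @^-1` V].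

End submanifold.

End manifolds.

Arguments chart R M n : clear implicits.

(* Coordinates (x, r) on N x [0, e) are points of 'rV_(d + 1), with r last. *)
Section collar.
Context {R : realType} {d : nat}.

Definition base (y : 'rV[R]_(d + 1)) : 'rV[R]_d := lsubmx y.
Definition hgt (y : 'rV[R]_(d + 1)) : R := y 0 (rshift d ord0).
Definition pt (x : 'rV[R]_d) (r : R) : 'rV[R]_(d + 1) := row_mx x r%:M.

Definition collar (U : set 'rV[R]_d) (e : R) : set 'rV[R]_(d + 1) :=
  [set y | U (base y) /\ 0 <= hgt y < e].

(* C^oo up to r = 0, with even Taylor expansion in r there. *)
Definition even_smooth_on (U : set 'rV[R]_d) (e : R)
    (f : 'rV[R]_(d + 1) -> R) : Prop :=
  smooth_on (collar U e) f /\
  forall x, U x -> exists V F, smooth_ext (collar U e) (pt x 0) V F f /\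
    forall m, odd m -> iter m (pd (rshift d ord0)) F (pt x 0) = 0.

(* q = O(b) as r -> 0+, locally uniformly near the boundary points (x, 0),
   x in U. *)
Definition boundaryO (U : set 'rV[R]_d) (q b : 'rV[R]_(d + 1) -> R) : Prop :=
  forall x, U x -> exists C : R,
    \forall y \near within [set y | 0 < hgt y] (nbhs (pt x 0)),
      `|q y| <= C * b y.

End collar.

Section poincare.
Context {R : realType} {n : nat} {M : manifold (R := R) n}.
Variables (g : riemannian_metric M) (e0 : R) (gr : R -> riemannian_metric M).

Definition gbar (phi : chart R M n) (y : 'rV[R]_(n + 1)) : 'M[R]_(n + 1) :=
  block_mx (gr (hgt y) phi (base y)) 0 0 1%:M.

Definition gplus (phi : chart R M n) (y : 'rV[R]_(n + 1)) : 'M[R]_(n + 1) :=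
  (hgt y) ^- 2 *: gbar phi y.

(* |Ric(g_+) + n g_+|_{g_+} *)
Definition einstein_defect (phi : chart R M n) (y : 'rV[R]_(n + 1)) : R :=
  Num.sqrt (tensor_normsq (gplus phi) y
    (\matrix_(i, j) (ricci (gplus phi) i j y + n%:R * gplus phi y i j))).

Definition even_poincare : Prop :=
  [/\ 0 < e0,
      forall phi, @atlas R n M phi -> forall i j,
        even_smooth_on (ccod phi) e0 (fun y => gr (hgt y) phi (base y) i j),
      forall phi x, @atlas R n M phi -> ccod phi x -> gr 0 phi x = g phi x &
      forall phi, @atlas R n M phi -> forall N : nat, odd n \/ N = n ->
        boundaryO (ccod phi) (einstein_defect phi) (fun y => hgt y ^+ N)].

End poincare.

Section minimal_extension.
Context {R : realType} {k n : nat}.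
Context {S : manifold (R := R) k} {M : manifold (R := R) n}.
Variables (g : riemannian_metric M) (gr : R -> riemannian_metric M).
Variables (iota : S -> M) (e1 : R).
(* U phi p r: components in the chart phi of U_r(p) in N_p S;
   E p r: the point exp_S U_r(p) of M. *)
Variables (U : chart R M n -> S -> R -> 'rV[R]_n) (E : S -> R -> M).

(* The parametrization (p, r) |-> (exp_S U_r(p), r) of Y, in charts. *)
Definition Ymap (psi : chart R S k) (phi : chart R M n) (y : 'rV[R]_(k + 1)) :
  'rV[R]_(n + 1) := pt (cto phi (E (cof psi (base y)) (hgt y))) (hgt y).

Definition hplus (psi : chart R S k) (phi : chart R M n) :
  'rV[R]_(k + 1) -> 'M[R]_(k + 1) := pullback (gplus gr phi) (Ymap psi phi).

(* |H_Y|_{gbar}, with H_Y computed with respect to g_+ *)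
Definition HY_norm (psi : chart R S k) (phi : chart R M n) (y : 'rV[R]_(k + 1)) : R :=
  let H := mean_curv (gplus gr phi) (Ymap psi phi) y in
  Num.sqrt (inner (gbar gr phi) (Ymap psi phi y) H H).

Definition normal_family : Prop :=
  [/\ forall phi phi' p r, @atlas R n M phi -> @atlas R n M phi' ->
        cdom phi (iota p) -> cdom phi' (iota p) ->
        U phi' p r = U phi p r *m jac (transition phi phi') (cto phi (iota p)),
      forall psi phi x r, @atlas R k S psi -> @atlas R n M phi ->
        ldom iota psi phi x -> 0 <= r < e1 ->
        U phi (cof psi x) r *m g phi (lmap iota psi phi x)
          *m (jac (lmap iota psi phi) x)^T = 0,
      forall psi phi, @atlas R k S psi -> @atlas R n M phi -> forall i,
        even_smooth_on (ldom iota psi phi) e1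
          (fun y => U phi (cof psi (base y)) (hgt y) 0 i) &
      forall phi p, @atlas R n M phi -> cdom phi (iota p) -> U phi p 0 = 0].

Definition even_minimal_extension : Prop :=
  [/\ normal_family,
      forall p r, 0 <= r < e1 -> is_exp g (iota p) (fun phi => U phi p r) (E p r),
      forall psi, @atlas R k S psi ->
        smooth_map_on (collar (ccod psi) e1)
          (fun y => E (cof psi (base y)) (hgt y)) &
      forall psi phi, @atlas R k S psi -> @atlas R n M phi ->
        forall N : nat, odd k \/ N = k.+2 ->
        boundaryO (ldom iota psi phi) (HY_norm psi phi) (fun y => hgt y ^+ N)].

End minimal_extension.

(* The GJMS construction for h_+ on Y, identified with S x [0, e1) by the
   parametrization above; functions on Y are functions of (p, r). *)
Section gjms.
Context {R : realType} {k n : nat}.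
Context {S : manifold (R := R) k} {M : manifold (R := R) n}.
Variables (g : riemannian_metric M) (gr : R -> riemannian_metric M).
Variables (iota : S -> M) (e1 : R) (E : S -> R -> M).

Definition smooth_on_Y (F : S -> R -> R) : Prop :=
  forall psi, @atlas R k S psi ->
    smooth_on (collar (ccod psi) e1) (fun y => F (cof psi (base y)) (hgt y)).

(* The nonvanishing of d rho on S is implied by the last condition. *)
Definition defining_function (rho : S -> R -> R) : Prop :=
  [/\ smooth_on_Y rho,
      forall p, rho p 0 = 0,
      forall p r, 0 < r < e1 -> 0 < rho p r &
      forall psi phi x, @atlas R k S psi -> @atlas R n M phi ->
        ldom iota psi phi x -> forall a b : 'I_k,
        (fun r => rho (cof psi x) r ^+ 2 *
             hplus gr E psi phi (pt x r) (lshift 1 a) (lshift 1 b)) @ 0^'+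
          --> pullback (g phi) (lmap iota psi phi) x a b].

Variable rho : S -> R -> R.

Definition rho_loc (psi : chart R S k) (y : 'rV[R]_(k + 1)) : R :=
  rho (cof psi (base y)) (hgt y).

(* (Delta_{h_+} + (k/2)^2 - l^2) (rho^(k/2 - l) F) *)
Definition gjms_expr (l : nat) (F : S -> R -> R)
    (psi : chart R S k) (phi : chart R M n) (y : 'rV[R]_(k + 1)) : R :=
  let u := fun z => rho_loc psi z `^ (k%:R / 2 - l%:R)
                      * F (cof psi (base z)) (hgt z) in
  laplacian (hplus gr E psi phi) u y + ((k%:R / 2) ^+ 2 - l%:R ^+ 2) * u y.

Definition gjms_const (l : nat) : R :=
  ((-1) ^+ l * 2 ^+ (2 * (l - 1)) * ((l - 1)`!)%:R ^+ 2)^-1.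

(* [gjms_value l f F c]: F is a solution for the boundary value f, and it yields
   the value c of P_{2l} f. *)
Definition gjms_value (l : nat) (f : S -> R) (F : S -> R -> R) (c : S -> R) : Prop :=
  [/\ smooth_on_Y F,
      forall p, F p 0 = f p &
      forall psi phi, @atlas R k S psi -> @atlas R n M phi ->
        boundaryO (ldom iota psi phi) (gjms_expr l F psi phi)
          (fun y => rho_loc psi y `^ (k%:R / 2 + l%:R)) /\
        forall x, ldom iota psi phi x ->
          (fun r => rho (cof psi x) r `^ (- (k%:R / 2) - l%:R)
                      * gjms_expr l F psi phi (pt x r)) @ 0^'+
            --> gjms_const l * c (cof psi x)].

Definition gjms_operator (l : nat) (P : (S -> R) -> S -> R) : Prop :=
  forall f, smooth_fun f -> exists F, gjms_value l f F (P f).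

(* Delta_{h_+} (log rho + A) + k *)
Definition critical_expr (A : S -> R -> R)
    (psi : chart R S k) (phi : chart R M n) (y : 'rV[R]_(k + 1)) : R :=
  laplacian (hplus gr E psi phi)
    (fun z => ln (rho_loc psi z) + A (cof psi (base z)) (hgt z)) y + k%:R.

Definition critical_Q (Q : S -> R) : Prop :=
  exists A : S -> R -> R,
  [/\ smooth_on_Y A,
      forall p, A p 0 = 0 &
      forall psi phi, @atlas R k S psi -> @atlas R n M phi ->
        boundaryO (ldom iota psi phi) (critical_expr A psi phi)
          (fun y => rho_loc psi y ^+ k) /\
        forall x, ldom iota psi phi x ->
          (fun r => rho (cof psi x) r ^- k * critical_expr A psi phi (pt x r))
            @ 0^'+ --> gjms_const k./2 * Q (cof psi x)].

(* Q is the Q-curvature associated with the operator P = P_{2l}. *)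
Definition gjms_Q (l : nat) (P : (S -> R) -> S -> R) (Q : S -> R) : Prop :=
  if (2 * l == k)%N then critical_Q Q
  else forall p, P (fun=> 1) p = (k%:R / 2 - l%:R) * Q p.

End gjms.

(* Main.v *)
(* In local coordinates g_r = g + r^2 gam + r^4 del + ... and exp U_r = X + r^2 U
   + r^4 V + ...; the expansions are even.  The Einstein condition gives
   gam = - P and, for n <> 4, del in terms of P^2 and the Bach tensor, together
   with div P = d tr P; minimality gives U = H / 2, and V is left undetermined.
   This yields the Taylor coefficients of r^2 h_+ up to order 4.

   Write rho = r s with s = 1 on the submanifold and m = k/2 - l.  Then
   Delta_{h_+} + m (k - m), conjugated by r^m, is an operator L that is smooth
   up to r = 0, acting on s^m F.  The vanishing of the coefficients
   of r^j, j < 2 l, in L (s^m F) gives the Taylor coefficients of s^m F in terms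
   of f, and the coefficient of r^(2 l) is P_{2l} f up to a constant.  In the
   critical dimension the logarithm of s takes the place of s^m F.  For l = 2 the
   coefficient of r^4 is compared with the geometric formula by the Gauss equation
   and by contracting the Weyl, Cotton and Bach tensors along the submanifold; all
   the terms that contain V cancel. *)

Require Import Defs.
From HB Require Import structures.
From mathcomp Require Import all_boot all_order all_algebra.
From mathcomp Require Import all_classical all_reals all_analysis.
From mathcomp Require Import ring lra.

Set Implicit Arguments.
Unset Strict Implicit.
Unset Printing Implicit Defensive.

Import Order.TTheory GRing.Theory Num.Theory.
Import numFieldNormedType.Exports.

Local Open Scope classical_set_scope.
Local Open Scope ring_scope.

(** * Functions of class C^N *)

(** Every tensor is expanded inside a commutative ring [smf V] of smooth functions with commuting
    derivations: curvature identities become ring identities, proved once and carried by ring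
    morphisms between the boundary, a box and its half [r > 0]. The obstacle is that [g_+] and [h_+]
    blow up at [r = 0], while the data exist only for [r >= 0]. The metrics are therefore extended
    to a box that crosses [r = 0], where Taylor coefficients are plain derivatives; the singular
    connections and curvatures live on [0 < r < e], and one factor [r] clears their poles. Decay is
    assumed for norms only; it passes to components by positivity, since the first nonzero
    coefficient of a defect would show in its square norm. The exception [n = 4] comes from the
    coefficient [2 n - 8 = 2 (n - 1) - 6] of the fourth-order term of [g_r] in the Einstein
    equation. The term [V] is not a vector field, but [V + Gamma(U, U) / 2] is; it cancels because
    the divergence of the mixed part of [r^2 h_+] reproduces the traces in which it occurs. Critical
    dimensions are covered because the identity for [Q_4] is proved without dividing by
    [m = k / 2 - 2]. *)

Section class_C_theory.
Context {R : realType} {d : nat}.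
Notation vec := 'rV[R]_d.
Notation e_ i := (delta_mx 0 i : vec).
Implicit Types (V : set vec) (f g : vec -> R) (x y : vec) (i j : 'I_d).

Lemma nbhs_boxP x (P : set vec) : nbhs x P <->
  exists2 e : R, 0 < e & forall y, (forall j, `|y 0 j - x 0 j| < e) -> P y.
Proof.
split.
  move=> /nbhs_ballP[e /= e0 eP]; exists e => // y xy; apply: eP; split => //.
  by move=> i j; rewrite /ball/= ord1 distrC.
move=> [e e0 eP]; apply/nbhs_ballP; exists e => // y [_ xy]; apply: eP => j.
by have := xy 0 j; rewrite /ball/= distrC.
Qed.

Lemma is_derive_line f x (v : vec) (t : R) : derivable f (x + t *: v) v ->
  is_derive t 1 (fun s : R => f (x + s *: v)) ('D_v f (x + t *: v)).
Proof.
have E : (fun h : R => h^-1 *: (f (x + (h *: 1 + t) *: v) - f (x + t *: v)))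
    = (fun h : R => h^-1 *: (f (h *: v + (x + t *: v)) - f (x + t *: v))).
  apply/funext => h; congr (_ *: (f _ - _)).
  by rewrite scalerDl addrCA /GRing.scale/= mulr1.
by move=> dv; apply: DeriveDef; rewrite /derivable /derive /= E.
Qed.

Lemma mvt_line f x i (t : R) :
  (forall s : R, `|s| <= `|t| -> derivable f (x + s *: e_ i) (e_ i)) ->
  exists2 s, `|s| <= `|t| & f (x + t *: e_ i) - f x = t * pd i f (x + s *: e_ i).
Proof.
move=> dv; pose g (s : R) := f (x + s *: e_ i).
have dg (s : R) : `|s| <= `|t| -> is_derive s (1 : R) g (pd i f (x + s *: e_ i)).
  by move=> st; apply: is_derive_line; apply: dv.
have cg (s : R) : `|s| <= `|t| -> {for s, continuous g}.
  move=> st; have [? _] := dg _ st.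
  by apply: differentiable_continuous; apply/derivable1_diffP.
have g0 : g 0 = f x by rewrite /g scale0r addr0.
have [t0|t0] := leP 0 t.
  have [|||c] := @MVT_segment R g (fun s => pd i f (x + s *: e_ i)) 0 t => //.
  - move=> s /[!in_itv]/= /andP[s0 st]; apply: dg.
    by rewrite !ger0_norm // ltW.
  - apply: continuous_in_subspaceT => s /[!inE]/= /[!in_itv]/= /andP[s0 st].
    by apply: cg; rewrite !ger0_norm.
  rewrite in_itv/= subr0 g0 => /andP[c0 ct] E; exists c; first by rewrite !ger0_norm.
  by rewrite -[f _]/(g t) E mulrC.
have [|||c] := @MVT_segment R g (fun s => pd i f (x + s *: e_ i)) t 0.
- exact: ltW.
- move=> s /[!in_itv]/= /andP[st s0]; apply: dg.
  by rewrite !ltr0_norm // lerN2 ltW.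
- apply: continuous_in_subspaceT => s /[!inE]/= /[!in_itv]/= /andP[st s0].
  by apply: cg; rewrite !ler0_norm ?lerN2 // ltW.
rewrite in_itv/= sub0r g0 => /andP[ct c0] E; exists c.
  by rewrite !ler0_norm ?lerN2 // ltW.
by rewrite -opprB -[f (x + t *: _)]/(g t) E mulrN opprK mulrC.
Qed.

Lemma pd_near_eq i f g x : {near x, f =1 g} -> pd i f x = pd i g x.
Proof. by move=> fg; rewrite /pd; apply: near_eq_derive. Qed.

Lemma open_near_eq V f g x : open V -> V x -> (forall y, V y -> f y = g y) ->
  {near x, f =1 g}.
Proof.
move=> oV Vx fg; have := open_nbhs_nbhs (conj oV Vx).
by apply: filterS => y; exact: fg.
Qed.

Lemma continuous_near_eq f g x : {near x, f =1 g} ->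
  {for x, continuous f} -> {for x, continuous g}.
Proof.
move=> fg; rewrite /prop_for /continuous_at -(nbhs_singleton fg) => cf.
by apply: cvg_trans cf; exact: (@near_eq_cvg _ _ (nbhs x) _ f g fg).
Qed.

Lemma class_C_eq N V f g : open V -> (forall x, V x -> f x = g x) ->
  class_C N V f -> class_C N V g.
Proof.
move=> oV; elim: N f g => [|N IH] f g fg /= [cf df]; split => //.
- by move=> x Vx; apply: continuous_near_eq (cf _ Vx); exact: open_near_eq Vx _.
- by move=> x Vx; apply: continuous_near_eq (cf _ Vx); exact: open_near_eq Vx _.
- move=> i; have [d1 d2] := df i; split.
    move=> x Vx; apply: near_eq_derivable (d1 _ Vx); exact: open_near_eq Vx _.
  apply: IH d2 => x Vx; apply: pd_near_eq; exact: open_near_eq Vx _.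
Qed.

Lemma class_C_sub N V V' f : V' `<=` V -> class_C N V f -> class_C N V' f.
Proof.
move=> VV; elim: N f => [|N IH] f /= [cf df]; split => //;
  try by move=> x /VV; exact: cf.
by move=> i; have [d1 d2] := df i; split; [move=> x /VV; exact: d1|exact: IH].
Qed.

Lemma class_CS N V f : class_C N.+1 V f -> class_C N V f.
Proof.
elim: N f => [|N IH] f [cf df]; split => //= i; have [d1 d2] := df i.
by split => //; apply: IH.
Qed.

Lemma class_C_cst N V (c : R) : open V -> class_C N V (fun=> c).
Proof.
move=> oV; elim: N c => [|N IH] c; split => //; try by move=> x _; exact: cst_continuous.
move=> i; split; first by move=> x _; exact: (@derivable_cst _ _ _ c x (e_ i)).
apply: class_C_eq (IH 0) => // x _.
by rewrite /pd derive_cst.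
Qed.

Lemma class_CD N V f g : open V -> class_C N V f -> class_C N V g ->
  class_C N V (fun x => f x + g x).
Proof.
move=> oV; elim: N f g => [|N IH] f g [cf df] [cg dg]; split => //;
  try by move=> x Vx; apply: (@continuousD _ _ _ f g x); [exact: cf|exact: cg].
move=> i; have [d1 d2] := df i; have [d3 d4] := dg i; split.
  by move=> x Vx; apply: derivableD; [exact: d1|exact: d3].
apply: class_C_eq (IH _ _ d2 d4) => // x Vx.
by rewrite /pd -deriveD; [|exact: d1|exact: d3].
Qed.

Lemma class_CM N V f g : open V -> class_C N V f -> class_C N V g ->
  class_C N V (fun x => f x * g x).
Proof.
move=> oV; elim: N f g => [|N IH] f g Cf Cg; have [cf df] := Cf; have [cg dg] := Cg;
  split => //; try by move=> x Vx; apply: (@continuousM _ _ f g x); [exact: cf|exact: cg].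
move=> i; have [d1 d2] := df i; have [d3 d4] := dg i; split.
  by move=> x Vx; apply: derivableM; [exact: d1|exact: d3].
have := class_CD oV (IH _ _ (class_CS Cf) d4) (IH _ _ (class_CS Cg) d2).
apply: class_C_eq => // x Vx.
by rewrite /pd -[fun=> _]/(f * g) deriveM; [|exact: d1|exact: d3].
Qed.

Lemma class_CV N V f : open V -> (forall x, V x -> f x != 0) -> class_C N V f ->
  class_C N V (fun x => (f x)^-1).
Proof.
move=> oV f0; elim: N => [|N IH] Cf; have [cf df] := Cf; split => //;
  try by move=> x Vx; apply: (@continuousV _ _ f x); [exact: f0|exact: cf].
move=> i; have [d1 d2] := df i; split.
  by move=> x Vx; apply: derivableV; [exact: f0|exact: d1].
have := IH (class_CS Cf) => CV.
have := class_CM oV (class_C_cst N (-1) oV) (class_CM oV (class_CM oV CV CV) d2).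
apply: class_C_eq => // x Vx.
rewrite /pd deriveV; [|exact: f0|exact: d1].
by rewrite /GRing.scale/= mulN1r mulNr -expr2 exprVn.
Qed.

Lemma pd_coord i j x : pd i (fun y => y 0 j) x = (i == j)%:R.
Proof.
have dd : differentiable (fun y : vec => y 0 j) x by exact: differentiable_coord.
have id : derivable (@id vec) x (e_ i) by exact: derivable_id.
have := derive_mx id; rewrite derive_id => /matrixP/(_ 0 j).
by rewrite !mxE eqxx /= eq_sym /pd => ->.
Qed.

Lemma class_C_coord N V j : open V -> class_C N V (fun x => x 0 j).
Proof.
move=> oV; case: N => [|N]; split => //; try by move=> x _; exact: coord_continuous.
move=> i; split.
  by move=> x _; apply: diff_derivable; exact: differentiable_coord.
by apply: class_C_eq (class_C_cst N (i == j)%:R oV) => // x _; rewrite pd_coord.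
Qed.

Lemma class_C_sum N V n (F : 'I_n -> vec -> R) : open V ->
  (forall m, class_C N V (F m)) -> class_C N V (fun x => \sum_m F m x).
Proof.
move=> oV CF; elim: n F CF => [|n IH] F CF.
  by apply: class_C_eq (class_C_cst N 0 oV) => // x _; rewrite big_ord0.
have := class_CD oV (CF ord0) (IH _ (fun m => CF (lift ord0 m))).
by apply: class_C_eq => // x _; rewrite big_ord_recl.
Qed.

(* The intermediate points come from moving one coordinate at a time. *)
Lemma mean_value_rV V f x : open V -> class_C 1 V f -> V x ->
  exists xi : 'I_d -> vec -> vec,
    (forall i, xi i y @[y --> x] --> x) /\
    \forall y \near x, f y - f x = \sum_i pd i f (xi i y) * (y 0 i - x 0 i).
Proof.
move=> oV [_ df] Vx.
have /nbhs_boxP[e e0 eV] : nbhs x V by exact: open_nbhs_nbhs.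
(* [w m y] has the first [m] coordinates of [y] and the others of [x], so that consecutive points
   differ in one coordinate and the differences telescope. *)
pose w m y : vec := \row_j (if (j < m)%N then y 0 j else x 0 j).
have wS y (i : 'I_d) : w i.+1 y = w i y + (y 0 i - x 0 i) *: e_ i.
  apply/rowP => j; rewrite !mxE eqxx /= ltnS leq_eqVlt.
  have [/val_inj ->|ji] := eqVneq (j : nat) i.
    by rewrite ltnn eqxx mulr1 addrC subrK.
  have -> : (j == i) = false by apply: contra_neqF ji => /eqP ->.
  by rewrite mulr0 addr0.
have H i y : exists z : vec, (forall j, `|z 0 j - x 0 j| <= `|y 0 j - x 0 j|) /\
    ((forall j, `|y 0 j - x 0 j| < e) ->
     f (w i.+1 y) - f (w i y) = pd i f z * (y 0 i - x 0 i)).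
  (* Outside the box the point [x] itself keeps [xi] total and satisfies the distance bound. *)
  have [ye|nye] := pselect (forall j, `|y 0 j - x 0 j| < e); last first.
    by exists x; split => // j; rewrite subrr normr0.
  have zi s : `|s| <= `|y 0 i - x 0 i| -> forall j,
      `|(w i y + s *: e_ i) 0 j - x 0 j| <= `|y 0 j - x 0 j|.
    move=> si j; rewrite !mxE eqxx /=; have [->|ji] := eqVneq j i.
      by rewrite ltnn mulr1 addrC addKr.
    by rewrite mulr0 addr0; case: ifP => // _; rewrite subrr normr0.
  have [|s si E] := @mvt_line f (w i y) i (y 0 i - x 0 i).
    move=> s si; have [d1 _] := df i; apply: d1; apply: eV => j.
    exact: le_lt_trans (zi _ si j) (ye j).
  exists (w i y + s *: e_ i); split; first exact: zi.
  by move=> _; rewrite wS E mulrC.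
have /choice[xi Hxi] : forall p : 'I_d * vec, exists z : vec,
    (forall j, `|z 0 j - x 0 j| <= `|p.2 0 j - x 0 j|) /\
    ((forall j, `|p.2 0 j - x 0 j| < e) ->
     f (w p.1.+1 p.2) - f (w p.1 p.2) = pd p.1 f z * (p.2 0 p.1 - x 0 p.1)).
  by move=> [i y]; exact: H.
exists (fun i y => xi (i, y)); split.
  move=> i; move=> P /nbhs_boxP[r r0 rP].
  suff : nbhs x [set y | P (xi (i, y))] by [].
  apply/nbhs_boxP; exists r => // y yr.
  apply: rP => j; have [/(_ j) h _] := Hxi (i, y).
  exact: le_lt_trans h (yr j).
suff : nbhs x [set y | f y - f x =
    \sum_i pd i f (xi (i, y)) * (y 0 i - x 0 i)] by [].
apply/nbhs_boxP; exists e => // y ye /=.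
have -> : f y - f x = f (w d y) - f (w 0%N y).
  congr (f _ - f _); apply/rowP => j; rewrite mxE ?ltn_ord //.
rewrite -(telescope_sumr (fun m => f (w m y)) (leq0n d)) big_mkord.
by apply: eq_bigr => i _; have [_ ->] := Hxi (i, y).
Qed.

End class_C_theory.

(** * Chain rule and symmetry of second derivatives *)

Section chain_rule.
Context {R : realType}.

Lemma is_deriveE_line {m} (f : 'rV[R]_m -> R) x v l :
  is_derive (0 : R) (1 : R) (fun s : R => f (x + s *: v)) l -> is_derive x v f l.
Proof.
have E : (fun h : R => h^-1 *: (f (x + (h *: 1 + 0) *: v) - f (x + 0 *: v)))
    = (fun h : R => h^-1 *: (f (h *: v + x) - f x)).
  apply/funext => h; rewrite scale0r !addr0; congr (_ *: (f _ - _)).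
  by rewrite addrC /GRing.scale/= mulr1.
by move=> [d1 d2]; apply: DeriveDef; move: d1 d2; rewrite /derivable /derive /= E.
Qed.

Lemma cvg_sumR {T : Type} (F : set_system T) {FF : Filter F} n
    (f : 'I_n -> T -> R) (a : 'I_n -> R) :
  (forall i, f i x @[x --> F] --> a i) ->
  (\sum_i f i x) @[x --> F] --> \sum_i a i.
Proof.
elim: n f a => [|n IH] f a fa.
  under eq_fun do rewrite big_ord0; rewrite big_ord0; exact: cvg_cst.
under eq_fun do rewrite big_ord_recl; rewrite big_ord_recl.
by apply: cvgD; [exact: fa|apply: IH => i; exact: fa].
Qed.

(** Continuity of the partial derivatives suffices: by the mean value formula the difference
    quotient is a sum of partial derivatives at points tending to [c t], times difference quotients
    of the coordinates. *)
Lemma chain_rule_curve {d} (V : set 'rV[R]_d) (f : 'rV[R]_d -> R)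
    (c : R -> 'rV[R]_d) (c' : 'I_d -> R) (t : R) :
  open V -> class_C 1 V f -> V (c t) ->
  (forall i, is_derive t (1 : R) (fun s => c s 0 i) (c' i)) ->
  is_derive t (1 : R) (f \o c) (\sum_i pd i f (c t) * c' i).
Proof.
move=> oV Cf Vt dc; have [xi [cxi nxi]] := mean_value_rV oV Cf Vt.
have tc : (fun h : R => h *: (1 : R) + t) @ 0^' --> t.
  apply/cvgrPdist_lt => e e0; near=> h.
  rewrite /GRing.scale/= mulr1 opprD addrCA subrr addr0 normrN.
  by near: h; exact: dnbhs0_lt.
have ct : c s @[s --> t] --> c t.
  move=> P /nbhs_boxP[e e0 eP].
  have H i : \forall s \near t, `|c s 0 i - c t 0 i| < e.
    have [d1 _] := dc i.
    have /differentiable_continuous : differentiable (fun s => c s 0 i) t.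
      exact/derivable1_diffP.
    move=> /cvgrPdist_lt/(_ e e0); apply: filterS => s.
    by rewrite distrC.
  have FA : \forall s \near t, forall i, `|c s 0 i - c t 0 i| < e.
    exact: (@filter_forall _ 'I_d (fun i s => `|c s 0 i - c t 0 i| < e) _ _ H).
  by apply: filterS FA => s h; exact: eP.
have cht : c (h *: (1 : R) + t) @[h --> 0^'] --> c t by exact: cvg_comp tc ct.
have L : h^-1 *: (f (c (h *: (1 : R) + t)) - f (c t)) @[h --> (0 : R)^'] -->
    \sum_i pd i f (c t) * c' i.
  have S : (\sum_i pd i f (xi i (c (h *: (1 : R) + t))) *
       (h^-1 *: (c (h *: (1 : R) + t) 0 i - c t 0 i))) @[h --> (0 : R)^'] -->
     \sum_i pd i f (c t) * c' i.
    apply: cvg_sumR => i; apply: cvgM.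
      have [_ df] := Cf; have [_ [cdf _]] := df i.
      have := cdf _ Vt; apply: cvg_comp.
      exact: cvg_comp cht (cxi i).
    have [d1 <-] := dc i; exact: d1.
  apply: cvg_trans S; apply: near_eq_cvg.
  apply: (@filterS _ (0 : R)^' _ _ _ _ (cht _ nxi)) => h /= ->.
  rewrite scaler_sumr; apply: eq_bigr => i _.
  by rewrite /GRing.scale/= mulrCA.
by apply: DeriveDef; [apply/cvg_ex; eexists; exact: L|apply/cvg_lim].
Unshelve. all: by end_near. Qed.

Lemma chain_rule {m d} (V : set 'rV[R]_d) (f : 'rV[R]_d -> R)
    (F : 'rV[R]_m -> 'rV[R]_d) (x : 'rV[R]_m) (v : 'rV[R]_m) :
  open V -> class_C 1 V f -> V (F x) ->
  (forall i, derivable (fun y => F y 0 i) x v) ->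
  is_derive x v (f \o F) (\sum_i pd i f (F x) * 'D_v (fun y => F y 0 i) x).
Proof.
move=> oV Cf Vx dF; apply: is_deriveE_line.
have := @chain_rule_curve _ V f (fun s => F (x + s *: v))
  (fun i => 'D_v (fun y => F y 0 i) x) 0 oV Cf.
rewrite scale0r addr0; apply => // i.
have := @is_derive_line _ _ (fun y => F y 0 i) x v 0.
by rewrite scale0r addr0; apply.
Qed.

Lemma class_C_comp {m d} N (U : set 'rV[R]_m) (V : set 'rV[R]_d)
    (f : 'rV[R]_d -> R) (F : 'rV[R]_m -> 'rV[R]_d) :
  open U -> open V -> (forall x, U x -> V (F x)) ->
  class_C N V f -> (forall i, class_C N U (fun y => F y 0 i)) ->
  class_C N U (f \o F).
Proof.
move=> oU oV UV.
have cFx : (forall i x, U x -> {for x, continuous (fun y => F y 0 i)}) ->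
    forall x, U x -> {for x, continuous F}.
  move=> cF x Ux P /nbhs_boxP[e e0 eP].
  have FA : \forall s \near x, forall i, `|F s 0 i - F x 0 i| < e.
    apply: (@filter_forall _ 'I_d (fun i s => `|F s 0 i - F x 0 i| < e) (nbhs x) _) => i.
    have /cvgrPdist_lt/(_ e e0) := cF i x Ux.
    by apply: (@filterS _ (nbhs x) _) => s; rewrite distrC.
  by apply: filterS FA => s h; exact: eP.
have cc g : (forall x, V x -> {for x, continuous g}) ->
    (forall i x, U x -> {for x, continuous (fun y => F y 0 i)}) ->
    forall x, U x -> {for x, continuous (g \o F)}.
  by move=> cg cF x Ux; exact: (@cvg_comp _ _ _ F g (nbhs x) (nbhs (F x)) (nbhs (g (F x))) (cFx cF x Ux) (cg _ (UV _ Ux))).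
elim: N f => [|N IH] f Cf CF; first by split => //; apply: cc Cf.1 _ => i; have [] := CF i.
split; first by apply: cc Cf.1 _ => i; have [] := CF i.
move=> a.
have dF x i : U x -> derivable (fun y => F y 0 i) x (delta_mx 0 a).
  by have [_ /(_ a)[+ _]] := CF i; apply.
have C1 : class_C 1 V f.
  have [c1 d1] := Cf; split => // i; have [? Ci] := d1 i; split => //.
  by case: (N) Ci => [|?] [].
have ch x : U x -> is_derive x (delta_mx 0 a) (f \o F)
    (\sum_i pd i f (F x) * 'D_(delta_mx 0 a) (fun y => F y 0 i) x).
  by move=> Ux; apply: chain_rule oV C1 (UV _ Ux) _ => i; exact: dF.
split; first by move=> x /ch[].
have : class_C N U (fun x => \sum_i (pd i f \o F) x * pd a (fun y => F y 0 i) x).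
  apply: (class_C_sum oU) => i.
  have Ci : class_C N V (pd i f) by have [_ /(_ i)[]] := Cf.
  have Ca : class_C N U (pd a (fun y => F y 0 i)) by have [_ /(_ a)[]] := CF i.
  have Cc : class_C N U (pd i f \o F) by apply: IH => // j; exact: class_CS.
  exact: class_CM oU Cc Ca.
by apply: class_C_eq => // x /ch h; rewrite /pd derive_val.
Qed.

(** Meant for powers and the logarithm, hence the restriction to positive arguments. The regularity
    of [p'] along [f] is a separate premise: it comes from an induction for powers and from
    [class_CV] for the logarithm. *)
Lemma class_C_comp1 {m} N (U : set 'rV[R]_m) (f : 'rV[R]_m -> R) (p p' : R -> R) :
  open U -> (forall x, U x -> 0 < f x) -> class_C N.+1 U f ->
  (forall t : R, 0 < t -> is_derive t (1 : R) p (p' t)) ->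
  class_C N U (p' \o f) -> class_C N.+1 U (p \o f).
Proof.
move=> oU f0 Cf dp Cp; split.
  move=> x Ux; apply: (@continuous_comp _ _ _ f p); first exact: Cf.1.
  apply: differentiable_continuous; apply/derivable1_diffP.
  by have [] := dp _ (f0 _ Ux).
have [_ df] := Cf.
have D i x : U x -> is_derive x (delta_mx 0 i) (p \o f) (p' (f x) * pd i f x).
  move=> Ux; apply: is_deriveE_line.
  have [df1 _] := df i; have := df1 _ Ux; rewrite -{1}[x]addr0 -(scale0r (delta_mx 0 i)).
  move=> /is_derive_line.
  rewrite scale0r addr0 => h1.
  have h2 : is_derive (f (x + 0 *: delta_mx 0 i)) (1 : R) p (p' (f x)).
    by rewrite scale0r addr0; apply: dp; exact: f0.
  have := @is_derive1_comp R p (fun s : R => f (x + s *: delta_mx 0 i)) 0 _ _ h2 h1.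
  by [].
move=> i; split; first by move=> x /(D i)[].
have := class_CM oU Cp (df i).2.
by apply: class_C_eq => // x /(D i) h; rewrite [RHS]/pd derive_val.
Qed.

Lemma class_C_powR {m} N (U : set 'rV[R]_m) (f : 'rV[R]_m -> R) (a : R) :
  open U -> (forall x, U x -> 0 < f x) -> class_C N U f ->
  class_C N U (fun x => f x `^ a).
Proof.
move=> oU f0.
have dp b (t : R) : 0 < t -> is_derive t (1 : R) (fun s => s `^ b) (b * t `^ (b - 1)).
  move=> t0; exact: is_derive1_powR.
elim: N a => [|N IH] a Cf.
  split => // x Ux; apply: (@continuous_comp _ _ _ f (fun t => t `^ a)).
    exact: Cf.1.
  apply: differentiable_continuous; apply/derivable1_diffP.
  by have [] := dp a _ (f0 _ Ux).
apply: (class_C_comp1 oU f0 Cf (dp a)).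
exact: class_CM oU (class_C_cst N a oU) (IH (a - 1) (class_CS Cf)).
Qed.

Lemma class_C_ln {m} N (U : set 'rV[R]_m) (f : 'rV[R]_m -> R) :
  open U -> (forall x, U x -> 0 < f x) -> class_C N U f ->
  class_C N U (fun x => ln (f x)).
Proof.
move=> oU f0; case: N => [|N] Cf.
  split => // x Ux; apply: (@continuous_comp _ _ _ f (@ln R)); first exact: Cf.1.
  exact/continuous_ln/f0.
apply: (class_C_comp1 oU f0 Cf (@is_derive1_ln R)).
by apply: class_CV (class_CS Cf) => // x /f0/lt0r_neq0.
Qed.

(** The second difference over a small square of side [h] equals [h^2] times either mixed derivative
    at some point of the square; continuity of both at [x] identifies them. *)
Lemma schwarz {d} (V : set 'rV[R]_d) (f : 'rV[R]_d -> R) i j x : open V ->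
  class_C 2 V f -> V x -> pd i (pd j f) x = pd j (pd i f) x.
Proof.
move=> oV [_ df] Vx; have [->//|ij] := eqVneq i j.
pose e_ a : 'rV[R]_d := delta_mx 0 a.
have fin (r A B C : R) : `|A - B| < r / 2 -> `|C - B| < r / 2 -> `|A - C| <= r.
  move=> h1 h2; apply: (le_trans (ler_distD B A C)); rewrite (splitr r).
  by apply: lerD; apply: ltW; rewrite // distrC.
have sub3 (A B C : R) : A + B + C - A = B + C by ring.
have /nbhs_boxP[e e0 eV] : nbhs x V by exact: open_nbhs_nbhs.
have inV (s t : R) a b : a != b -> `|s| < e -> `|t| < e -> V (x + s *: e_ a + t *: e_ b).
  move=> ab se te; apply: eV => l; rewrite !mxE eqxx /=.
  rewrite sub3; have [->|la] := eqVneq l a.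
    by rewrite (negbTE ab) mulr0 addr0 mulr1.
  by rewrite mulr0 add0r; case: eqP => _; rewrite ?mulr1 // mulr0 normr0.
have D1 a y : V y -> derivable f y (e_ a) by have [+ _] := df a; apply.
have D2 a b y : V y -> derivable (pd a f) y (e_ b).
  by have [_ [_ /(_ b)[+ _]]] := df a; apply.
have H a b (h : R) : a != b -> 0 < h < e -> exists s t : R,
    [/\ `|s| <= h, `|t| <= h &
     f (x + h *: e_ a + h *: e_ b) - f (x + h *: e_ a) - (f (x + h *: e_ b) - f x)
     = h * h * pd b (pd a f) (x + s *: e_ a + t *: e_ b)].
  move=> ab /andP[h0 he]; have ah : `|h| = h by rewrite gtr0_norm.
  pose u y := f (y + h *: e_ b) - f y.
  have sw (s : R) y : y + h *: e_ b + s *: e_ a = y + s *: e_ a + h *: e_ b.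
    by rewrite addrAC.
  have du (s : R) : `|s| <= `|h| -> is_derive (x + s *: e_ a) (e_ a) u
      (pd a f (x + s *: e_ a + h *: e_ b) - pd a f (x + s *: e_ a)).
    rewrite ah => sh; have sle := le_lt_trans sh he.
    apply: is_deriveB.
      apply: is_deriveE_line.
      under [X in is_derive _ _ X _]funext do rewrite addrAC.
      have := @is_derive_line _ _ f (x + s *: e_ a + h *: e_ b) (e_ a) 0.
      rewrite scale0r addr0; apply; apply: D1; apply: inV => //.
      by rewrite ah.
    apply: DeriveDef => //; apply: D1.
    have := @inV s 0 a b ab sle; rewrite scale0r addr0 normr0; exact.
  have [|s sh E1] := @mvt_line _ _ u x a h; first by move=> s /du[].
  have [_ P1] := du _ sh.
  have [|t th E2] := @mvt_line _ _ (pd a f) (x + s *: e_ a) b h.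
    move=> t th; apply: D2; apply: inV => //; rewrite (le_lt_trans _ he) //.
      by rewrite -ah.
    by rewrite -ah.
  exists s, t; split; [by rewrite -ah|by rewrite -ah|].
  rewrite -[LHS]/(u (x + h *: delta_mx 0 a) - u x) E1 -mulrA; congr (_ * _).
  by rewrite /pd P1; exact: E2.
have C2 a b : {for x, continuous (pd b (pd a f))}.
  by have [_ [_ /(_ b)[_ [+ _]]]] := df a; apply.
apply/eqP; rewrite -subr_eq0 -normr_le0; apply/ler_addgt0Pl => r r0; rewrite addr0.
have r2 : 0 < r / 2 by rewrite divr_gt0.
have /cvgrPdist_lt/(_ _ r2)/nbhs_boxP[e1 e10 E1] := C2 j i.
have /cvgrPdist_lt/(_ _ r2)/nbhs_boxP[e2 e20 E2] := C2 i j.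
(* Half the minimum keeps the square inside [V] and within both moduli of continuity. *)
pose h := Num.min e (Num.min e1 e2) / 2.
have m0 : 0 < Num.min e (Num.min e1 e2) by rewrite !lt_min e0 e10 e20.
have [h0 hm] : 0 < h /\ h < Num.min e (Num.min e1 e2).
  by rewrite /h; split; lra.
move: hm; rewrite !lt_min => /and3P[he he1 he2].
have hh : 0 < h < e by rewrite h0.
have bx (s t : R) (a b : 'I_d) (e3 : R) : a != b -> h < e3 -> `|s| <= h -> `|t| <= h ->
    forall l, `|(x + s *: e_ a + t *: e_ b) 0 l - x 0 l| < e3.
  move=> ab h3 se te l; rewrite !mxE eqxx /=.
  rewrite sub3; have [->|la] := eqVneq l a.
    by rewrite (negbTE ab) mulr0 addr0 mulr1 (le_lt_trans se).
  rewrite mulr0 add0r; case: eqP => _; first by rewrite mulr1 (le_lt_trans te).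
  by rewrite mulr0 normr0 (lt_trans h0).
have [s1 [t1 [s1h t1h F1]]] := H i j h ij hh.
have ji : j != i by rewrite eq_sym.
have [s2 [t2 [s2h t2h F2]]] := H j i h ji hh.
have F12 : pd j (pd i f) (x + s1 *: e_ i + t1 *: e_ j) =
    pd i (pd j f) (x + s2 *: e_ j + t2 *: e_ i).
  have hn : h * h != 0 by rewrite mulf_neq0 // gt_eqF.
  apply: (mulfI hn); apply: (etrans (esym F1)); apply: (etrans _ F2).
  rewrite [in RHS](_ : x + h *: e_ j + h *: e_ i = x + h *: e_ i + h *: e_ j); last first.
    exact: addrAC.
  have sw (A B C D : R) : A - B - (C - D) = A - C - (B - D) by ring.
  exact: sw.
have G1 := E1 _ (bx _ _ _ _ _ ji he1 s2h t2h).
have G2 := E2 _ (bx _ _ _ _ _ ij he2 s1h t1h).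
rewrite F12 in G2.
exact: fin G1 G2.
Qed.

End chain_rule.

(* Definitions are locked so that unification does not look through them. *)
Fact lock_key : unit. Proof. exact: tt. Qed.

(** The chosen point makes the ring of functions on the set nontrivial, as [smul10] requires. *)
Record odom (R : realType) d := Odom {
  oset :> 'rV[R]_d -> Prop;
  oset_open : open oset;
  opt : 'rV[R]_d;
  opt_in : oset opt }.

(* Smooth functions on V, normalised to vanish outside V so that equality on V
   is Leibniz equality. *)
Record smf (R : realType) d (V : odom R d) := Smf {
  smf_fun :> 'rV[R]_d -> R;
  smf_smooth : forall N, class_C N V smf_fun;
  smf_out : forall x, ~ V x -> smf_fun x = 0 }.

(** * The ring of smooth functions on an open set *)

Section smf_ring.
Context {R : realType} {d : nat} {V : odom R d}.
Local Notation sm := (smf V).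
Implicit Types (f g : sm) (x : 'rV[R]_d).

Lemma smf_ext f g : (forall x, V x -> f x = g x) -> f = g.
Proof.
case: f g => f f1 f2 [g g1 g2] /= fg.
have E : f = g.
  by apply/funext => x; have [/fg//|nV] := pselect (V x); rewrite f2 // g2.
by subst g; congr Smf; exact: Prop_irrelevance.
Qed.

Definition smf_trim (f : 'rV[R]_d -> R) x := if pselect (V x) then f x else 0.

Lemma smf_trim_in (f : 'rV[R]_d -> R) x : V x -> smf_trim f x = f x.
Proof. by rewrite /smf_trim; case: pselect. Qed.

Lemma smf_trim_out (f : 'rV[R]_d -> R) x : ~ V x -> smf_trim f x = 0.
Proof. by rewrite /smf_trim; case: pselect. Qed.

Lemma smf_trim_smooth (f : 'rV[R]_d -> R) : (forall N, class_C N V f) ->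
  forall N, class_C N V (smf_trim f).
Proof.
move=> Cf N; apply: class_C_eq (Cf N); first exact: oset_open.
by move=> x Vx; rewrite smf_trim_in.
Qed.

Definition smk : forall f : 'rV[R]_d -> R, (forall N, class_C N V f) -> sm :=
  locked_with lock_key (fun (f : 'rV[R]_d -> R) Cf => Smf (smf_trim_smooth Cf) (@smf_trim_out f)).

Lemma smkE (f : 'rV[R]_d -> R) Cf x : V x -> @smk f Cf x = f x.
Proof. by rewrite /smk unlock; exact: smf_trim_in. Qed.

Let oV := @oset_open R d V.

Definition scst : R -> sm :=
  locked_with lock_key (fun c => smk (fun N => class_C_cst N c oV)).
Definition sadd : sm -> sm -> sm := locked_with lock_key (fun f g => smk (fun N => class_CD oV (smf_smooth f N) (smf_smooth g N))).
Definition smul : sm -> sm -> sm := locked_with lock_key (fun f g => smk (fun N => class_CM oV (smf_smooth f N) (smf_smooth g N))).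
Definition sopp f : sm := smul (scst (-1)) f.

Lemma saddE f g x : V x -> sadd f g x = f x + g x.
Proof. by rewrite /sadd unlock; exact: smkE. Qed.
Lemma smulE f g x : V x -> smul f g x = f x * g x.
Proof. by rewrite /smul unlock; exact: smkE. Qed.
Lemma scstE c x : V x -> scst c x = c.
Proof. by rewrite /scst unlock; exact: smkE. Qed.
Lemma soppE f x : V x -> sopp f x = - f x.
Proof. by move=> Vx; rewrite smulE // scstE // mulN1r. Qed.

HB.instance Definition _ := gen_eqMixin (smf V).
HB.instance Definition _ := gen_choiceMixin (smf V).

Lemma saddA : associative sadd.
Proof. by move=> f g h; apply: smf_ext => x Vx; rewrite !saddE // addrA. Qed.
Lemma saddC : commutative sadd.
Proof. by move=> f g; apply: smf_ext => x Vx; rewrite !saddE // addrC. Qed.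
Lemma sadd0 : left_id (scst 0) sadd.
Proof. by move=> f; apply: smf_ext => x Vx; rewrite saddE // scstE // add0r. Qed.
Lemma saddN : left_inverse (scst 0) sopp sadd.
Proof. by move=> f; apply: smf_ext => x Vx; rewrite saddE // scstE // soppE // addNr. Qed.
HB.instance Definition _ := GRing.isZmodule.Build (smf V) saddA saddC sadd0 saddN.

Lemma smulA : associative smul.
Proof. by move=> f g h; apply: smf_ext => x Vx; rewrite !smulE // mulrA. Qed.
Lemma smulC : commutative smul.
Proof. by move=> f g; apply: smf_ext => x Vx; rewrite !smulE // mulrC. Qed.
Lemma smul1 : left_id (scst 1) smul.
Proof. by move=> f; apply: smf_ext => x Vx; rewrite smulE // scstE // mul1r. Qed.
Lemma smulD : left_distributive smul sadd.
Proof.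
by move=> f g h; apply: smf_ext => x Vx; rewrite !(smulE, saddE) // mulrDl.
Qed.
Lemma smul10 : scst 1 != scst 0.
Proof.
apply/eqP => /(congr1 (fun f : sm => f (opt V))).
by rewrite !scstE; try exact: opt_in; move/eqP; rewrite oner_eq0.
Qed.
HB.instance Definition _ := GRing.Zmodule_isComNzRing.Build (smf V)
  smulA smulC smul1 smulD smul10.

Lemma scst_additive : zmod_morphism scst.
Proof.
move=> a b; apply: smf_ext => x Vx.
by rewrite -[RHS]/(sadd (scst a) (sopp (scst b)) x) saddE // soppE // !scstE.
Qed.
HB.instance Definition _ := GRing.isZmodMorphism.Build R (smf V) scst scst_additive.
Lemma scst_multiplicative : monoid_morphism scst.
Proof.
split => [//|a b]; apply: smf_ext => x Vx.
by rewrite -[RHS]/(smul (scst a) (scst b) x) smulE // !scstE.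
Qed.
HB.instance Definition _ := GRing.isMonoidMorphism.Build R (smf V) scst scst_multiplicative.

Definition sev x (Vx : V x) f : R := f x.
Lemma sev_additive x Vx : zmod_morphism (@sev x Vx).
Proof. by move=> f g; rewrite /sev -[LHS]/(sadd f (sopp g) x) saddE // soppE. Qed.
HB.instance Definition _ x Vx :=
  GRing.isZmodMorphism.Build (smf V) R (@sev x Vx) (sev_additive Vx).
Lemma sev_multiplicative x Vx : monoid_morphism (@sev x Vx).
Proof.
by split => [|f g]; rewrite /sev; [exact: scstE|exact: smulE].
Qed.
HB.instance Definition _ x Vx :=
  GRing.isMonoidMorphism.Build (smf V) R (@sev x Vx) (sev_multiplicative Vx).

Lemma smfD f g x : V x -> (f + g) x = f x + g x.
Proof. exact: saddE. Qed.
Lemma smfM f g x : V x -> (f * g) x = f x * g x.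
Proof. exact: smulE. Qed.
Lemma smfN f x : V x -> (- f) x = - f x.
Proof. exact: soppE. Qed.
Lemma smfB f g x : V x -> (f - g) x = f x - g x.
Proof. by move=> Vx; rewrite smfD // smfN. Qed.
Lemma smf0 x : (0 : sm) x = 0.
Proof. by have [Vx|Vx] := pselect (V x); [exact: scstE|exact: smf_out]. Qed.
Lemma smf_nat n x : V x -> (n%:R : sm) x = n%:R.
Proof. by move=> Vx; rewrite -[LHS]/(sev Vx _) rmorph_nat. Qed.
Lemma smf1 x : V x -> (1 : sm) x = 1.
Proof. exact: (@smf_nat 1). Qed.
Lemma smf_sum (I : finType) (P : pred I) (F : I -> sm) x : V x ->
  (\sum_(i | P i) F i) x = \sum_(i | P i) F i x.
Proof. by move=> Vx; rewrite -[LHS]/(sev Vx _) rmorph_sum. Qed.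
Lemma smfX f n x : V x -> (f ^+ n) x = f x ^+ n.
Proof. by move=> Vx; rewrite -[LHS]/(sev Vx _) rmorphXn. Qed.

Lemma class_C_pd i f N : class_C N V (pd i f).
Proof. by have [_ /(_ i)[]] := smf_smooth f N.+1. Qed.

Definition sD : 'I_d -> sm -> sm := locked_with lock_key (fun i f => smk (class_C_pd i f)).

Lemma sDE i f x : V x -> sD i f x = pd i f x.
Proof. by rewrite /sD unlock; exact: smkE. Qed.

Lemma smf_derivable i f x : V x -> derivable f x (delta_mx 0 i).
Proof. by move=> Vx; have [_ /(_ i)[+ _]] := smf_smooth f 1; apply. Qed.

Lemma smf_near (F : 'rV[R]_d -> R) f x : (forall y, V y -> f y = F y) -> V x ->
  {near x, f =1 F}.
Proof. move=> fF Vx; exact: open_near_eq oV Vx fF. Qed.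

Lemma pd_smf i (F : 'rV[R]_d -> R) f x : (forall y, V y -> F y = f y) -> V x ->
  pd i F x = sD i f x.
Proof.
by move=> fF Vx; rewrite sDE //; apply: pd_near_eq; exact: open_near_eq oV Vx fF.
Qed.

Lemma sD_additive i : zmod_morphism (sD i).
Proof.
move=> f g; apply: smf_ext => x Vx; rewrite smfB // !sDE //.
rewrite (@pd_near_eq _ _ i _ (fun y => f y - g y)).
  exact: (deriveB (@smf_derivable i f x Vx) (@smf_derivable i g x Vx)).
by apply: smf_near => // y Vy; rewrite smfB.
Qed.
HB.instance Definition _ i := GRing.isZmodMorphism.Build (smf V) (smf V) (sD i) (sD_additive i).

Lemma sDM i f g : sD i (f * g) = sD i f * g + f * sD i g.
Proof.
apply: smf_ext => x Vx; rewrite smfD // !smfM // !sDE //.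
rewrite (@pd_near_eq _ _ i _ (fun y => f y * g y)); last first.
  by apply: smf_near => // y Vy; rewrite smfM.
have := deriveM (@smf_derivable i f x Vx) (@smf_derivable i g x Vx).
by rewrite /GRing.scale/= [RHS]addrC [g x * _]mulrC.
Qed.

Lemma sD_cst i c : sD i (scst c) = 0.
Proof.
apply: smf_ext => x Vx.
rewrite -[RHS]/(sev Vx 0) rmorph0 sDE // (@pd_near_eq _ _ i _ (fun=> c)).
  by rewrite /pd derive_cst.
by apply: smf_near => // y Vy; rewrite scstE.
Qed.

Lemma sDC i j f : sD i (sD j f) = sD j (sD i f).
Proof.
have E a b x : V x -> sD a (sD b f) x = pd a (pd b f) x.
  move=> Vx; rewrite sDE //; apply: pd_near_eq.
  by apply: smf_near => // y Vy; rewrite sDE.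
apply: smf_ext => x Vx; apply: (etrans (E i j x Vx)); apply: (etrans _ (esym (E j i x Vx))).
exact: (schwarz i j oV (smf_smooth f 2) Vx).
Qed.

Definition scoord : 'I_d -> sm := locked_with lock_key (fun j => smk (fun N => class_C_coord N j oV)).
Lemma scoordE j x : V x -> scoord j x = x 0 j.
Proof. by rewrite /scoord unlock; exact: smkE. Qed.
Lemma sD_coord i j : sD i (scoord j) = (i == j)%:R.
Proof.
apply: smf_ext => x Vx.
rewrite -[RHS]/(sev Vx _) rmorph_nat sDE // (@pd_near_eq _ _ i _ (fun y => y 0 j)).
  by rewrite pd_coord.
by apply: smf_near => // y Vy; rewrite scoordE.
Qed.

Definition sinv f (f0 : forall x, V x -> f x != 0) : sm :=
  smk (fun N => class_CV oV f0 (smf_smooth f N)).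
Lemma sinvE f (f0 : forall x, V x -> f x != 0) x : V x -> @sinv f f0 x = (f x)^-1. Proof. exact: smkE. Qed.
Lemma smulV f (f0 : forall x, V x -> f x != 0) : f * @sinv f f0 = 1.
Proof.
apply: smf_ext => x Vx; rewrite smfM // sinvE //.
by rewrite divff ?f0 // smf1.
Qed.

Definition spow f (f0 : forall x, V x -> 0 < f x) (a : R) : sm :=
  smk (fun N => class_C_powR a oV f0 (smf_smooth f N)).
Lemma spowE f (f0 : forall x, V x -> 0 < f x) a x : V x -> @spow f f0 a x = f x `^ a. Proof. exact: smkE. Qed.

Definition sln f (f0 : forall x, V x -> 0 < f x) : sm :=
  smk (fun N => class_C_ln oV f0 (smf_smooth f N)).
Lemma slnE f (f0 : forall x, V x -> 0 < f x) x : V x -> @sln f f0 x = ln (f x). Proof. exact: smkE. Qed.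

End smf_ring.

Arguments sD {R d V} i f.

Section pullback_ring.
Context {R : realType} {m d : nat} {U : odom R m} {V : odom R d}.
Variables (Phi : 'I_d -> smf U) (UV : forall x, U x -> V (\row_i Phi i x)).

Lemma spull_smooth (f : smf V) N : class_C N U (f \o (fun x => \row_i Phi i x)).
Proof.
apply: class_C_comp (smf_smooth f N) _ => //; try exact: oset_open.
move=> i; apply: class_C_eq (smf_smooth (Phi i) N); first exact: oset_open.
by move=> x _; rewrite mxE.
Qed.

(** Restriction to smaller sets, the slice [r = 0] and evaluation along the extension are all
    instances, so each of them is a ring morphism obeying the chain rule [sD_pull]. *)
Definition spull : smf V -> smf U := locked_with lock_key (fun f => smk (spull_smooth f)).

Lemma spullE f x : U x -> spull f x = f (\row_i Phi i x).
Proof. by rewrite /spull unlock; exact: smkE. Qed.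

Lemma spull_additive : zmod_morphism spull.
Proof.
move=> f g; apply: smf_ext => x Ux.
by rewrite smfB // !spullE // smfB //; exact: UV.
Qed.
HB.instance Definition _ := GRing.isZmodMorphism.Build (smf V) (smf U) spull spull_additive.

Lemma spull_multiplicative : monoid_morphism spull.
Proof.
split=> [|f g]; apply: smf_ext => x Ux.
  by rewrite spullE // !smf1 //; exact: UV.
by rewrite smfM // !spullE // smfM //; exact: UV.
Qed.
HB.instance Definition _ := GRing.isMonoidMorphism.Build (smf V) (smf U) spull
  spull_multiplicative.

Lemma spull_cst c : spull (scst c) = scst c.
Proof.
by apply: smf_ext => x Ux; rewrite spullE // !scstE //; exact: UV.
Qed.

Lemma sD_pull a f : sD a (spull f) = \sum_i spull (sD i f) * sD a (Phi i).
Proof.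
apply: smf_ext => x Ux; rewrite smf_sum // sDE //.
have h := @chain_rule R m d V f (fun x => \row_i Phi i x) x (delta_mx 0 a)
  (@oset_open _ _ V) (smf_smooth f 1) (UV Ux).
have {}h := h _; rewrite (@pd_near_eq _ _ a _ (f \o (fun x => \row_i Phi i x))).
  have E i : (fun y => (\row_i Phi i y : 'rV[R]_d) 0 i) = Phi i.
    by apply/funext => y; rewrite mxE.
  rewrite /pd; have [|_ ->] := h; first by move=> i; rewrite E; exact: smf_derivable.
  apply: eq_bigr => i _; rewrite smfM // spullE // !sDE //; last exact: UV.
  by rewrite E.
by apply: smf_near => // y Uy; rewrite spullE.
Qed.

End pullback_ring.

Section restriction.
Context {R : realType} {d : nat} {U V : odom R d} (UV : forall x, U x -> V x).

Lemma sres_in x : U x -> V (\row_i (scoord i : smf U) x).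
Proof.
move=> Ux; rewrite (_ : \row_i _ = x); first exact: UV.
by apply/rowP => i; rewrite mxE scoordE.
Qed.

Definition sres : smf V -> smf U := spull sres_in.
HB.instance Definition _ := GRing.RMorphism.on sres.

Lemma sresE f x : U x -> sres f x = f x.
Proof.
move=> Ux; rewrite /sres spullE //; congr (f _).
by apply/rowP => i; rewrite mxE scoordE.
Qed.

Lemma sD_sres i f : sD i (sres f) = sres (sD i f).
Proof.
rewrite /sres sD_pull (bigD1 i) //= sD_coord eqxx mulr1 big1 ?addr0 // => j ji.
by rewrite sD_coord eq_sym (negbTE ji) mulr0.
Qed.

Lemma sres_cst c : sres (scst c) = scst c.
Proof. exact: spull_cst. Qed.

End restriction.

Section derivations.
Context {R : realType} {d : nat} {V : odom R d}.
Implicit Types f g : smf V.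

Lemma sD_1 i : sD i (1 : smf V) = 0.
Proof. by rewrite -(rmorph1 scst) sD_cst. Qed.

Lemma sD_nat i n : sD i (n%:R : smf V) = 0.
Proof. by rewrite raddfMn /= sD_1 mul0rn. Qed.

Lemma sD_inv i f g : f * g = 1 -> sD i g = - (g * g * sD i f).
Proof.
move=> fg; have := congr1 (sD i) fg; rewrite sDM sD_1 => E.
have : g * (sD i f * g + f * sD i g) = 0 by rewrite E mulr0.
rewrite mulrDr [g * (f * _)]mulrA [g * f]mulrC fg mul1r => /eqP.
rewrite addrC addr_eq0 => /eqP ->; ring.
Qed.

Lemma sDXn i f n : sD i (f ^+ n) = n%:R * f ^+ n.-1 * sD i f.
Proof.
elim: n => [|n IH]; first by rewrite expr0 sD_1 !mul0r.
rewrite exprS sDM IH /=; case: n IH => [|n] IH; first by rewrite !mul0r mulr0 addr0 expr0 mulr1 !mul1r.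
by rewrite /= exprS -[n.+2%:R]natr1; ring.
Qed.

End derivations.

Lemma continuous_box {R : realType} {d} (f : 'rV[R]_d -> R) (x : 'rV[R]_d) :
  (forall eps : R, 0 < eps -> exists2 b : R, 0 < b &
    forall z : 'rV[R]_d, (forall j, `|z 0 j - x 0 j| < b) -> `|f x - f z| < eps) ->
  {for x, continuous f}.
Proof.
move=> H P /nbhs_ballP[eps /= /H[b b0 B] eP].
suff : nbhs x [set z | P (f z)] by [].
by apply/nbhs_boxP; exists b => // z /B; exact: eP.
Qed.

(** * Taylor coefficients at the boundary of a collar *)

Section collar_points.
Context {R : realType} {d : nat}.
Implicit Types (x : 'rV[R]_d) (y : 'rV[R]_(d + 1)).
Local Notation ir := (rshift d (ord0 : 'I_1)).

Lemma base_pt x r : base (pt x r) = x. Proof. exact: row_mxKl. Qed.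
Lemma hgt_pt x r : hgt (pt x r) = r.
Proof. by rewrite /hgt /pt row_mxEr mxE eqxx mulr1n. Qed.
Lemma pt_base_hgt y : pt (base y) (hgt y) = y.
Proof.
rewrite /pt -[RHS](hsubmxK y); congr row_mx.
by apply/rowP => j; rewrite ord1 !mxE eqxx mulr1n.
Qed.
Lemma pt_lshift x r j : pt x r 0 (lshift 1 j) = x 0 j.
Proof. exact: row_mxEl. Qed.
Lemma pt_rshift x r : pt x r 0 ir = r. Proof. exact: hgt_pt. Qed.
Lemma baseE y j : base y 0 j = y 0 (lshift 1 j). Proof. by rewrite mxE. Qed.

Lemma ord_add1 (P : 'I_(d + 1) -> Prop) :
  (forall a, P (lshift 1 a)) -> P ir -> forall i, P i.
Proof.
move=> Pl Pr i; rewrite -(splitK i); case: fintype.split => [a|b]; first exact: Pl.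
by rewrite /= (ord1 b).
Qed.

Lemma lrshiftF a : (lshift 1 a == ir :> 'I_(d + 1)) = false.
Proof. exact: eq_lrshift. Qed.
Lemma rlshiftF a : (ir == lshift 1 a :> 'I_(d + 1)) = false.
Proof. exact: eq_rlshift. Qed.

Lemma base_moveL y (s : R) a :
  base (y + s *: delta_mx 0 (lshift 1 a)) = base y + s *: delta_mx 0 a.
Proof.
by apply/rowP => j; rewrite !mxE eqxx /= eq_lshift.
Qed.
Lemma hgt_moveL y (s : R) a : hgt (y + s *: delta_mx 0 (lshift 1 a)) = hgt y.
Proof. by rewrite /hgt !mxE eqxx /= rlshiftF mulr0 addr0. Qed.
Lemma base_moveR y (s : R) : base (y + s *: delta_mx 0 ir) = base y.
Proof.
by apply/rowP => j; rewrite !mxE eqxx /= lrshiftF mulr0 addr0.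
Qed.
Lemma hgt_moveR y (s : R) : hgt (y + s *: delta_mx 0 ir) = hgt y + s.
Proof. by rewrite /hgt !mxE !eqxx mulr1. Qed.
Lemma pt_moveR x (s t : R) : pt x s + t *: delta_mx 0 ir = pt x (s + t).
Proof.
by rewrite -[LHS]pt_base_hgt base_moveR hgt_moveR base_pt hgt_pt.
Qed.

End collar_points.

Notation ir := (rshift _ (ord0 : 'I_1)).

Section boxes.
Context {R : realType} {d : nat} (V0 : odom R d) (e : R) (e0 : 0 < e).

(** The box crosses [r = 0], so that boundary jets are ordinary derivatives at interior points. On
    the half [pbox_set] the coordinate [r] is invertible, and the singular metrics live there. *)
Definition box_set : set 'rV[R]_(d + 1) := [set y | V0 (base y) /\ `|hgt y| < e].
Definition pbox_set : set 'rV[R]_(d + 1) := [set y | V0 (base y) /\ 0 < hgt y < e].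

Lemma base_hgt_open (P : set R) : open P -> open [set y : 'rV[R]_(d + 1) | V0 (base y) /\ P (hgt y)].
Proof.
move=> oP; rewrite openE => y [Vy Py].
have /nbhs_boxP[a a0 aV] : nbhs (base y) V0.
  by apply: open_nbhs_nbhs; split => //; exact: oset_open.
have /nbhs_ballP[b /= b0 bP] : nbhs (hgt y) P by exact: open_nbhs_nbhs.
apply/nbhs_boxP; exists (Num.min a b); first by rewrite lt_min a0.
move=> z yz; split.
  by apply: aV => j; rewrite !baseE; apply: lt_le_trans (yz _) _; rewrite ge_min lexx.
apply: bP; rewrite /ball/= distrC.
by apply: lt_le_trans (yz _) _; rewrite ge_min lexx orbT.
Qed.

Lemma box_open : open box_set.
Proof.
rewrite [X in open X](_ : _ = [set y | V0 (base y) /\ [set` `]-e, e[] (hgt y)]).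
  exact/base_hgt_open/interval_open.
by apply/seteqP; split => y; rewrite /box_set /= in_itv /= -ltr_norml.
Qed.

Lemma pbox_open : open pbox_set.
Proof.
rewrite [X in open X](_ : _ = [set y | V0 (base y) /\ [set` `]0, e[] (hgt y)]).
  exact/base_hgt_open/interval_open.
by apply/seteqP; split => y [Vy] /=; rewrite in_itv.
Qed.

Lemma box_opt : box_set (pt (opt V0) 0).
Proof.
by rewrite /box_set/= base_pt hgt_pt normr0; split => //; exact: opt_in.
Qed.

Lemma pbox_opt : pbox_set (pt (opt V0) (e / 2)).
Proof.
rewrite /pbox_set/= base_pt hgt_pt; split; first exact: opt_in.
by rewrite divr_gt0 //= ltr_pdivrMr // mulr_natr mulr2n ltrDl.
Qed.

Definition obox := Odom box_open box_opt.
Definition pbox := Odom pbox_open pbox_opt.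

Lemma box_pt x r : V0 x -> `|r| < e -> obox (pt x r).
Proof. by move=> Vx re; rewrite /= /box_set /= base_pt hgt_pt. Qed.

Lemma pbox_pt x r : V0 x -> 0 < r < e -> pbox (pt x r).
Proof. by move=> Vx re; rewrite /= /pbox_set /= base_pt hgt_pt. Qed.

Lemma pbox_box y : pbox y -> obox y.
Proof. by move=> [Vy /andP[h0 he]]; split => //; rewrite gtr0_norm. Qed.

Local Notation A := (smf obox).
Local Notation A0 := (smf V0).

Definition slice_coord (i : 'I_(d + 1)) : A0 :=
  match fintype.split i with inl j => scoord j | inr _ => 0 end.

Lemma slice_pt x : V0 x -> \row_i slice_coord i x = pt x 0.
Proof.
move=> Vx; apply/rowP; apply: ord_add1 => [a|]; rewrite mxE /slice_coord.
  by rewrite (unsplitK (inl a)) scoordE // pt_lshift.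
by rewrite (unsplitK (inr _)) smf0 pt_rshift.
Qed.

Lemma slice_in x : V0 x -> obox (\row_i slice_coord i x).
Proof. by move=> Vx; rewrite slice_pt //; apply: box_pt; rewrite // normr0. Qed.

Definition slice : A -> A0 := spull slice_in.
HB.instance Definition _ := GRing.RMorphism.on slice.

Lemma sliceE f x : V0 x -> slice f x = f (pt x 0).
Proof. by move=> Vx; rewrite /slice spullE // slice_pt. Qed.

Lemma sD_slice a f : sD a (slice f) = slice (sD (lshift 1 a) f).
Proof.
rewrite /slice sD_pull (bigD1 (lshift 1 a)) //= big1 ?addr0.
  by rewrite /slice_coord (unsplitK (inl a)) sD_coord eqxx mulr1.
apply: ord_add1 => [b|_].
  rewrite eq_lshift => ba; rewrite /slice_coord (unsplitK (inl b)) sD_coord.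
  by rewrite eq_sym (negbTE ba) mulr0.
by rewrite /slice_coord (unsplitK (inr _)) raddf0 mulr0.
Qed.

Definition res : A -> smf pbox := sres pbox_box.
HB.instance Definition _ := GRing.RMorphism.on res.

Lemma resE f y : pbox y -> res f y = f y. Proof. exact: sresE. Qed.
Lemma sD_res i f : sD i (res f) = res (sD i f). Proof. exact: sD_sres. Qed.

Definition sr : A := scoord ir.
Lemma srE y : obox y -> sr y = hgt y. Proof. exact: scoordE. Qed.

(* The coefficient of r^j in the Taylor expansion at r = 0. *)
Definition co : nat -> A -> A0 :=
  locked_with lock_key (fun j f => scst (j`!%:R^-1) * slice (iter j (sD ir) f)).
Lemma coE j f : co j f = scst (j`!%:R^-1) * slice (iter j (sD ir) f).
Proof. by rewrite /co unlock. Qed.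

Lemma co_is_additive j : zmod_morphism (co j).
Proof.
move=> f g; rewrite !coE -mulrBr -rmorphB; congr (_ * slice _).
by elim: j => //= j ->; rewrite raddfB.
Qed.
HB.instance Definition _ j := GRing.isZmodMorphism.Build A A0 (co j) (co_is_additive j).

Lemma co0 f : co 0 f = slice f.
Proof. by rewrite coE fact0 invr1 rmorph1 mul1r. Qed.

Lemma iterD_comm j i f : iter j (sD ir) (sD i f) = sD i (iter j (sD ir) f) :> A.
Proof. by elim: j => //= j ->; rewrite sDC. Qed.

Lemma co_sD j a f : co j (sD (lshift 1 a) f) = sD a (co j f).
Proof. by rewrite !coE iterD_comm sDM sD_cst mul0r add0r sD_slice. Qed.

Lemma co_Dr j f : co j (sD ir f) = j.+1%:R * co j.+1 f.
Proof.
rewrite !coE -iterSr mulrA; congr (_ * _).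
rewrite -[j.+1%:R](rmorph_nat (@scst _ _ V0)) -rmorphM; congr scst.
by rewrite factS natrM invfM mulrA divff ?mul1r // pnatr_eq0.
Qed.

Lemma smf_natI n (f g : A0) : n.+1%:R * f = n.+1%:R * g -> f = g.
Proof.
move=> E; apply: smf_ext => x Vx; have := congr1 (fun h : A0 => h x) E.
by rewrite !smfM // !smf_nat //; apply: mulfI; rewrite pnatr_eq0.
Qed.

(** Induction through the derivation: [j + 1] times the coefficient of order [j + 1] is the [j]-th
    coefficient of the [r]-derivative, and in the product rule the weights [i] and [j + 1 - i] add
    up to [j + 1]. *)
Lemma coM j f g : co j (f * g) = \sum_(i < j.+1) co i f * co (j - i) g.
Proof.
elim: j f g => [|j IH] f g; first by rewrite big_ord1 subn0 !co0 rmorphM.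
apply: (@smf_natI j); rewrite -co_Dr sDM raddfD /= !IH.
have E1 : \sum_(i < j.+1) co i (sD ir f) * co (j - i) g =
    \sum_(i < j.+2) i%:R * (co i f * co (j.+1 - i) g).
  rewrite [RHS]big_ord_recl mul0r add0r; apply: eq_bigr => i _.
  by rewrite co_Dr lift0 subSS mulrA.
have E2 : \sum_(i < j.+1) co i f * co (j - i) (sD ir g) =
    \sum_(i < j.+2) (j.+1 - i)%:R * (co i f * co (j.+1 - i) g).
  rewrite [RHS]big_ord_recr /= subnn mul0r addr0; apply: eq_bigr => i _.
  by rewrite co_Dr mulrCA -subSn // -ltnS.
rewrite E1 E2 -big_split /= mulr_sumr; apply: eq_bigr => i _.
by rewrite -mulrDl -natrD subnKC // -ltnS.
Qed.

Lemma co_cst j c : co j (scst c) = if j is 0 then scst c else 0.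
Proof.
case: j => [|j]; first by rewrite co0 /slice spull_cst.
by apply: (@smf_natI j); rewrite -co_Dr sD_cst raddf0 mulr0.
Qed.

Lemma co_r j : co j sr = (j == 1%N)%:R.
Proof.
case: j => [|[|j]].
- rewrite co0; apply: smf_ext => x Vx.
  by rewrite sliceE // srE ?hgt_pt ?smf0 //; apply: box_pt; rewrite // normr0.
- apply: (@smf_natI 0); rewrite -co_Dr sD_coord eqxx co0 rmorph1 mulr1.
  by rewrite mulr1n.
- apply: (@smf_natI j.+1); rewrite -co_Dr sD_coord eqxx /= mulr0.
  by rewrite -(rmorph1 scst) co_cst.
Qed.

Lemma co_Mr j f : co j.+1 (sr * f) = co j f.
Proof.
rewrite coM big_ord_recl co_r mul0r add0r big_ord_recl co_r mul1r.
rewrite big1 ?addr0 => [|i _]; last by rewrite co_r mul0r.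
by rewrite lift0 /= subSS subn0.
Qed.

Lemma co0_Mr f : co 0 (sr * f) = 0.
Proof. by rewrite coM big_ord1 co_r mul0r. Qed.

(** The Taylor polynomial is frozen at the base point [x], with constants as coefficients, so that
    [sD ir] simply lowers the order of the remainder. It is used only on the vertical line over
    [x]. *)
Definition trem N (x : 'rV[R]_d) f : A := f - \sum_(j < N) scst (co j f x) * sr ^+ j.

Lemma sD_rXn n : sD ir (sr ^+ n) = n%:R * sr ^+ n.-1.
Proof.
elim: n => [|n IH]; first by rewrite expr0 -(rmorph1 scst) sD_cst mul0r.
rewrite exprS sDM sD_coord eqxx mul1r IH /=.
case: n IH => [|n] IH; first by rewrite mul0r mulr0 addr0 mul1r.
by rewrite mulrCA -exprS /= -[n.+2%:R]natr1 mulrDl mul1r addrC.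
Qed.

Lemma sD_trem N x f : V0 x -> sD ir (trem N.+1 x f) = trem N x (sD ir f).
Proof.
move=> Vx; rewrite /trem raddfB raddf_sum /= big_ord_recl expr0 mulr1 sD_cst add0r.
congr (_ - _); apply: eq_bigr => i _.
rewrite sDM sD_cst mul0r add0r sD_rXn lift0 /= mulrA; congr (_ * _).
rewrite co_Dr smfM // smf_nat // rmorphM mulrC; congr (_ * _).
by rewrite rmorph_nat.
Qed.

Lemma trem_pt N x f r : V0 x -> `|r| < e ->
  trem N x f (pt x r) = f (pt x r) - \sum_(j < N) co j f x * r ^+ j.
Proof.
move=> Vx re; have Vr := box_pt Vx re.
rewrite smfB // smf_sum //; congr (_ - _); apply: eq_bigr => j _.
by rewrite smfM // scstE // smfX // srE // hgt_pt.
Qed.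

(** Repeated mean value theorem in [r]. The factor [1 / N!] is given up, since only the order in [r]
    matters. *)
Lemma taylor_bound N f x (C r : R) : V0 x -> `|r| < e ->
  (forall s, `|s| <= `|r| -> `|iter N (sD ir) f (pt x s)| <= C) ->
  `|trem N x f (pt x r)| <= C * `|r| ^+ N.
Proof.
move=> Vx; elim: N f r => [|N IH] f r re Cs.
  by rewrite /trem big_ord0 subr0 expr0 mulr1; exact: Cs.
have [|s sr E] := @mvt_line _ _ (trem N.+1 x f) (pt x 0) ir r.
  move=> s sr; apply: smf_derivable; rewrite pt_moveR add0r.
  by apply: box_pt => //; exact: le_lt_trans re.
move: E; rewrite !pt_moveR !add0r.
rewrite [X in _ - X]trem_pt ?normr0 // big_ord_recl expr0 mulr1 big1; last first.
  by move=> j _; rewrite expr0n mulr0.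
rewrite co0 sliceE // addr0 subrr subr0 => ->.
have se := le_lt_trans sr re.
rewrite -sDE; last exact: box_pt.
rewrite sD_trem // normrM exprS mulrCA ler_wpM2l //.
have C0 : 0 <= C by apply: le_trans (normr_ge0 _) (Cs 0 _); rewrite normr0.
have hN : `|trem N x (sD ir f) (pt x s)| <= C * `|s| ^+ N.
  by apply: IH => // t ts; rewrite -iterSr; apply: Cs; exact: le_trans sr.
by apply: le_trans hN _; rewrite ler_wpM2l // lerXn2r // nnegrE.
Qed.

(** Uniformity in the base point is what makes quotients by powers of [r] continuous across [r = 0]
    in [divr_cont]. *)
Lemma taylor N (f : A) x : V0 x -> exists2 C : R, 0 < C & exists2 b : R, 0 < b <= e &
  forall (z : 'rV[R]_d) (r : R), (forall j, `|z 0 j - x 0 j| < b) -> `|r| < b ->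
  V0 z /\ `|f (pt z r) - \sum_(j < N) co j f z * r ^+ j| <= C * `|r| ^+ N.
Proof.
move=> Vx; set g := iter N (sD ir) f.
have Vp : obox (pt x 0) by apply: box_pt; rewrite // normr0.
have gc : {for pt x 0, continuous g} by have [+ _] := smf_smooth g 0; apply.
have /cvgrPdist_lt/(_ 1 ltr01)/nbhs_boxP[b1 b10 B1] := gc.
have /nbhs_boxP[b2 b20 B2] : nbhs x V0.
  by apply: open_nbhs_nbhs; split => //; exact: oset_open.
exists (`|g (pt x 0)| + 1); first by rewrite ltr_wpDl.
exists (Num.min e (Num.min b1 b2)); first by rewrite !lt_min e0 b10 b20 ge_min lexx.
move=> z r zb; rewrite !lt_min => /and3P[re rb1 rb2].
have Vz : V0 z.
  by apply: B2 => j; apply: lt_le_trans (zb j) _; rewrite !ge_min lexx !orbT.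
split => //; rewrite -trem_pt //; apply: taylor_bound => // s sr.
have := B1 (pt z s); rewrite -/g => gb.
have {}gb : `|g (pt x 0) - g (pt z s)| < 1.
  apply: gb; apply: ord_add1 => [a|].
    by rewrite !pt_lshift; apply: lt_le_trans (zb a) _; rewrite !ge_min lexx !orbT.
  by rewrite !pt_rshift subr0; exact: le_lt_trans sr rb1.
rewrite -[g (pt z s)](subKr (g (pt x 0))); apply: le_trans (ler_normB _ _) _.
by rewrite lerD2l ltW.
Qed.

Lemma co_cvg N (f : A) x : V0 x -> (forall j, (j < N)%N -> co j f x = 0) ->
  (fun r : R => r ^- N * f (pt x r)) @ 0^'+ --> co N f x.
Proof.
move=> Vx c0; have [C C0 [b /andP[b0 be] H]] := taylor N.+1 f Vx.
apply/cvgrPdist_lt => eps eps0; near=> r.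
have r0 : 0 < r by [].
have rb : `|r| < b by rewrite gtr0_norm //; near: r; exact: nbhs_right_lt.
have [|_] := H x r _ rb; first by move=> j; rewrite subrr normr0.
rewrite big_ord_recr /= big1 ?add0r => [|i _]; last by rewrite c0 ?mul0r.
move=> h.
have rN0 : r ^+ N != 0 by rewrite expf_neq0 // gt_eqF.
have -> : co N f x - r ^- N * f (pt x r) = - (r ^- N * (f (pt x r) - co N f x * r ^+ N)).
  by rewrite mulrBr mulrCA mulVf // mulr1 opprB.
rewrite normrN normrM normfV normrX.
rewrite gtr0_norm // in h *; rewrite mulrC ltr_pdivrMr ?exprn_gt0 //.
apply: le_lt_trans h _; rewrite exprS mulrA ltr_pM2r ?exprn_gt0 //.
rewrite mulrC -ltr_pdivlMr //; near: r; apply: nbhs_right_lt.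
by rewrite divr_gt0.
Unshelve. all: by end_near. Qed.

(** By induction on [j], the quotient of [f] by [r^j] tends both to the coefficient and to zero.
    Only positive [r] are consulted: the jets on the slice are determined by the side where the
    geometry is defined. *)
Lemma co_eq0 N (f : A) x (C : R) : V0 x -> 
  (\forall r \near (0 : R)^'+, `|f (pt x r)| <= C * r ^+ N) ->
  forall j, (j < N)%N -> co j f x = 0.
Proof.
move=> Vx fC; elim/ltn_ind => j IH jN.
have L : (fun r : R => r ^- j * f (pt x r)) @ 0^'+ --> co j f x.
  by apply: co_cvg => // i ij; apply: IH => //; exact: ltn_trans jN.
have L0 : (fun r : R => r ^- j * f (pt x r)) @ 0^'+ --> (0 : R).
  apply/cvgrPdist_lt => eps eps0; near=> r.
  have r0 : 0 < r by [].
  rewrite sub0r normrN normrM normfV normrX gtr0_norm // mulrC.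
  rewrite ltr_pdivrMr ?exprn_gt0 //.
  have h : `|f (pt x r)| <= C * r ^+ N by near: r.
  apply: le_lt_trans h _.
  have C1 : 0 < `|C| + 1 by rewrite ltr_wpDl.
  apply: (@le_lt_trans _ _ ((`|C| + 1) * r ^+ N)).
    rewrite ler_pM2r ?exprn_gt0 //; apply: le_trans (ler_norm _) _.
    by rewrite lerDl.
  rewrite -(subnK jN) addnS -addSn exprD mulrA ltr_pM2r ?exprn_gt0 //.
  rewrite exprS mulrA.
  have r1 : r < 1 by near: r; exact: nbhs_right_lt.
  apply: (@le_lt_trans _ _ ((`|C| + 1) * r)).
    apply: ler_piMr; first by rewrite mulr_ge0 ?ltW.
    by apply: exprn_ile1; exact: ltW.
  rewrite mulrC -ltr_pdivlMr //; near: r; apply: nbhs_right_lt.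
  by rewrite divr_gt0.
exact: cvg_unique L L0.
Unshelve. all: by end_near. Qed.

(** The quotient of [f] by [r^m], filled in at [r = 0] by the Taylor coefficient. General [m] is
    needed even to divide by [r] once: the [r]-derivative is again such a quotient, with [m + 1] in
    place of [m] and numerator [r f' - m f], which lets smoothness be proved by induction. *)
Definition divr m f (y : 'rV[R]_(d + 1)) : R :=
  if hgt y == 0 then co m f (base y) else f y / hgt y ^+ m.

Lemma off_slice_open : open [set y | obox y /\ hgt y != 0].
Proof.
rewrite [X in open X](_ : _ = [set y | V0 (base y) /\
    ([set` `]-e, e[] `&` ([set` `]-oo, 0[] `|` [set` `]0, +oo[])) (hgt y)]).
  apply: base_hgt_open; apply: openI; first exact: interval_open.
  by apply: openU; exact: interval_open.
apply/seteqP; split => y /=; rewrite /box_set /= !in_itv /= andbT -ltr_norml.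
  by move=> [[Vy ye]]; rewrite neq_lt => /orP[]; do 2!split => //; [left|right].
by move=> [Vy [ye y0]]; split; [split|case: y0 => ?; [rewrite lt_eqF|rewrite gt_eqF]].
Qed.

Section off_slice.
Variables (y : 'rV[R]_(d + 1)) (Vy : obox y /\ hgt y != 0).
Definition off_dom := @Odom R _ _ off_slice_open y Vy.
Lemma off_box z : off_dom z -> obox z. Proof. by case. Qed.
Definition off_r : smf off_dom := sres off_box sr.
Lemma off_rE z : off_dom z -> off_r z = hgt z.
Proof. by move=> [h1 h2]; rewrite /off_r sresE // srE. Qed.
Lemma off_r_neq0 z : off_dom z -> off_r z != 0.
Proof. by move=> Oz; rewrite off_rE //; case: Oz. Qed.
Definition off_w := sinv off_r_neq0.
Definition off_q m f := sres off_box f * off_w ^+ m.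

Lemma off_qE m f z : off_dom z -> off_q m f z = divr m f z.
Proof.
move=> Oz; rewrite /off_q smfM // sresE // smfX // sinvE // off_rE // exprVn.
by rewrite /divr; case: Oz => _ /negbTE ->.
Qed.

Lemma sD_off_qL a m f : sD (lshift 1 a) (off_q m f) = off_q m (sD (lshift 1 a) f).
Proof.
rewrite /off_q sDM sD_sres sDXn (sD_inv _ (smulV off_r_neq0)).
by rewrite /off_r sD_sres sD_coord lrshiftF raddf0 !(mulr0, oppr0) addr0.
Qed.

Lemma sD_off_qR m f : sD ir (off_q m f) = off_q m.+1 (sr * sD ir f - m%:R * f).
Proof.
rewrite /off_q sDM sD_sres sDXn (sD_inv _ (smulV off_r_neq0)).
rewrite {1}/off_r sD_sres sD_coord eqxx rmorph1 mulr1 rmorphB !rmorphM rmorph_nat.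
rewrite -/off_r -/off_w mulrBl; congr (_ + _).
  by rewrite exprS [off_r * _]mulrC -!mulrA [off_r * _]mulrA (smulV off_r_neq0) mul1r.
rewrite !(mulrN, mulNr); congr (- _).
case: m => [|m]; first by rewrite !(mulr0, mul0r).
by rewrite /= !exprS; ring.
Qed.

End off_slice.

Lemma divr_cont m f y : (forall j, (j < m)%N -> co j f = 0) -> obox y ->
  {for y, continuous (divr m f)}.
Proof.
move=> f0 Vy; have [y0|y0] := eqVneq (hgt y) 0; last first.
  have Oy : off_dom (conj Vy y0) y by [].
  have [cq _] := smf_smooth (off_q (conj Vy y0) m f) 0.
  apply: continuous_near_eq (cq _ Oy).
  by apply: (smf_near _ Oy) => z Oz; exact: off_qE.
have [Vx _] := Vy.
have [C C0 [b /andP[b0 be] H]] := taylor m.+1 f Vx.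
have cm : {for base y, continuous (co m f)} by have [+ _] := smf_smooth (co m f) 0; apply.
apply: continuous_box => eps eps0; have eps2 : 0 < eps / 2 by rewrite divr_gt0.
have /cvgrPdist_lt/(_ _ eps2)/nbhs_boxP[b1 b10 B1] := cm.
exists (Num.min b (Num.min b1 (eps / 2 / C))).
  by rewrite !lt_min b0 b10 divr_gt0.
move=> z zy.
have zb j : `|base z 0 j - base y 0 j| < b.
  by rewrite !baseE; apply: lt_le_trans (zy _) _; rewrite ge_min lexx.
have zb1 j : `|base z 0 j - base y 0 j| < b1.
  by rewrite !baseE; apply: lt_le_trans (zy _) _; rewrite !ge_min lexx !orbT.
have := zy ir; rewrite -!/(hgt _) y0 subr0 !lt_min => /and3P[rb _ rC].
have h1 := B1 _ zb1.
rewrite /= {1}/divr y0 eqxx /divr; case: ifPn => z0.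
  by apply: lt_trans h1 _; rewrite ltr_pdivrMr // mulr_natr mulr2n ltrDl.
have [_] := H _ _ zb rb; rewrite pt_base_hgt big_ord_recr /= big1 ?add0r => [|i _]; last first.
  by rewrite f0 // smf0 mul0r.
set r := hgt z; set c := co m f (base z) => h2.
have rn : `|r| ^+ m != 0 by rewrite expf_neq0 // normr_eq0.
have rm0 : r ^+ m != 0 by rewrite expf_neq0.
have h3 : `|f z / r ^+ m - c| <= C * `|r|.
  have -> : f z / r ^+ m - c = (f z - c * r ^+ m) / r ^+ m by rewrite mulrBl mulfK.
  rewrite normrM normfV normrX ler_pdivrMr; last by rewrite exprn_gt0 ?normr_gt0.
  by rewrite -mulrA -exprS.
have h4 : C * `|r| < eps / 2 by rewrite mulrC -ltr_pdivlMr.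
have -> : co m f (base y) - f z / r ^+ m = (co m f (base y) - c) - (f z / r ^+ m - c) by ring.
apply: le_lt_trans (ler_normB _ _) _; rewrite (splitr eps).
by apply: ltrD => //; exact: le_lt_trans h4.
Qed.

Lemma divr_deriveL m f a y : obox y ->
  is_derive y (delta_mx 0 (lshift 1 a)) (divr m f) (divr m (sD (lshift 1 a) f) y).
Proof.
move=> Vy; have [y0|y0] := eqVneq (hgt y) 0; last first.
  have Oy : off_dom (conj Vy y0) y by [].
  rewrite -(off_qE _ _ Oy) -sD_off_qL sDE //.
  apply: (@near_eq_is_derive _ _ _ (off_q (conj Vy y0) m f)).
    by apply: (smf_near _ Oy) => z Oz; exact: off_qE.
  by apply: DeriveDef => //; exact: smf_derivable.
apply: is_deriveE_line.
have -> : (fun s => divr m f (y + s *: delta_mx 0 (lshift 1 a))) =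
    (fun s => co m f (base y + s *: delta_mx 0 a)).
  by apply/funext => s; rewrite /divr hgt_moveL y0 eqxx base_moveL.
rewrite /divr y0 eqxx co_sD.
have [Vx _] := Vy.
have := @is_derive_line _ _ (co m f) (base y) (delta_mx 0 a) 0.
rewrite scale0r addr0 sDE //; apply; exact: smf_derivable.
Qed.

Lemma co_natM j m f : co j (m%:R * f) = m%:R * co j f.
Proof. by rewrite !mulr_natl raddfMn. Qed.

(** The coefficient of [r^j] in [r f' - m f] is [(j - m)] times that of [f], so the one at [j = m]
    vanishes too. *)
Lemma co_divrR m f : (forall j, (j < m)%N -> co j f = 0) ->
  forall j, (j < m.+1)%N -> co j (sr * sD ir f - m%:R * f) = 0.
Proof.
move=> f0 [|j] jm; rewrite raddfB /= co_natM.
  rewrite co0_Mr sub0r; case: m f0 jm => [|m] f0 jm; first by rewrite mul0r oppr0.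
  by rewrite (f0 0%N) // mulr0 oppr0.
rewrite co_Mr co_Dr.
have [jm'|] := ltnP j.+1 m; first by rewrite f0 // !mulr0 subr0.
rewrite leq_eqVlt => /orP[/eqP->|mj]; first by rewrite subrr.
by move: jm; rewrite ltnS ltnNge => /negP; case; exact: mj.
Qed.

Lemma divr_deriveR m f y : (forall j, (j < m)%N -> co j f = 0) -> obox y ->
  is_derive y (delta_mx 0 ir) (divr m f) (divr m.+1 (sr * sD ir f - m%:R * f) y).
Proof.
move=> f0 Vy; have [y0|y0] := eqVneq (hgt y) 0; last first.
  have Oy : off_dom (conj Vy y0) y by [].
  rewrite -(off_qE _ _ Oy) -sD_off_qR sDE //.
  apply: (@near_eq_is_derive _ _ _ (off_q (conj Vy y0) m f)).
    by apply: (smf_near _ Oy) => z Oz; exact: off_qE.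
  by apply: DeriveDef => //; exact: smf_derivable.
have [Vx _] := Vy; set x := base y in Vx.
have yE : y = pt x 0 by rewrite -[LHS]pt_base_hgt y0.
apply: is_deriveE_line; rewrite yE.
under [X in is_derive _ _ X _]funext do rewrite pt_moveR add0r.
have -> : divr m.+1 (sr * sD ir f - m%:R * f) (pt x 0) = co m.+1 f x.
  rewrite /divr hgt_pt eqxx base_pt raddfB /= co_natM co_Mr co_Dr.
  by rewrite smfB // !smfM // !smf_nat // -mulrBl -[m.+1%:R]natr1 addrC addKr mul1r.
have [C C0 [b /andP[b0 be] H]] := taylor m.+2 f Vx.
pose G (s : R) := divr m f (pt x s).
have L : h^-1 *: (G (h *: (1 : R) + 0) - G 0) @[h --> (0 : R)^'] --> co m.+1 f x.
  apply/cvgrPdist_lt => eps eps0; near=> h.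
  have h0 : h != 0 by near: h; exact: nbhs_dnbhs_neq.
  have hb : `|h| < b by near: h; exact: dnbhs0_lt.
  have [|_] := H x h _ hb; first by move=> j; rewrite subrr normr0.
  rewrite /G /GRing.scale /= mulr1 addr0 /divr !hgt_pt !base_pt eqxx (negbTE h0).
  rewrite !big_ord_recr /= big1 ?add0r => [|i _]; last by rewrite f0 // smf0 mul0r.
  set c := co m f x; set c1 := co m.+1 f x => h1.
  have hm0 : h ^+ m != 0 by rewrite expf_neq0.
  have -> : c1 - h^-1 * (f (pt x h) / h ^+ m - c) =
     - ((f (pt x h) - (c * h ^+ m + c1 * h ^+ m.+1)) / h ^+ m.+1).
    by rewrite exprS; field; rewrite ?h0 ?hm0.
  rewrite normrN normrM normfV normrX ltr_pdivrMr; last by rewrite exprn_gt0 ?normr_gt0.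
  apply: le_lt_trans h1 _; rewrite exprS mulrA ltr_pM2r; last first.
    by rewrite exprn_gt0 ?normr_gt0.
  rewrite mulrC -ltr_pdivlMr //; near: h; apply: dnbhs0_lt.
  by rewrite divr_gt0.
by apply: DeriveDef; [apply/cvg_ex; eexists; exact: L|apply/cvg_lim].
Unshelve. all: by end_near. Qed.

Lemma divr_class N m f : (forall j, (j < m)%N -> co j f = 0) ->
  class_C N obox (divr m f).
Proof.
elim: N m f => [|N IH] m f f0; split => // y; try by move=> Vy; exact: divr_cont.
move: y; apply: ord_add1 => [a|].
  split; first by move=> y Vy; have [] := divr_deriveL m f a Vy.
  have f1 j : (j < m)%N -> co j (sD (lshift 1 a) f) = 0.
    by move=> jm; rewrite co_sD f0 // raddf0.
  apply: class_C_eq (IH m _ f1); first exact: oset_open.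
  by move=> y Vy; have [_ <-] := divr_deriveL m f a Vy.
split; first by move=> y Vy; have [] := divr_deriveR f0 Vy.
apply: class_C_eq (IH m.+1 _ (co_divrR f0)); first exact: oset_open.
by move=> y Vy; have [_ <-] := divr_deriveR f0 Vy.
Qed.

(** Serves to divide a defining function by [r]. *)
Lemma hadamard f : co 0 f = 0 -> exists2 q : A, f = sr * q & slice q = co 1 f.
Proof.
move=> f0; have f1 j : (j < 1)%N -> co j f = 0 by case: j.
exists (smk (fun N => divr_class N f1)).
  apply: smf_ext => y Vy; rewrite smfM // smkE // srE // /divr.
  have [y0|y0] := eqVneq (hgt y) 0; last by rewrite expr1 mulrC divfK.
  have [Vx _] := Vy.
  by rewrite y0 mul0r -[y]pt_base_hgt y0 -sliceE // -co0 f0 smf0.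
apply: smf_ext => x Vx; rewrite sliceE // smkE ?/divr ?hgt_pt ?eqxx ?base_pt //.
by apply: box_pt; rewrite // normr0.
Qed.

End boxes.
Arguments slice {R d V0 e e0} f.
Arguments res {R d V0 e e0} f.

Section matrix_entries.
Context {A : pzRingType} {m n : nat}.
Implicit Types M N : 'M[A]_(m, n).
Lemma mxD_E M N i j : (M + N) i j = M i j + N i j. Proof. by rewrite mxE. Qed.
Lemma mxN_E M i j : (- M) i j = - M i j. Proof. by rewrite mxE. Qed.
Lemma mxZ_E a M i j : (a *: M) i j = a * M i j. Proof. by rewrite mxE. Qed.
Lemma mx0_E i j : (0 : 'M[A]_(m, n)) i j = 0. Proof. by rewrite mxE. Qed.
End matrix_entries.

Section transpose_additive.
Context {A : pzRingType} {m n : nat}.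
Implicit Types M N : 'M[A]_(m, n).
Lemma trmxD M N : (M + N)^T = M^T + N^T. Proof. exact: raddfD. Qed.
Lemma trmxN M : (- M)^T = - M^T. Proof. exact: raddfN. Qed.
Lemma trmxZ a M : (a *: M)^T = a *: M^T. Proof. exact: linearZ. Qed.
Lemma mxtraceN {k} (M : 'M[A]_k) : \tr (- M) = - \tr M. Proof. exact: raddfN. Qed.
End transpose_additive.

Definition mxlinE := (@mxD_E, @mxN_E, @mxZ_E, @mx0_E).

(* Equalities of linear combinations of matrices, products being atoms *)
Ltac mxring := apply/matrixP => ? ?; rewrite !mxlinE; ring.

Lemma trmx_mul3 (A : comPzRingType) m n p q (M : 'M[A]_(m, n)) (N : 'M[A]_(n, p))
  (P : 'M[A]_(p, q)) : (M *m N *m P)^T = P^T *m N^T *m M^T.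
Proof. by rewrite !trmx_mul mulmxA. Qed.

(** * Connections and curvature over a ring with derivations *)

Section derivation_matrices.
Context {A : comNzRingType} (d : {additive A -> A}).
Hypothesis dM : forall f g, d (f * g) = d f * g + f * d g.

Lemma deriv1 : d 1 = 0.
Proof.
have := dM 1 1; rewrite !mulr1 mul1r => /eqP.
by rewrite -subr_eq0 opprD addNKr oppr_eq0 => /eqP.
Qed.

Lemma dmxD m n (M N : 'M[A]_(m, n)) : map_mx d (M + N) = map_mx d M + map_mx d N.
Proof. exact: raddfD. Qed.

Lemma dmxN m n (M : 'M[A]_(m, n)) : map_mx d (- M) = - map_mx d M.
Proof. exact: raddfN. Qed.

Lemma dmxT m n (M : 'M[A]_(m, n)) : map_mx d M^T = (map_mx d M)^T.
Proof. by rewrite map_trmx. Qed.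

Lemma dmxM m n p (M : 'M[A]_(m, n)) (N : 'M[A]_(n, p)) :
  map_mx d (M *m N) = map_mx d M *m N + M *m map_mx d N.
Proof.
apply/matrixP => i j; rewrite !mxE raddf_sum -big_split; apply: eq_bigr => k _.
by rewrite dM !mxE.
Qed.

Lemma dmx1 n : map_mx d (1%:M : 'M[A]_n) = 0.
Proof. by apply/matrixP => i j; rewrite !mxE raddfMn /= deriv1 mul0rn. Qed.

Lemma dmxZ m n a (M : 'M[A]_(m, n)) : map_mx d (a *: M) = d a *: M + a *: map_mx d M.
Proof. by apply/matrixP => i j; rewrite !mxE dM. Qed.

Lemma dmx_inv n (G Gi : 'M[A]_n) : G *m Gi = 1%:M ->
  map_mx d Gi = - (Gi *m map_mx d G *m Gi).
Proof.
move=> GGi; have GiG : Gi *m G = 1%:M by exact: mulmx1C.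
have := congr1 (map_mx d) GGi; rewrite dmx1 dmxM => /(congr1 (mulmx Gi)).
rewrite mulmx0 mulmxDr !mulmxA GiG mul1mx => /eqP.
by rewrite addrC addr_eq0 => /eqP.
Qed.

Lemma dmx_tr n (M : 'M[A]_n) : d (\tr M) = \tr (map_mx d M).
Proof. by rewrite raddf_sum; apply: eq_bigr => i _; rewrite mxE. Qed.

(** The ring is not a field, so [1 / 2] is an element [half] with [half + half = 1]; this lemma
    makes it a constant for every derivation. *)
Lemma deriv_half (half : A) : half + half = 1 -> d half = 0.
Proof.
move=> h2; have dh : d half + d half = 0 by rewrite -raddfD h2 deriv1.
by rewrite -[LHS]mul1r -{1}h2 mulrDl -mulrDr dh mulr0.
Qed.

End derivation_matrices.

Section connection.
Context {A : comNzRingType} {n : nat} (D : 'I_n -> {additive A -> A}).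
Hypothesis DM : forall i f g, D i (f * g) = D i f * g + f * D i g.
Hypothesis DC : forall i j f, D i (D j f) = D j (D i f).
Variable half : A.
Hypothesis half2 : half + half = 1.

Lemma half_dbl (x : A) : half * x + half * x = x.
Proof. by rewrite -mulrDl half2 mul1r. Qed.

(** Christoffel symbols of the first kind: [Gamma_{e,ab}] is the entry [(e, b)] of the matrix with
    index [a]. *)
Definition LowGam (G : 'M[A]_n) (a : 'I_n) : 'M[A]_n :=
  half *: \matrix_(e, b) (D a (G e b) + D b (G e a) - D e (G a b)).

Lemma LowGamE G a e b :
  LowGam G a e b = half * (D a (G e b) + D b (G e a) - D e (G a b)).
Proof. by rewrite !mxE. Qed.

(* [Gam G Gi a] has entries Gamma^c_{ab} at (c, b). *)
Definition Gam : 'M[A]_n -> 'M[A]_n -> 'I_n -> 'M[A]_n :=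
  locked_with lock_key (fun G Gi a => Gi *m LowGam G a).

Lemma GamE G Gi a : Gam G Gi a = Gi *m LowGam G a.
Proof. by rewrite /Gam unlock. Qed.

(** Entry [(m, j)] is [R^m_{jkl}]: the curvature as an endomorphism, in the form [dA + A A] of a
    connection matrix. *)
Definition Rm (Ga : 'I_n -> 'M[A]_n) k l : 'M[A]_n :=
  map_mx (D k) (Ga l) - map_mx (D l) (Ga k) + (Ga k *m Ga l - Ga l *m Ga k).

Definition Ric (Ga : 'I_n -> 'M[A]_n) i j : A := \sum_k Rm Ga k j k i.

Section metric.
Variables (G Gi : 'M[A]_n).
Hypothesis Gsym : G^T = G.
Hypothesis GGi : G *m Gi = 1%:M.
Local Notation Ga := (Gam G Gi).

Lemma Gs i j : G i j = G j i. Proof. by rewrite -{1}Gsym mxE. Qed.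
Lemma GiG : Gi *m G = 1%:M. Proof. exact: mulmx1C. Qed.
Lemma Gi_sym : Gi^T = Gi.
Proof.
have : Gi^T *m G = 1%:M by rewrite -{1}Gsym -trmx_mul GGi trmx1.
by move=> h; rewrite -[LHS]mulmx1 -GGi mulmxA h mul1mx.
Qed.
Lemma Gis i j : Gi i j = Gi j i. Proof. by rewrite -{1}Gi_sym mxE. Qed.

Lemma G_Gam a : G *m Ga a = LowGam G a.
Proof. by rewrite GamE mulmxA GGi mul1mx. Qed.

Lemma GamC a b c : Ga a c b = Ga b c a.
Proof.
rewrite !GamE !mxE; apply: eq_bigr => e _; rewrite !mxE; congr (_ * (_ * _)).
by rewrite (Gs b a) [D a _ + _]addrC.
Qed.

(** Christoffel symbols of explicit metrics are verified with the index lowered, where no inverse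
    matrix appears. *)
Lemma Gam_unique (Ca : 'I_n -> 'M[A]_n) :
  (forall a, G *m Ca a = LowGam G a) -> forall a, Ga a = Ca a.
Proof. by move=> h a; rewrite GamE -h mulmxA GiG mul1mx. Qed.

Lemma D_metric a : map_mx (D a) G = (Ga a)^T *m G + G *m Ga a.
Proof.
have -> : (Ga a)^T *m G = (G *m Ga a)^T by rewrite trmx_mul Gsym.
rewrite G_Gam; apply/matrixP => i j; rewrite !mxE.
rewrite -mulrDr (Gs j i) (Gs j a) (Gs i a) -[LHS]half_dbl; ring.
Qed.

Lemma D_imetric a : map_mx (D a) Gi = - (Ga a *m Gi + Gi *m (Ga a)^T).
Proof.
rewrite (dmx_inv (DM a) GGi) D_metric mulmxDr mulmxDl; congr (- _).
by rewrite !mulmxA GiG mul1mx -!mulmxA GGi mulmx1 addrC.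
Qed.

(** The curvature is what remains when metric compatibility is differentiated once more and the
    second derivatives of [G] are commuted. *)
Lemma Rm_metric k l : (Rm Ga k l)^T *m G + G *m Rm Ga k l = 0.
Proof.
have E a b : map_mx (D a) (map_mx (D b) G) =
   (map_mx (D a) (Ga b))^T *m G + (Ga b)^T *m (Ga a)^T *m G
   + (Ga b)^T *m G *m Ga a + (Ga a)^T *m G *m Ga b + G *m Ga a *m Ga b
   + G *m map_mx (D a) (Ga b).
  rewrite D_metric dmxD !(dmxM (DM a)) D_metric dmxT.
  by rewrite mulmxDr mulmxDl !mulmxA -!addrA.
have DDC : map_mx (D k) (map_mx (D l) G) = map_mx (D l) (map_mx (D k) G).
  by apply/matrixP => i j; rewrite !mxE DC.
move/eqP: DDC; rewrite -subr_eq0 !E => /eqP <-.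
rewrite /Rm !(trmxD, trmxN, trmx_mul, mulmxDl, mulmxDr, mulNmx, mulmxN, mulmxA).
mxring.
Qed.

Lemma low_Rm_anti k l p q : (G *m Rm Ga k l) p q = - (G *m Rm Ga k l) q p.
Proof.
have /matrixP/(_ p q) := Rm_metric k l; rewrite !mxlinE => /eqP.
rewrite addrC addr_eq0 => /eqP ->; congr (- _).
by rewrite -[in LHS]Gsym -trmx_mul mxE Gsym.
Qed.

Lemma RmN k l : Rm Ga k l = - Rm Ga l k.
Proof. by rewrite /Rm; mxring. Qed.

(** Antisymmetry of the lowered curvature in its endomorphism indices moves the trace to the pair
    that defines [Ric]. *)
Lemma tr_Rm_Ric i m : \sum_k \sum_l Gi k l * Rm Ga k i m l =
  - \sum_p Gi m p * Ric Ga p i.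
Proof.
have E k l : Rm Ga k i m l = - \sum_p Gi m p * (G *m Rm Ga k i) l p.
  have {1}-> : Rm Ga k i = Gi *m (G *m Rm Ga k i) by rewrite mulmxA GiG mul1mx.
  by rewrite mxE -sumrN; apply: eq_bigr => p _; rewrite low_Rm_anti mulrN.
under eq_bigr do under eq_bigr do rewrite E mulrN mulr_sumr.
under eq_bigr do rewrite sumrN exchange_big /=.
rewrite sumrN exchange_big /=; congr (- _); apply: eq_bigr => p _.
rewrite /Ric mulr_sumr; apply: eq_bigr => k _.
have {2}-> : Rm Ga k i = Gi *m (G *m Rm Ga k i) by rewrite mulmxA GiG mul1mx.
rewrite [in RHS]mxE mulr_sumr; apply: eq_bigr => l _.
by rewrite mulrCA.
Qed.

Definition nab (a : 'I_n) (T : 'M[A]_n) : 'M[A]_n :=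
  map_mx (D a) T - ((Ga a)^T *m T + T *m Ga a).

(** The Ricci identity for bilinear forms. The direction indices are left uncorrected: by symmetry
    of the Christoffel symbols those corrections would cancel in the commutator. *)
Lemma nab_comm k l T : nab k (nab l T) - nab l (nab k T) =
  - ((Rm Ga k l)^T *m T + T *m Rm Ga k l).
Proof.
have DDC : map_mx (D k) (map_mx (D l) T) = map_mx (D l) (map_mx (D k) T).
  by apply/matrixP => i j; rewrite !mxE DC.
rewrite /nab /Rm !(dmxD, dmxN, dmxM (DM k), dmxM (DM l), dmxT) DDC.
rewrite !(trmxD, trmxN, trmx_mul, mulmxDl, mulmxDr, mulNmx, mulmxN, mulmxA).
mxring.
Qed.

Lemma nab_sym a T : T^T = T -> (nab a T)^T = nab a T.
Proof.
move=> Ts; rewrite /nab trmxD trmxN trmxD -dmxT !trmx_mul trmxK Ts.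
mxring.
Qed.

Lemma D_contract a T : D a (\tr (Gi *m T)) = \tr (Gi *m nab a T).
Proof.
have E : \tr (Ga a *m Gi *m T) = \tr (Gi *m T *m Ga a).
  by rewrite -mulmxA mxtrace_mulC.
rewrite (dmx_tr (D a)) (dmxM (DM a)) D_imetric /nab mulmxBr mulmxDr.
rewrite mulNmx mulmxDl !mulmxA !(mxtraceD, mxtraceN) E; ring.
Qed.

End metric.
End connection.

Section naturality.
Context {A B : comNzRingType} {n : nat} (D : 'I_n -> {additive A -> A})
  (D' : 'I_n -> {additive B -> B}) (f : {rmorphism A -> B}).
Hypothesis fD : forall i x, f (D i x) = D' i (f x).
Variable half : A.

Lemma map_dmx m p i (M : 'M[A]_(m, p)) :
  map_mx f (map_mx (D i) M) = map_mx (D' i) (map_mx f M).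
Proof. by apply/matrixP => a b; rewrite !mxE fD. Qed.

(** With [f] the slice at [r = 0] this computes leading coefficients; with [f] the restriction to
    the half box it compares smooth and singular metrics. *)
Lemma map_Gam G Gi a :
  map_mx f (Gam D half G Gi a) = Gam D' (f half) (map_mx f G) (map_mx f Gi) a.
Proof.
rewrite !GamE map_mxM; congr (_ *m _); apply/matrixP => i j.
by rewrite !mxE rmorphM rmorphB rmorphD !fD.
Qed.

Lemma map_Rm (Ga : 'I_n -> 'M[A]_n) k l :
  map_mx f (Rm D Ga k l) = Rm D' (fun a => map_mx f (Ga a)) k l.
Proof. by rewrite /Rm map_mxD !map_mxB !map_mxM !map_dmx. Qed.

Lemma map_Ric (Ga : 'I_n -> 'M[A]_n) i j :
  f (Ric D Ga i j) = Ric D' (fun a => map_mx f (Ga a)) i j.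
Proof.
by rewrite /Ric rmorph_sum; apply: eq_bigr => k _; rewrite -map_Rm [RHS]mxE.
Qed.

Lemma Rm_ext (Ga Ga' : 'I_n -> 'M[A]_n) k l : (forall a, Ga a = Ga' a) ->
  Rm D Ga k l = Rm D Ga' k l.
Proof. by move=> h; rewrite /Rm !h. Qed.

Lemma Ric_ext (Ga Ga' : 'I_n -> 'M[A]_n) i j : (forall a, Ga a = Ga' a) ->
  Ric D Ga i j = Ric D Ga' i j.
Proof. by move=> h; apply: eq_bigr => k _; rewrite (Rm_ext _ _ h). Qed.

End naturality.

(** * The Einstein condition *)

Section poincare_ricci.
Context {A : comNzRingType} {n : nat} (D : 'I_(n + 1) -> {additive A -> A}).
Hypothesis DM : forall i f g, D i (f * g) = D i f * g + f * D i g.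
Variables (half r : A).
Hypothesis half2 : half + half = 1.
Local Notation Dx := (fun i : 'I_n => D (lshift 1 i)).
Local Notation DZ := (D ir).
Variables (g gi : 'M[A]_n).
Hypothesis gsym : g^T = g.
Hypothesis ggi : g *m gi = 1%:M.
Local Notation Gg := (Gam Dx half g gi).

(** Half of [g^-1 g']: up to sign the shape operator of the slices of constant [r] in the metric
    [dr^2 + g_r]. *)
Definition PB : 'M[A]_n := locked_with lock_key (half *: (gi *m map_mx DZ g)).
Lemma PBE : PB = half *: (gi *m map_mx DZ g). Proof. by rewrite /PB unlock. Qed.

(* r (Ric(g_+) + n g_+), which is smooth up to r = 0 *)
Definition PQ : 'M[A]_(n + 1) := block_mx
  (\matrix_(i, j) (r * (Ric Dx Gg i j - \tr PB * (g *m PB) j i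
      + (g *m PB *m PB) j i + (g *m PB *m PB) j i - half * DZ (DZ (g j i)))
    + \tr PB * g j i + (n%:R - 1) * (g *m PB) j i))
  (\matrix_(i, j) (r * \sum_k (map_mx (D (lshift 1 k)) PB - map_mx DZ (Gg k)
      + (Gg k *m PB - PB *m Gg k)) k i))
  (\matrix_(i, j) (r * \sum_k (DZ 0 + D (lshift 1 k) (PB k j) - D (lshift 1 j) (PB k k)
      + (Gg k *m PB) k j - (Gg j *m PB) k k)))
  (\matrix_(i, j) (- r * \tr (map_mx DZ PB) + \tr PB - r * \tr (PB *m PB))).

Variable w : A.
Hypothesis rw : r * w = 1.
Hypothesis Dxr : forall i, D (lshift 1 i) r = 0.
Hypothesis DZr : DZ r = 1.

Definition PGp : 'M[A]_(n + 1) := w ^+ 2 *: block_mx g 0 0 1%:M.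
Definition PGpi : 'M[A]_(n + 1) := r ^+ 2 *: block_mx gi 0 0 1%:M.

Lemma PGp_inv : PGp *m PGpi = 1%:M.
Proof.
rewrite /PGp /PGpi -scalemxAl -scalemxAr scalerA -exprMn mulrC rw expr1n scale1r.
by rewrite mulmx_block !(mul0mx, mulmx0, mul1mx, addr0, add0r) ggi -scalar_mx_block.
Qed.

Lemma Dw i : D i w = - (w * w * D i r).
Proof.
have := congr1 (D i) rw; rewrite DM (deriv1 (DM i)) => E.
have : w * (D i r * w + r * D i w) = 0 by rewrite E mulr0.
rewrite mulrDr [w * (r * _)]mulrA [w * r]mulrC rw mul1r => /eqP.
by rewrite addrC addr_eq0 => /eqP ->; ring.
Qed.
Lemma Dxw i : D (lshift 1 i) w = 0. Proof. by rewrite Dw Dxr mulr0 oppr0. Qed.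
Lemma DZw : DZ w = - (w * w). Proof. by rewrite Dw DZr mulr1. Qed.

(** With [w = 1 / r], these are blocks of the Christoffel symbols of [g_+]: [PC] is [Gamma^k_{ir}]
    and [- PK] is [Gamma^r_{ij}]. Lowering an index of [PC] by [g_r] gives [PK]. *)
Definition PK : 'M[A]_n := locked_with lock_key (half *: map_mx DZ g - w *: g).
Definition PC : 'M[A]_n := locked_with lock_key (PB - w%:M).
Lemma PKE : PK = half *: map_mx DZ g - w *: g. Proof. by rewrite /PK unlock. Qed.
Lemma PCE : PC = PB - w%:M. Proof. by rewrite /PC unlock. Qed.

Lemma g_PC : g *m PC = PK.
Proof.
rewrite PCE PBE PKE mulmxBr -scalemxAr mulmxA ggi mul1mx.
by rewrite mul_mx_scalar.
Qed.

Lemma PK_sym : PK^T = PK.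
Proof. by rewrite PKE trmxD trmxN !trmxZ -dmxT gsym. Qed.

Definition PGam (a : 'I_(n + 1)) : 'M[A]_(n + 1) :=
  match fintype.split a with
  | inl i => block_mx (Gg i) (col i PC) (- row i PK) 0
  | inr _ => block_mx PC 0 0 (- w)%:M
  end.

Lemma PGamL i : PGam (lshift 1 i) = block_mx (Gg i) (col i PC) (- row i PK) 0.
Proof. by rewrite /PGam (unsplitK (inl i)). Qed.
Lemma PGamR : PGam ir = block_mx PC 0 0 (- w)%:M.
Proof. by rewrite /PGam (unsplitK (inr ord0)). Qed.

Lemma PGpLL i j : PGp (lshift 1 i) (lshift 1 j) = w ^+ 2 * g i j.
Proof. by rewrite mxE block_mxEul. Qed.
Lemma PGpLR i : PGp (lshift 1 i) ir = 0.
Proof. by rewrite mxE block_mxEur mxE mulr0. Qed.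
Lemma PGpRL i : PGp ir (lshift 1 i) = 0.
Proof. by rewrite mxE block_mxEdl mxE mulr0. Qed.
Lemma PGpRR : PGp ir ir = w ^+ 2.
Proof. by rewrite mxE block_mxEdr mxE eqxx mulr1. Qed.

Lemma DZw2 x : DZ (w ^+ 2 * x) = w ^+ 2 * (DZ x - (w * x + w * x)).
Proof. by rewrite expr2 !DM DZw; ring. Qed.
Lemma Dxw2 i x : D (lshift 1 i) (w ^+ 2 * x) = w ^+ 2 * D (lshift 1 i) x.
Proof. by rewrite expr2 !DM Dxw; ring. Qed.

Lemma mul_colE (M N : 'M[A]_n) e i : (M *m col i N) e ord0 = (M *m N) e i.
Proof. by rewrite !mxE; apply: eq_bigr => k _; rewrite mxE. Qed.
Lemma mul_rowE (M N : 'M[A]_n) e i : (row e M *m N) ord0 i = (M *m N) e i.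
Proof. by rewrite !mxE; apply: eq_bigr => k _; rewrite mxE. Qed.

Lemma Gam_PGp a : Gam D half PGp PGpi a = PGam a.
Proof.
move: a; apply: (Gam_unique PGp_inv); apply: ord_add1 => [i|].
  rewrite PGamL /PGp -scalemxAl mulmx_block !(mul0mx, mulmx0, mul1mx, addr0, add0r).
  rewrite (G_Gam _ _ ggi); apply/matrixP; apply: ord_add1 => [e|]; apply: ord_add1 => [b|].
  - rewrite mxZ_E block_mxEul LowGamE [RHS]LowGamE !PGpLL !Dxw2; ring.
  - rewrite mxZ_E block_mxEur mul_colE g_PC [RHS]LowGamE !(PGpLR, PGpLL) !raddf0.
    rewrite DZw2 PKE !mxlinE mxE; set x := DZ _; rewrite -[w * _ in LHS](half_dbl half2); ring.
  - rewrite mxZ_E block_mxEdl [RHS]LowGamE !(PGpRL, PGpLR, PGpLL) !raddf0 DZw2.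
    rewrite mxN_E mxE PKE !mxlinE mxE; set x := DZ _; rewrite -[w * _ in LHS](half_dbl half2); ring.
  - rewrite mxZ_E block_mxEdr [RHS]LowGamE !(PGpRR, PGpRL, PGpLR) !raddf0 mx0_E.
    by rewrite -[w ^+ 2 in RHS]mulr1 Dxw2 (deriv1 (DM _)); ring.
rewrite PGamR /PGp -scalemxAl mulmx_block !(mul0mx, mulmx0, mul1mx, addr0, add0r) g_PC.
apply/matrixP; apply: ord_add1 => [e|]; apply: ord_add1 => [b|].
- rewrite mxZ_E block_mxEul [RHS]LowGamE !(PGpLL, PGpLR, PGpRL) !raddf0 DZw2.
  rewrite PKE !mxlinE mxE; set x := DZ _; rewrite -[w * _ in LHS](half_dbl half2); ring.
- rewrite mxZ_E block_mxEur [RHS]LowGamE !(PGpLR, PGpRR) !raddf0 mx0_E.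
  by rewrite -[w ^+ 2 in RHS]mulr1 Dxw2 (deriv1 (DM _)); ring.
- rewrite mxZ_E block_mxEdl [RHS]LowGamE !(PGpRL, PGpRR) !raddf0 mx0_E.
  by rewrite -[w ^+ 2 in RHS]mulr1 Dxw2 (deriv1 (DM _)); ring.
- rewrite mxZ_E block_mxEdr [RHS]LowGamE !PGpRR -[w ^+ 2 in RHS]mulr1 DZw2 (deriv1 (DM _)).
  by rewrite mxE eqxx mulr1n -[LHS](half_dbl half2); ring.
Qed.

Lemma Ric_PGpLL i j : Ric D PGam (lshift 1 i) (lshift 1 j) =
  Ric Dx Gg i j - \tr PC * PK j i + (PC^T *m PK) j i
  - DZ (PK j i) + w * PK j i + (PK *m PC) j i.
Proof.
rewrite /Ric big_split_ord big_ord1 /=.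
have -> : \sum_(k < n) Rm D PGam (lshift 1 k) (lshift 1 j) (lshift 1 k) (lshift 1 i) =
    \sum_(k < n) (Rm Dx Gg k j k i - PC k k * PK j i + PC k j * PK k i).
  apply: eq_bigr => k _; rewrite /Rm !PGamL !map_block_mx !mulmx_block.
  rewrite opp_block_mx add_block_mx opp_block_mx add_block_mx add_block_mx block_mxEul.
  rewrite !mxlinE; rewrite !mxE !big_ord1 !mxE; ring.
rewrite big_split sumrB /= -mulr_suml -/(\tr PC).
rewrite [Rm D PGam ir _]/Rm PGamL PGamR !map_block_mx !mulmx_block.
rewrite opp_block_mx add_block_mx opp_block_mx add_block_mx add_block_mx block_mxEdl.
rewrite !mxlinE.
have -> : (PC^T *m PK) j i = \sum_(k < n) PC k j * PK k i.
  by rewrite mxE; apply: eq_bigr => k _; rewrite mxE.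
have -> : (- row j PK *m PC) ord0 i = - (PK *m PC) j i.
  by rewrite mulNmx mxN_E mul_rowE.
rewrite !(mul0mx, mul_scalar_mx) !mxlinE.
have -> : map_mx DZ (- row j PK) ord0 i = - DZ (PK j i) by rewrite !mxE raddfN.
have -> : (map_mx (D (lshift 1 j)) (0 : 'M[A]_(1, n))) ord0 i = 0 by rewrite !mxE raddf0.
have -> : row j PK ord0 i = PK j i by rewrite mxE.
ring.
Qed.

Lemma Ric_PGpRR : Ric D PGam ir ir =
  - \tr (map_mx DZ PC) - w * \tr PC - \tr (PC *m PC).
Proof.
rewrite /Ric big_split_ord big_ord1 /=.
have -> : Rm D PGam ir ir ir ir = 0 by rewrite /Rm !subrr addr0 mxE.
rewrite addr0 /mxtrace mulr_sumr -!sumrN -!big_split /=; apply: eq_bigr => k _.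
rewrite /Rm PGamL PGamR !map_block_mx !mulmx_block.
rewrite opp_block_mx add_block_mx opp_block_mx add_block_mx add_block_mx block_mxEur.
rewrite !(mulmx0, mul0mx, addr0, add0r) !mxlinE mul_mx_scalar mul_colE.
have -> : (map_mx (D (lshift 1 k)) (0 : 'M[A]_(n, 1))) k ord0 = 0 by rewrite mxE mxE raddf0.
have -> : (map_mx DZ (col k PC)) k ord0 = map_mx DZ PC k k by rewrite !mxE.
have -> : (- w *: col k PC) k ord0 = - w * PC k k by rewrite mxZ_E mxE.
ring.
Qed.

Lemma Ric_PGpRL j : Ric D PGam ir (lshift 1 j) =
  \sum_k (D (lshift 1 k) (PC k j) - D (lshift 1 j) (PC k k)
      + (Gg k *m PC) k j - (Gg j *m PC) k k).
Proof.
rewrite /Ric big_split_ord big_ord1 /=.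
have -> : Rm D PGam ir (lshift 1 j) ir ir = 0.
  rewrite /Rm PGamL PGamR !map_block_mx !mulmx_block.
  rewrite opp_block_mx add_block_mx opp_block_mx add_block_mx add_block_mx block_mxEdr.
  rewrite !(mulmx0, mul0mx, addr0, add0r) !mxlinE !mxE !raddf0 eqxx mulr1n raddfN /= Dxw; ring.
rewrite addr0; apply: eq_bigr => k _.
rewrite /Rm !PGamL !map_block_mx !mulmx_block.
rewrite opp_block_mx add_block_mx opp_block_mx add_block_mx add_block_mx block_mxEur.
rewrite !(mulmx0, addr0) !mxlinE !mul_colE.
by rewrite !mxE; ring.
Qed.

Lemma Ric_PGpLR i : Ric D PGam (lshift 1 i) ir =
  \sum_k (map_mx (D (lshift 1 k)) PC - map_mx DZ (Gg k)
      + (Gg k *m PC - PC *m Gg k)) k i.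
Proof.
rewrite /Ric big_split_ord big_ord1 /=.
have -> : Rm D PGam ir ir ir (lshift 1 i) = 0 by rewrite /Rm !subrr addr0 mxE.
rewrite addr0; apply: eq_bigr => k _.
rewrite /Rm PGamL PGamR !map_block_mx !mulmx_block.
rewrite opp_block_mx add_block_mx opp_block_mx add_block_mx add_block_mx block_mxEul.
by rewrite !(mulmx0, mul0mx, addr0).
Qed.

(** The terms in [r^-2] of the Ricci tensor cancel against [n g_+], so a single factor [r] clears
    the remaining pole. *)
Lemma Poincare_defect a b :
  r * (Ric D (Gam D half PGp PGpi) a b + n%:R * PGp a b) = PQ a b.
Proof.
have wr x : r * (w * x) = x by rewrite mulrA rw mul1r.
have DZpb k l : DZ (PC k l) = DZ (PB k l) + w * w *+ (k == l).
  by rewrite PCE mxD_E mxN_E [w%:M k l]mxE raddfB /= raddfMn /= DZw mulNrn opprK.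
have gB : (g *m PB)= half *: map_mx DZ g by rewrite PBE -scalemxAr mulmxA ggi mul1mx.
have sgB : (g *m PB)^T = g *m PB by rewrite gB trmxZ -dmxT gsym.
have sgBE i j : (g *m PB) i j = (g *m PB) j i by rewrite -{1}sgB mxE.
have KE : PK = g *m PB - w *: g by rewrite PKE gB.
have CTK : PC^T *m PK = PK *m PC.
  by rewrite -[in LHS]g_PC mulmxA -[PC^T *m g](trmxK) trmx_mul trmxK gsym g_PC PK_sym.
have KC : PK *m PC = g *m PB *m PB - (w + w) *: (g *m PB) + (w * w) *: g.
  rewrite KE PCE mulmxBr !mulmxBl !mul_mx_scalar -scalemxAl scalerA.
  by mxring.
have trC : \tr PC = \tr PB - n%:R * w.
  by rewrite PCE mxtraceD mxtraceN mxtrace_scalar mulr_natl.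
rewrite (Ric_ext _ _ _ Gam_PGp); move: a b; apply: ord_add1 => [i|]; apply: ord_add1 => [j|].
- rewrite Ric_PGpLL PGpLL block_mxEul [RHS]mxE CTK KC trC.
  have -> : DZ (PK j i) = half * DZ (DZ (g j i)) + (w * w) * g j i - w * DZ (g j i).
    rewrite PKE mxD_E mxN_E !mxZ_E mxE raddfB /= !DM (deriv_half (DM _) half2) DZw; ring.
  have -> : DZ (g j i) = (g *m PB) j i + (g *m PB) j i.
    by rewrite gB mxZ_E mxE half_dbl.
  rewrite KE !mxlinE expr2 (_ : g i j = g j i); last by rewrite -{1}gsym mxE.
  by ring: (rw).
- rewrite Ric_PGpLR PGpLR mulr0 addr0 block_mxEur [RHS]mxE; congr (_ * _).
  apply: eq_bigr => k _; rewrite PCE mulmxBr mulmxBl mul_mx_scalar mul_scalar_mx.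
  have -> : map_mx (D (lshift 1 k)) (PB - w%:M) = map_mx (D (lshift 1 k)) PB.
    apply/matrixP => x y; rewrite !mxE raddfB /= raddfMn /= Dxw mul0rn subr0 //.
  by rewrite !mxlinE; ring.
- rewrite Ric_PGpRL PGpRL mulr0 addr0 block_mxEdl [RHS]mxE; congr (_ * _).
  apply/eqP; rewrite -subr_eq0 -sumrB; apply/eqP.
  (* The two sides differ by [w] times a trace of the torsion of [Gg], which vanishes. *)
  rewrite (eq_bigr (fun k => w * (Gg j k k - Gg k k j))) => [|k _].
    by rewrite big1 // => k _; rewrite (@GamC _ _ Dx half g gi gsym j k k) subrr mulr0.
  rewrite PCE !mulmxBr !mul_mx_scalar !mxlinE raddf0.
  have E x p y z : D (lshift 1 x) (p - (w%:M : 'M[A]_n) y z) = D (lshift 1 x) p.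
    by rewrite raddfB /= [w%:M _ _]mxE raddfMn /= Dxw mul0rn subr0.
  by rewrite !E; ring.
- rewrite Ric_PGpRR PGpRR block_mxEdr [RHS]mxE trC.
  have -> : \tr (map_mx DZ PC) = \tr (map_mx DZ PB) + n%:R * (w * w).
    rewrite /mxtrace (eq_bigr (fun k => map_mx DZ PB k k + w * w)) => [|k _].
      by rewrite big_split /= sumr_const card_ord mulr_natl.
    by rewrite mxE DZpb eqxx mulr1n [in RHS]mxE.
  have -> : \tr (PC *m PC) = \tr (PB *m PB) - (w + w) * \tr PB + n%:R * (w * w).
    rewrite PCE mulmxBr !mulmxBl !mul_mx_scalar mul_scalar_mx.
    rewrite !(mxtraceD, mxtraceN, mxtraceZ) mxtrace_scalar; ring.
  by ring: (rw).
Qed.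

End poincare_ricci.

(** * Linearized Ricci curvature *)

Section linearized_ricci.
Context {A : comNzRingType} {n : nat} (D : 'I_n -> {additive A -> A}).
Hypothesis DM : forall i f g, D i (f * g) = D i f * g + f * D i g.
Hypothesis DC : forall i j f, D i (D j f) = D j (D i f).
Variable half : A.
Hypothesis half2 : half + half = 1.
Variables (G Gi : 'M[A]_n).
Hypothesis Gsym : G^T = G.
Hypothesis GGi : G *m Gi = 1%:M.
Local Notation Ga := (Gam D half G Gi).
Local Notation nabG := (nab D half G Gi).

Definition cov3 (T : 'I_n -> 'I_n -> 'I_n -> A) i j k l : A :=
  D l (T i j k) - \sum_m (Ga l m i * T m j k + Ga l m j * T i m k + Ga l m k * T i j m).

Lemma cov3_perm (T : 'I_n -> 'I_n -> 'I_n -> A) i j k l :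
  cov3 (fun a b c => T b c a) i j k l = cov3 T j k i l.
Proof. by rewrite /cov3; congr (_ - _); apply: eq_bigr => m _; ring. Qed.

Lemma cov3_perm2 (T : 'I_n -> 'I_n -> 'I_n -> A) i j k l :
  cov3 (fun a b c => T c a b) i j k l = cov3 T k i j l.
Proof. by rewrite /cov3; congr (_ - _); apply: eq_bigr => m _; ring. Qed.

Lemma cov3_ext (T T' : 'I_n -> 'I_n -> 'I_n -> A) i j k l :
  (forall a b c, T a b c = T' a b c) -> cov3 T i j k l = cov3 T' i j k l.
Proof.
by move=> h; rewrite /cov3 h; congr (_ - _); apply: eq_bigr => m _; rewrite !h.
Qed.

Lemma cov3_swap (T : 'I_n -> 'I_n -> 'I_n -> A) i j k l :
  cov3 (fun a b c => T b a c) i j k l = cov3 T j i k l.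
Proof. by rewrite /cov3; congr (_ - _); apply: eq_bigr => m _; ring. Qed.

Lemma cov3B (T T' : 'I_n -> 'I_n -> 'I_n -> A) i j k l :
  cov3 (fun a b c => T a b c - T' a b c) i j k l = cov3 T i j k l - cov3 T' i j k l.
Proof.
rewrite /cov3 raddfB /= (eq_bigr (fun m =>
  (Ga l m i * T m j k + Ga l m j * T i m k + Ga l m k * T i j m) -
  (Ga l m i * T' m j k + Ga l m j * T' i m k + Ga l m k * T' i j m))) => [|m _].
  by rewrite sumrB; ring.
by ring.
Qed.

Lemma cov3_half (T : 'I_n -> 'I_n -> 'I_n -> A) i j k l :
  cov3 (fun a b c => half * T a b c) i j k l = half * cov3 T i j k l.
Proof.
rewrite /cov3 DM (deriv_half (DM l) half2) mul0r add0r mulrBr; congr (_ - _).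
by rewrite mulr_sumr; apply: eq_bigr => m _; ring.
Qed.

Lemma cov3_nab (T : 'I_n -> 'M[A]_n) i j k l :
  cov3 (fun a b c => T c a b) i j k l = nabG l (T k) i j - \sum_m Ga l m k * T m i j.
Proof.
rewrite /cov3 /nab !mxlinE [(map_mx _ _) _ _]mxE [(_ *m _) i j]mxE [(_ *m _) i j]mxE.
rewrite -big_split /= -addrA -opprD -big_split /=; congr (_ - _).
by apply: eq_bigr => m _; rewrite [(Ga l)^T _ _]mxE; ring.
Qed.

Lemma cov3_contract (T : 'I_n -> 'I_n -> 'I_n -> A) i l :
  let t c := \sum_a \sum_b Gi a b * T a b c in
  \sum_a \sum_b Gi a b * cov3 T a b i l = D l (t i) - \sum_m Ga l m i * t m.
Proof.
move=> t; pose M c := \matrix_(b, a) T b a c.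
have tE c : t c = \tr (Gi *m (M c)).
  rewrite /t exchange_big /=; apply: eq_bigr => a _; rewrite mxE; apply: eq_bigr => b _.
  by rewrite mxE (Gis Gsym GGi).
rewrite tE (D_contract DM half2 Gsym GGi).
have -> : \tr (Gi *m nabG l (M i)) = \sum_a \sum_b Gi a b * nabG l (M i) a b.
  rewrite /mxtrace exchange_big /=; apply: eq_bigr => a _; rewrite mxE; apply: eq_bigr => b _.
  by rewrite (Gis Gsym GGi).
have -> : \sum_m Ga l m i * t m = \sum_a \sum_b Gi a b * (\sum_m Ga l m i * T a b m).
  under [in RHS]eq_bigr do under eq_bigr do rewrite mulr_sumr.
  under [in RHS]eq_bigr do rewrite exchange_big /=.
  rewrite exchange_big /=; apply: eq_bigr => m _; rewrite mulr_sumr.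
  apply: eq_bigr => a _; rewrite mulr_sumr; apply: eq_bigr => b _; ring.
rewrite -sumrB; apply: eq_bigr => a _; rewrite -sumrB; apply: eq_bigr => b _.
rewrite -mulrBr; congr (_ * _).
have -> : cov3 T a b i l = cov3 (fun a b c => M c a b) a b i l.
  by rewrite /cov3 !mxE; congr (_ - _); apply: eq_bigr => m _; rewrite !mxE.
by rewrite cov3_nab; congr (_ - _); apply: eq_bigr => m _; rewrite mxE.
Qed.

Variables (P : 'M[A]_n) (S : 'I_n -> 'M[A]_n).
Hypothesis Psym : P^T = P.
Hypothesis HS : forall a, G *m S a - P *m Ga a = LowGam D half (- P) a.

(** First variation of the curvature when the Christoffel symbols vary by [S]. The hypothesis [HS]
    is the first-order part of lowering an index when the metric varies in the direction [- P]. *)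
Definition linRm k l : 'M[A]_n := map_mx (D k) (S l) - map_mx (D l) (S k)
  + (S k *m Ga l + Ga k *m S l - S l *m Ga k - Ga l *m S k).
Definition linRic i j := \sum_k linRm k j k i.

Definition covP i j k := nabG k P i j.
Definition cotP i j k := covP i j k - covP i k j.

Let Sl a := G *m S a.

Lemma linRm_low k l : linRm k l = Gi *m (nabG k (Sl l) - nabG l (Sl k)).
Proof.
have E a b : map_mx (D a) (S b) + Ga a *m S b - S b *m Ga a = Gi *m nabG a (Sl b).
  rewrite /nab /Sl mulmxBr mulmxDr (dmxM (DM a)) (D_metric D half2 Gsym GGi).
  rewrite mulmxDr mulmxDl !mulmxDr !mulmxA (GiG GGi) !mul1mx; mxring.
rewrite mulmxBr -!E /linRm; mxring.
Qed.

(** The usual three covariant derivatives in the variation of a Levi-Civita connection, grouped so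
    that two of them form a Cotton tensor. *)
Lemma Sl_cot a e b : Sl a e b = half * (cotP b a e - covP a e b).
Proof.
have -> : Sl a e b = (LowGam D half (- P) a + P *m Ga a) e b by rewrite -HS addrNK.
rewrite mxD_E LowGamE !mxN_E !raddfN /=.
have cE i j k : covP i j k = D k (P i j) - (\sum_m (Ga k m i * P m j) + \sum_m P i m * Ga k m j).
  rewrite /covP /nab !mxlinE [(map_mx _ _) _ _]mxE; congr (_ - (_ + _)); rewrite mxE //.
  by apply: eq_bigr => m _; rewrite [(Ga k)^T _ _]mxE.
have Ps i j : P i j = P j i by rewrite -{1}Psym mxE.
rewrite /cotP !cE.
have -> : (P *m Ga a) e b = \sum_m P e m * Ga a m b by rewrite mxE.
have s1 i j k : \sum_m Ga k m i * P m j = \sum_m P j m * Ga k m i.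
  by apply: eq_bigr => m _; rewrite mulrC Ps.
have s2 i j k : \sum_m P i m * Ga k m j = \sum_m P i m * Ga j m k.
  by apply: eq_bigr => m _; rewrite (GamC D half Gi Gsym).
rewrite !s1 (s2 a b e) (s2 e b a) (s2 a e b) (Ps b a) (Ps b e) (Ps a e) (s2 b a e) (s2 b e a).
set X := \sum_m P e m * _; rewrite -[X in _ + X](half_dbl half2).
by ring.
Qed.

Definition divcot i j := \sum_k \sum_l Gi k l * cov3 cotP i j k l.
Definition J := \tr (Gi *m P).
Definition divP j := \sum_k \sum_l Gi k l * covP j k l.
Hypothesis contracted_bianchi : forall j, divP j = D j J.

Lemma trcovP j : \sum_k \sum_l Gi k l * covP k l j = D j J.
Proof.
rewrite /J (D_contract DM half2 Gsym GGi) /mxtrace exchange_big /=.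
by apply: eq_bigr => l _; rewrite mxE; apply: eq_bigr => k _; rewrite (Gis Gsym GGi).
Qed.

Lemma cov3_comm j l i k : cov3 covP j l i k - cov3 covP j l k i =
  - ((Rm D Ga k i)^T *m P + P *m Rm D Ga k i) j l.
Proof.
have E a b : cov3 covP j l a b = nabG b (nabG a P) j l - \sum_m Ga b m a * covP j l m.
  exact: (cov3_nab (fun c => nabG c P)).
rewrite !E -mxN_E -(@nab_comm _ _ D DM DC half G Gi k i P).
have sp (M N : 'M[A]_n) : (M - N) j l = M j l - N j l by rewrite !mxlinE.
rewrite [in RHS]sp.
have -> : \sum_m Ga k m i * covP j l m = \sum_m Ga i m k * covP j l m.
  by apply: eq_bigr => m _; rewrite (GamC D half Gi Gsym).
ring.
Qed.

(** The divergence terms reduce, by [div P = d tr P], to two Hessians of [J] that cancel. What is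
    left is the divergence of the Cotton tensor and the curvature terms of the Ricci identity: the
    ingredients of the Bach tensor. *)
Lemma linRic_eq i j : linRic i j = half * (divcot i j
  + \sum_k \sum_l Gi k l * ((Rm D Ga k i)^T *m P) j l - (P *m Gi *m \matrix_(p, q) Ric D Ga p q) j i).
Proof.
pose T l i a := Sl a l i.
have TE l i0 a : T l i0 a = half * (cotP i0 a l - covP a l i0) by exact: Sl_cot.
have cT l i0 a b : cov3 T l i0 a b = half * (cov3 cotP i0 a l b - cov3 covP a l i0 b).
  rewrite (cov3_ext _ _ _ _ TE) cov3_half.
  rewrite (cov3B (fun l i0 a => cotP i0 a l) (fun l i0 a => covP a l i0)).
  congr (_ * (_ - _)); [exact: (cov3_perm cotP)|exact: (cov3_perm2 covP)].
have -> : linRic i j = \sum_k \sum_l Gi k l * (cov3 T l i j k - cov3 T l i k j).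
  apply: eq_bigr => k _; rewrite linRm_low mxE; apply: eq_bigr => l _; congr (_ * _).
  have E a b : cov3 T l i a b = nabG b (Sl a) l i - \sum_m Ga b m a * Sl m l i.
    exact: (cov3_nab Sl).
  rewrite !E mxD_E mxN_E.
  have -> : \sum_m Ga k m j * Sl m l i = \sum_m Ga j m k * Sl m l i.
    by apply: eq_bigr => m _; rewrite (GamC D half Gi Gsym).
  ring.
pose HD a b := D a (D b J) - \sum_m Ga a m b * D m J.
have HDC : HD i j = HD j i.
  rewrite /HD DC; congr (_ - _); apply: eq_bigr => m _.
  by rewrite (GamC D half Gi Gsym).
have E1 : \sum_k \sum_l Gi k l * cov3 T l i k j = - (half * HD j i).
  have t0 c : \sum_k \sum_l Gi k l * T l c k = - (half * D c J).
    rewrite -trcovP.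
    have -> : \sum_k \sum_l Gi k l * T l c k = half *
        (\sum_k \sum_l Gi k l * cotP c k l - \sum_k \sum_l Gi k l * covP k l c).
      rewrite -sumrB mulr_sumr; apply: eq_bigr => k _.
      by rewrite -sumrB mulr_sumr; apply: eq_bigr => l _; rewrite TE; ring.
    have -> : \sum_k \sum_l Gi k l * cotP c k l = 0.
      rewrite /cotP (eq_bigr (fun k => \sum_l Gi k l * covP c k l - \sum_l Gi k l * covP c l k)) => [|k _].
        rewrite sumrB exchange_big /=; apply/eqP; rewrite subr_eq0; apply/eqP.
        by apply: eq_bigr => k _; apply: eq_bigr => l _; rewrite (Gis Gsym GGi).
      by rewrite -sumrB; apply: eq_bigr => l _; rewrite mulrBr.
    by ring.
  have -> : \sum_k \sum_l Gi k l * cov3 T l i k j =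
      \sum_k \sum_l Gi k l * cov3 (fun a b c => T b c a) k l i j.
    apply: eq_bigr => k _; apply: eq_bigr => l _; congr (_ * _).
    exact: esym (cov3_perm T k l i j).
  rewrite (cov3_contract (fun a b c => T b c a)) /= t0 raddfN /= DM (deriv_half (DM j) half2).
  rewrite (eq_bigr (fun m => - (half * (Ga j m i * D m J)))) => [|m _]; last by rewrite t0; ring.
  by rewrite sumrN -mulr_sumr /HD; ring.
have E2 : \sum_k \sum_l Gi k l * cov3 covP j l k i = HD i j.
  have -> : \sum_k \sum_l Gi k l * cov3 covP j l k i =
      \sum_k \sum_l Gi k l * cov3 (fun a b c => covP c b a) k l j i.
    apply: eq_bigr => k _; apply: eq_bigr => l _; congr (_ * _).
    exact: esym (etrans (cov3_swap (fun a b c => covP c a b) k l j i) (cov3_perm2 covP l k j i)).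
  rewrite (cov3_contract (fun a b c => covP c b a)) /=.
  have t1 c : \sum_a \sum_b Gi a b * covP c b a = D c J.
    rewrite -contracted_bianchi /divP exchange_big /=.
    by apply: eq_bigr => a _; apply: eq_bigr => b _; rewrite (Gis Gsym GGi).
  by rewrite t1 /HD; congr (_ - _); apply: eq_bigr => m _; rewrite t1.
have E3 : \sum_k \sum_l Gi k l * cov3 cotP i j l k = divcot i j.
  rewrite /divcot exchange_big /=.
  by apply: eq_bigr => a _; apply: eq_bigr => b _; rewrite (Gis Gsym GGi).
have E4 : \sum_k \sum_l Gi k l * (P *m Rm D Ga k i) j l =
    - (P *m Gi *m \matrix_(p, q) Ric D Ga p q) j i.
  have -> : \sum_k \sum_l Gi k l * (P *m Rm D Ga k i) j l =
      \sum_m P j m * \sum_k \sum_l Gi k l * Rm D Ga k i m l.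
    under eq_bigr do under eq_bigr do rewrite mxE mulr_sumr.
    under eq_bigr do rewrite exchange_big /=.
    rewrite exchange_big /=; apply: eq_bigr => m _; rewrite mulr_sumr.
    apply: eq_bigr => k _; rewrite mulr_sumr; apply: eq_bigr => l _; ring.
  rewrite -mulmxA [in RHS]mxE -sumrN; apply: eq_bigr => m _.
  rewrite (tr_Rm_Ric DM DC half2 Gsym GGi) mulrN; congr (- (_ * _)).
  by rewrite mxE; apply: eq_bigr => p _; rewrite mxE.
have -> : \sum_k \sum_l Gi k l * (cov3 T l i j k - cov3 T l i k j) =
    \sum_k \sum_l Gi k l * cov3 T l i j k - \sum_k \sum_l Gi k l * cov3 T l i k j.
  rewrite -sumrB; apply: eq_bigr => k _; rewrite -sumrB; apply: eq_bigr => l _; ring.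
rewrite E1 opprK.
have -> : \sum_k \sum_l Gi k l * cov3 T l i j k = half * (
    \sum_k \sum_l Gi k l * cov3 cotP i j l k - \sum_k \sum_l Gi k l * cov3 covP j l k i
    + (\sum_k \sum_l Gi k l * ((Rm D Ga k i)^T *m P) j l +
       \sum_k \sum_l Gi k l * (P *m Rm D Ga k i) j l)).
  rewrite -sumrB -!big_split /= mulr_sumr; apply: eq_bigr => k _.
  rewrite -sumrB -!big_split /= mulr_sumr; apply: eq_bigr => l _.
  rewrite cT.
  have -> : cov3 covP j l i k = cov3 covP j l k i - ((Rm D Ga k i)^T *m P + P *m Rm D Ga k i) j l.
    by rewrite -cov3_comm; ring.
  by rewrite mxD_E; ring.
by rewrite E2 E3 E4 HDC; ring.
Qed.

End linearized_ricci.

Definition sDa {R : realType} {d} {V : odom R d} (i : 'I_d) : {additive smf V -> smf V} := sD i.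

(** * Taylor coefficients of matrices *)

Section coefficient_matrices.
Context {R : realType} {d : nat} (V0 : odom R d) (e : R) (e0 : 0 < e).
Local Notation A := (smf (obox V0 e0)).
Local Notation A0 := (smf V0).
Implicit Types (f g : A).

Lemma coD j f g : co j (f + g) = co j f + co j g. Proof. exact: raddfD. Qed.
Lemma coN j f : co j (- f) = - co j f. Proof. exact: raddfN. Qed.
Lemma coB j f g : co j (f - g) = co j f - co j g. Proof. exact: raddfB. Qed.

Lemma co0M f g : co 0 (f * g) = co 0 f * co 0 g.
Proof. by rewrite coM big_ord1. Qed.
Lemma co1M f g : co 1 (f * g) = co 0 f * co 1 g + co 1 f * co 0 g.
Proof. by rewrite coM !big_ord_recl big_ord0 addr0. Qed.
Lemma co2M f g : co 2 (f * g) = co 0 f * co 2 g + (co 1 f * co 1 g + co 2 f * co 0 g).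
Proof. by rewrite coM !big_ord_recl big_ord0 addr0. Qed.
Lemma co3M f g : co 3 (f * g) =
  co 0 f * co 3 g + (co 1 f * co 2 g + (co 2 f * co 1 g + co 3 f * co 0 g)).
Proof. by rewrite coM !big_ord_recl big_ord0 addr0. Qed.
Lemma co4M f g : co 4 (f * g) =
  co 0 f * co 4 g + (co 1 f * co 3 g + (co 2 f * co 2 g + (co 3 f * co 1 g + co 4 f * co 0 g))).
Proof. by rewrite coM !big_ord_recl big_ord0 addr0. Qed.

Lemma co_cstM j c f : co j (scst c * f) = scst c * co j f.
Proof.
rewrite coM big_ord_recl co_cst subn0 big1 ?addr0 // => i _.
by rewrite co_cst mul0r.
Qed.

Lemma co_1 j : co j (1 : A) = (j == 0%N)%:R.
Proof. by rewrite -(rmorph1 scst) co_cst; case: j => [|j]; rewrite ?rmorph1. Qed.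

Definition cmx : forall {m n}, nat -> 'M[A]_(m, n) -> 'M[A0]_(m, n) :=
  locked_with lock_key (fun m n j M => map_mx (co j) M).

Lemma cmxE {m n} j (M : 'M[A]_(m, n)) p q : cmx j M p q = co j (M p q).
Proof. by rewrite /cmx unlock mxE. Qed.

Lemma cmxD {m n} j (M N : 'M[A]_(m, n)) : cmx j (M + N) = cmx j M + cmx j N.
Proof. by apply/matrixP => p q; rewrite !(cmxE, mxlinE) raddfD. Qed.
Lemma cmxN {m n} j (M : 'M[A]_(m, n)) : cmx j (- M) = - cmx j M.
Proof. by apply/matrixP => p q; rewrite !(cmxE, mxlinE) raddfN. Qed.

Lemma cmx_cstZ {m n} j c (M : 'M[A]_(m, n)) : cmx j (scst c *: M) = scst c *: cmx j M.
Proof. by apply/matrixP => p q; rewrite !(cmxE, mxlinE) co_cstM. Qed.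

Lemma cmxT {m n} j (M : 'M[A]_(m, n)) : cmx j M^T = (cmx j M)^T.
Proof. by apply/matrixP => p q; rewrite !(cmxE, mxE). Qed.

Lemma cmx_tr {n} j (M : 'M[A]_n) : co j (\tr M) = \tr (cmx j M).
Proof. by rewrite raddf_sum; apply: eq_bigr => i _; rewrite cmxE. Qed.

Lemma cmxM {m n p} j (M : 'M[A]_(m, n)) (N : 'M[A]_(n, p)) :
  cmx j (M *m N) = \sum_(i < j.+1) cmx i M *m cmx (j - i) N.
Proof.
apply/matrixP => a b; rewrite summxE cmxE mxE raddf_sum /=.
under eq_bigr do rewrite coM.
rewrite exchange_big; apply: eq_bigr => i _; rewrite mxE.
by apply: eq_bigr => k _; rewrite !cmxE.
Qed.

Lemma cmx0M {m n p} (M : 'M[A]_(m, n)) (N : 'M[A]_(n, p)) :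
  cmx 0 (M *m N) = cmx 0 M *m cmx 0 N.
Proof. by rewrite cmxM big_ord1. Qed.
Lemma cmx1M {m n p} (M : 'M[A]_(m, n)) (N : 'M[A]_(n, p)) :
  cmx 1 (M *m N) = cmx 0 M *m cmx 1 N + cmx 1 M *m cmx 0 N.
Proof. by rewrite cmxM !big_ord_recl big_ord0 addr0. Qed.
Lemma cmx2M {m n p} (M : 'M[A]_(m, n)) (N : 'M[A]_(n, p)) : cmx 2 (M *m N) =
  cmx 0 M *m cmx 2 N + (cmx 1 M *m cmx 1 N + cmx 2 M *m cmx 0 N).
Proof. by rewrite cmxM !big_ord_recl big_ord0 addr0. Qed.
Lemma cmx3M {m n p} (M : 'M[A]_(m, n)) (N : 'M[A]_(n, p)) : cmx 3 (M *m N) =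
  cmx 0 M *m cmx 3 N + (cmx 1 M *m cmx 2 N + (cmx 2 M *m cmx 1 N + cmx 3 M *m cmx 0 N)).
Proof. by rewrite cmxM !big_ord_recl big_ord0 addr0. Qed.
Lemma cmx4M {m n p} (M : 'M[A]_(m, n)) (N : 'M[A]_(n, p)) : cmx 4 (M *m N) =
  cmx 0 M *m cmx 4 N + (cmx 1 M *m cmx 3 N + (cmx 2 M *m cmx 2 N
    + (cmx 3 M *m cmx 1 N + cmx 4 M *m cmx 0 N))).
Proof. by rewrite cmxM !big_ord_recl big_ord0 addr0. Qed.

(** Parity empties most of the Cauchy products. In these names [_e] marks a first factor whose odd
    coefficients vanish as far as they matter, [_o] and [_oo] mark factors whose even ones do. *)
Lemma cmx1M_e {m n p} (M : 'M[A]_(m, n)) (N : 'M[A]_(n, p)) :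
  cmx 1 M = 0 -> cmx 1 (M *m N) = cmx 0 M *m cmx 1 N.
Proof. by rewrite cmx1M => ->; rewrite mul0mx addr0. Qed.
Lemma cmx2M_e {m n p} (M : 'M[A]_(m, n)) (N : 'M[A]_(n, p)) :
  cmx 1 M = 0 -> cmx 2 (M *m N) = cmx 0 M *m cmx 2 N + cmx 2 M *m cmx 0 N.
Proof. by rewrite cmx2M => ->; rewrite mul0mx add0r. Qed.
Lemma cmx3M_e {m n p} (M : 'M[A]_(m, n)) (N : 'M[A]_(n, p)) :
  cmx 1 M = 0 -> cmx 3 M = 0 ->
  cmx 3 (M *m N) = cmx 0 M *m cmx 3 N + cmx 2 M *m cmx 1 N.
Proof.
rewrite cmx3M; move: (cmx 1 N) (cmx 3 N) (cmx 2 N) (cmx 0 N) (cmx 2 M) => ? ? ? ? ? -> ->.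
by rewrite !mul0mx add0r addr0.
Qed.
Lemma cmx2M_at {m n p} (M : 'M[A]_(m, n)) (N : 'M[A]_(n, p)) M0 N0 :
  cmx 1 M = 0 -> cmx 0 M = M0 -> cmx 0 N = N0 ->
  cmx 2 (M *m N) = M0 *m cmx 2 N + cmx 2 M *m N0.
Proof. by move=> h <- <-; apply: cmx2M_e. Qed.
Lemma co5 j f1 f2 f3 f4 f5 : co j (f1 + f2 - f3 + f4 - f5) =
  co j f1 + co j f2 - co j f3 + co j f4 - co j f5.
Proof. by rewrite (coB j (_ + _)) (coD j (_ - _)) (coB j (_ + _)) (coD j f1). Qed.
Lemma cmx_comb4_at {m n} j (M1 M2 M3 M4 : 'M[A]_(m, n)) N1 N2 N3 N4 :
  cmx j M1 = N1 -> cmx j M2 = N2 -> cmx j M3 = N3 -> cmx j M4 = N4 ->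
  cmx j (M1 - M2 + (M3 - M4)) = N1 - N2 + (N3 - N4).
Proof. by move=> <- <- <- <-; rewrite (cmxD j (_ - _)) (cmxD j M1) (cmxD j M3) !cmxN. Qed.
Lemma cmx2M_oo {m n p} (M : 'M[A]_(m, n)) (N : 'M[A]_(n, p)) :
  cmx 0 M = 0 -> cmx 0 N = 0 -> cmx 2 (M *m N) = cmx 1 M *m cmx 1 N.
Proof. by rewrite cmx2M => -> ->; rewrite mul0mx mulmx0 add0r addr0. Qed.
Lemma cmx0M_o {m n p} (M : 'M[A]_(m, n)) (N : 'M[A]_(n, p)) :
  cmx 0 N = 0 -> cmx 0 (M *m N) = 0.
Proof. by rewrite cmx0M => ->; rewrite mulmx0. Qed.
Lemma co3M_o f g : co 0 f = 0 -> co 2 f = 0 ->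
  co 3 (f * g) = co 1 f * co 2 g + co 3 f * co 0 g.
Proof. by rewrite co3M => -> ->; rewrite !mul0r !add0r. Qed.
Lemma co2M_oo f g : co 0 f = 0 -> co 0 g = 0 -> co 2 (f * g) = co 1 f * co 1 g.
Proof. by rewrite co2M => -> ->; rewrite mul0r mulr0 add0r addr0. Qed.
Lemma co1M_o f g : co 0 f = 0 -> co 1 (f * g) = co 1 f * co 0 g.
Proof. by rewrite co1M => ->; rewrite mul0r add0r. Qed.

Lemma cmx_Dr {m n} j (M : 'M[A]_(m, n)) : cmx j (map_mx (sDa ir) M) = j.+1%:R *: cmx j.+1 M.
Proof. by apply/matrixP => p q; rewrite !(cmxE, mxE) /= co_Dr. Qed.
Lemma cmx_Dx {m n} j a (M : 'M[A]_(m, n)) :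
  cmx j (map_mx (sDa (lshift 1 a)) M) = map_mx (sDa a) (cmx j M).
Proof. by apply/matrixP => p q; rewrite !(cmxE, mxE) /= co_sD. Qed.

Lemma cmx_1 {n} j : cmx j (1%:M : 'M[A]_n) = if j is 0 then 1%:M else 0.
Proof.
by apply/matrixP => p q; rewrite cmxE mxE raddfMn /= co_1; case: j => [|j]; rewrite mxE ?mul0rn.
Qed.

Lemma cmx0_slice {m n} (M : 'M[A]_(m, n)) : cmx 0 M = map_mx slice M.
Proof. by apply/matrixP => p q; rewrite cmxE mxE co0. Qed.

Section inverse.
Variables (n : nat) (G Gi : 'M[A]_n).
Hypothesis GGi : G *m Gi = 1%:M.
Hypothesis G1 : cmx 1 G = 0.

Lemma cmx0_inv : cmx 0 G *m cmx 0 Gi = 1%:M.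
Proof. by rewrite -cmx0M GGi cmx_1. Qed.

Let iK m (M : 'M[A0]_(n, m)) : cmx 0 G *m M = 0 -> M = 0.
Proof.
by move=> h; rewrite -[M]mul1mx -(mulmx1C cmx0_inv) -mulmxA h mulmx0.
Qed.

Lemma cmx1_inv : cmx 1 Gi = 0.
Proof.
apply: iK; have := congr1 (cmx 1) GGi.
by rewrite cmx1M cmx_1 G1 mul0mx addr0.
Qed.

Lemma cmx2_inv : cmx 2 Gi = - (cmx 0 Gi *m cmx 2 G *m cmx 0 Gi).
Proof.
apply/eqP; rewrite -subr_eq0 opprK; apply/eqP; apply: iK.
have := congr1 (cmx 2) GGi; rewrite cmx2M cmx_1 G1 mul0mx add0r => h.
by rewrite mulmxDr !mulmxA cmx0_inv mul1mx.
Qed.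

Lemma cmx3_inv : cmx 3 G = 0 -> cmx 3 Gi = 0.
Proof.
move=> G3; apply: iK; have := congr1 (cmx 3) GGi.
by rewrite cmx3M cmx_1 G1 G3 cmx1_inv mulmx0 !mul0mx !addr0.
Qed.
End inverse.

End coefficient_matrices.

(** * Expansion of the Einstein equation *)

Section fefferman_graham.
Context {R : realType} {n : nat} (W0 : odom R n) (e : R) (e0 : 0 < e).
Local Notation A := (smf (obox W0 e0)).
Local Notation A0 := (smf W0).
Variables (g gi : 'M[A]_n).
Hypothesis gsym : g^T = g.
Hypothesis ggi : g *m gi = 1%:M.
Hypothesis g1 : cmx 1 g = 0.
Hypothesis g3 : cmx 3 g = 0.
Local Notation half := (scst 2^-1).
Local Notation D := (@sDa R _ (obox W0 e0)).
Local Notation D0 := (@sDa R _ W0).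
Local Notation PB := (PB D half g gi).
Local Notation Q := (PQ D half (sr W0 e0) g gi).
Local Notation g0 := (cmx 0 g).
Local Notation gi0 := (cmx 0 gi).
Local Notation gam := (cmx 2 g).
Local Notation del := (cmx 4 g).
Local Notation Gg := (Gam (fun i : 'I_n => D (lshift 1 i)) half g gi).
Local Notation G0 := (Gam D0 half g0 gi0).

Lemma half2 d (V : odom R d) : half + half = 1 :> smf V.
Proof.
rewrite -rmorphD -(rmorph1 scst); congr scst.
by have := splitr (1 : R); rewrite mul1r => <-.
Qed.

Lemma sDaM d (V : odom R d) i (f h : smf V) : sDa i (f * h) = sDa i f * h + f * sDa i h.
Proof. exact: sDM. Qed.
Lemma sDaC d (V : odom R d) i j (f : smf V) : sDa i (sDa j f) = sDa j (sDa i f).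
Proof. exact: sDC. Qed.

Lemma g0_sym : g0^T = g0. Proof. by rewrite -cmxT gsym. Qed.
Lemma gam_sym : gam^T = gam. Proof. by rewrite -cmxT gsym. Qed.
Lemma del_sym : del^T = del. Proof. by rewrite -cmxT gsym. Qed.
Let ggi0 := cmx0_inv ggi.

Lemma half_twice (x : A0) : half * (x + x) = x.
Proof. by rewrite mulrDr -mulrDl half2 mul1r. Qed.

Lemma cmx_Dg j : cmx j (map_mx (D ir) g) = j.+1%:R *: cmx j.+1 g.
Proof. exact: cmx_Dr. Qed.

Let gi1 : cmx 1 gi = 0. Proof. exact: cmx1_inv ggi g1. Qed.
Let gi2 : cmx 2 gi = - (gi0 *m gam *m gi0). Proof. exact: cmx2_inv ggi g1. Qed.
Let gi3 : cmx 3 gi = 0. Proof. exact: cmx3_inv ggi g1 g3. Qed.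

Lemma halfZ_twice m p (M : 'M[A0]_(m, p)) : half *: (2%:R *: M) = M.
Proof. by rewrite scalerA mulr_natr mulr2n half2 scale1r. Qed.

Lemma Dg0 : cmx 0 (map_mx (D ir) g) = 0.
Proof. by rewrite cmx_Dg g1 scaler0. Qed.
Lemma Dg2 : cmx 2 (map_mx (D ir) g) = 0.
Proof. by rewrite cmx_Dg g3 scaler0. Qed.

Lemma PB0 : cmx 0 PB = 0.
Proof. by rewrite PBE cmx_cstZ (cmx0M_o gi Dg0) scaler0. Qed.
Lemma PB1 : cmx 1 PB = gi0 *m gam.
Proof. by rewrite PBE cmx_cstZ (cmx1M_e _ gi1) cmx_Dg -scalemxAr halfZ_twice. Qed.
Lemma PB2 : cmx 2 PB = 0.
Proof. by rewrite PBE cmx_cstZ (cmx2M_e _ gi1) Dg2 Dg0 mulmx0 mulmx0 addr0 scaler0. Qed.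
Lemma PB3 : cmx 3 PB = 2%:R *: (gi0 *m del) - gi0 *m gam *m gi0 *m gam.
Proof.
rewrite PBE cmx_cstZ (cmx3M_e _ gi1 gi3) !cmx_Dg gi2 (natrM _ 2 2) -!scalemxAr.
by rewrite -scalerA scalerDr !halfZ_twice mulNmx.
Qed.

Lemma gPBE : g *m PB = half *: map_mx (D ir) g.
Proof. by rewrite PBE -scalemxAr mulmxA ggi mul1mx. Qed.
Lemma gPB0 : cmx 0 (g *m PB) = 0.
Proof. exact: cmx0M_o PB0. Qed.
Lemma gPB1 : cmx 1 (g *m PB) = gam.
Proof. by rewrite gPBE cmx_cstZ cmx_Dg halfZ_twice. Qed.
Lemma gPB3 : cmx 3 (g *m PB) = 2%:R *: del.
Proof. by rewrite gPBE cmx_cstZ cmx_Dg (natrM _ 2 2) -scalerA halfZ_twice. Qed.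

Lemma Gg0 a : cmx 0 (Gg a) = G0 a.
Proof.
have fD i (x : A) : slice (D (lshift 1 i) x) = D0 i (slice x).
  by rewrite -(co0 x) -(co0 (D _ _)) (co_sD 0 i x).
rewrite cmx0_slice (map_Gam fD) -(cmx0_slice g) -(cmx0_slice gi).
have hs : slice (half : A) = half by rewrite -[LHS]co0 co_cst.
exact: (congr1 (fun t => Gam D0 t g0 gi0 a) hs).
Qed.

Lemma cmx_LowGam j a : cmx j (LowGam (fun i : 'I_n => D (lshift 1 i)) half g a) =
  LowGam D0 half (cmx j g) a.
Proof.
by apply/matrixP => b c; rewrite cmxE !LowGamE co_cstM coB coD /= !co_sD -!cmxE.
Qed.

Lemma gGg a : g *m Gg a = LowGam (fun i : 'I_n => D (lshift 1 i)) half g a.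
Proof. exact: G_Gam. Qed.

Lemma LowGam0 a : LowGam D0 half (0 : 'M[A0]_n) a = 0.
Proof.
apply/matrixP => b c; rewrite LowGamE !mx0_E.
have d0 i : D0 i 0 = 0 by exact: raddf0.
by rewrite !d0; ring.
Qed.

Lemma Gg1 a : cmx 1 (Gg a) = 0.
Proof.
have := congr1 (cmx 1) (gGg a); rewrite (cmx1M_e _ g1) cmx_LowGam g1 LowGam0 => h.
by rewrite -[LHS]mul1mx -(mulmx1C ggi0) -mulmxA h mulmx0.
Qed.

Local Notation S := (fun a => cmx 2 (Gg a)).

(** Puts the second coefficient of the Christoffel symbols of [g_r] into the form of the hypothesis
    [HS] of the linearized Ricci formula, with [P = - gam]. *)
Lemma Gg2 a : g0 *m S a - - gam *m G0 a = LowGam D0 half (- - gam) a.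
Proof.
by rewrite !opprK mulNmx opprK -cmx_LowGam -gGg (cmx2M_e _ g1) Gg0.
Qed.

Lemma co0_Ric i j : co 0 (Ric (fun i : 'I_n => D (lshift 1 i)) Gg i j) = Ric D0 G0 i j.
Proof.
have fD k (x : A) : slice (D (lshift 1 k) x) = D0 k (slice x).
  by rewrite /= -!co0 co_sD.
rewrite co0 (map_Ric fD).
by apply: Ric_ext => a; rewrite -cmx0_slice Gg0.
Qed.

(** Since odd coefficients vanish, the term in [r^2] of the curvature of [g_r] is linear in the
    second coefficient of the connection. *)
Lemma co2_Ric i j : co 2 (Ric (fun i : 'I_n => D (lshift 1 i)) Gg i j) = linRic D0 half g0 gi0 S i j.
Proof.
rewrite raddf_sum; apply: eq_bigr => k _; rewrite -[LHS]cmxE; congr (fun_of_matrix _ k i).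
have E a b : cmx 2 (Gg a *m Gg b) = G0 a *m cmx 2 (Gg b) + cmx 2 (Gg a) *m G0 b.
  exact: (cmx2M_at (Gg1 a) (Gg0 a) (Gg0 b)).
have {}E := cmx_comb4_at (cmx_Dx 2 k (Gg j)) (cmx_Dx 2 j (Gg k)) (E k j) (E j k).
refine (etrans E _); rewrite /linRm.
move: (map_mx _ _) (map_mx _ _) (G0 k *m _) (G0 j *m _) (S k *m _) (S j *m _) => ? ? M1 M2 M3 M4.
by congr (_ + _); rewrite opprD (addrC M1 M3) (addrC (- M2)) !addrA.
Qed.

Lemma PQ_LL i j : Q (lshift 1 i) (lshift 1 j) =
  sr W0 e0 * (Ric (fun i : 'I_n => D (lshift 1 i)) Gg i j - \tr PB * (g *m PB) j i
      + (g *m PB *m PB) j i + (g *m PB *m PB) j i - half * D ir (D ir (g j i)))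
    + \tr PB * g j i + (n%:R - 1) * (g *m PB) j i.
Proof. by rewrite block_mxEul mxE. Qed.

Let sE (M : 'M[A0]_n) i j : M^T = M -> M j i = M i j.
Proof. by move=> h; rewrite -{2}h mxE. Qed.
Let gg : (gam *m gi0 *m gam)^T = gam *m gi0 *m gam.
Proof. by rewrite trmx_mul3 gam_sym (Gi_sym g0_sym ggi0). Qed.

Lemma DDg k i j : co k (D ir (D ir (g j i))) = k.+1%:R * (k.+2%:R * cmx k.+2 g j i).
Proof. by rewrite !co_Dr cmxE. Qed.

(** In the tangential block at order one, [n - 2] is the [n - 1] of [PQ] less one from the second
    [r]-derivative of [g]. That [gam] is minus the Schouten tensor is then read off in
    [schouten_P]. *)
Lemma FG_low : (forall i j, co 1 (Q (lshift 1 i) (lshift 1 j)) = 0) ->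
  forall i j, Ric D0 G0 i j + (n%:R - 2) * gam i j + \tr (gi0 *m gam) * g0 i j = 0.
Proof.
move=> H i j; rewrite -[RHS](H i j) PQ_LL (coD 1 (_ + _)) (coD 1 (sr _ _ * _)) co_Mr.
have -> : co 0 (Ric (fun i : 'I_n => D (lshift 1 i)) Gg i j - \tr PB * (g *m PB) j i
    + (g *m PB *m PB) j i + (g *m PB *m PB) j i - half * D ir (D ir (g j i)))
    = Ric D0 G0 i j - gam i j.
  rewrite coB coD coD coB co0_Ric co_cstM DDg (co0M (\tr PB)) -!cmxE.
  rewrite gPB0 (cmx0M_o _ PB0) mx0_E (sE i j gam_sym) mul1r.
  rewrite (_ : 2%:R * gam i j = gam i j + gam i j) ?half_twice; ring.
have -> : co 1 (\tr PB * g j i) = \tr (gi0 *m gam) * g0 i j.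
  rewrite co1M_o cmx_tr; last by rewrite PB0 mxtrace0.
  by rewrite PB1 -cmxE (sE i j g0_sym).
have -> : co 1 ((n%:R - 1) * (g *m PB) j i) = (n%:R - 1) * gam i j.
  by rewrite mulrBl mul1r coB co_natM -cmxE gPB1 (sE i j gam_sym); ring.
ring.
Qed.

(** The [rr] component alone yields the trace of [del], which enters [FG_high] as a further
    unknown. *)
Lemma FG_tr : co 3 (Q ir ir) = 0 ->
  2%:R * (2%:R * \tr (gi0 *m del) - \tr (gi0 *m gam *m gi0 *m gam)) =
  - \tr (gi0 *m gam *m gi0 *m gam).
Proof.
rewrite block_mxEdr mxE (coB 3 (_ + _)) (coD 3 (- _ * _)) mulNr coN !co_Mr !cmx_tr.
rewrite (cmx2M_oo PB0 PB0) PB1 cmx_Dr PB3.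
rewrite mulmxA; move: (gi0 *m del) (gi0 *m gam *m gi0 *m gam) => X Y.
rewrite (mxtraceZ 3%:R) (mxtraceD _ (- Y)) (mxtraceN Y) (mxtraceZ _ X) => h.
by apply/eqP; rewrite -subr_eq0 -[X in _ == X]oppr0 -h; apply/eqP; ring.
Qed.

(** The mixed component at order two: through [divP_J] it takes the place of the contracted second
    Bianchi identity. *)
Lemma FG_div : (forall j, co 2 (Q ir (lshift 1 j)) = 0) ->
  forall j, \sum_k (gi0 *m nab D0 half g0 gi0 k gam) k j = D0 j (\tr (gi0 *m gam)).
Proof.
move=> H j; have := H j; rewrite block_mxEdl mxE co_Mr raddf_sum /= => h.
rewrite (dmx_tr (D0 j)) /mxtrace; apply/eqP; rewrite -subr_eq0 -sumrB; apply/eqP; rewrite -[RHS]h.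
have E2 : \sum_k (gi0 *m gam *m G0 k) k j = \sum_k (G0 j *m (gi0 *m gam)) k k.
  have -> : \sum_k (G0 j *m (gi0 *m gam)) k k = \tr (gi0 *m gam *m G0 j).
    by rewrite mxtrace_mulC.
  apply: eq_bigr => k _; rewrite [LHS]mxE [RHS]mxE; apply: eq_bigr => m _; congr (_ * _).
  exact: (GamC D0 half gi0 g0_sym).
have E3 k : co 1 (sD ir 0 + sD (lshift 1 k) (PB k j) - sD (lshift 1 j) (PB k k) +
    (Gg k *m PB) k j - (Gg j *m PB) k k) = (gi0 *m nab D0 half g0 gi0 k gam) k j
   - map_mx (D0 j) (gi0 *m gam) k k + (gi0 *m gam *m G0 k) k j
   - (G0 j *m (gi0 *m gam)) k k.
  have c1 a : cmx 1 (Gg a *m PB) = G0 a *m (gi0 *m gam).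
    by rewrite (cmx1M_e _ (Gg1 a)) Gg0 PB1.
  have c2 a p q : co 1 ((Gg a *m PB) p q) = (G0 a *m (gi0 *m gam)) p q.
    by rewrite -cmxE c1.
  have pb p q : co 1 (PB p q) = (gi0 *m gam) p q by rewrite -cmxE PB1.
  rewrite co5 (co_sD 1 k (PB k j)) (co_sD 1 j (PB k k)).
  rewrite (c2 k k j) (c2 j k k) (pb k j) (pb k k).
  have -> : co 1 (sD ir (0 : A)) = 0 by rewrite (raddf0 (sD ir)) (raddf0 (co 1)).
  have -> : gi0 *m nab D0 half g0 gi0 k gam =
     map_mx (D0 k) (gi0 *m gam) + G0 k *m (gi0 *m gam) - gi0 *m gam *m G0 k.
    rewrite /nab (dmxM (sDaM k)) (D_imetric (@sDaM _ W0) (half2 _) g0_sym ggi0).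
    rewrite mulmxBr mulmxDr mulNmx mulmxDl !mulmxA; mxring.
  move: (gi0 *m gam *m G0 k) => M1; move: (G0 k *m _) => M2; move: (G0 j *m _) => M4.
  move: (gi0 *m gam) => M3.
  by rewrite !mxlinE [(map_mx _ _) k j]mxE [(map_mx _ _) k k]mxE /=; ring.
rewrite (eq_bigr _ (fun k _ => E3 k)).
by rewrite [RHS]sumrB [X in _ = X - _]big_split /= E2 addrK.
Qed.

(** The factor of [del] is [2 (n - 1)] from the zeroth-order terms less [6] from the second
    [r]-derivative. It vanishes exactly for [n = 4], where this equation no longer determines
    [del]. *)
Lemma FG_high : (forall i j, co 3 (Q (lshift 1 i) (lshift 1 j)) = 0) ->
  forall i j, linRic D0 half g0 gi0 S i j + (2%:R * n%:R - 8%:R) * del i j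
    + 2%:R * (gam *m gi0 *m gam) i j
    + (2%:R * \tr (gi0 *m del) - \tr (gi0 *m gam *m gi0 *m gam)) * g0 i j = 0.
Proof.
move=> H i j; rewrite -[RHS](H i j) PQ_LL (coD 3 (_ + _)) (coD 3 (sr _ _ * _)) co_Mr.
have -> : co 2 (Ric (fun i : 'I_n => D (lshift 1 i)) Gg i j - \tr PB * (g *m PB) j i
    + (g *m PB *m PB) j i + (g *m PB *m PB) j i - half * D ir (D ir (g j i)))
    = linRic D0 half g0 gi0 S i j - \tr (gi0 *m gam) * gam i j
     + 2%:R * (gam *m gi0 *m gam) i j - 6%:R * del i j.
  rewrite coB coD coD coB co2_Ric co_cstM DDg co2M_oo; last first.
  - by rewrite -cmxE gPB0 mx0_E.
  - by rewrite cmx_tr PB0 mxtrace0.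
  rewrite -!cmxE (cmx2M_oo gPB0 PB0) gPB1 PB1 cmx_tr PB1 mulmxA.
  rewrite (sE i j del_sym) (sE i j gam_sym) (sE i j gg).
  rewrite (_ : 3%:R * (4%:R * del i j) = 6%:R * del i j + 6%:R * del i j) ?half_twice; ring.
have -> : co 3 (\tr PB * g j i) = \tr (gi0 *m gam) * gam i j
    + (2%:R * \tr (gi0 *m del) - \tr (gi0 *m gam *m gi0 *m gam)) * g0 i j.
  rewrite co3M_o !cmx_tr; [|by rewrite PB0 mxtrace0|by rewrite PB2 mxtrace0].
  rewrite PB1 PB3 -!cmxE (sE i j g0_sym) (sE i j gam_sym).
  move: (gi0 *m del) (gi0 *m gam *m gi0 *m gam) => X Y.
  by rewrite (mxtraceD _ (- Y)) (mxtraceN Y) (mxtraceZ _ X); ring.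
have -> : co 3 ((n%:R - 1) * (g *m PB) j i) = (n%:R - 1) * (2%:R * del i j).
  by rewrite mulrBl mul1r coB co_natM -cmxE gPB3 mxZ_E (sE i j del_sym); ring.
move: (linRic _ _ _ _ _ _ _) ((gam *m gi0 *m gam) i j) (\tr (gi0 *m del)) => L gg' td.
move: (\tr (gi0 *m gam *m gi0 *m gam)) (\tr (gi0 *m gam)) (gam i j) (del i j) (g0 i j) => *.
ring.
Qed.

End fefferman_graham.

(** * Coordinate tensors as elements of the ring *)

Section coordinate_expressions.
Context {R : realType} {d : nat} {V : odom R d}.
Local Notation A := (smf V).
Local Notation half := (scst 2^-1).
Local Notation D := (@sDa R d V).

Definition mev {m p} (x : 'rV[R]_d) (M : 'M[A]_(m, p)) : 'M[R]_(m, p) :=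
  map_mx (fun f : A => f x) M.

Lemma mevE m p x (M : 'M[A]_(m, p)) i j : mev x M i j = M i j x.
Proof. by rewrite mxE. Qed.

Lemma mevM m p q x (M : 'M[A]_(m, p)) (N : 'M[A]_(p, q)) : V x ->
  mev x (M *m N) = mev x M *m mev x N.
Proof. by move=> Vx; rewrite -[LHS]/(map_mx (sev Vx) _) map_mxM. Qed.

Lemma mev1 m x : V x -> mev x (1%:M : 'M[A]_m) = 1%:M.
Proof. by move=> Vx; rewrite -[LHS]/(map_mx (sev Vx) _) map_mx1. Qed.

Lemma mevT m p x (M : 'M[A]_(m, p)) : mev x M^T = (mev x M)^T.
Proof. by rewrite /mev map_trmx. Qed.

Lemma mev_tr m x (M : 'M[A]_m) : V x -> (\tr M) x = \tr (mev x M).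
Proof.
move=> Vx; rewrite smf_sum //; apply: eq_bigr => i _; by rewrite mevE.
Qed.

Variables (G : 'rV[R]_d -> 'M[R]_d) (Gm Gi : 'M[A]_d).
Hypothesis GE : forall x, V x -> G x = mev x Gm.
Hypothesis GGi : Gm *m Gi = 1%:M.
Local Notation Ga := (Gam D half Gm Gi).

Lemma G_ij i j x : V x -> G x i j = Gm i j x.
Proof. by move=> Vx; rewrite GE // mevE. Qed.

Lemma invmx_smf x : V x -> invmx (G x) = mev x Gi.
Proof.
move=> Vx; have h : G x *m mev x Gi = 1%:M by rewrite GE // -mevM // GGi mev1.
by have [u _] := mulmx1_unit h; rewrite -[LHS]mulmx1 -h mulmxA mulVmx // mul1mx.
Qed.

Lemma pd_G i a b x : V x -> pd i (fun y => G y a b) x = D i (Gm a b) x.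
Proof. by move=> Vx; apply: pd_smf => // y Vy; rewrite G_ij. Qed.

Lemma christoffel_smf c a b x : V x -> christoffel G c a b x = Ga a c b x.
Proof.
move=> Vx; rewrite /christoffel invmx_smf // GamE mxE smf_sum // mulr_sumr.
apply: eq_bigr => e _; rewrite smfM // LowGamE mevE smfM // scstE // smfB // smfD //.
by rewrite !pd_G // mulrCA.
Qed.

Lemma riemann_up_smf m j k l x : V x -> riemann_up G m j k l x = Rm D Ga k l m j x.
Proof.
move=> Vx; rewrite /riemann_up /Rm mxD_E mxD_E mxN_E mxD_E mxN_E smfD // smfB //.
rewrite [(map_mx _ _) m j]mxE [(map_mx _ _) m j]mxE; congr (_ - _ + _).
- by apply: pd_smf => // y Vy; rewrite christoffel_smf.
- by apply: pd_smf => // y Vy; rewrite christoffel_smf.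
rewrite smfB // [(_ *m _) m j]mxE [(_ *m _) m j]mxE !smf_sum // -sumrB.
by apply: eq_bigr => s _; rewrite !smfM // !christoffel_smf.
Qed.

Lemma ricci_smf i j x : V x -> ricci G i j x = Ric D Ga i j x.
Proof.
by move=> Vx; rewrite smf_sum //; apply: eq_bigr => k _; rewrite riemann_up_smf.
Qed.

Lemma divergence_smf (w : 'I_d -> 'rV[R]_d -> R) (ws : 'I_d -> A) x :
  (forall a y, V y -> w a y = ws a y) -> V x ->
  divergence G w x =
  (\sum_a \sum_b Gi a b * (D b (ws a) - \sum_c Ga b c a * ws c)) x.
Proof.
move=> wE Vx; rewrite smf_sum //; apply: eq_bigr => a _; rewrite smf_sum //.
apply: eq_bigr => b _; rewrite smfM // smfB // smf_sum // invmx_smf // mevE.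
congr (_ * (_ - _)); first by apply: pd_smf => // y Vy; rewrite wE.
by apply: eq_bigr => c _; rewrite smfM // christoffel_smf // wE.
Qed.

Variable P : 'M[A]_d.
Hypothesis PE : forall i j x, V x -> schouten G i j x = P i j x.

Lemma nabla2_smf i j k x : V x ->
  nabla2 G (schouten G) i j k x = covP D half Gm Gi P i j k x.
Proof.
move=> Vx; rewrite /covP /nab mxD_E mxN_E mxD_E [(map_mx _ _) _ _]mxE smfB //.
rewrite /nabla2; congr (_ - _); first by apply: pd_smf => // y Vy; rewrite PE.
rewrite smfD // [(_ *m _) i j]mxE [(_ *m _) i j]mxE !smf_sum // -big_split.
apply: eq_bigr => m _; rewrite !smfM // [(Ga k)^T _ _]mxE !christoffel_smf // !PE //.
by rewrite [X in _ + X]mulrC.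
Qed.

Lemma cotton_smf i j k x : V x -> cotton G i j k x = cotP D half Gm Gi P i j k x.
Proof. by move=> Vx; rewrite /cotton !nabla2_smf // /cotP smfB. Qed.

Lemma nabla3_smf i j k l x : V x ->
  nabla3 G (cotton G) i j k l x = cov3 D half Gm Gi (cotP D half Gm Gi P) i j k l x.
Proof.
move=> Vx; rewrite /nabla3 /cov3 smfB // smf_sum //; congr (_ - _).
  by apply: pd_smf => // y Vy; rewrite cotton_smf.
by apply: eq_bigr => m _; rewrite !smfD // !smfM // !christoffel_smf // !cotton_smf.
Qed.

Hypothesis Gsym : Gm^T = Gm.
Hypothesis Psym : P^T = P.

Definition RPc i j : A := \sum_k \sum_l Gi k l * ((Rm D Ga k i)^T *m P) j l.

(** The Bach tensor with its Weyl tensor expanded into Riemann and Schouten tensors; [RPc] is the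
    curvature term that the linearized Ricci formula produces. *)
Definition bachs i j : A := divcot D half Gm Gi P i j + RPc j i
  + 2%:R * (P *m Gi *m P) i j - \tr (Gi *m P) * P i j
  - \tr (Gi *m P *m Gi *m P) * Gm i j.

Lemma bach_smf i j x : V x -> bach G i j x = bachs i j x.
Proof.
move=> Vx; have Gis := Gis Gsym GGi; have Gs_ := Gs Gsym.
have Ps a b : P a b = P b a by rewrite -{1}Psym mxE.
(* [Pu] is [P] with both indices raised; [Rl] and [Wl] are the lowered Riemann and Weyl tensors with
   index order [k i j l]. *)
pose Pu := Gi *m P *m Gi.
have Pus a b : Pu a b = Pu b a.
  by rewrite -{1}[Pu]trmxK mxE /Pu trmx_mul3 (Gi_sym Gsym GGi) Psym.
pose Rl k l : A := \sum_m Gm k m * Rm D Ga j l m i.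
pose Wl k l : A := Rl k l
  - (P k j * Gm i l - P i j * Gm k l - P k l * Gm i j + P i l * Gm k j).
have -> : bach G i j x = (divcot D half Gm Gi P i j - \sum_k \sum_l Pu k l * Wl k l) x.
  rewrite smfB //; congr (_ - _).
    rewrite smf_sum //; apply: eq_bigr => k _; rewrite smf_sum //.
    by apply: eq_bigr => l _; rewrite smfM // invmx_smf // mevE nabla3_smf.
  rewrite smf_sum //; apply: eq_bigr => k _; rewrite smf_sum //.
  apply: eq_bigr => l _; rewrite smfM //; congr (_ * _).
    rewrite /Pu mxE smf_sum // exchange_big; apply: eq_bigr => b _ /=.
    rewrite smfM // mxE smf_sum // mulr_suml; apply: eq_bigr => a _.
    by rewrite smfM // invmx_smf // !mevE PE // (Gis b l) mulrAC.
  rewrite /weyl !PE // /Wl smfB // !G_ij // smfD // !smfB // !smfM //; congr (_ - _).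
  rewrite /riemann /Rl smf_sum //; apply: eq_bigr => m _.
  by rewrite smfM // G_ij // riemann_up_smf.
congr (smf_fun _ x); rewrite /bachs -!addrA; congr (_ + _).
have GPu : Gm *m Pu = P *m Gi by rewrite /Pu !mulmxA GGi mul1mx.
have PuG : Pu *m Gm = Gi *m P by rewrite /Pu -mulmxA (GiG GGi) mulmx1.
have E1 : \sum_k \sum_l Pu k l * (P k j * Gm i l) = (P *m Gi *m P) i j.
  rewrite -GPu mxE; apply: eq_bigr => k _; rewrite mxE mulr_suml.
  by apply: eq_bigr => l _; rewrite (Pus l k); ring.
have E4 : \sum_k \sum_l Pu k l * (P i l * Gm k j) = (P *m Gi *m P) i j.
  rewrite -mulmxA -PuG mxE exchange_big; apply: eq_bigr => l _; rewrite mxE mulr_sumr.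
  by apply: eq_bigr => k _; rewrite (Pus k l) /=; ring.
have E2 : \sum_k \sum_l Pu k l * (P i j * Gm k l) = \tr (Gi *m P) * P i j.
  rewrite -PuG /mxtrace mulr_suml; apply: eq_bigr => k _; rewrite mxE mulr_suml.
  by apply: eq_bigr => l _; rewrite (Gs_ k l); ring.
have E3 : \sum_k \sum_l Pu k l * (P k l * Gm i j) = \tr (Gi *m P *m Gi *m P) * Gm i j.
  rewrite -/Pu /mxtrace mulr_suml; apply: eq_bigr => k _; rewrite mxE mulr_suml.
  by apply: eq_bigr => l _; rewrite (Ps k l); ring.
have E0 : \sum_k \sum_l Pu k l * Rl k l = - RPc j i.
  rewrite /RPc exchange_big -sumrN; apply: eq_bigr => l _ /=.
  transitivity (\sum_m (Gi *m P) l m * Rm D Ga j l m i).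
    under eq_bigr do rewrite /Rl mulr_sumr; rewrite exchange_big; apply: eq_bigr => m _ /=.
    rewrite -PuG [(Pu *m Gm) l m]mxE mulr_suml; apply: eq_bigr => k _; rewrite (Pus k l); ring.
  have e m : (Gi *m P) l m * Rm D Ga j l m i = \sum_p Gi l p * P p m * Rm D Ga j l m i.
    by rewrite mxE mulr_suml.
  rewrite (eq_bigr _ (fun m _ => e m)) exchange_big -sumrN; apply: eq_bigr => p _ /=.
  rewrite mxE mulr_sumr -sumrN; apply: eq_bigr => m _.
  by rewrite (RmN D half Gm Gi j l) mxN_E [_^T _ _]mxE (Ps p m); ring.
rewrite /Wl.
under eq_bigr do under eq_bigr do rewrite mulrBr mulrDr 2!mulrBr.
under eq_bigr do rewrite sumrB big_split /= sumrB sumrB.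
rewrite sumrB big_split /= sumrB sumrB E0 E1 E2 E3 E4; ring.
Qed.

End coordinate_expressions.

Section fefferman_graham_solution.
Context {R : realType} {n : nat} (W0 : odom R n) (e : R) (e0 : 0 < e).
Local Notation A := (smf (obox W0 e0)).
Local Notation A0 := (smf W0).
Variables (g gi : 'M[A]_n).
Hypothesis gsym : g^T = g.
Hypothesis ggi : g *m gi = 1%:M.
Hypothesis g1 : cmx 1 g = 0.
Local Notation half := (scst 2^-1).
Local Notation D0 := (@sDa R _ W0).
Local Notation Q := (PQ (@sDa R _ (obox W0 e0)) half (sr W0 e0) g gi).
Local Notation g0 := (cmx 0 g).
Local Notation gi0 := (cmx 0 gi).
Local Notation gam := (cmx 2 g).
Local Notation del := (cmx 4 g).
Local Notation G0 := (Gam D0 half g0 gi0).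
Local Notation S := (fun a => cmx 2 (Gam (fun i : 'I_n => @sDa R _ (obox W0 e0) (lshift 1 i)) half g gi a)).
Local Notation P := (- gam).
Local Notation P2 := (P *m gi0 *m P).
Local Notation trP := (\tr (gi0 *m P)).
Local Notation trPP := (\tr (gi0 *m P *m gi0 *m P)).

Let gs0 := g0_sym gsym.
Let ggi0 := cmx0_inv ggi.
Let Psym : P^T = P. Proof. by rewrite trmxN gam_sym. Qed.

Section low_order.
Hypothesis Q1 : forall i j, co 1 (Q (lshift 1 i) (lshift 1 j)) = 0.

Lemma Ric_P i j : Ric D0 G0 i j = (n%:R - 2) * P i j + trP * g0 i j.
Proof.
have := FG_low gsym ggi g1 Q1 i j; rewrite mulmxN mxtraceN mxN_E => h.
by apply/eqP; rewrite -subr_eq0 -[X in _ == X]h; apply/eqP; ring.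
Qed.

Lemma schouten_P (G : 'rV[R]_n -> 'M[R]_n) i j x : (3 <= n)%N ->
  (forall x, W0 x -> G x = mev x g0) -> W0 x -> schouten G i j x = P i j x.
Proof.
move=> n3 GE Wx; rewrite /schouten (ricci_smf GE ggi0) // Ric_P (G_ij GE) //.
have -> : scalar_curv G x = (2 * (n%:R - 1)) * trP x.
  rewrite /scalar_curv.
  have -> : \sum_i \sum_j invmx (G x) i j * ricci G i j x =
     (\sum_i \sum_j gi0 i j * ((n%:R - 2) * P i j + trP * g0 i j)) x.
    rewrite smf_sum //; apply: eq_bigr => a _; rewrite smf_sum //; apply: eq_bigr => b _.
    by rewrite smfM // -Ric_P (invmx_smf GE ggi0) // mevE (ricci_smf GE ggi0).
  have -> : \sum_i \sum_j gi0 i j * ((n%:R - 2) * P i j + trP * g0 i j) =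
     (n%:R - 2) * trP + trP * \tr (gi0 *m g0).
    rewrite {2}/mxtrace [\tr (gi0 *m g0)]/mxtrace !mulr_sumr -big_split.
    apply: eq_bigr => a _ /=; rewrite mxE mxE !mulr_sumr -big_split; apply: eq_bigr => b _ /=.
    by rewrite (Gs gs0 b a) (Gs Psym b a); ring.
  rewrite (GiG ggi0) mxtrace1; move: (trP) => t.
  by rewrite smfD // !smfM // smfB // !smf_nat //; ring.
rewrite smfD // !smfM // smfB // !smf_nat //.
have h1 : n%:R - 2 != 0 :> R by rewrite subr_eq0 eqr_nat neq_ltn n3 orbT.
have h2 : n%:R - 1 != 0 :> R by rewrite subr_eq0 pnatr_eq1 neq_ltn (leq_trans _ n3) ?orbT.
by field; rewrite h1 h2.
Qed.
End low_order.

Hypothesis g3 : cmx 3 g = 0.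
Hypothesis Q0 : forall a b j, (j < 4)%N -> co j (Q a b) = 0.

Lemma nabN k (T : 'M[A0]_n) : nab D0 half g0 gi0 k (- T) = - nab D0 half g0 gi0 k T.
Proof.
rewrite /nab dmxN mulmxN mulNmx; move: (map_mx _ _) (_ *m T) (T *m _) => *; mxring.
Qed.

Lemma divP_J j : divP D0 half g0 gi0 P j = D0 j (J gi0 P).
Proof.
rewrite /J mulmxN mxtraceN raddfN /= -(FG_div gsym ggi g1 (fun j => Q0 _ _ (isT : (2 < 4)%N))).
rewrite /divP exchange_big -sumrN; apply: eq_bigr => l _ /=.
rewrite mxE -sumrN; apply: eq_bigr => k _; rewrite (Gis gs0 ggi0) -mulrN; congr (_ * _).
rewrite /covP nabN mxN_E; congr (- _).
by rewrite -{1}(@nab_sym _ _ D0 half g0 gi0 l gam (gam_sym gsym)) mxE.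
Qed.

(** Linearized Ricci contains [RPc i j] where [bachs i j] contains [RPc j i]. Adding the equations
    for [(i, j)] and [(j, i)] reconciles the two without a proof that the Bach tensor is symmetric;
    this doubles the constants to [8 (n - 4)]. *)
Lemma del_bach i j : (8%:R * n%:R - 32%:R) * del i j =
  (2%:R * n%:R - 8%:R) * P2 i j - (bachs g0 gi0 P i j + bachs g0 gi0 P j i).
Proof.
have HS := Gg2 ggi g1; have DJ := divP_J.
have LE a b := linRic_eq (@sDaM R _ W0) (@sDaC R _ W0) (half2 W0) gs0 ggi0 Psym HS DJ a b.
have RicM : P *m gi0 *m \matrix_(p, q) Ric D0 G0 p q = (n%:R - 2) *: P2 + trP *: P.
  have -> : \matrix_(p, q) Ric D0 G0 p q = (n%:R - 2) *: P + trP *: g0.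
    by apply/matrixP => p q; rewrite mxE Ric_P => [|? ?]; [rewrite !mxlinE|exact: Q0].
  by rewrite mulmxDr -!scalemxAr -(mulmxA P gi0 g0) (GiG ggi0) mulmx1.
have H a b := FG_high gsym ggi g1 g3 (fun i j => Q0 _ _ (isT : (3 < 4)%N)) a b.
have T := FG_tr ggi g1 g3 (Q0 _ _ (isT : (3 < 4)%N)).
have P2s a b : P2 a b = P2 b a.
  by rewrite -{1}[P2]trmxK mxE trmx_mul3 (Gi_sym gs0 ggi0) Psym.
have Ps a b : P a b = P b a by rewrite -{1}Psym mxE.
have ds a b : del a b = del b a by rewrite -{1}(del_sym gsym) mxE.
have gs a b := Gs gs0 a b.
have gg2 : gam *m gi0 *m gam = P2 by rewrite mulNmx mulmxN mulNmx opprK.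
have gt : \tr (gi0 *m gam *m gi0 *m gam) = trPP.
  by rewrite !(mulmxN, mulNmx) opprK.
move: (H i j) (H j i); rewrite !LE RicM gg2 gt {H LE}.
rewrite (ds j i) (P2s j i) (gs j i) /bachs -/(RPc g0 gi0 P i j) -/(RPc g0 gi0 P j i).
rewrite !(mxD_E, mxZ_E) (P2s j i) (Ps j i) (gs j i).
rewrite gt in T.
move: (RPc g0 gi0 P i j) (RPc g0 gi0 P j i) (divcot _ _ _ _ _ i j) (divcot _ _ _ _ _ j i).
move: (del i j) (P2 i j) (g0 i j) (P i j) (trP) T.
move: (trPP) (\tr (gi0 *m del)) (half2 W0) => t td; move: (half) => h h2.
move=> dl p2 gg p tp T r1 r2 c1 c2 H1 H2.
apply/eqP; rewrite -subr_eq0; apply/eqP.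
have hx x : h * x + h * x = x by rewrite -mulrDl h2 mul1r.
have E1 := hx (c1 + r1 - ((n%:R - 2) * p2 + tp * p)).
have E2 := hx (c2 + r2 - ((n%:R - 2) * p2 + tp * p)).
move: (h * (c1 + _ - _)) (h * (c2 + _ - _)) H1 H2 E1 E2 => y1 y2 H1 H2 E1 E2.
have T' : 2%:R * (2%:R * td - t) * gg = - t * gg by rewrite T.
(* A linear combination of [H1], [H2], the relations [E1], [E2] that remove [half], and [T'], which
   removes the trace of [del]. *)
transitivity (2%:R * (y1 + (2%:R * n%:R - 8%:R) * dl + 2%:R * p2 + (2%:R * td - t) * gg)
  + 2%:R * (y2 + (2%:R * n%:R - 8%:R) * dl + 2%:R * p2 + (2%:R * td - t) * gg)
  - (y1 + y1 - (c1 + r1 - ((n%:R - 2) * p2 + tp * p)))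
  - (y2 + y2 - (c2 + r2 - ((n%:R - 2) * p2 + tp * p)))
  - 2%:R * (2%:R * (2%:R * td - t) * gg - - t * gg)); last first.
  by rewrite H1 H2 E1 E2 T' !subrr !mulr0; ring.
ring.
Qed.

End fefferman_graham_solution.

(** * Positive definite matrices *)

Section positive_definite.
Context {R : realType}.

Definition posdef {n} (M : 'M[R]_n) :=
  M^T = M /\ forall v : 'rV[R]_n, v != 0 -> 0 < (v *m M *m v^T) 0 0.

(** Cholesky factorization, by induction on the size through the Schur complement of the first
    entry. *)
Lemma posdef_factor n (M : 'M[R]_n) : posdef M -> exists A : 'M[R]_n, M = A *m A^T.
Proof.
elim: n M => [|n IH] M; first by exists 0; rewrite [LHS]flatmx0 [RHS]flatmx0.
rewrite -[n.+1]/(1 + n)%N in M *; case=> Ms Mp.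
pose a := (ulsubmx M) 0 0; pose b := ursubmx M; pose D := drsubmx M.
have ME : M = block_mx a%:M b b^T D.
  rewrite -[LHS]submxK -mx11_scalar; congr (block_mx _ _ _ _).
  by rewrite /b trmx_ursub Ms.
have a0 : 0 < a.
  have := Mp (row_mx 1%:M 0); rewrite ME mul_row_block tr_row_mx mul_row_col.
  rewrite !(mul0mx, mul1mx, trmx0, trmx1, mulmx0, mulmx1, addr0) mxE eqxx mulr1n; apply.
  apply/eqP => /(congr1 lsubmx); rewrite row_mxKl => /matrixP/(_ 0 0)/eqP.
  by rewrite !mxE eqxx oner_eq0.
have an0 : a != 0 by rewrite gt_eqF.
pose S := D - a^-1 *: (b^T *m b).
have [|A' SA] := IH S.
  split.
    rewrite /S trmxD trmxN trmxZ trmx_mul trmxK; congr (_ - _).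
    by rewrite /D trmx_drsub Ms.
  move=> w w0; have := Mp (row_mx (- (a^-1 *: (w *m b^T))) w).
  have -> : row_mx (- (a^-1 *: (w *m b^T))) w *m M
     *m (row_mx (- (a^-1 *: (w *m b^T))) w)^T = w *m S *m w^T.
    rewrite ME mul_row_block tr_row_mx mul_row_col mul_mx_scalar.
    rewrite scalerN scalerA divff // scale1r addNr mul0mx add0r.
    congr (_ *m _); rewrite /S mulmxBr -scalemxAr mulmxA mulNmx -scalemxAl.
    by rewrite addrC.
  apply; apply/eqP => /(congr1 rsubmx); rewrite row_mxKr linear0 => w00.
  by rewrite w00 eqxx in w0.
exists (block_mx (Num.sqrt a)%:M 0 ((Num.sqrt a)^-1 *: b^T) A').
have sa : Num.sqrt a != 0 by rewrite gt_eqF // sqrtr_gt0.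
have ss : Num.sqrt a * Num.sqrt a = a by rewrite -expr2 sqr_sqrtr // ltW.
rewrite ME tr_block_mx mulmx_block trmx0 !(mulmx0, mul0mx, addr0) tr_scalar_mx trmxZ trmxK.
rewrite -scalar_mxM ss; congr (block_mx _ _ _ _).
- by rewrite mul_scalar_mx scalerA divff // scale1r.
- by rewrite mul_mx_scalar scalerA divff // scale1r.
- by rewrite -SA /S -scalemxAl -scalemxAr scalerA -invfM ss addrC subrK.
Qed.

Lemma tr_mulT_sum m p (X : 'M[R]_(m, p)) : \tr (X *m X^T) = \sum_i \sum_j X i j ^+ 2.
Proof.
by apply: eq_bigr => i _; rewrite mxE; apply: eq_bigr => j _; rewrite mxE expr2.
Qed.

Lemma tr_quad n (B T : 'M[R]_n) : let M := B *m B^T in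
  \tr (M *m T *m M *m T^T) = \tr ((B^T *m T *m B) *m (B^T *m T *m B)^T).
Proof.
rewrite /= -!mulmxA mxtrace_mulC !trmx_mul trmxK !mulmxA; congr (\tr _).
Qed.

Lemma tr_quad_ge0 n (M T : 'M[R]_n) : posdef M -> 0 <= \tr (M *m T *m M *m T^T).
Proof.
move=> /posdef_factor[B ->]; rewrite tr_quad tr_mulT_sum.
by apply: sumr_ge0 => i _; apply: sumr_ge0 => j _; exact: sqr_ge0.
Qed.

Lemma posdef_unit n (M : 'M[R]_n) : posdef M -> M \in unitmx.
Proof.
case=> Ms Mp; rewrite -row_free_unit -kermx_eq0; apply/negPn/negP => /rowV0Pn[v].
rewrite sub_kermx => /eqP vM /Mp; rewrite vM mul0mx mxE ltxx //.
Qed.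

(** With [M = B B^T] the trace is the sum of the squares of the entries of [B^T T B], and [B] is
    invertible. *)
Lemma tr_quad_eq0 n (M T : 'M[R]_n) : posdef M ->
  \tr (M *m T *m M *m T^T) = 0 -> T = 0.
Proof.
move=> Mp; have [B MB] := posdef_factor Mp.
have Bu : B \in unitmx by have := posdef_unit Mp; rewrite MB unitmx_mul => /andP[].
rewrite MB tr_quad tr_mulT_sum; set X := _ *m B => h.
have X0 : X = 0.
  apply/matrixP => i j; rewrite [RHS]mxE; apply/eqP; rewrite -sqrf_eq0; apply/eqP.
  have sq i' j' : 0 <= X i' j' ^+ 2 by exact: sqr_ge0.
  have row0 i' : 0 <= \sum_j X i' j ^+ 2 by apply: sumr_ge0.
  move/eqP: h; rewrite psumr_eq0 // => /allP/(_ i).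
  rewrite mem_index_enum => /(_ isT)/implyP/(_ isT).
  by rewrite psumr_eq0 // => /allP/(_ j); rewrite mem_index_enum => /(_ isT)/implyP/(_ isT)/eqP.
have : (invmx B)^T *m X *m invmx B = T.
  by rewrite /X !mulmxA -trmx_mul mulmxV // trmx1 mul1mx -mulmxA mulmxV // mulmx1.
by rewrite X0 mulmx0 mul0mx.
Qed.

Lemma posdef_inv n (M N : 'M[R]_n) : posdef M -> M *m N = 1%:M -> posdef N.
Proof.
move=> [Ms Mp] MN; have NM := mulmx1C MN; have Ns := Gi_sym Ms MN; split => // v v0.
have := Mp (v *m N); rewrite trmx_mul Ns -[v *m N *m M]mulmxA NM mulmx1 mulmxA; apply.
by apply/eqP => h; move: v0; rewrite -[v]mulmx1 -NM mulmxA h mul0mx eqxx.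
Qed.

Lemma posdef_block1 n (M : 'M[R]_n) : posdef M -> posdef (block_mx M 0 0 (1%:M : 'M[R]_1)).
Proof.
case=> Ms Mp; split; first by rewrite tr_block_mx Ms !trmx0 trmx1.
move=> v v0; rewrite -[v]hsubmxK tr_row_mx mul_row_block mul_row_col !mulmx0 addr0 add0r.
rewrite mulmx1 mxE.
have sq (u : 'rV[R]_1) : (u *m u^T) 0 0 = u 0 0 ^+ 2 by rewrite mxE big_ord1 mxE expr2.
rewrite sq; have [l0|/Mp l0] := eqVneq (lsubmx v) 0; last by rewrite ltr_pwDl ?sqr_ge0.
rewrite l0 !mul0mx mxE add0r lt_def sqr_ge0 andbT sqrf_eq0.
apply: contra v0 => /eqP r0; rewrite -[v]hsubmxK l0 [rsubmx v]mx11_scalar r0.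
by rewrite raddf0 row_mx0.
Qed.

End positive_definite.

(** * From one-sided smooth functions to elements of the rings *)

Section smooth_boxes.
Context {R : realType} {d : nat}.

Definition cube (x : 'rV[R]_d) (b : R) : set 'rV[R]_d :=
  [set z | forall j, `|z 0 j - x 0 j| < b].

Lemma cube_open x b : open (cube x b).
Proof.
rewrite openE => z zx.
have : nbhs z [set y : 'rV[R]_d | forall j, `|y 0 j - x 0 j| < b].
  apply: (@filter_forall _ 'I_d (fun j (y : 'rV[R]_d) => `|y 0 j - x 0 j| < b) (nbhs z) _) => j.
  have : {for z, continuous (fun y : 'rV[R]_d => `|y 0 j - x 0 j|)}.
    apply: (@continuous_comp _ _ _ (fun y : 'rV[R]_d => y 0 j - x 0 j) Num.norm).
      by apply: continuousB; [exact: coord_continuous|exact: cst_continuous].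
    exact: norm_continuous.
  by move=> /(_ [set t | t < b]); apply; exact: lt_nbhsl (zx j).
by [].
Qed.

Variables (x : 'rV[R]_d).

Section ocube.
Variables (b : R) (b0 : 0 < b).
Lemma cube_opt : cube x b x. Proof. by move=> j; rewrite subrr normr0. Qed.
Definition ocube := Odom (@cube_open x b) cube_opt.
End ocube.

(** The form [for every b <= b1] recurs in all local statements: finitely many of them can then be
    used on one common box. *)
Lemma nbhs_cube (P : set 'rV[R]_d) : nbhs x P ->
  exists2 b1 : R, 0 < b1 & forall b (b0 : 0 < b), b <= b1 -> forall z, ocube b0 z -> P z.
Proof.
move=> /nbhs_boxP[e e0 H]; exists e => // b b0 be z zb; apply: H => j.
exact: lt_le_trans (zb j) be.
Qed.

Lemma nbhs_obox (P : set 'rV[R]_(d + 1)) : nbhs (pt x 0) P ->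
  exists2 b1 : R, 0 < b1 & forall b (b0 : 0 < b), b <= b1 ->
    forall y, obox (ocube b0) b0 y -> P y.
Proof.
move=> /nbhs_boxP[e e0 H]; exists e => // b b0 be y [yb yr]; apply: H.
apply: ord_add1 => [j|].
  by rewrite pt_lshift -baseE; exact: lt_le_trans (yb j) be.
by rewrite pt_rshift subr0; exact: lt_le_trans yr be.
Qed.

Lemma smooth_smf (U : set 'rV[R]_d) f : open U -> U x -> smooth_on U f ->
  exists2 b1 : R, 0 < b1 & forall b (b0 : 0 < b), b <= b1 ->
    exists F : smf (ocube b0), forall z, ocube b0 z -> U z /\ f z = F z.
Proof.
move=> oU Ux /(_ x Ux)[V [F [oV Vx CF fF]]].
have [b1 b10 H] := nbhs_cube (filterI (open_nbhs_nbhs (conj oU Ux)) (open_nbhs_nbhs (conj oV Vx))).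
exists b1 => // b b0 bb1; have HV := H b b0 bb1.
exists (smk (fun N => class_C_sub (fun z zb => (HV z zb).2) (CF N))) => z zb.
by have [Uz Vz] := HV z zb; split => //; rewrite smkE // fF.
Qed.

Lemma collar_smf (U : set 'rV[R]_d) e f : open U -> U x -> 0 < e ->
  smooth_on (collar U e) f ->
  exists2 b1 : R, 0 < b1 <= e & forall b (b0 : 0 < b), b <= b1 ->
    exists F : smf (obox (ocube b0) b0), forall y, obox (ocube b0) b0 y ->
      U (base y) /\ (0 <= hgt y -> f y = F y).
Proof.
move=> oU Ux e0 sf; have c0 : collar U e (pt x 0).
  by rewrite /collar /= base_pt hgt_pt lexx.
have [V [F [oV Vx CF fF]]] := sf _ c0.
have [b1 b10 H] := nbhs_obox (open_nbhs_nbhs (conj oV Vx)).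
have [b2 b20 H2] := nbhs_cube (open_nbhs_nbhs (conj oU Ux)).
exists (Num.min e (Num.min b1 b2)); first by rewrite !lt_min e0 b10 b20 ge_min lexx.
move=> b b0; rewrite !le_min => /and3P[be bb1 bb2].
have HV := H b b0 bb1.
exists (smk (fun N => class_C_sub HV (CF N))) => y yb.
have [/(H2 b b0 bb2) Uy yr] := yb; split => // y0; rewrite smkE //.
apply: fF; last exact: HV.
by split => //; rewrite y0 (le_lt_trans (ler_norm _)) // (lt_le_trans yr).
Qed.

End smooth_boxes.

Lemma iter_pd_smf {R : realType} {d} {V : odom R d} i m (f : 'rV[R]_d -> R) (F : smf V) :
  (forall y, V y -> f y = F y) -> forall y, V y -> iter m (pd i) f y = iter m (sD i) F y.
Proof.
move=> fF; elim: m => [//|m IH] y Vy; rewrite !iterS; exact: pd_smf.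
Qed.

Section even_extension.
Context {R : realType} {d : nat}.

Lemma co_pd {V0 : odom R d} {e : R} {e0 : 0 < e} m f (F : smf (obox V0 e0)) z :
  (forall y, obox V0 e0 y -> f y = F y) -> V0 z ->
  co m F z = m`!%:R^-1 * iter m (pd ir) f (pt z 0).
Proof.
move=> fF Vz; rewrite coE smfM // scstE // sliceE //; congr (_ * _).
by rewrite (iter_pd_smf _ _ fF) //; apply: box_pt; rewrite // normr0.
Qed.

(** [even_smooth_on] offers, at each boundary point separately, some extension with vanishing odd
    derivatives. One extension [F] is fixed here; at each [z] its coefficients equal those of the
    extension belonging to [z], because both coincide with [f] for [r > 0]. *)
Lemma even_smf (x : 'rV[R]_d) (U : set 'rV[R]_d) e f : open U -> U x -> 0 < e ->
  even_smooth_on U e f ->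
  exists2 b1 : R, 0 < b1 <= e & forall b (b0 : 0 < b), b <= b1 ->
    exists2 F : smf (obox (ocube x b0) b0),
      (forall y, obox (ocube x b0) b0 y -> U (base y) /\ (0 <= hgt y -> f y = F y)) &
      forall j, odd j -> co j F = 0.
Proof.
move=> oU Ux e0 [sf ev]; have [b1 b10 H] := collar_smf oU Ux e0 sf.
exists b1 => // b b0 bb1; have [F HF] := H b b0 bb1; exists F => // j oj.
apply: smf_ext => z Vz; rewrite smf0.
have zB : obox (ocube x b0) b0 (pt z 0) by apply: box_pt; rewrite // normr0.
have Uz : U z by have [] := HF _ zB; rewrite base_pt.
have [V' [F' [[oV' Vz' CF' fF'] odd0]]] := ev z Uz.
have [b2 b20 H2] := nbhs_obox (filterI (open_nbhs_nbhs (conj oV' Vz'))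
  (open_nbhs_nbhs (conj (@oset_open _ _ (obox (ocube x b0) b0)) zB))).
have H2' := H2 b2 b20 (lexx _).
pose F1 := sres (fun y yb => (H2' y yb).2) F.
pose F2 := smk (fun N => class_C_sub (fun y yb => (H2' y yb).1) (CF' N)).
have zz : ocube z b20 z by exact: cube_opt.
rewrite (co_pd j (f := F)) // -(co_pd j (F := F1)) //; last by move=> y yb; rewrite sresE.
have -> : co j F1 z = co j F2 z.
  apply/eqP; rewrite -subr_eq0 -smfB // -coB; apply/eqP.
  (* The difference vanishes for small positive [r], so [co_eq0] applies with the bound [0]. *)
  apply: (@co_eq0 _ _ _ _ _ j.+1 _ _ 0) => //.
  near=> r; rewrite mul0r.
  have yb : obox (ocube z b20) b20 (pt z r).
    by apply: box_pt; rewrite // gtr0_norm; near: r; [exact: nbhs_right_lt|exact: nbhs_right_gt].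
  have re : r < e.
    by near: r; apply: nbhs_right_lt.
  have [Vy By] := H2' _ yb; have r0 : 0 < r by near: r; exact: nbhs_right_gt.
  rewrite smfB // sresE // smkE //.
  have [Uy <-] := HF _ By; last by rewrite hgt_pt ltW.
  by rewrite fF' ?subrr ?normr0 //; split => //; rewrite hgt_pt ltW.
rewrite (co_pd j (f := F')) //; last by move=> y yb; rewrite smkE.
by rewrite odd0 // mulr0.
Unshelve. all: by end_near. Qed.

Lemma boundaryO_at (U : set 'rV[R]_d) (q b : 'rV[R]_(d + 1) -> R) x :
  boundaryO U q b -> U x ->
  exists C : R, \forall r \near (0 : R)^'+, `|q (pt x r)| <= C * b (pt x r).
Proof.
move=> H Ux; have [C HC] := H x Ux; exists C.
have [e e0 He] : exists2 e : R, 0 < e & forall y : 'rV[R]_(d + 1),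
    (forall j, `|y 0 j - (pt x 0) 0 j| < e) ->
    0 < hgt y -> `|q y| <= C * b y by apply/nbhs_boxP; exact: HC.
near=> r; have r0 : 0 < r by near: r; exact: nbhs_right_gt.
apply: He; last by rewrite hgt_pt.
apply: ord_add1 => [j|]; first by rewrite !pt_lshift subrr normr0.
by rewrite !pt_rshift subr0 gtr0_norm //; near: r; exact: nbhs_right_lt.
Unshelve. all: by end_near. Qed.

End even_extension.

Section map_PQ.
Context {A B : comNzRingType} {n : nat} (f : {rmorphism A -> B}).
Context (D : 'I_(n + 1) -> {additive A -> A}) (D' : 'I_(n + 1) -> {additive B -> B}).
Hypothesis fD : forall i x, f (D i x) = D' i (f x).
Variables (half r : A) (g gi : 'M[A]_n).
Local Notation Dx := (fun i : 'I_n => D (lshift 1 i)).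
Local Notation Dx' := (fun i : 'I_n => D' (lshift 1 i)).
Local Notation fg := (map_mx f g).
Local Notation fgi := (map_mx f gi).

Let fDx i x : f (Dx i x) = Dx' i (f x). Proof. exact: fD. Qed.

Lemma map_PB : map_mx f (PB D half g gi) = PB D' (f half) fg fgi.
Proof. by rewrite !PBE map_mxZ map_mxM (map_dmx fD). Qed.

Lemma map_PQ : map_mx f (PQ D half r g gi) = PQ D' (f half) (f r) fg fgi.
Proof.
have PBij i j : f (PB D half g gi i j) = PB D' (f half) fg fgi i j.
  by rewrite -map_PB mxE.
have Gamij a i j : f (Gam Dx half g gi a i j) = Gam Dx' (f half) fg fgi a i j.
  by rewrite -(map_Gam fDx) mxE.
have mulij (M N : 'M[A]_n) i j : f ((M *m N) i j) = (map_mx f M *m map_mx f N) i j.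
  by rewrite -map_mxM [RHS]mxE.
have trf (M : 'M[A]_n) : f (\tr M) = \tr (map_mx f M) by rewrite trace_map_mx.
have gij i j : f (g i j) = fg i j by rewrite mxE.
rewrite /PQ map_block_mx; congr (block_mx _ _ _ _); apply/matrixP => i j;
  rewrite [LHS]mxE [X in f X]mxE [RHS]mxE.
- have -> : Ric Dx' (Gam Dx' (f half) fg fgi) i j = f (Ric Dx (Gam Dx half g gi) i j).
    by rewrite (map_Ric fDx); apply: Ric_ext => a; rewrite (map_Gam fDx).
  rewrite !rmorphD !rmorphM !rmorphD !rmorphN !rmorphM !fD rmorph1 rmorph_nat.
  by rewrite !mulij !map_mxM map_PB trf map_PB gij.
- rewrite rmorphM rmorph_sum; congr (_ * _); apply: eq_bigr => k _.
  have -> (X : 'M[A]_n) : f (X k i) = map_mx f X k i by rewrite mxE.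
  by rewrite map_mxD !map_mxB !map_mxM !(map_dmx fD) map_PB !(map_Gam fDx).
- rewrite rmorphM rmorph_sum; congr (_ * _); apply: eq_bigr => k _.
  rewrite !rmorphD !rmorphN !fD !rmorph0 !mulij map_PB !(map_Gam fDx).
  by rewrite !PBij.
- rewrite !rmorphD !rmorphN !rmorphM !trf !map_mxM !(map_dmx fD) map_PB.
  by rewrite rmorphN.
Qed.
End map_PQ.

(** * Orders of vanishing read off from norms *)

Section valuation.
Context {R : realType} {d : nat} {V0 : odom R d} {e : R} {e0 : 0 < e}.
Local Notation A := (smf (obox V0 e0)).

Lemma cmx_low m n p j (M : 'M[A]_(m, n)) (N : 'M[A]_(n, p)) :
  (forall i, (i < j)%N -> cmx i N = 0) ->
  (forall i, (i < j)%N -> cmx i (M *m N) = 0) /\ cmx j (M *m N) = cmx 0 M *m cmx j N.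
Proof.
move=> N0; have E i : (i < j)%N -> cmx i (M *m N) = 0.
  move=> ij; rewrite cmxM big1 // => k _; rewrite (N0 (i - k)%N) ?mulmx0 //.
  exact: leq_ltn_trans (leq_subr _ _) ij.
split => //; rewrite cmxM big_ord_recl subn0 big1 ?addr0 // => k _.
by rewrite N0 ?mulmx0 // lift0 ltn_subrL /=; case: (j) k => [[]|].
Qed.

(** If a defect starts at order [j], its square norm starts at order [2 j], with the product of the
    leading coefficients. *)
Lemma cmx_dbl m n p j (M : 'M[A]_(m, n)) (N : 'M[A]_(n, p)) :
  (forall i, (i < j)%N -> cmx i M = 0) -> (forall i, (i < j)%N -> cmx i N = 0) ->
  cmx (j + j) (M *m N) = cmx j M *m cmx j N.
Proof.
move=> M0 N0; rewrite cmxM.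
have jlt : (j < (j + j).+1)%N by rewrite ltnS leq_addr.
rewrite (bigD1 (Ordinal jlt)) //= addnK big1 ?addr0 // => k /eqP kj.
have [kj'|jk|kj'] := ltngtP k j.
- by rewrite M0 // mul0mx.
- by rewrite N0 ?mulmx0 // ltn_subLR ?ltn_add2r // -ltnS.
- by case: kj; apply: val_inj.
Qed.

End valuation.

Section einstein.
Context {R : realType} {n : nat} {M : manifold (R := R) n}.
Variables (gr : R -> riemannian_metric M) (phi : chart R M n).
Hypothesis aphi : atlas phi.
Variables (W0 : odom R n) (e : R) (e0 : 0 < e).
Hypothesis Wphi : forall x, W0 x -> ccod phi x.
Local Notation A := (smf (obox W0 e0)).
Variables (g gi : 'M[A]_n).
Hypothesis ggi : g *m gi = 1%:M.
Hypothesis gsym : g^T = g.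
Hypothesis gE : forall y, obox W0 e0 y -> 0 <= hgt y -> gr (hgt y) phi (base y) = mev y g.
Local Notation half := (scst 2^-1).
Local Notation sr0 := (sr W0 e0).
Local Notation Q := (PQ (@sDa R _ (obox W0 e0)) half sr0 g gi).

Lemma sr_pos y : pbox W0 e0 y -> res sr0 y != 0.
Proof.
move=> Vy; have By := pbox_box Vy; case: (Vy) => _ /andP[h _].
by rewrite resE // srE // gt_eqF.
Qed.
(* 1 / r *)
Definition sw : smf (pbox W0 e0) := sinv sr_pos.
Lemma swE y : pbox W0 e0 y -> sw y = (hgt y)^-1.
Proof. by move=> Vy; rewrite sinvE // resE // srE //; exact: pbox_box. Qed.
Lemma srw : res sr0 * sw = 1. Proof. exact: smulV. Qed.

Local Notation rg := (map_mx res g).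
Local Notation rgi := (map_mx res gi).
Local Notation Gp := (PGp rg sw).
Local Notation Gpi := (PGpi (res sr0) rgi).

Lemma mev_res m p y (N : 'M[A]_(m, p)) : pbox W0 e0 y -> mev y (map_mx res N) = mev y N.
Proof. by move=> Vy; apply/matrixP => i j; rewrite !mxE resE. Qed.

Lemma mev_block (V : odom R (n + 1)) y (N : 'M[smf V]_n) : V y ->
  mev y (block_mx N 0 0 (1%:M : 'M[smf V]_1)) = block_mx (mev y N) 0 0 1%:M.
Proof.
by move=> Vy; rewrite -[LHS]/(map_mx (sev Vy) _) map_block_mx !map_mx0 map_mx1.
Qed.

Lemma mevZ (V : odom R (n + 1)) m p y (f : smf V) (N : 'M[smf V]_(m, p)) : V y ->
  mev y (f *: N) = f y *: mev y N.
Proof. by move=> Vy; apply/matrixP => i j; rewrite !mxE smfM. Qed.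

Lemma gbar_smf y : obox W0 e0 y -> 0 <= hgt y ->
  gbar gr phi y = mev y (block_mx g 0 0 1%:M).
Proof. by move=> Vy y0; rewrite /gbar gE // mev_block. Qed.

Lemma gplus_smf y : pbox W0 e0 y -> gplus gr phi y = mev y Gp.
Proof.
move=> Vy; have By := pbox_box Vy; case: (Vy) => _ /andP[h _].
rewrite /gplus gbar_smf // ?ltW // /PGp mevZ // smfX // swE // exprVn mev_block //.
by rewrite [in RHS]mev_block // mev_res.
Qed.

Lemma rg_inv : rg *m rgi = 1%:M. Proof. by rewrite -map_mxM ggi map_mx1. Qed.

Lemma res_sD i (x : A) : res (@sDa R _ (obox W0 e0) i x) = @sDa R _ (pbox W0 e0) i (res x).
Proof. by rewrite /= sD_res. Qed.

Lemma res_half : res (half : A) = half. Proof. exact: sres_cst. Qed.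

Lemma Dx_sr i : @sDa R _ (pbox W0 e0) (lshift 1 i) (res sr0) = 0.
Proof. by rewrite /= sD_res sD_coord lrshiftF rmorph0. Qed.
Lemma DZ_sr : @sDa R _ (pbox W0 e0) ir (res sr0) = 1.
Proof. by rewrite /= sD_res sD_coord eqxx rmorph1. Qed.

Lemma rgsym : rg^T = rg. Proof. by rewrite map_trmx gsym. Qed.

Lemma ricci_gplus y a b : pbox W0 e0 y ->
  ricci (gplus gr phi) a b y + n%:R * gplus gr phi y a b = (hgt y)^-1 * Q a b y.
Proof.
move=> Vy; rewrite (ricci_smf gplus_smf (PGp_inv rg_inv srw)) // (G_ij gplus_smf) //.
rewrite -(smf_nat n Vy) -smfM // -smfD //.
have := Poincare_defect (@sDaM R _ (pbox W0 e0)) (half2 _) rgsym rg_inv srw Dx_sr DZ_sr a b.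
set T := _ + _ => h.
have -> : T = sw * PQ (@sDa R _ (pbox W0 e0)) half (res sr0) rg rgi a b.
  by rewrite -h mulrA [sw * _]mulrC srw mul1r.
rewrite smfM // swE // -res_half -(map_PQ res_sD) mxE resE //.
Qed.

Local Notation Gb := (block_mx g 0 0 (1%:M : 'M[A]_1)).
Local Notation Gbi := (block_mx gi 0 0 (1%:M : 'M[A]_1)).
(** The square norm for [gbar] of [r (Ric + n g_+)]; unlike the norm itself it is smooth across
    [r = 0]. *)
Definition defect2 : A := \tr (Gbi *m Q *m Gbi *m Q^T).

Lemma Gb_inv : Gb *m Gbi = 1%:M.
Proof. by rewrite mulmx_block !(mul0mx, mulmx0, mul1mx, addr0, add0r) ggi -scalar_mx_block. Qed.

Lemma gbi_pos y : obox W0 e0 y -> 0 <= hgt y -> posdef (mev y Gbi).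
Proof.
move=> Vy y0; apply: (@posdef_inv _ _ (mev y Gb)); last by rewrite -mevM // Gb_inv mev1.
rewrite mev_block //; apply: posdef_block1; rewrite -gE //.
have cy : ccod phi (base y) by apply: Wphi; case: Vy.
by split; [exact: rmet_sym|exact: rmet_pos].
Qed.

Lemma defect2_mev y : obox W0 e0 y ->
  defect2 y = \tr (mev y Gbi *m mev y Q *m mev y Gbi *m (mev y Q)^T).
Proof. by move=> Vy; rewrite mev_tr // !mevM // mevT. Qed.

(** The norm of a covariant two-tensor in [r^-2 gbar] brings a factor [r^2], and [Q] brings [r^-1].
    The net factor [r] is the reason for [N.+1] in [einstein_Q]. *)
Lemma einstein_defect_smf y : pbox W0 e0 y ->
  einstein_defect gr phi y = hgt y * Num.sqrt (defect2 y).
Proof.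
move=> Vy; have By := pbox_box Vy; case: (Vy) => _ /andP[h _].
rewrite /einstein_defect /tensor_normsq (invmx_smf gplus_smf (PGp_inv rg_inv srw)) //.
have -> : \matrix_(i, j) (ricci (gplus gr phi) i j y + n%:R * gplus gr phi y i j) =
    (hgt y)^-1 *: mev y Q.
  by apply/matrixP => i j; rewrite mxE ricci_gplus // [RHS]mxE mevE.
have -> : mev y Gpi = hgt y ^+ 2 *: mev y Gbi.
  rewrite /PGpi mevZ // smfX // resE // srE //; congr (_ *: _).
  by rewrite !mev_block // mev_res.
rewrite trmxZ -!(scalemxAl, scalemxAr) !scalerA mxtraceZ defect2_mev //.
have -> : (hgt y)^-1 * hgt y ^+ 2 * hgt y ^+ 2 / hgt y = hgt y ^+ 2.
  by field; rewrite gt_eqF.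
by rewrite sqrtrM ?sqr_ge0 // sqrtr_sqr gtr0_norm.
Qed.

(** Induction on the order: once the coefficients below [j] vanish, the coefficient of [r^(2 j)] in
    [defect2] is the square norm of the [j]-th one at the boundary. It is zero since [defect2] is of
    order [2 N], and positivity does the rest. *)
Lemma einstein_Q N : boundaryO (ccod phi) (einstein_defect gr phi) (fun y => hgt y ^+ N.+1) ->
  forall a b j, (j < N)%N -> co j (Q a b) = 0.
Proof.
move=> bO; suff H j : (j < N)%N -> cmx j Q = 0.
  by move=> a b j jN; rewrite -cmxE H // mx0_E.
elim/ltn_ind: j => j IH jN.
have IH' i : (i < j)%N -> cmx i Q = 0 by move=> ij; apply: IH => //; exact: ltn_trans jN.
have IHT i : (i < j)%N -> cmx i Q^T = 0 by move=> ij; rewrite cmxT IH' // trmx0.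
have [X0 Xj] := cmx_low Gbi IH'; have [Y0 Yj] := cmx_low Gbi IHT.
have E : co (j + j) defect2 = \tr (cmx 0 Gbi *m cmx j Q *m cmx 0 Gbi *m (cmx j Q)^T).
  by rewrite cmx_tr -mulmxA (cmx_dbl X0 Y0) Xj Yj cmxT !mulmxA.
have ev0 x : W0 x -> co (j + j) defect2 x = 0.
  move=> Wx; have [C HC] := boundaryO_at bO (Wphi Wx).
  apply: (@co_eq0 _ _ _ _ _ (N + N) _ _ (C ^+ 2)); rewrite // ?ltn_add //.
    near=> r; have r0 : 0 < r by near: r; exact: nbhs_right_gt.
    have re : r < e by near: r; exact: nbhs_right_lt.
    have Vy : pbox W0 e0 (pt x r) by apply: pbox_pt; rewrite // r0.
    have By := pbox_box Vy.
    have h : `|einstein_defect gr phi (pt x r)| <= C * hgt (pt x r) ^+ N.+1 by near: r.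
    move: h; rewrite einstein_defect_smf // hgt_pt.
    have t0 : 0 <= defect2 (pt x r).
      rewrite defect2_mev //; apply: tr_quad_ge0; apply: gbi_pos => //.
      by rewrite hgt_pt ltW.
    have nn : 0 <= r * Num.sqrt (defect2 (pt x r)) by rewrite mulr_ge0 ?sqrtr_ge0 // ltW.
    rewrite (ger0_norm nn) exprS mulrCA ler_pM2l // => h.
    rewrite ger0_norm // -[leLHS]sqr_sqrtr // exprD expr2 [C ^+ 2]expr2 mulrACA -!expr2.
    by rewrite lerXn2r // ?nnegrE ?sqrtr_ge0 // (le_trans _ h) ?sqrtr_ge0.
  by rewrite !addnn ltn_double.
apply/matrixP => a b; rewrite mx0_E; apply: smf_ext => x Wx; rewrite smf0.
have Vy : obox W0 e0 (pt x 0) by apply: box_pt; rewrite // normr0.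
have mc m p (K : 'M[A]_(m, p)) : mev x (cmx 0 K) = mev (pt x 0) K.
  by apply/matrixP => i k; rewrite !mevE cmxE co0 sliceE.
have := ev0 x Wx; rewrite E mev_tr // !mevM // mevT !mc => /(tr_quad_eq0 (gbi_pos Vy _)).
by rewrite hgt_pt lexx => /(_ isT)/matrixP/(_ a b); rewrite mevE mxE.
Unshelve. all: by end_near. Qed.

End einstein.

(** * Expansion of the induced metric *)

Section covariant_expansion.
Context {B : comNzRingType} {k n : nat}.
Variable half : B.
Hypothesis half2 : half + half = 1.

(** Pure matrix algebra, applied with [N = Gamma(U)], [K = (d_U Gamma)(U)], [GA = Gamma(A)] and
    [GN = Gamma(Gamma(U, U))]. The left side is the raw fourth coefficient of the pulled-back
    metric; on the right ordinary derivatives of fields have become covariant ones, at the price of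
    the curvature term [RU]. *)
Lemma q_covariant (X dU dA RU Mm : 'M[B]_(k, n)) (g N K gam gamU del GA GN : 'M[B]_n) :
  Mm = X *m K^T + X *m N^T *m N^T - X *m GN^T - RU ->
  let DU := dU + X *m N^T in
  let DA := dA + X *m GA^T in
  let dV := dA - half *: (dU *m N^T + dU *m N^T + Mm) in
  let g2 := gam + (N^T *m g + g *m N) in
  let g4 := del + gamU + (GA^T *m g + g *m GA) - half *: (GN^T *m g + g *m GN)
    + half *: (K^T *m g + g *m K + N^T *m N^T *m g + N^T *m g *m N + N^T *m g *m N
               + g *m N *m N) in
  X *m g4 *m X^T + (dU *m g2 *m X^T + X *m g2 *m dU^T) + dU *m g *m dU^T
    + (dV *m g *m X^T + X *m g *m dV^T) =
  X *m del *m X^T + X *m (gamU - N^T *m gam - gam *m N) *m X^T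
    + (DU *m gam *m X^T + X *m gam *m DU^T) + DU *m g *m DU^T
    + (DA *m g *m X^T + X *m g *m DA^T)
    + half *: (RU *m g *m X^T + X *m g *m RU^T).
Proof.
move=> -> /=.
rewrite !(trmxD, trmxN, trmxZ, trmx_mul, trmxK) !(mulmxDl, mulmxDr, mulmxN, mulNmx).
rewrite -!(scalemxAl, scalemxAr) !(mulmxDl, mulmxDr, mulmxN, mulNmx) !(scalerDr, scalerN) !mulmxA.
apply/matrixP => i j; rewrite !mxlinE; apply/eqP; rewrite -subr_eq0; apply/eqP.
(* [ring] does not know that [half + half = 1], so the difference of the two sides is exhibited as a
   multiple of [half + half - 1]. The same device recurs further on. *)
transitivity ((half + half - 1) * ((X *m N^T *m g *m N *m X^T) i j
   - (dU *m N^T *m g *m X^T) i j - (X *m g *m N *m dU^T) i j)); first ring.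
by rewrite half2 subrr mul0r.
Qed.

Lemma p_covariant (X dU : 'M[B]_(k, n)) (g N gam : 'M[B]_n) :
  X *m (gam + (N^T *m g + g *m N)) *m X^T + (dU *m g *m X^T + X *m g *m dU^T) =
  X *m gam *m X^T + ((dU + X *m N^T) *m g *m X^T + X *m g *m (dU + X *m N^T)^T).
Proof.
rewrite !(trmxD, trmx_mul, trmxK, mulmxDl, mulmxDr, mulmxA).
by apply/matrixP => i j; rewrite !mxlinE; ring.
Qed.

Lemma c_covariant (X dU : 'M[B]_(k, n)) (U V : 'rV[B]_n) (g N gam : 'M[B]_n) :
  X *m g *m (4%:R *: V)^T + dU *m g *m (2%:R *: U)^T
    + X *m (gam + (N^T *m g + g *m N)) *m (2%:R *: U)^T =
  4%:R *: (X *m g *m (V + half *: (U *m N^T))^T)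
    + 2%:R *: ((dU + X *m N^T) *m g *m U^T) + 2%:R *: (X *m gam *m U^T).
Proof.
rewrite !(trmxD, trmxZ, trmx_mul, trmxK, mulmxDl, mulmxDr, scalerDr,
  =^~ scalemxAl, =^~ scalemxAr, mulmxA).
apply/matrixP => i j; rewrite !mxlinE.
have E x : 4%:R * (half * x) = 2%:R * x.
  have -> : 4%:R * (half * x) = 2%:R * ((half + half) * x) by ring.
  by rewrite half2 mul1r.
by rewrite E; ring.
Qed.

Lemma b_covariant (U V : 'rV[B]_n) (g N gam : 'M[B]_n) : g^T = g ->
  4%:R *: U *m (gam + (N^T *m g + g *m N)) *m U^T
    + (8%:R *: V *m g *m U^T + 8%:R *: U *m g *m V^T) =
  16%:R *: (U *m g *m (V + half *: (U *m N^T))^T) + 4%:R *: (U *m gam *m U^T).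
Proof.
move=> gs.
have sym11 (M : 'M[B]_1) : M^T = M by rewrite [M]mx11_scalar tr_scalar_mx.
have E : V *m g *m U^T = U *m g *m V^T by rewrite -[LHS]sym11 trmx_mul3 trmxK gs.
have E2 : U *m N^T *m g *m U^T = U *m g *m N *m U^T.
  by rewrite -[LHS]sym11 !trmx_mul !trmxK gs !mulmxA.
rewrite !(trmxD, trmxZ, trmx_mul, trmxK, mulmxDl, mulmxDr, scalerDr,
  =^~ scalemxAl, =^~ scalemxAr, mulmxA) E E2.
apply/matrixP => i j; rewrite !mxlinE.
have E3 x : 16%:R * (half * x) = 8%:R * x.
  have -> : 16%:R * (half * x) = 8%:R * ((half + half) * x) by ring.
  by rewrite half2 mul1r.
by rewrite E3; ring.
Qed.

End covariant_expansion.

Lemma mul1nr (T : pzRingType) (x : T) : 1%:R * x = x. Proof. exact: mul1r. Qed.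

Section curve_coefficients.
Context {R : realType} {k n : nat} (V0 : odom R k) (e : R) (e0 : 0 < e).
Context (W0 : odom R n) (e' : R) (e0' : 0 < e').
Local Notation A := (smf (obox V0 e0)).
Local Notation B := (smf V0).
Local Notation C := (smf (obox W0 e0')).
Local Notation C0 := (smf W0).
Local Notation half := (scst 2^-1).
Variable E : 'I_n -> A.

(** The map sending [(x, r)] to [(E (x, r), r)], which parametrizes the extension [Y]. *)
Definition emap (i : 'I_(n + 1)) : A :=
  match fintype.split i with inl j => E j | inr _ => sr V0 e0 end.

Lemma emapL j : emap (lshift 1 j) = E j.
Proof. by rewrite /emap (unsplitK (inl j)). Qed.
Lemma emapR : emap ir = sr V0 e0.
Proof. by rewrite /emap (unsplitK (inr ord0)). Qed.

Hypothesis UV : forall y, obox V0 e0 y -> obox W0 e0' (\row_i emap i y).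

Definition ev : C -> A := spull UV.
HB.instance Definition _ := GRing.RMorphism.on ev.

Definition X0 i : B := co 0 (E i).

Lemma X0_in x : V0 x -> W0 (\row_i X0 i x).
Proof.
move=> Vx; have Bx : obox V0 e0 (pt x 0) by apply: box_pt; rewrite // normr0.
have [+ _] := UV Bx; rewrite (_ : base _ = \row_i X0 i x) //.
by apply/rowP => i; rewrite baseE !mxE emapL /X0 co0 sliceE.
Qed.

Definition iot : C0 -> B := spull X0_in.
HB.instance Definition _ := GRing.RMorphism.on iot.

Lemma emap_pt y : obox V0 e0 y ->
  \row_i emap i y = pt (\row_i E i y) (hgt y).
Proof.
move=> By; apply/rowP; apply: ord_add1 => [j|]; first by rewrite pt_lshift !mxE emapL.
by rewrite pt_rshift mxE emapR srE.
Qed.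

Lemma evE f y : obox V0 e0 y -> ev f y = f (pt (\row_i E i y) (hgt y)).
Proof. by move=> By; rewrite /ev spullE // emap_pt. Qed.

Lemma ev0 f : co 0 (ev f) = iot (co 0 f).
Proof.
rewrite !co0; apply: smf_ext => x Vx; have Bx : obox V0 e0 (pt x 0).
  by apply: box_pt; rewrite // normr0.
rewrite sliceE // evE // /iot spullE // sliceE; last exact: X0_in.
rewrite hgt_pt; congr (smf_fun _ (pt _ _)); apply/rowP => i.
by rewrite !mxE /X0 co0 sliceE.
Qed.

Lemma sD_evr f : sD ir (ev f) = \sum_i ev (sD (lshift 1 i) f) * sD ir (E i) + ev (sD ir f).
Proof.
rewrite /ev sD_pull big_split_ord big_ord1 emapR sD_coord eqxx mulr1.
by congr (_ + _); apply: eq_bigr => i _; rewrite emapL.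
Qed.

Lemma sD_iot a f : sD a (iot f) = \sum_i iot (sD i f) * sD a (X0 i).
Proof. exact: sD_pull. Qed.

Hypothesis E1 : forall i, co 1 (E i) = 0.
Hypothesis E3 : forall i, co 3 (E i) = 0.
Local Notation U := (fun i => co 2 (E i)).
Local Notation V := (fun i => co 4 (E i)).

Let Dr0 i : co 0 (sD ir (E i)) = 0. Proof. by rewrite co_Dr E1 mulr0. Qed.
Let Dr1 i : co 1 (sD ir (E i)) = 2%:R * U i. Proof. exact: co_Dr. Qed.
Let Dr2 i : co 2 (sD ir (E i)) = 0. Proof. by rewrite co_Dr E3 mulr0. Qed.
Let Dr3 i : co 3 (sD ir (E i)) = 4%:R * V i. Proof. exact: co_Dr. Qed.

Lemma ev1 f : co 1 (ev f) = iot (co 1 f).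
Proof.
have := co_Dr 0 (ev f); rewrite mul1nr => <-; rewrite sD_evr coD ev0 co_Dr mul1nr.
rewrite raddf_sum big1 ?add0r // => i _; by rewrite /= co0M Dr0 mulr0.
Qed.

Lemma ev2 f : co 2 (ev f) = \sum_i iot (sD i (co 0 f)) * U i + iot (co 2 f).
Proof.
apply: (@smf_natI _ _ _ 1); rewrite -(co_Dr 1 (ev f)) sD_evr coD ev1 co_Dr.
rewrite mulrDr rmorphM rmorph_nat; congr (_ + _).
rewrite raddf_sum mulr_sumr; apply: eq_bigr => i _ /=.
by rewrite co1M Dr0 mulr0 addr0 ev0 co_sD Dr1 mulrCA.
Qed.

Lemma ev3 f : co 1 f = 0 -> co 3 f = 0 -> co 3 (ev f) = 0.
Proof.
move=> f1 f3; apply: (@smf_natI _ _ _ 2); rewrite -(co_Dr 2 (ev f)) sD_evr coD mulr0.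
rewrite raddf_sum big1 ?add0r => [|i _]; last first.
  rewrite /= co2M Dr0 Dr2 !mulr0 add0r addr0 ev1 co_sD f1.
  by rewrite (raddf0 (sD i)) rmorph0 mul0r.
rewrite ev2 !co_Dr f3 f1 !mulr0 rmorph0 addr0 big1 // => i _.
by rewrite (raddf0 (sD i)) rmorph0 mul0r.
Qed.

Lemma ev3r f : co 1 f = 0 -> co 3 f = 0 -> co 3 (ev (sD ir f)) =
  2%:R * (\sum_i iot (sD i (co 2 f)) * U i) + 4%:R * iot (co 4 f).
Proof.
move=> f1 f3; apply: (@smf_natI _ _ _ 2); rewrite -(co_Dr 2 (ev _)) sD_evr coD.
have c1 : co 1 (sD ir f) = 2%:R * co 2 f by rewrite co_Dr.
have -> : co 2 (ev (sD ir (sD ir f))) =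
    2%:R * (\sum_i iot (sD i (co 2 f)) * U i) + 12%:R * iot (co 4 f).
  rewrite ev2 !co_Dr mul1nr -[12%N]/(3 * 4)%N natrM -mulrA.
  rewrite !(rmorphM iot) !(rmorph_nat iot); congr (_ + _).
  rewrite mulr_sumr; apply: eq_bigr => i _.
  by rewrite sDM sD_nat mul0r add0r rmorphM rmorph_nat mulrA.
rewrite raddf_sum (eq_bigr (fun i => 4%:R * (iot (sD i (co 2 f)) * U i))) => [|i _].
  by rewrite -mulr_sumr; move: (\sum_i _) => s; ring.
rewrite /= co2M Dr0 Dr2 !mulr0 add0r addr0 ev1 co_sD c1 Dr1.
by rewrite sDM sD_nat mul0r add0r rmorphM rmorph_nat; ring.
Qed.

(** Composition of even expansions at order four: [V] enters through the gradient of the leading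
    term, [U] through its Hessian and through the gradient of the second coefficient. The recursion
    on the [r]-derivative avoids a general formula for higher chain rules. *)
Lemma ev4 f : co 1 f = 0 -> co 3 f = 0 -> co 4 (ev f) =
  iot (co 4 f) + \sum_i iot (sD i (co 2 f)) * U i + \sum_i iot (sD i (co 0 f)) * V i
  + half * \sum_i \sum_j iot (sD j (sD i (co 0 f))) * U j * U i.
Proof.
move=> f1 f3; apply: (@smf_natI _ _ _ 3); rewrite -(co_Dr 3 (ev f)) sD_evr coD ev3r //.
have -> : co 3 (\sum_i ev (sD (lshift 1 i) f) * sD ir (E i)) =
    4%:R * (\sum_i iot (sD i (co 0 f)) * V i)
    + 2%:R * (\sum_i iot (sD i (co 2 f)) * U i)
    + 2%:R * (\sum_i \sum_j iot (sD j (sD i (co 0 f))) * U j * U i).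
  rewrite raddf_sum !mulr_sumr -!big_split; apply: eq_bigr => i _ /=.
  rewrite co3M Dr0 Dr2 !mulr0 addr0 Dr3 Dr1 ev0 ev2 !co_sD -mulr_suml.
  by move: (\sum_j _) => s; ring.
have h4 (x : B) : 4%:R * (half * x) = 2%:R * x.
  have -> : 4%:R * (half * x) = 2%:R * ((half + half) * x) by ring.
  by rewrite half2 mul1r.
rewrite 3!mulrDr h4; move: (\sum_i _) (\sum_i _) (\sum_i \sum_j _) => s1 s2 s3; ring.
Qed.

End curve_coefficients.

Section parity_products.
Context {R : realType} {d : nat} {V0 : odom R d} {e : R} {e0 : 0 < e}.
Local Notation A := (smf (obox V0 e0)).

Definition evenmx {m n} (M : 'M[A]_(m, n)) := cmx 1 M = 0 /\ cmx 3 M = 0.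
Definition oddmx {m n} (M : 'M[A]_(m, n)) := cmx 0 M = 0 /\ cmx 2 M = 0.

Section products.
Context {m n p : nat} (M : 'M[A]_(m, n)) (N : 'M[A]_(n, p)).

Lemma evenM : evenmx M -> evenmx N -> evenmx (M *m N).
Proof.
move=> [M1 M3] [N1 N3]; split; first by rewrite cmx1M M1 N1 mulmx0 mul0mx addr0.
by rewrite cmx3M M1 M3 N1 N3 !mulmx0 !mul0mx !addr0.
Qed.

Lemma even2M : evenmx M -> evenmx N ->
  cmx 2 (M *m N) = cmx 0 M *m cmx 2 N + cmx 2 M *m cmx 0 N.
Proof. by move=> [M1 _] _; exact: cmx2M_e. Qed.

Lemma even4M : evenmx M -> evenmx N ->
  cmx 4 (M *m N) = cmx 0 M *m cmx 4 N + (cmx 2 M *m cmx 2 N + cmx 4 M *m cmx 0 N).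
Proof.
move=> [M1 M3] [N1 N3]; rewrite cmx4M M1 M3; move: (cmx 3 N) (cmx 1 N) => Y Z.
by rewrite !mul0mx !add0r.
Qed.

Lemma evenoddM : evenmx M -> oddmx N -> oddmx (M *m N).
Proof.
move=> [M1 M3] [N0 N2]; split; first by rewrite cmx0M N0 mulmx0.
by rewrite cmx2M M1 N0 N2 !mulmx0 mul0mx !addr0.
Qed.

Lemma evenodd1M : oddmx N -> cmx 1 (M *m N) = cmx 0 M *m cmx 1 N.
Proof. by move=> [N0 _]; rewrite cmx1M N0 mulmx0 addr0. Qed.

Lemma evenodd3M : evenmx M -> oddmx N ->
  cmx 3 (M *m N) = cmx 0 M *m cmx 3 N + cmx 2 M *m cmx 1 N.
Proof.
move=> [M1 M3] [N0 N2]; rewrite cmx3M M1 M3; move: (cmx 0 N) (cmx 2 N) => Y Z.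
by rewrite !mul0mx add0r addr0.
Qed.

Lemma oddevenM : oddmx M -> evenmx N -> oddmx (M *m N).
Proof.
move=> [M0 M2] [N1 N3]; split; first by rewrite cmx0M M0 mul0mx.
by rewrite cmx2M M0 M2 N1 !mulmx0 !mul0mx !addr0.
Qed.

Lemma oddeven1M : oddmx M -> cmx 1 (M *m N) = cmx 1 M *m cmx 0 N.
Proof. by move=> [M0 _]; rewrite cmx1M M0 mul0mx add0r. Qed.

Lemma oddeven3M : oddmx M -> evenmx N ->
  cmx 3 (M *m N) = cmx 1 M *m cmx 2 N + cmx 3 M *m cmx 0 N.
Proof.
move=> [M0 M2] [N1 N3]; rewrite cmx3M M0 M2; move: (cmx 1 N) (cmx 3 N) => Y Z.
by rewrite !mul0mx !add0r.
Qed.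

Lemma oddoddM : oddmx M -> oddmx N ->
  [/\ cmx 0 (M *m N) = 0, evenmx (M *m N), cmx 2 (M *m N) = cmx 1 M *m cmx 1 N &
      cmx 4 (M *m N) = cmx 1 M *m cmx 3 N + cmx 3 M *m cmx 1 N].
Proof.
move=> [M0 M2] [N0 N2]; split.
- by rewrite cmx0M M0 mul0mx.
- split; first by rewrite cmx1M M0 N0 mulmx0 mul0mx addr0.
  by rewrite cmx3M M0 M2 N0 N2 !mulmx0 !mul0mx !addr0.
- by rewrite (cmx2M_oo M0 N0).
rewrite cmx4M M0 M2 N0 N2; move: (cmx 4 N) (cmx 4 M) => Y Z.
by rewrite !mul0mx !mulmx0 addr0 !add0r.
Qed.
End products.

Lemma evenT m n (M : 'M[A]_(m, n)) : evenmx M -> evenmx M^T.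
Proof. by move=> [M1 M3]; split; rewrite cmxT ?M1 ?M3 trmx0. Qed.
Lemma oddT m n (M : 'M[A]_(m, n)) : oddmx M -> oddmx M^T.
Proof. by move=> [M0 M2]; split; rewrite cmxT ?M0 ?M2 trmx0. Qed.

End parity_products.

(** * Covariant derivatives along the submanifold *)

Section extrinsic_geometry.
Context {R : realType} {k n : nat} (V0 : odom R k) (e : R) (e0 : 0 < e).
Context (W0 : odom R n) (e' : R) (e0' : 0 < e').
Local Notation A := (smf (obox V0 e0)).
Local Notation B := (smf V0).
Local Notation C := (smf (obox W0 e0')).
Local Notation C0 := (smf W0).
Local Notation half := (scst 2^-1).
Variable E : 'I_n -> A.
Hypothesis UV : forall y, obox V0 e0 y -> obox W0 e0' (\row_i emap E i y).
Hypothesis E1 : forall i, co 1 (E i) = 0.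
Hypothesis E3 : forall i, co 3 (E i) = 0.
Variables (g gi : 'M[C]_n).
Hypothesis gsym : g^T = g.
Hypothesis ggi : g *m gi = 1%:M.
Hypothesis g1 : cmx 1 g = 0.
Hypothesis g3 : cmx 3 g = 0.
Local Notation D0 := (@sDa R _ W0).
Local Notation d_ := (@sDa R _ V0).
Local Notation g0 := (cmx 0 g).
Local Notation gi0 := (cmx 0 gi).
Local Notation G0 := (Gam D0 half g0 gi0).
Local Notation io := (iot UV).

Definition gh : 'M[B]_n := map_mx io g0.
Definition ghi : 'M[B]_n := map_mx io gi0.
Definition gamh : 'M[B]_n := map_mx io (cmx 2 g).
Definition delh : 'M[B]_n := map_mx io (cmx 4 g).
Definition Xr : 'rV[B]_n := \row_i co 0 (E i).
Definition Ur : 'rV[B]_n := \row_i co 2 (E i).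
Definition Vr : 'rV[B]_n := \row_i co 4 (E i).
Definition dmat (Z : 'rV[B]_n) : 'M[B]_(k, n) := \matrix_(a, i) sD a (Z 0 i).
Definition Xm : 'M[B]_(k, n) := dmat Xr.
Definition Gh i : 'M[B]_n := map_mx io (G0 i).
Definition DGh i j : 'M[B]_n := map_mx io (map_mx (D0 i) (G0 j)).
(** The endomorphism [Gamma(Z)] along the submanifold; [DGG Y Z] is its analogue for the Christoffel
    symbols differentiated in the direction [Y]. *)
Definition GG (Z : 'rV[B]_n) : 'M[B]_n := \sum_i Z 0 i *: Gh i.
Definition DGG (Y Z : 'rV[B]_n) : 'M[B]_n := \sum_i \sum_j (Y 0 i * Z 0 j) *: DGh i j.
(** Row [a] is the ambient covariant derivative of the field [Z] in the direction of the [a]-th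
    coordinate of the submanifold. *)
Definition cd (Z : 'rV[B]_n) : 'M[B]_(k, n) := dmat Z + Xm *m (GG Z)^T.

Lemma gh_sym : gh^T = gh.
Proof. by rewrite /gh map_trmx g0_sym. Qed.
Lemma gh_inv : gh *m ghi = 1%:M.
Proof. by rewrite /gh /ghi -map_mxM (cmx0_inv ggi) map_mx1. Qed.
Lemma gamh_sym : gamh^T = gamh.
Proof. by rewrite /gamh map_trmx gam_sym. Qed.

Lemma row_dmat a Z : row a (dmat Z) = map_mx (d_ a) Z.
Proof. by apply/rowP => i; rewrite !mxE. Qed.

Lemma sumZ_E m p (I : finType) (c : I -> B) (M : I -> 'M[B]_(m, p)) i j :
  (\sum_l c l *: M l) i j = \sum_l c l * M l i j.
Proof. by rewrite summxE; apply: eq_bigr => l _; rewrite mxE. Qed.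

Lemma GG_E Z i j : GG Z i j = \sum_l Z 0 l * Gh l i j.
Proof. exact: sumZ_E. Qed.

Lemma GhC i a b : Gh i a b = Gh b a i.
Proof. by rewrite !mxE (GamC D0 half gi0 (g0_sym gsym)). Qed.

Lemma GG_sym (Y Z : 'rV[B]_n) : GG Y *m Z^T = GG Z *m Y^T.
Proof.
apply/matrixP => a z; rewrite !mxE.
under eq_bigr do rewrite GG_E mulr_suml; under [RHS]eq_bigr do rewrite GG_E mulr_suml.
rewrite exchange_big; apply: eq_bigr => i _; apply: eq_bigr => j _ /=.
by rewrite (GhC i a j) [Z^T _ _]mxE [Y^T _ _]mxE !ord1; ring.
Qed.

Lemma GG_symT (Y Z : 'rV[B]_n) : Z *m (GG Y)^T = Y *m (GG Z)^T.
Proof. by apply: trmx_inj; rewrite !trmx_mul !trmxK GG_sym. Qed.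

Lemma DGG_E Y Z a b : DGG Y Z a b = \sum_i \sum_j Y 0 i * Z 0 j * DGh i j a b.
Proof. by rewrite summxE; apply: eq_bigr => i _; rewrite sumZ_E. Qed.

Lemma DGhC i j a b : DGh i j a b = DGh i b a j.
Proof. by rewrite !mxE (GamC D0 half gi0 (g0_sym gsym) j). Qed.

Lemma DGG_sym (Y Z T : 'rV[B]_n) : DGG Y Z *m T^T = DGG Y T *m Z^T.
Proof.
apply/matrixP => a z; rewrite !mxE.
under eq_bigr do rewrite DGG_E mulr_suml; under [RHS]eq_bigr do rewrite DGG_E mulr_suml.
rewrite exchange_big [RHS]exchange_big; apply: eq_bigr => i _ /=.
under eq_bigr do rewrite mulr_suml; under [RHS]eq_bigr do rewrite mulr_suml.
rewrite exchange_big; apply: eq_bigr => p _; apply: eq_bigr => j _ /=.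
by rewrite (DGhC i p a j) [T^T _ _]mxE [Z^T _ _]mxE !ord1; ring.
Qed.

Lemma GGD Y Z : GG (Y + Z) = GG Y + GG Z.
Proof.
by rewrite /GG -big_split; apply: eq_bigr => i _; rewrite mxE scalerDl.
Qed.
Lemma GGZ c Z : GG (c *: Z) = c *: GG Z.
Proof. by rewrite /GG scaler_sumr; apply: eq_bigr => i _; rewrite mxE scalerA. Qed.

Lemma Dg_GG (Z : 'rV[B]_n) : \sum_i Z 0 i *: map_mx io (map_mx (D0 i) g0) =
  (GG Z)^T *m gh + gh *m GG Z.
Proof.
have Dg i : map_mx io (map_mx (D0 i) g0) = (Gh i)^T *m gh + gh *m Gh i.
  rewrite (D_metric D0 (half2 W0) (g0_sym gsym) (cmx0_inv ggi)) map_mxD !map_mxM.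
  by rewrite -map_trmx.
under eq_bigr do rewrite Dg scalerDr.
rewrite big_split /= /GG raddf_sum mulmx_suml mulmx_sumr; congr (_ + _).
  by apply: eq_bigr => i _; rewrite /= trmxZ scalemxAl.
by apply: eq_bigr => i _; rewrite scalemxAr.
Qed.

Lemma DDg_GG (Z : 'rV[B]_n) :
  \sum_i \sum_j (Z 0 j * Z 0 i) *: map_mx io (map_mx (D0 j) (map_mx (D0 i) g0)) =
  let N := GG Z in let K := DGG Z Z in
  K^T *m gh + gh *m K + N^T *m N^T *m gh + N^T *m gh *m N + N^T *m gh *m N + gh *m N *m N.
Proof.
have DDg j i : map_mx io (map_mx (D0 j) (map_mx (D0 i) g0)) =
   (DGh j i)^T *m gh + gh *m DGh j i + (Gh i)^T *m ((Gh j)^T *m gh) + (Gh i)^T *m (gh *m Gh j)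
   + (Gh j)^T *m (gh *m Gh i) + gh *m Gh j *m Gh i.
  rewrite (D_metric D0 (half2 W0) (g0_sym gsym) (cmx0_inv ggi) i) dmxD.
  rewrite !(dmxM (@sDaM _ _ W0 j)) (D_metric D0 (half2 W0) (g0_sym gsym) (cmx0_inv ggi) j) dmxT.
  rewrite !(map_mxD, map_mxM) -!map_trmx -/(gh) -/(Gh i) -/(Gh j) -/(DGh j i).
  rewrite !(mulmxDl, mulmxDr) !mulmxA.
  move: ((DGh j i)^T *m gh) (gh *m DGh j i) ((Gh i)^T *m (Gh j)^T *m gh) => *.
  move: ((Gh i)^T *m gh *m Gh j) ((Gh j)^T *m gh *m Gh i) (gh *m Gh j *m Gh i) => *.
  mxring.
cbv zeta; set N := GG Z; set K := DGG Z Z.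
have sumL p (F : 'I_n -> 'I_n -> B) (H : 'I_n -> 'I_n -> 'M[B]_n) (T : 'M[B]_(n, p)) :
   (\sum_i \sum_j F i j *: H i j) *m T = \sum_i \sum_j F i j *: (H i j *m T).
  rewrite mulmx_suml; apply: eq_bigr => i _; rewrite mulmx_suml.
  by apply: eq_bigr => j _; rewrite -scalemxAl.
have sumR p (F : 'I_n -> 'I_n -> B) (H : 'I_n -> 'I_n -> 'M[B]_n) (T : 'M[B]_(p, n)) :
   T *m (\sum_i \sum_j F i j *: H i j) = \sum_i \sum_j F i j *: (T *m H i j).
  rewrite mulmx_sumr; apply: eq_bigr => i _; rewrite mulmx_sumr.
  by apply: eq_bigr => j _; rewrite -scalemxAr.
have NTN (T : 'M[B]_n) : N^T *m T = \sum_i Z 0 i *: ((Gh i)^T *m T).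
  by rewrite /N /GG raddf_sum mulmx_suml; apply: eq_bigr => i _; rewrite /= trmxZ scalemxAl.
have TN (T : 'M[B]_n) : T *m N = \sum_i Z 0 i *: (T *m Gh i).
  by rewrite /N /GG mulmx_sumr; apply: eq_bigr => i _; rewrite scalemxAr.
have KE : K = \sum_i \sum_j (Z 0 j * Z 0 i) *: DGh j i.
  by rewrite /K /DGG exchange_big.
have KT : K^T = \sum_i \sum_j (Z 0 j * Z 0 i) *: (DGh j i)^T.
  rewrite KE raddf_sum; apply: eq_bigr => i _; rewrite /= raddf_sum.
  by apply: eq_bigr => j _; rewrite /= trmxZ.
have dbl (F : 'I_n -> 'I_n -> 'M[B]_n) :
  \sum_i Z 0 i *: (\sum_j Z 0 j *: F i j) = \sum_i \sum_j (Z 0 j * Z 0 i) *: F i j.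
  apply: eq_bigr => i _; rewrite scaler_sumr; apply: eq_bigr => j _.
  by rewrite scalerA mulrC.
have -> : N^T *m N^T *m gh = \sum_i \sum_j (Z 0 j * Z 0 i) *: ((Gh i)^T *m ((Gh j)^T *m gh)).
  rewrite -mulmxA NTN -dbl; apply: eq_bigr => i _; rewrite NTN mulmx_sumr; congr (_ *: _).
  by apply: eq_bigr => j _; rewrite -scalemxAr.
have E3' : N^T *m gh *m N = \sum_i \sum_j (Z 0 j * Z 0 i) *: ((Gh i)^T *m (gh *m Gh j)).
  rewrite -mulmxA NTN -dbl; apply: eq_bigr => i _; rewrite TN mulmx_sumr; congr (_ *: _).
  by apply: eq_bigr => j _; rewrite -scalemxAr.
have E4' : N^T *m gh *m N = \sum_i \sum_j (Z 0 j * Z 0 i) *: ((Gh j)^T *m (gh *m Gh i)).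
  by rewrite E3' [LHS]exchange_big; apply: eq_bigr => i _; apply: eq_bigr => j _; rewrite mulrC.
have -> : gh *m N *m N = \sum_i \sum_j (Z 0 j * Z 0 i) *: (gh *m Gh j *m Gh i).
  rewrite TN -dbl; apply: eq_bigr => i _; rewrite TN mulmx_suml; congr (_ *: _).
  by apply: eq_bigr => j _; rewrite -scalemxAl.
rewrite {1}E3' E4' KT KE sumL sumR -!big_split; apply: eq_bigr => i _ /=.
rewrite -!big_split; apply: eq_bigr => j _ /=.
by rewrite DDg !scalerDr.
Qed.

Local Notation evg := (map_mx (ev UV) g).
Local Notation N := (GG Ur).

Let co_g i j m : co m (g i j) = cmx m g i j. Proof. by rewrite cmxE. Qed.

Lemma evg_even : evenmx evg.
Proof.
have z1 i j : co 1 (g i j) = 0 by rewrite co_g g1 mx0_E.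
have z3 i j : co 3 (g i j) = 0 by rewrite co_g g3 mx0_E.
split; apply/matrixP => i j; rewrite cmxE mx0_E mxE; last exact: ev3.
by rewrite ev1 // z1 rmorph0.
Qed.

Lemma evg0 : cmx 0 evg = gh.
Proof. by apply/matrixP => i j; rewrite cmxE !mxE ev0 co_g. Qed.

Lemma evg2 : cmx 2 evg = gamh + (N^T *m gh + gh *m N).
Proof.
apply/matrixP => i j; rewrite cmxE mxE ev2 // addrC mxD_E -Dg_GG sumZ_E co_g.
rewrite [gamh _ _]mxE; congr (_ + _); apply: eq_bigr => l _.
by rewrite !mxE mulrC co_g.
Qed.

Definition gamU : 'M[B]_n := \sum_i Ur 0 i *: map_mx io (map_mx (D0 i) (cmx 2 g)).

Lemma evg4 : cmx 4 evg = delh + gamU + ((GG Vr)^T *m gh + gh *m GG Vr)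
  + half *: (let K := DGG Ur Ur in K^T *m gh + gh *m K + N^T *m N^T *m gh
     + N^T *m gh *m N + N^T *m gh *m N + gh *m N *m N).
Proof.
have z1 i j : co 1 (g i j) = 0 by rewrite co_g g1 mx0_E.
have z3 i j : co 3 (g i j) = 0 by rewrite co_g g3 mx0_E.
rewrite -DDg_GG -Dg_GG; apply/matrixP => i j; rewrite cmxE mxE ev4 //.
rewrite !mxlinE !sumZ_E co_g [delh _ _]mxE; congr (_ + _ + _ + half * _).
- by apply: eq_bigr => l _; rewrite !mxE mulrC co_g.
- by apply: eq_bigr => l _; rewrite !mxE mulrC co_g.
rewrite summxE; apply: eq_bigr => l _; rewrite sumZ_E; apply: eq_bigr => m _.
by rewrite !mxE co_g /=; ring.
Qed.

Definition Ea : 'M[A]_(k, n) := \matrix_(a, i) sD (lshift 1 a) (E i).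
Definition Er : 'rV[A]_n := \row_i sD ir (E i).

Lemma cmx_Ea j : cmx j Ea = dmat (\row_i co j (E i)).
Proof. by apply/matrixP => a i; rewrite cmxE !mxE co_sD. Qed.
Lemma Ea_even : evenmx Ea.
Proof.
by split; rewrite cmx_Ea; apply/matrixP => a i; rewrite !mxE ?E1 ?E3; exact: (raddf0 (sD a)).
Qed.
Lemma cmx_Er j : cmx j Er = j.+1%:R *: \row_i co j.+1 (E i).
Proof. by apply/rowP => i; rewrite cmxE !mxE co_Dr. Qed.

Lemma Er_odd : oddmx Er.
Proof. by split; rewrite cmx_Er; apply/rowP => i; rewrite !mxE ?E1 ?E3 mulr0. Qed.

Hypothesis UX : Xm *m gh *m Ur^T = 0.

(** The blocks of [r^2 h_+]: [Hh] along the submanifold, [Hc] mixed, and [1 + Ha] in the radial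
    direction. *)
Definition Hh : 'M[A]_k := Ea *m evg *m Ea^T.
Definition Hc : 'M[A]_(k, 1) := Ea *m evg *m Er^T.
Definition Ha : 'M[A]_1 := Er *m evg *m Er^T.
(* V + Gamma(U, U) / 2, which unlike V is a vector field along the submanifold *)
Definition Ar : 'rV[B]_n := Vr + half *: (Ur *m N^T).
Local Notation DU := (cd Ur).

Let Ea0 : cmx 0 Ea = Xm. Proof. exact: cmx_Ea. Qed.
Let Ea2 : cmx 2 Ea = dmat Ur. Proof. exact: cmx_Ea. Qed.
Let Ea4 : cmx 4 Ea = dmat Vr. Proof. exact: cmx_Ea. Qed.
Let Er1 : cmx 1 Er = 2%:R *: Ur. Proof. exact: cmx_Er. Qed.
Let Er3 : cmx 3 Er = 4%:R *: Vr. Proof. exact: cmx_Er. Qed.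
Let EgE : evenmx (Ea *m evg). Proof. exact: evenM Ea_even evg_even. Qed.
Let Eg2 : cmx 2 (Ea *m evg) = Xm *m cmx 2 evg + dmat Ur *m gh.
Proof. by rewrite (even2M Ea_even evg_even) Ea0 Ea2 evg0. Qed.
Let Eg0 : cmx 0 (Ea *m evg) = Xm *m gh.
Proof. by rewrite cmx0M Ea0 evg0. Qed.

Lemma Hh_even : evenmx Hh.
Proof. exact: evenM EgE (evenT Ea_even). Qed.
Lemma Hh0 : cmx 0 Hh = Xm *m gh *m Xm^T.
Proof. by rewrite cmx0M Eg0 cmxT Ea0. Qed.
Lemma Hh2 : cmx 2 Hh = Xm *m gamh *m Xm^T + (DU *m gh *m Xm^T + Xm *m gh *m DU^T).
Proof.
rewrite (even2M EgE (evenT Ea_even)) Eg0 Eg2 !cmxT Ea0 Ea2 evg2 -p_covariant.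
move: (gamh + _) => G2; rewrite mulmxDl.
by move: (_ *m _ *m _) (_ *m _ *m _) (_ *m _ *m _) => *; mxring.
Qed.

Lemma Hc_odd : oddmx Hc.
Proof. exact: evenoddM EgE (oddT Er_odd). Qed.
Lemma Hc1 : cmx 1 Hc = 0.
Proof.
by rewrite (evenodd1M _ (oddT Er_odd)) Eg0 cmxT Er1 trmxZ -scalemxAr UX scaler0.
Qed.
Lemma Hc3 : cmx 3 Hc =
  4%:R *: (Xm *m gh *m Ar^T) + 2%:R *: (DU *m gh *m Ur^T) + 2%:R *: (Xm *m gamh *m Ur^T).
Proof.
rewrite (evenodd3M EgE (oddT Er_odd)) Eg0 Eg2 !cmxT Er1 Er3 evg2.
rewrite -(c_covariant (half2 V0)).
move: (gamh + _) => G2; rewrite mulmxDl.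
by move: (_ *m _ *m _) (_ *m _ *m _) (_ *m _ *m _) => *; mxring.
Qed.

Let ErO : oddmx (Er *m evg). Proof. exact: oddevenM Er_odd evg_even. Qed.
Lemma Ha_even : evenmx Ha.
Proof. by have [] := oddoddM ErO (oddT Er_odd). Qed.
Lemma Ha0 : cmx 0 Ha = 0.
Proof. by have [] := oddoddM ErO (oddT Er_odd). Qed.
Lemma Ha2 : cmx 2 Ha = 4%:R *: (Ur *m gh *m Ur^T).
Proof.
have [_ _ -> _] := oddoddM ErO (oddT Er_odd).
rewrite (oddeven1M _ Er_odd) cmxT Er1 evg0 trmxZ -!scalemxAl -scalemxAr scalerA.
by rewrite -natrM.
Qed.
Lemma Ha4 : cmx 4 Ha = 16%:R *: (Ur *m gh *m Ar^T) + 4%:R *: (Ur *m gamh *m Ur^T).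
Proof.
have [_ _ _ ->] := oddoddM ErO (oddT Er_odd).
rewrite (oddeven1M _ Er_odd) (oddeven3M Er_odd evg_even) !cmxT Er1 Er3 evg0 evg2.
rewrite -(b_covariant (half2 V0) Ur Vr N gamh gh_sym).
move: (gamh + _) => G2; rewrite mulmxDl !trmxZ -!scalemxAl -!scalemxAr.
move: (Ur *m gh *m Vr^T) (Ur *m G2 *m Ur^T) (Vr *m gh *m Ur^T) => P Q T.
by rewrite !scalerA -!natrM; mxring.
Qed.

Definition Rh (Y Z : 'rV[B]_n) : 'M[B]_n :=
  \sum_i \sum_j (Y 0 i * Z 0 j) *: map_mx io (Rm D0 G0 i j).

Lemma Rh_E Y Z : Rh Y Z = DGG Y Z - DGG Z Y + (GG Y *m GG Z - GG Z *m GG Y).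
Proof.
have E2' (P Q : 'rV[B]_n) : GG P *m GG Q = \sum_i \sum_j (P 0 i * Q 0 j) *: (Gh i *m Gh j).
  rewrite /GG mulmx_suml; apply: eq_bigr => i _; rewrite mulmx_sumr.
  by apply: eq_bigr => j _; rewrite -scalemxAl -scalemxAr scalerA.
have Ex (H : 'I_n -> 'I_n -> 'M[B]_n) : \sum_i \sum_j (Z 0 i * Y 0 j) *: H i j =
    \sum_i \sum_j (Y 0 i * Z 0 j) *: H j i.
  by rewrite exchange_big; apply: eq_bigr => i _; apply: eq_bigr => j _; rewrite mulrC.
rewrite !E2' /DGG !Ex -!sumrN -!big_split; apply: eq_bigr => i _ /=.
rewrite -!sumrN -!big_split; apply: eq_bigr => j _ /=.
by rewrite /Rm map_mxD !map_mxB !map_mxM -!scalerBr -scalerDr.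
Qed.

Definition Mm : 'M[B]_(k, n) := \matrix_b (Ur *m (DGG (row b Xm) Ur)^T).
(** Row [b] is [R(U, x_b) U], with [x_b] the coordinate frame. *)
Definition RU : 'M[B]_(k, n) := \matrix_b (Ur *m (Rh Ur (row b Xm))^T).

(** Exchanges the derivative of [Gamma] along the frame, which [d (Gamma(U, U))] contains, for the
    derivative along [U], which the expansion of [g] contains. The commutator is curvature. *)
Lemma Mm_RU : Mm = Xm *m (DGG Ur Ur)^T + Xm *m N^T *m N^T - Xm *m (GG (Ur *m N^T))^T - RU.
Proof.
apply/row_matrixP => b; rewrite 2!linearB linearD /= !row_mul 2!rowK Rh_E.
set x := row b Xm; apply: trmx_inj; rewrite !(trmxD, trmxN, trmx_mul, trmxK).
have -> : GG (Ur *m N^T) *m x^T = GG x *m (N *m Ur^T).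
  by rewrite GG_sym trmx_mul trmxK.
rewrite !(mulmxDl, mulNmx) -(mulmxA N) (GG_sym x Ur) (DGG_sym Ur x Ur).
by rewrite -(mulmxA (GG x)); move: (_ *m _) (_ *m _) (_ *m _) (_ *m _) => *; mxring.
Qed.

Lemma d_io b (T : 'M[C0]_n) : map_mx (d_ b) (map_mx io T) =
  \sum_i (row b Xm) 0 i *: map_mx io (map_mx (D0 i) T).
Proof.
apply/matrixP => p q; rewrite sumZ_E !mxE /= sD_iot; apply: eq_bigr => i _.
by rewrite !mxE mulrC.
Qed.

Lemma d_GG b (Z : 'rV[B]_n) :
  map_mx (d_ b) (GG Z) = GG (row b (dmat Z)) + DGG (row b Xm) Z.
Proof.
rewrite /DGG exchange_big /GG -big_split raddf_sum; apply: eq_bigr => i _ /=.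
rewrite (dmxZ (@sDaM _ _ V0 b)) /= row_dmat [map_mx _ Z 0 i]mxE; congr (_ + _).
rewrite /Gh d_io scaler_sumr; apply: eq_bigr => j _.
by rewrite scalerA mulrC.
Qed.

Lemma dmatD Y Z : dmat (Y + Z) = dmat Y + dmat Z.
Proof. by apply/matrixP => a i; rewrite !mxE raddfD. Qed.
Lemma dmat_half Z : dmat (half *: Z) = half *: dmat Z.
Proof. by apply/matrixP => a i; rewrite !mxE sDM sD_cst mul0r add0r. Qed.

Lemma dmat_UN : dmat (Ur *m N^T) = dmat Ur *m N^T + dmat Ur *m N^T + Mm.
Proof.
apply/row_matrixP => b; rewrite !linearD /= !row_mul !rowK (row_dmat b (Ur *m _)).
rewrite (dmxM (@sDaM _ _ V0 b)) dmxT d_GG -!row_dmat trmxD mulmxDr addrA.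
by rewrite (GG_symT _ (row b _)).
Qed.

Lemma Hh4 : cmx 4 Hh = Xm *m delh *m Xm^T + Xm *m (gamU - N^T *m gamh - gamh *m N) *m Xm^T
    + (DU *m gamh *m Xm^T + Xm *m gamh *m DU^T) + DU *m gh *m DU^T
    + (cd Ar *m gh *m Xm^T + Xm *m gh *m (cd Ar)^T)
    + half *: (RU *m gh *m Xm^T + Xm *m gh *m RU^T).
Proof.
rewrite -(q_covariant (half2 V0) (dmat Ur) (dmat Ar) gh gamh gamU delh (GG Ar) Mm_RU).
have -> : dmat Ar - half *: (dmat Ur *m N^T + dmat Ur *m N^T + Mm) = dmat Vr.
  by rewrite -dmat_UN -dmat_half /Ar dmatD addrK.
rewrite (even4M EgE (evenT Ea_even)) Eg0 Eg2 !cmxT (even4M Ea_even evg_even).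
rewrite Ea0 Ea2 Ea4 evg0 -evg2; set g4 := (_ + half *: (_ + _)).
have -> : g4 = cmx 4 evg.
  rewrite evg4 /g4; cbv zeta; congr (_ + _).
  have -> : GG Vr = GG Ar - half *: GG (Ur *m N^T) by rewrite /Ar GGD GGZ addrK.
  rewrite trmxD trmxN trmxZ mulmxDl mulmxDr mulNmx mulmxN -scalemxAl -scalemxAr.
  move: (delh + gamU) ((GG _)^T *m gh) (gh *m GG _) ((GG _)^T *m gh) (gh *m GG _) => *.
  mxring.
rewrite !mulmxDl; move: (_ *m (dmat Ur)^T) (_ *m (dmat Vr)^T) => *.
move: (Xm *m cmx 4 _ *m _) (dmat Ur *m cmx 2 _ *m _) (dmat Ur *m gh *m _) (dmat Vr *m gh *m _) => *.
mxring.
Qed.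

Definition NB (Z : 'rV[B]_n) : 'M[B]_n :=
  \sum_i Z 0 i *: map_mx io (nab D0 half g0 gi0 i (cmx 2 g)).

Lemma NB_E (Z : 'rV[B]_n) : NB Z = \sum_i Z 0 i *: map_mx io (map_mx (D0 i) (cmx 2 g))
  - ((GG Z)^T *m gamh + gamh *m GG Z).
Proof.
rewrite /GG raddf_sum mulmx_suml mulmx_sumr -big_split -sumrB; apply: eq_bigr => i _ /=.
rewrite /nab map_mxB map_mxD !map_mxM -map_trmx scalerBr scalerDr trmxZ -scalemxAl.
by rewrite -scalemxAr.
Qed.

Lemma row_cd b Z : row b (cd Z) = map_mx (d_ b) Z + Z *m (GG (row b Xm))^T.
Proof. by rewrite linearD /= row_dmat row_mul GG_symT. Qed.

Lemma cd_XC a b : row b (cd (row a Xm)) = row a (cd (row b Xm)).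
Proof.
rewrite !row_cd GG_symT; congr (_ + _).
by apply/rowP => i; rewrite !mxE /= sDC.
Qed.

Definition covT b (T : 'M[B]_n) : 'M[B]_n :=
  map_mx (d_ b) T - ((GG (row b Xm))^T *m T + T *m GG (row b Xm)).

Lemma covT_gh b : covT b gh = 0.
Proof. by rewrite /covT /gh d_io Dg_GG subrr. Qed.
Lemma covT_gam b : covT b gamh = NB (row b Xm).
Proof. by rewrite /covT NB_E /gamh d_io. Qed.

Lemma d_pair b (Y Z : 'rV[B]_n) (T : 'M[B]_n) : map_mx (d_ b) (Y *m T *m Z^T) =
  row b (cd Y) *m T *m Z^T + Y *m covT b T *m Z^T + Y *m T *m (row b (cd Z))^T.
Proof.
rewrite !(dmxM (@sDaM _ _ V0 b)) dmxT !row_cd /covT.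
rewrite !(trmxD, trmx_mul, trmxK, mulmxDl, mulmxDr, mulmxN, mulNmx, mulmxA).
move: (map_mx _ Y *m T *m Z^T) (Y *m map_mx (d_ b) T *m Z^T) (Y *m T *m (map_mx _ Z)^T) => *.
by move: (Y *m (GG _)^T *m T *m Z^T) (Y *m T *m GG _ *m Z^T) => *; mxring.
Qed.

End extrinsic_geometry.

(** * Moving frames *)

Section bilinear_forms.
Context {B : comNzRingType} {n : nat}.
Implicit Types (T : 'M[B]_n) (Y Z : 'rV[B]_n).

Definition bil T Y Z : B := (Y *m T *m Z^T) 0 0.

Lemma bilDl T Y Y' Z : bil T (Y + Y') Z = bil T Y Z + bil T Y' Z.
Proof. by rewrite /bil !mulmxDl mxE. Qed.
Lemma bilNl T Y Z : bil T (- Y) Z = - bil T Y Z.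
Proof. by rewrite /bil !mulNmx mxE. Qed.
Lemma bilBl T Y Y' Z : bil T (Y - Y') Z = bil T Y Z - bil T Y' Z.
Proof. by rewrite bilDl bilNl. Qed.
Lemma bilZl T c Y Z : bil T (c *: Y) Z = c * bil T Y Z.
Proof. by rewrite /bil -!scalemxAl mxE. Qed.
Lemma bil_suml T (I : finType) (F : I -> 'rV[B]_n) Z :
  bil T (\sum_i F i) Z = \sum_i bil T (F i) Z.
Proof. by rewrite /bil !mulmx_suml summxE. Qed.
Lemma bilC T Y Z : T^T = T -> bil T Y Z = bil T Z Y.
Proof.
move=> Ts; have -> : bil T Y Z = (Y *m T *m Z^T)^T 0 0 by rewrite mxE.
by rewrite trmx_mul3 trmxK Ts.
Qed.
Lemma bilNT T Y Z : bil (- T) Y Z = - bil T Y Z.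
Proof. by rewrite /bil mulmxN mulNmx mxE. Qed.

Lemma mx_bil m p (Y : 'M[B]_(m, n)) T (Z : 'M[B]_(p, n)) a b :
  (Y *m T *m Z^T) a b = bil T (row a Y) (row b Z).
Proof.
rewrite /bil [LHS]mxE [RHS]mxE; apply: eq_bigr => j _.
by rewrite -row_mul [row a _ _ _]mxE [Z^T _ _]mxE [(row b Z)^T _ _]mxE [row b Z _ _]mxE.
Qed.

Lemma tr_bil k (hi : 'M[B]_k) (Y Z : 'M[B]_(k, n)) T :
  \tr (hi *m (Y *m T *m Z^T)) = \sum_a \sum_b hi a b * bil T (row b Y) (row a Z).
Proof.
by apply: eq_bigr => a _; rewrite mxE; apply: eq_bigr => b _; rewrite mx_bil.
Qed.

End bilinear_forms.

Section moving_frame.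
Context {B : comNzRingType} {k n : nat} (d_ : 'I_k -> {additive B -> B}).
Hypothesis DM : forall i f g, d_ i (f * g) = d_ i f * g + f * d_ i g.
Variable half : B.
Hypothesis half2 : half + half = 1.
Variables (X : 'M[B]_(k, n)) (g : 'M[B]_n) (hi : 'M[B]_k).
Variable cdr : 'I_k -> 'rV[B]_n -> 'rV[B]_n.
Local Notation x a := (row a X).
Local Notation h := (X *m g *m X^T).
Hypothesis gsym : g^T = g.
Hypothesis hhi : h *m hi = 1%:M.
Hypothesis d_g : forall b Y Z, d_ b (bil g Y Z) = bil g (cdr b Y) Z + bil g Y (cdr b Z).
Hypothesis torsion : forall a b, cdr b (x a) = cdr a (x b).

Lemma frame_sym : h^T = h. Proof. by rewrite trmx_mul3 trmxK gsym. Qed.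
Let hs := frame_sym.
Let his : hi^T = hi. Proof. exact: Gi_sym hs hhi. Qed.

Definition GS := Gam d_ half h hi.

(** The Gauss formula: by the Koszul formula the tangential part of the ambient derivative of the
    frame is the Levi-Civita connection of the induced metric. *)
Lemma GS_low b e a : (h *m GS b) e a = bil g (x e) (cdr b (x a)).
Proof.
rewrite (G_Gam d_ half hhi) LowGamE !mx_bil !d_g.
rewrite (torsion b e) (torsion a e) (torsion b a) (bilC (x b) _ gsym).
set s := bil g (x e) _; rewrite -[RHS](half_dbl half2).
ring.
Qed.

Definition LL b a : 'rV[B]_n := cdr b (x a) - \sum_c GS b c a *: x c.

Lemma LLC b a : LL b a = LL a b.
Proof.
by rewrite /LL torsion; congr (_ - _); apply: eq_bigr => c _; rewrite /GS (GamC d_ half hi hs).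
Qed.

(** Connects the second fundamental form of the Gauss formula with the normal projection in
    [second_ff]. *)
Lemma LL_proj b a : LL b a = cdr b (x a) - cdr b (x a) *m g *m X^T *m hi *m X.
Proof.
congr (_ - _); apply/rowP => i; rewrite summxE mxE; apply: eq_bigr => c _.
rewrite !mxE; congr (_ * _).
have -> : GS b = hi *m (h *m GS b) by rewrite mulmxA (GiG hhi) mul1mx.
rewrite mxE; apply: eq_bigr => e _; rewrite GS_low mulrC -{1}his mxE; congr (_ * _).
rewrite (bilC _ _ gsym) mx_bil; congr (bil _ _ _).
by apply/rowP => j; rewrite mxE.
Qed.

Definition divS (w : 'I_k -> B) : B :=
  \sum_a \sum_b hi a b * (d_ b (w a) - \sum_c GS b c a * w c).

Lemma divSD w w' : divS (fun a => w a + w' a) = divS w + divS w'.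
Proof.
rewrite -big_split; apply: eq_bigr => a _; rewrite -big_split; apply: eq_bigr => b _ /=.
rewrite raddfD -mulrDr; congr (_ * _).
have -> : \sum_c GS b c a * (w c + w' c) = \sum_c GS b c a * w c + \sum_c GS b c a * w' c.
  by rewrite -big_split; apply: eq_bigr => c _; exact: mulrDr.
ring.
Qed.

Lemma divS_natZ m w : divS (fun a => m%:R * w a) = m%:R * divS w.
Proof.
rewrite mulr_sumr; apply: eq_bigr => a _; rewrite mulr_sumr; apply: eq_bigr => b _ /=.
have -> : d_ b (m%:R * w a) = m%:R * d_ b (w a) by rewrite !mulr_natl raddfMn.
have -> : \sum_c GS b c a * (m%:R * w c) = m%:R * \sum_c GS b c a * w c.
  by rewrite mulr_sumr; apply: eq_bigr => c _; exact: mulrCA.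
ring.
Qed.

Lemma divS_ext w w' : (forall a, w a = w' a) -> divS w = divS w'.
Proof. by move=> E; apply: eq_bigr => a _; apply: eq_bigr => b _; rewrite E; congr (_ * (_ - _)); apply: eq_bigr => c _; rewrite E. Qed.

(** Differentiating the frame intrinsically rather than in the ambient space leaves the trace of the
    second fundamental form, the first term on the right. *)
Lemma divS_pair (T : 'M[B]_n) (NT : 'I_k -> 'M[B]_n) Z :
  (forall b Y Z, d_ b (bil T Y Z) = bil T (cdr b Y) Z + bil (NT b) Y Z + bil T Y (cdr b Z)) ->
  divS (fun a => bil T (x a) Z) =
  bil T (\sum_a \sum_b hi a b *: LL b a) Z
  + \sum_a \sum_b hi a b * bil (NT b) (x a) Z
  + \sum_a \sum_b hi a b * bil T (x a) (cdr b Z).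
Proof.
move=> dT; rewrite bil_suml -!big_split; apply: eq_bigr => a _ /=.
rewrite bil_suml -!big_split; apply: eq_bigr => b _ /=.
rewrite dT bilZl /LL bilBl bil_suml.
have -> : \sum_c bil T (GS b c a *: x c) Z = \sum_c GS b c a * bil T (x c) Z.
  by apply: eq_bigr => c _; rewrite bilZl.
ring.
Qed.

Variables (gam NU del : 'M[B]_n) (NB : 'I_k -> 'M[B]_n) (U A : 'rV[B]_n) (RU : 'M[B]_(k, n)).
Hypothesis gam_sym : gam^T = gam.
Hypothesis d_gam : forall b Y Z,
  d_ b (bil gam Y Z) = bil gam (cdr b Y) Z + bil (NB b) Y Z + bil gam Y (cdr b Z).
Hypothesis HU : \sum_a \sum_b hi a b *: LL b a = (2%:R * k%:R) *: U.
Definition DUm : 'M[B]_(k, n) := \matrix_b cdr b U.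
Definition DAm : 'M[B]_(k, n) := \matrix_b cdr b A.

(** This is where the fourth-order part of the extension disappears. Applied to [4 g(x_a, A)], the
    divergence yields [8 k g(U, A)] through the mean curvature and four times the trace of [DA];
    these are exactly the [A]-terms of the other two summands on the left. *)
Lemma bracket_eq :
  let q := X *m del *m X^T + X *m NU *m X^T + (DUm *m gam *m X^T + X *m gam *m DUm^T)
    + DUm *m g *m DUm^T + (DAm *m g *m X^T + X *m g *m DAm^T)
    + half *: (RU *m g *m X^T + X *m g *m RU^T) in
  let c := fun a => 4%:R * bil g (x a) A + 2%:R * bil g (cdr a U) U + 2%:R * bil gam (x a) U in
  half * k%:R * (16%:R * bil g U A + 4%:R * bil gam U U) + 2%:R * \tr (hi *m q) - divS c =
  - divS (fun a => d_ a (bil g U U)) - 2%:R * k%:R * bil gam U U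
  + 2%:R * \tr (hi *m (DUm *m g *m DUm^T)) + 2%:R * \tr (hi *m (RU *m g *m X^T))
  + 2%:R * \tr (hi *m (X *m NU *m X^T)) + 2%:R * \tr (hi *m (DUm *m gam *m X^T))
  + 2%:R * \tr (hi *m (X *m del *m X^T))
  - 2%:R * \sum_a \sum_b hi a b * bil (NB b) (x a) U.
Proof.
cbv zeta.
have trT (Y Z : 'M[B]_(k, n)) (T : 'M[B]_n) : T^T = T ->
    \tr (hi *m (Y *m T *m Z^T)) = \tr (hi *m (Z *m T *m Y^T)).
  move=> Ts; rewrite -mxtrace_tr trmx_mul his mxtrace_mulC.
  by rewrite trmx_mul3 trmxK Ts.
have sw (Z : 'rV[B]_n) (T : 'M[B]_n) : T^T = T -> \sum_a \sum_b hi a b * bil T (x a) (cdr b Z) =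
    \tr (hi *m ((\matrix_b cdr b Z) *m T *m X^T)).
  move=> Ts; rewrite tr_bil; apply: eq_bigr => a _; apply: eq_bigr => b _.
  by rewrite rowK (bilC _ _ Ts).
have d_g' b Y Z : d_ b (bil g Y Z) = bil g (cdr b Y) Z + bil 0 Y Z + bil g Y (cdr b Z).
  have -> : bil 0 Y Z = 0 by rewrite /bil mulmx0 mul0mx mxE.
  by rewrite d_g addr0.
have z0 Z : \sum_a \sum_b hi a b * bil 0 (x a) Z = 0.
  by rewrite big1 // => a _; rewrite big1 // => b _; rewrite /bil mulmx0 mul0mx mxE mulr0.
rewrite !divSD !divS_natZ (divS_pair A (NT := fun=> 0) d_g') z0 (divS_pair U d_gam) HU !bilZl.
rewrite (sw A g gsym) (sw U gam gam_sym) -/DAm -/DUm.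
have -> : divS (fun a => d_ a (bil g U U)) = 2%:R * divS (fun a => bil g (cdr a U) U).
  rewrite -divS_natZ; apply: divS_ext => a; rewrite d_g (bilC U _ gsym) mulr_natl mulr2n //.
rewrite !mulmxDr -!scalemxAr !mulmxDr !(mxtraceD, mxtraceZ).
rewrite (trT X DUm gam gam_sym) (trT X DAm g gsym) (trT X RU g gsym).
set t1 := \tr _; set t2 := \tr _; set t3 := \tr _; set t4 := \tr _; set t5 := \tr _; set t6 := \tr _.
set s1 := bil g U A; set s2 := bil gam U U; set s3 := divS _; set s4 := \sum_a _.
apply/eqP; rewrite -subr_eq0; apply/eqP.
transitivity ((half + half - 1) * (k%:R * (8%:R * s1 + 2%:R * s2) + 2%:R * t6)); first ring.
by rewrite half2 subrr mul0r.
Qed.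

End moving_frame.

(** * The operator L and its Taylor coefficients *)

Section divergence_formula.
Context {A : comNzRingType} {n : nat} (D : 'I_n -> {additive A -> A}).
Hypothesis DM : forall i f g, D i (f * g) = D i f * g + f * D i g.
Variable half : A.
Hypothesis half2 : half + half = 1.
Variables (G Gi : 'M[A]_n).
Hypothesis Gsym : G^T = G.
Hypothesis GGi : G *m Gi = 1%:M.
Local Notation Ga := (Gam D half G Gi).

Definition divG (w : 'I_n -> A) : A :=
  \sum_a \sum_b Gi a b * (D b (w a) - \sum_c Ga b c a * w c).

Lemma tr_Gam b : \tr (Ga b) = half * \tr (Gi *m map_mx (D b) G).
Proof.
have E : \tr (Gi *m map_mx (D b) G) = \tr (Ga b) + \tr (Ga b).
  rewrite (D_metric D half2 Gsym GGi) mulmxDr mxtraceD !mulmxA (GiG GGi) mul1mx.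
  rewrite -mulmxA mxtrace_mulC -mulmxA GGi mulmx1 mxtrace_tr; ring.
by rewrite E mulrDr half_dbl.
Qed.

(** [half tr(G^-1 dG)] is the logarithmic derivative of the square root of [det G]; in this form
    neither determinants nor roots appear. *)
Lemma div_formula (w : 'I_n -> A) : divG w =
  \sum_b (D b (\sum_a Gi a b * w a)
          + half * \tr (Gi *m map_mx (D b) G) * (\sum_a Gi a b * w a)).
Proof.
have S1 : \sum_b D b (\sum_a Gi a b * w a) =
    \sum_a \sum_b Gi a b * D b (w a) + \sum_a \sum_b D b (Gi a b) * w a.
  under eq_bigr do rewrite raddf_sum; rewrite exchange_big -big_split.
  apply: eq_bigr => a _ /=; rewrite -big_split; apply: eq_bigr => b _ /=.
  by rewrite DM addrC.
have S2 : \sum_a \sum_b D b (Gi a b) * w a =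
    - (\sum_a \sum_b Gi a b * \sum_c Ga b c a * w c)
    - \sum_b half * \tr (Gi *m map_mx (D b) G) * (\sum_a Gi a b * w a).
  have -> : \sum_a \sum_b D b (Gi a b) * w a =
     - (\sum_a \sum_b (Ga b *m Gi) a b * w a) - \sum_a \sum_b (Gi *m (Ga b)^T) a b * w a.
    rewrite -!sumrN -big_split; apply: eq_bigr => a _; rewrite -!sumrN -big_split.
    apply: eq_bigr => b _ /=.
    have -> : D b (Gi a b) = map_mx (D b) Gi a b by rewrite mxE.
    by rewrite (D_imetric DM half2 Gsym GGi) mxN_E mxD_E; ring.
  congr (- _ - _).
    under [RHS]eq_bigr do under eq_bigr do rewrite mulr_sumr.
    under [RHS]eq_bigr do rewrite exchange_big /=.
    rewrite [RHS]exchange_big; apply: eq_bigr => c _ /=; rewrite [RHS]exchange_big.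
    apply: eq_bigr => b _ /=; rewrite mxE mulr_suml; apply: eq_bigr => a _.
    by rewrite (Gis Gsym GGi a b); ring.
  under [RHS]eq_bigr do rewrite mulr_sumr.
  rewrite [RHS]exchange_big; apply: eq_bigr => a _ /=.
  transitivity (\sum_c \sum_b Gi a c * Ga b b c * w a).
    rewrite exchange_big; apply: eq_bigr => b _ /=; rewrite mxE mulr_suml.
    by apply: eq_bigr => c _; rewrite [_^T _ _]mxE.
  apply: eq_bigr => c _; rewrite -tr_Gam mulr_suml; apply: eq_bigr => b _.
  by rewrite (GamC D half Gi Gsym b c b); ring.
rewrite big_split /= S1 S2 /divG.
have -> : \sum_a \sum_b Gi a b * (D b (w a) - \sum_c Ga b c a * w c) =
    \sum_a \sum_b Gi a b * D b (w a) - \sum_a \sum_b Gi a b * \sum_c Ga b c a * w c.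
  rewrite -sumrB; apply: eq_bigr => a _; rewrite -sumrB; apply: eq_bigr => b _.
  exact: mulrBr.
ring.
Qed.
End divergence_formula.

Lemma sum_comb5 (V : zmodType) (I : finType) (T1 T2 T3 T4 T5 : I -> V) :
  \sum_i (T1 i + T2 i + T3 i + T4 i - T5 i) =
  \sum_i T1 i + \sum_i T2 i + \sum_i T3 i + \sum_i T4 i - \sum_i T5 i.
Proof. by rewrite sumrB !big_split. Qed.
Lemma sum_comb3 (V : zmodType) (I : finType) (T1 T2 T3 : I -> V) :
  \sum_i (T1 i + T2 i - T3 i) = \sum_i T1 i + \sum_i T2 i - \sum_i T3 i.
Proof. by rewrite sumrB !big_split. Qed.

Section gjms_operator_expansion.
Context {A : comNzRingType} {k : nat} (D : 'I_(k + 1) -> {additive A -> A}).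
Variables (half r : A) (H N : 'M[A]_(k + 1)).

Definition tv b : A := \tr (N *m map_mx (D b) H).
Definition vup (F : A) b : A := \sum_a N a b * D a F.
(** [Lbar] and [Kup] are the Laplacians of [F] and of [r] for the metric [H], in the form of
    [div_formula]. *)
Definition Lbar F : A := \sum_b (D b (vup F b) + half * tv b * vup F b).
Definition Kup : A := \sum_b (D b (N ir b) + half * tv b * N ir b).
(* r^(-m) (Delta + m (k - m)) r^m for the metric r^(-2) H, when c1 = 1 + 2 m - k,
   c2 = k - m and M = m F. *)
Definition Lop (c1 c2 F M : A) : A :=
  r * (r * Lbar F) + c1 * (r * vup F ir) + M * (r * Kup + c2 * (1 - N ir ir)).

Hypothesis DM : forall i f g, D i (f * g) = D i f * g + f * D i g.
Hypothesis half2 : half + half = 1.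
Hypothesis Hsym : H^T = H.
Hypothesis HN : H *m N = 1%:M.
Variable w : A.
Hypothesis rw : r * w = 1.
Hypothesis Dxr : forall i, D (lshift 1 i) r = 0.
Hypothesis DZr : D ir r = 1.
Local Notation G := (w ^+ 2 *: H).
Local Notation Gi := (r ^+ 2 *: N).

Let Nsym : N^T = N. Proof. exact: Gi_sym Hsym HN. Qed.
Let Ns a b : N a b = N b a. Proof. by rewrite -{1}Nsym mxE. Qed.

Lemma conf_inv : G *m Gi = 1%:M.
Proof.
by rewrite -scalemxAl -scalemxAr scalerA -exprMn mulrC rw expr1n scale1r HN.
Qed.
Lemma conf_sym : G^T = G. Proof. by rewrite trmxZ Hsym. Qed.

Lemma D_w i : D i w = - (w * w * D i r). Proof.
have := congr1 (D i) rw; rewrite DM (deriv1 (DM i)) => E.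
have : w * (D i r * w + r * D i w) = 0 by rewrite E mulr0.
rewrite mulrDr [w * (r * _)]mulrA [w * r]mulrC rw mul1r => /eqP.
by rewrite addrC addr_eq0 => /eqP ->; ring.
Qed.

Lemma sum_Dr (f : 'I_(k + 1) -> A) : \sum_b D b r * f b = f ir.
Proof.
rewrite big_split_ord big_ord1 /= DZr mul1r big1 ?add0r // => i _.
by rewrite Dxr mul0r.
Qed.

(** The constant [1 - k] is [2 - (k + 1)]: two from differentiating the factor [r^2] of the inverse
    metric, [k + 1] from the volume density of [r^-2 H]. *)
Lemma div_conf (W : 'I_(k + 1) -> A) : let v b := \sum_a N a b * W a in
  divG D half G Gi W = r * (r * \sum_b (D b (v b) + half * tv b * v b))
    + (1 - k%:R) * (r * v ir).
Proof.
move=> v; rewrite (div_formula DM half2 conf_sym conf_inv).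
have vE b : \sum_a Gi a b * W a = r * (r * v b).
  rewrite mulr_sumr mulr_sumr; apply: eq_bigr => a _; rewrite mxZ_E; ring.
have tE b : half * \tr (Gi *m map_mx (D b) G) = half * tv b - (k%:R + 1) * (w * D b r).
  rewrite (dmxZ (DM b)) mulmxDr -!scalemxAr -!scalemxAl !scalerA mxtraceD !mxtraceZ.
  have -> : \tr (N *m H) = k%:R + 1 by rewrite (mulmx1C HN) mxtrace1 natrD.
  rewrite expr2 DM D_w -/(tv b).
  rewrite (_ : half * _ = (r * w) ^+ 2 * (half * tv b) - (half + half) * (r * w) ^+ 2 * ((k%:R + 1) * (w * D b r))); last ring.
  by rewrite rw half2 expr1n !mul1r.
rewrite (eq_bigr (fun b => r * (r * (D b (v b) + half * tv b * v b))
   + D b r * ((1 - k%:R) * (r * v b)))) => [|b _].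
  by rewrite big_split /= sum_Dr -!mulr_sumr.
rewrite vE tE !DM.
have -> : (half * tv b - (k%:R + 1) * (w * D b r)) * (r * (r * v b)) =
   r * (r * (half * tv b * v b)) - (r * w) * ((k%:R + 1) * D b r * (r * v b)) by ring.
rewrite rw; ring.
Qed.

Lemma vup_r b : \sum_a N a b * (w * D a r) = w * N ir b.
Proof.
by rewrite -(sum_Dr (fun a => w * N a b)); apply: eq_bigr => a _; ring.
Qed.

Variables (m : A).
Hypothesis Dm : forall b, D b m = 0.

(** The power [r^m] enters only through its differential equation, so that the conjugation is pure
    algebra and real exponents cause no trouble. *)
Lemma gjms_conf (P F : A) : (forall b, D b P = m * (w * D b r) * P) ->
  divG D half G Gi (fun b => D b (P * F)) + m * (k%:R - m) * (P * F) =
  P * Lop (1 + 2%:R * m - k%:R) (k%:R - m) F (m * F).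
Proof.
move=> DP; rewrite div_conf.
have vE b : \sum_a N a b * D a (P * F) = P * (vup F b + m * F * (w * N ir b)).
  rewrite -vup_r mulrDr !mulr_sumr -big_split; apply: eq_bigr => a _ /=.
  by rewrite DM DP; ring.
rewrite (eq_bigr (fun b => P * (D b (vup F b) + half * tv b * vup F b)
   + P * (m * F * w) * (D b (N ir b) + half * tv b * N ir b)
   + D b r * (P * m * w * (vup F b + vup F b + m * F * (w * N ir b) - F * (w * N ir b)))
   + P * (m * w) * (N ir b * D b F) - P * (m * w) * (D b r * vup F b))) => [|b _]; last first.
  by rewrite vE DM raddfD /= !DM DP D_w Dm; ring.
rewrite sum_comb5 -!mulr_sumr sum_Dr sum_Dr vE -/(Lbar F) -/Kup.
have -> : \sum_b N ir b * D b F = vup F ir by apply: eq_bigr => b _; rewrite Ns.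
rewrite /Lop; move: (Lbar F) (Kup) (vup F ir) (N ir ir) => L K V N0.
by ring: (rw).
Qed.

(** For this case [Lop] takes [M] apart from [F]: the constants are those of [m = 0], and the
    derivative [dr / r] of the logarithm plays the part of [m F dr / r] with weight one. *)
Lemma critical_conf (P F : A) : (forall b, D b P = w * D b r) ->
  divG D half G Gi (fun b => D b (P + F)) + k%:R = Lop (1 - k%:R) k%:R F 1.
Proof.
move=> DP; rewrite div_conf.
have vE b : \sum_a N a b * D a (P + F) = vup F b + w * N ir b.
  rewrite -vup_r -big_split; apply: eq_bigr => a _ /=.
  by rewrite raddfD DP; ring.
rewrite (eq_bigr (fun b => (D b (vup F b) + half * tv b * vup F b)
   + w * (D b (N ir b) + half * tv b * N ir b)
   - D b r * (w * (w * N ir b)))) => [|b _]; last first.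
  by rewrite vE raddfD /= DM D_w; ring.
rewrite sum_comb3 -mulr_sumr sum_Dr vE -/(Lbar F) -/Kup.
rewrite /Lop; move: (Lbar F) (Kup) (vup F ir) (N ir ir) => L K V N0.
by ring: (rw).
Qed.

End gjms_operator_expansion.

Section map_Lop.
Context {A B : comNzRingType} {k : nat} (f : {rmorphism A -> B}).
Context (D : 'I_(k + 1) -> {additive A -> A}) (D' : 'I_(k + 1) -> {additive B -> B}).
Hypothesis fD : forall i x, f (D i x) = D' i (f x).
Variables (half r : A) (H N : 'M[A]_(k + 1)).

Lemma map_tv b : f (tv D H N b) = tv D' (map_mx f H) (map_mx f N) b.
Proof. by rewrite /tv -trace_map_mx map_mxM (map_dmx fD). Qed.
Lemma map_vup F b : f (vup D N F b) = vup D' (map_mx f N) (f F) b.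
Proof. by rewrite rmorph_sum; apply: eq_bigr => a _; rewrite rmorphM fD mxE. Qed.
Lemma map_Lop c1 c2 F M : f (Lop D half r H N c1 c2 F M) =
  Lop D' (f half) (f r) (map_mx f H) (map_mx f N) (f c1) (f c2) (f F) (f M).
Proof.
have E1 : f (Lbar D half H N F) = Lbar D' (f half) (map_mx f H) (map_mx f N) (f F).
  rewrite rmorph_sum; apply: eq_bigr => b _.
  by rewrite rmorphD !rmorphM fD !map_vup map_tv.
have E2 : f (Kup D half H N) = Kup D' (f half) (map_mx f H) (map_mx f N).
  rewrite rmorph_sum; apply: eq_bigr => b _.
  by rewrite rmorphD !rmorphM fD map_tv mxE.
by rewrite /Lop !(rmorphD f, rmorphM f, rmorphN f, rmorph1 f) E1 E2 map_vup [map_mx f N ir ir]mxE.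
Qed.
End map_Lop.

Section gjms_coefficients.
Context {R : realType} {k : nat} (V0 : odom R k) (e : R) (e0 : 0 < e).
Local Notation A := (smf (obox V0 e0)).
Local Notation B := (smf V0).
Local Notation half := (scst 2^-1).
Local Notation D := (@sDa R _ (obox V0 e0)).
Local Notation D0 := (@sDa R _ V0).
Variables (H N : 'M[A]_(k + 1)).
Hypothesis HN : H *m N = 1%:M.
Variables (h hi p q : 'M[B]_k) (c z : 'M[B]_(k, 1)) (z' : 'M[B]_(1, k)) (a b : B).
Hypothesis hs : h^T = h.
Hypothesis hhi : h *m hi = 1%:M.
Hypothesis ps : p^T = p.
Hypothesis H0 : cmx 0 H = block_mx h 0 0 1%:M.
Hypothesis H1 : cmx 1 H = 0.
Hypothesis H2 : cmx 2 H = block_mx p 0 0 a%:M.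
Hypothesis H3 : cmx 3 H = block_mx 0 c c^T 0.
Hypothesis H4 : cmx 4 H = block_mx q z z' b%:M.

Local Notation tp := (\tr (hi *m p)).
Local Notation tq := (\tr (hi *m q)).
Local Notation tpp := (\tr (hi *m p *m hi *m p)).

Let his : hi^T = hi. Proof. exact: Gi_sym hs hhi. Qed.

Let hphs : (hi *m p *m hi)^T = hi *m p *m hi.
Proof. by rewrite trmx_mul3 his ps. Qed.

Lemma N0E : cmx 0 N = block_mx hi 0 0 1%:M.
Proof.
have E : block_mx h 0 0 (1%:M : 'M[B]_1) *m block_mx hi 0 0 1%:M = 1%:M.
  by rewrite mulmx_block !(mulmx0, mul0mx, mulmx1, addr0, add0r) hhi -scalar_mx_block.
have := cmx0_inv HN; rewrite H0 => E'.
by rewrite -[LHS]mul1mx -(mulmx1C E) -mulmxA E' mulmx1.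
Qed.
Lemma N1E : cmx 1 N = 0. Proof. exact: cmx1_inv HN H1. Qed.
Lemma N2E : cmx 2 N = block_mx (- (hi *m p *m hi)) 0 0 (- a)%:M.
Proof.
rewrite (cmx2_inv HN H1) N0E H2 !mulmx_block !(mulmx0, mul0mx, mulmx1, mul1mx, addr0, add0r).
by rewrite opp_block_mx !oppr0 raddfN.
Qed.

Let iK m (M : 'M[B]_(k + 1, m)) (M' : 'M[B]_(k + 1, m)) :
  cmx 0 H *m M + M' = 0 -> M = - (cmx 0 N *m M').
Proof.
move=> E; have := congr1 (mulmx (cmx 0 N)) E.
rewrite mulmx0 mulmxDr mulmxA (mulmx1C (cmx0_inv HN)) mul1mx => /eqP.
by rewrite addr_eq0 => /eqP.
Qed.

Lemma N3E : cmx 3 N = block_mx 0 (- (hi *m c)) (- (hi *m c)^T) 0.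
Proof.
have := congr1 (cmx 3) HN; rewrite cmx3M cmx_1 H1 N1E mul0mx mulmx0 !add0r => /iK ->.
rewrite N0E H3 !mulmx_block !(mulmx0, mul0mx, mulmx1, mul1mx, addr0, add0r).
by rewrite opp_block_mx !oppr0 trmx_mul his.
Qed.

Lemma N4E : cmx 4 N ir ir = a * a - b.
Proof.
have := congr1 (cmx 4) HN; rewrite cmx4M cmx_1 H1 N1E.
move: (cmx 3 H) (cmx 3 N) => x3 y3; rewrite mul0mx mulmx0 !add0r => /iK ->.
rewrite N0E H2 H4 N2E !mulmx_block !(mulmx0, mul0mx, mulmx1, mul1mx, addr0, add0r).
rewrite add_block_mx mulmx_block opp_block_mx block_mxEdr.
rewrite !(mulmx0, mul0mx, mul1mx, addr0, add0r) -scalar_mxM -raddfD -raddfN mxE eqxx mulr1n.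
ring.
Qed.

Let ul j x y (M : 'M[A]_(k + 1)) : co j (M x y) = cmx j M x y. Proof. by rewrite cmxE. Qed.

Lemma Nxx0 x y : co 0 (N (lshift 1 x) (lshift 1 y)) = hi x y.
Proof. by rewrite ul N0E block_mxEul. Qed.
Lemma Nxx1 x y : co 1 (N x y) = 0.
Proof. by rewrite ul N1E mx0_E. Qed.
Lemma Nxx2 x y : co 2 (N (lshift 1 x) (lshift 1 y)) = - (hi *m p *m hi) x y.
Proof. by rewrite ul N2E block_mxEul mxN_E. Qed.
Lemma Nxr0 x : co 0 (N (lshift 1 x) ir) = 0.
Proof. by rewrite ul N0E block_mxEur mx0_E. Qed.
Lemma Nrx0 x : co 0 (N ir (lshift 1 x)) = 0.
Proof. by rewrite ul N0E block_mxEdl mx0_E. Qed.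
Lemma Nrx2 x : co 2 (N ir (lshift 1 x)) = 0.
Proof. by rewrite ul N2E block_mxEdl mx0_E. Qed.
Lemma Nrx3 x : co 3 (N ir (lshift 1 x)) = - (hi *m c) x 0.
Proof. by rewrite ul N3E block_mxEdl mxN_E [_^T _ _]mxE. Qed.
Lemma Nrr0 : co 0 (N ir ir) = 1.
Proof. by rewrite ul N0E block_mxEdr mxE eqxx. Qed.
Lemma Nrr2 : co 2 (N ir ir) = - a.
Proof. by rewrite ul N2E block_mxEdr mxE eqxx mulr1n. Qed.
Lemma Nrr3 : co 3 (N ir ir) = 0.
Proof. by rewrite ul N3E block_mxEdr mx0_E. Qed.
Lemma Nrr4 : co 4 (N ir ir) = a * a - b.
Proof. by rewrite ul N4E. Qed.

Local Notation tr_ b := (tv D H N b).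

Lemma tr0 : co 0 (tr_ ir) = 0.
Proof. by rewrite cmx_tr cmx0M cmx_Dr H1 scaler0 mulmx0 mxtrace0. Qed.
Lemma tr1 : co 1 (tr_ ir) = 2%:R * (tp + a).
Proof.
rewrite cmx_tr cmx1M N1E mul0mx addr0 cmx_Dr H2 N0E -scalemxAr mxtraceZ; congr (_ * _).
rewrite mulmx_block !(mulmx0, mul0mx, mulmx1, mul1mx, addr0, add0r) mxtrace_block.
by rewrite mxtrace_scalar.
Qed.
Lemma tr2 : co 2 (tr_ ir) = 0.
Proof.
rewrite cmx_tr cmx2M N1E mul0mx add0r !cmx_Dr H1 scaler0 mulmx0 addr0 H3 N0E -scalemxAr mxtraceZ.
rewrite mulmx_block !(mulmx0, mul0mx, mulmx1, mul1mx, addr0, add0r) mxtrace_block.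
by rewrite !mxtrace0 addr0 mulr0.
Qed.
Lemma tr3 : co 3 (tr_ ir) = 4%:R * (tq + b) - 2%:R * (tpp + a * a).
Proof.
rewrite cmx_tr cmx3M N1E !cmx_Dr H1; move: (cmx 3 N) (3%:R *: _) => x y.
rewrite mul0mx scaler0 mulmx0 add0r addr0 H2 H4 N0E N2E -!scalemxAr.
rewrite !mulmx_block !(mulmx0, mul0mx, mulmx1, mul1mx, addr0, add0r) mxtraceD !mxtraceZ.
rewrite !mxtrace_block -scalar_mxM !mxtrace_scalar mulNmx mxtraceN !mulr1n.
ring.
Qed.

Local Notation dh x := (\tr (hi *m map_mx (D0 x) h)).

Lemma tx0 x : co 0 (tr_ (lshift 1 x)) = dh x.
Proof.
rewrite cmx_tr cmx0M cmx_Dx H0 N0E map_block_mx mulmx_block mxtrace_block.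
rewrite dmx1 ?mulmx0; last exact: sDaM.
by rewrite !map_mx0 !(mulmx0, addr0) mxtrace0 addr0.
Qed.
Lemma tx1 x : co 1 (tr_ (lshift 1 x)) = 0.
Proof.
rewrite cmx_tr cmx1M N1E mul0mx addr0 cmx_Dx H1 map_mx0 mulmx0 mxtrace0 //.
Qed.
Lemma tx2 x : co 2 (tr_ (lshift 1 x)) = D0 x (tp + a).
Proof.
rewrite cmx_tr cmx2M N1E mul0mx add0r !cmx_Dx H0 H2 N0E N2E !map_block_mx !map_mx0.
rewrite (dmx1 (@sDaM _ _ V0 x)) !mulmx_block.
rewrite !(mulmx0, mul0mx, mulmx1, mul1mx, addr0, add0r) mxtraceD !mxtrace_block mxtrace0 addr0.
rewrite raddfD /= (dmx_tr (D0 x)) (dmxM (@sDaM _ _ V0 x)) mxtraceD.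
rewrite (dmx_inv (@sDaM _ _ V0 x) hhi) !mulNmx !mxtraceN.
have -> : \tr (hi *m map_mx (D0 x) h *m hi *m p) = \tr (hi *m p *m hi *m map_mx (D0 x) h).
  by rewrite -mulmxA mxtrace_mulC mulmxA.
have -> : \tr (map_mx (sD x) a%:M : 'M[B]_1) = sD x a.
  by rewrite /mxtrace big_ord1 !mxE eqxx mulr1n.
by rewrite /=; ring.
Qed.

Definition dv (w : 'I_k -> B) : B :=
  \sum_y (D0 y (\sum_x hi x y * w x) + half * dh y * \sum_x hi x y * w x).

Section one_function.
Variable F : A.
Local Notation v := (vup D N F).
Local Notation Fj j := (co j F).

Let DaF j x : co j (D (lshift 1 x) F) = D0 x (Fj j). Proof. exact: co_sD. Qed.
Let DrF j : co j (D ir F) = j.+1%:R * Fj j.+1. Proof. exact: co_Dr. Qed.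

Let v_irE : v ir = \sum_x N (lshift 1 x) ir * D (lshift 1 x) F + N ir ir * D ir F.
Proof. by rewrite /vup big_split_ord big_ord1. Qed.
Let v_xE y : v (lshift 1 y) =
  \sum_x N (lshift 1 x) (lshift 1 y) * D (lshift 1 x) F + N ir (lshift 1 y) * D ir F.
Proof. by rewrite /vup big_split_ord big_ord1. Qed.

Let mul1n (x : B) : 1%:R * x = x. Proof. exact: mul1r. Qed.

Lemma v0 : co 0 (v ir) = Fj 1.
Proof.
rewrite v_irE coD raddf_sum big1 => [|x _]; last by rewrite /= co0M Nxr0 mul0r.
by rewrite co0M Nrr0 DrF mul1r add0r mul1n.
Qed.
Lemma v1 : co 1 (v ir) = 2%:R * Fj 2.
Proof.
rewrite v_irE coD raddf_sum big1 => [|x _]; last by rewrite /= co1M Nxr0 Nxx1 !mul0r addr0.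
by rewrite co1M Nrr0 Nxx1 DrF mul1r mul0r add0r addr0.
Qed.

Hypothesis F1 : Fj 1 = 0.

Let DF1 x : D0 x (Fj 1) = 0. Proof. by rewrite F1; exact: raddf0. Qed.

Lemma vx0 y : co 0 (v (lshift 1 y)) = \sum_x hi x y * D0 x (Fj 0).
Proof.
rewrite v_xE coD (co0M (N ir _)) Nrx0 mul0r addr0 raddf_sum; apply: eq_bigr => x _ /=.
by rewrite co0M Nxx0 DaF.
Qed.
Lemma vx2 y : co 2 (v (lshift 1 y)) =
  \sum_x hi x y * D0 x (Fj 2) - \sum_x (hi *m p *m hi) x y * D0 x (Fj 0).
Proof.
rewrite v_xE coD (co2M (N ir _)) Nrx0 Nxx1 Nrx2 !mul0r !addr0 raddf_sum -sumrB.
apply: eq_bigr => x _ /=.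
by rewrite co2M Nxx0 Nxx1 Nxx2 !DaF mul0r add0r mulNr.
Qed.

Local Notation LbF := (Lbar D half H N F).

Let LbE : LbF = \sum_y (D (lshift 1 y) (v (lshift 1 y)) + half * tr_ (lshift 1 y) * v (lshift 1 y))
   + (D ir (v ir) + half * tr_ ir * v ir).
Proof. by rewrite /Lbar big_split_ord big_ord1. Qed.

Lemma Lb0 : co 0 LbF = 2%:R * Fj 2 + dv (fun x => D0 x (Fj 0)).
Proof.
rewrite LbE coD addrC coD (co_Dr 0 (v ir)) mul1n v1 -mulrA co_cstM co0M tr0 mul0r mulr0 addr0.
congr (_ + _); rewrite raddf_sum; apply: eq_bigr => y _ /=.
by rewrite coD co_sD -mulrA co_cstM co0M tx0 vx0 mulrA.
Qed.

Lemma Lb2 : co 2 LbF = 3%:R * co 3 (v ir) + 2%:R * (tp + a) * Fj 2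
   + dv (fun x => D0 x (Fj 2)) - dv (fun x => \sum_y (p *m hi) x y * D0 y (Fj 0))
   + half * \sum_y D0 y (tp + a) * \sum_x hi x y * D0 x (Fj 0).
Proof.
rewrite LbE coD addrC coD (co_Dr 2 (v ir)) -mulrA co_cstM co2M tr0 tr2 tr1 v1 mul0r mul0r addr0 add0r.
have -> : half * (2%:R * (tp + a) * (2%:R * Fj 2)) = 2%:R * (tp + a) * Fj 2.
  have -> : half * (2%:R * (tp + a) * (2%:R * Fj 2)) = (half + half) * (2%:R * (tp + a) * Fj 2) by ring.
  by rewrite half2 mul1r.
rewrite -!addrA; congr (_ + (_ + _)); rewrite !addrA /dv raddf_sum mulr_sumr -sumrB -big_split.
apply: eq_bigr => y _ /=.
rewrite coD co_sD -mulrA co_cstM co2M tx0 tx1 tx2 vx0 vx2 mul0r add0r.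
have -> : \sum_x hi x y * (\sum_y0 (p *m hi) x y0 * D0 y0 (Fj 0)) =
    \sum_x (hi *m p *m hi) x y * D0 x (Fj 0).
  under eq_bigr do rewrite mulr_sumr.
  rewrite exchange_big; apply: eq_bigr => x _ /=.
  rewrite (Gs hphs x y) -mulmxA mxE mulr_suml; apply: eq_bigr => m _.
  by rewrite (Gs his m y) mulrA.
rewrite raddfB /=.
ring.
Qed.
End one_function.

Local Notation K := (Kup D half H N).

Let KE : K = \sum_y (D (lshift 1 y) (N ir (lshift 1 y)) + half * tr_ (lshift 1 y) * N ir (lshift 1 y))
   + (D ir (N ir ir) + half * tr_ ir * N ir ir).
Proof. by rewrite /Kup big_split_ord big_ord1. Qed.
Let zD y : D0 y 0 = 0. Proof. exact: raddf0. Qed.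

Lemma K0 : co 0 K = 0.
Proof.
rewrite KE coD raddf_sum big1 ?add0r => [|y _]; last first.
  by rewrite /= coD co_sD Nrx0 -mulrA co_cstM co0M Nrx0 !mulr0 addr0; exact: zD.
by rewrite coD co_Dr Nxx1 mulr0 -mulrA co_cstM co0M tr0 mul0r mulr0 addr0.
Qed.
Lemma K1 : co 1 K = tp - a.
Proof.
rewrite KE coD raddf_sum big1 ?add0r => [|y _]; last first.
  rewrite /= coD co_sD Nxx1 -mulrA co_cstM co1M Nrx0 Nxx1 !mulr0 !addr0 mulr0 addr0; exact: zD.
rewrite coD co_Dr Nrr2 -mulrA co_cstM co1M tr0 tr1 Nrr0 mul0r add0r mulr1.
have -> : half * (2%:R * (tp + a)) = (half + half) * (tp + a) by ring.
by rewrite half2; ring.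
Qed.
Lemma K2 : co 2 K = 0.
Proof.
rewrite KE coD raddf_sum big1 ?add0r => [|y _]; last first.
  rewrite /= coD co_sD Nrx2 -mulrA co_cstM co2M Nrx0 Nxx1 Nrx2 !mulr0 !addr0 mulr0 addr0; exact: zD.
by rewrite coD co_Dr Nrr3 mulr0 -mulrA co_cstM co2M tr0 tr2 Nxx1 mulr0 !mul0r !addr0 mulr0 add0r.
Qed.
Lemma K3 : co 3 K = - dv (fun x => c x 0) + 2%:R * (a * a) - 2%:R * b + 2%:R * tq - tpp - a * tp.
Proof.
rewrite KE coD raddf_sum (_ : \sum_y _ = - dv (fun x => c x 0)); last first.
  rewrite -sumrN; apply: eq_bigr => y _.
  rewrite /= coD co_sD Nrx3 -mulrA co_cstM co3M tx0 Nrx3 Nrx0 Nxx1 Nrx2 !mulr0 !addr0.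
  have -> : (hi *m c) y 0 = \sum_x hi x y * c x 0.
    by rewrite mxE; apply: eq_bigr => x _; rewrite (Gs his).
  by rewrite raddfN /=; ring.
rewrite coD co_Dr Nrr4 -mulrA co_cstM co3M tr0 tr2 tr1 tr3 Nxx1 Nrr0 Nrr2.
rewrite !mul0r mulr1 !add0r.
have -> : half * (2%:R * (tp + a) * - a + (4%:R * (tq + b) - 2%:R * (tpp + a * a))) =
  (half + half) * ((tp + a) * - a + 2%:R * (tq + b) - (tpp + a * a)) by ring.
by rewrite half2; ring.
Qed.

Section operator.
Variables (c1 c2 : R) (F M : A).
Local Notation L := (Lop D half (sr V0 e0) H N (scst c1) (scst c2) F M).
Local Notation Fj j := (co j F).
Local Notation Z := (sr V0 e0 * K + scst c2 * (1 - N ir ir)).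
Local Notation sig := (tp + (scst c2 - 1) * a).

Lemma Z0 : co 0 Z = 0.
Proof. by rewrite coD co0_Mr co_cstM coB co_1 Nrr0 subrr mulr0 addr0. Qed.
Lemma Z1 : co 1 Z = 0.
Proof. by rewrite coD co_Mr K0 co_cstM coB co_1 Nxx1 subrr mulr0 addr0. Qed.
Lemma Z2 : co 2 Z = sig.
Proof. by rewrite coD co_Mr K1 co_cstM coB co_1 Nrr2 sub0r opprK; ring. Qed.
Lemma Z3 : co 3 Z = 0.
Proof. by rewrite coD co_Mr K2 co_cstM coB co_1 Nrr3 subrr mulr0 addr0. Qed.
Lemma Z4 : co 4 Z = - dv (fun x => c x 0) + 2%:R * tq - tpp - a * tp
  + (2%:R - scst c2) * (a * a - b).
Proof. by rewrite coD co_Mr K3 co_cstM coB co_1 Nrr4 sub0r; ring. Qed.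

Lemma L1 : co 1 L = scst c1 * Fj 1.
Proof.
rewrite !coD co_Mr co0_Mr add0r co_cstM co_Mr v0 -[RHS]addr0; congr (_ + _).
by rewrite co1M Z0 Z1 !mulr0 addr0.
Qed.

Hypothesis F1 : Fj 1 = 0.
Hypothesis M1 : co 1 M = 0.

(** The factor [2 + 2 c1] is zero for [c1 = -1], where this coefficient is the value of the operator
    of order two. For [c1 = -3] it is [-4], and the equation determines the second coefficient of
    [F]. *)
Lemma L2 : co 2 L = (2%:R + 2%:R * scst c1) * Fj 2 + dv (fun x => D0 x (Fj 0)) + co 0 M * sig.
Proof.
rewrite !coD !co_Mr co_cstM co_Mr v1 Lb0 //.
by rewrite (co2M M) Z0 Z1 Z2 !mulr0 !addr0; move: (dv _) => t; ring.
Qed.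

Hypothesis F3 : Fj 3 = 0.

(** The fourth coefficient of [F] sits in the third coefficient of [v ir], which occurs with factor
    [3] in the Laplacian and with factor [c1]. For [c1 = -3] the two cancel. *)
Lemma L4 : c1 = -3 -> co 4 L = 2%:R * (tp + a) * Fj 2 + dv (fun x => D0 x (Fj 2))
  - dv (fun x => \sum_y (p *m hi) x y * D0 y (Fj 0))
  + half * (\sum_y D0 y (tp + a) * \sum_x hi x y * D0 x (Fj 0))
  + co 0 M * (- dv (fun x => c x 0) + 2%:R * tq - tpp - a * tp
              + (2%:R - scst c2) * (a * a - b))
  + co 2 M * sig.
Proof.
move=> c1E; rewrite !coD !co_Mr co_cstM co_Mr Lb2 //.
rewrite (co4M M) Z0 Z1 Z2 Z3 Z4 !mulr0 add0r addr0.
have -> : (scst c1 : B) = - 3%:R by rewrite c1E rmorphN /= rmorph_nat.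
by move: (dv _) (dv _) (dv _) (co 3 _) => t1 t2 t3 t4; ring.
Qed.

End operator.

End gjms_coefficients.

(** * The extrinsic Q-curvature *)

Section extrinsic_Q_curvature.
Context {B : comNzRingType} {k n : nat} (d_ : 'I_k -> {additive B -> B}).
Hypothesis DM : forall i f g, d_ i (f * g) = d_ i f * g + f * d_ i g.
Variable half : B.
Hypothesis half2 : half + half = 1.
Variables (X : 'M[B]_(k, n)) (g gi : 'M[B]_n) (hi : 'M[B]_k).
Variable cdr : 'I_k -> 'rV[B]_n -> 'rV[B]_n.
Local Notation x a := (row a X).
Local Notation h := (X *m g *m X^T).
Hypothesis gsym : g^T = g.
Hypothesis ggi : g *m gi = 1%:M.
Hypothesis hhi : h *m hi = 1%:M.
Hypothesis d_g : forall b Y Z, d_ b (bil g Y Z) = bil g (cdr b Y) Z + bil g Y (cdr b Z).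
Hypothesis torsion : forall a b, cdr b (x a) = cdr a (x b).
Variables (gam : 'M[B]_n) (U : 'rV[B]_n).
Hypothesis gam_sym : gam^T = gam.
Local Notation LLab := (LL d_ half X g hi cdr).
Local Notation dS := (divS d_ half X g hi).
Hypothesis HU : \sum_a \sum_b hi a b *: LLab b a = (2%:R * k%:R) *: U.
Hypothesis UX : forall a, bil g U (x a) = 0.
Local Notation DU := (DUm (k := k) cdr U).

Let hs : h^T = h. Proof. exact: frame_sym. Qed.
Let his : hi^T = hi. Proof. exact: Gi_sym hs hhi. Qed.

(** This is [|H|^2], as the mean curvature vector is [2 U]. *)
Definition aH := 4%:R * bil g U U.
Definition Ptan : 'M[B]_k := locked_with lock_key (- (X *m gam *m X^T)).
Lemma PtanE : Ptan = - (X *m gam *m X^T). Proof. by rewrite /Ptan unlock. Qed.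
Definition HLm : 'M[B]_k := \matrix_(a, b) (2%:R * bil g U (LLab a b)).
Definition Jt := \tr (hi *m Ptan).
Definition pmx : 'M[B]_k := X *m gam *m X^T + (DU *m g *m X^T + X *m g *m DU^T).

Lemma bil_g0l c (Y : 'I_k -> 'rV[B]_n) : (forall b, bil g U (Y b) = 0) ->
  bil g U (\sum_b c b *: Y b) = 0.
Proof.
move=> Y0; rewrite (bilC _ _ gsym) bil_suml big1 // => b _.
by rewrite bilZl (bilC _ _ gsym) Y0 mulr0.
Qed.

Lemma bil_U_LL b a : bil g U (cdr b (x a)) = bil g U (LLab b a).
Proof.
have -> : cdr b (x a) = LLab b a + \sum_c GS d_ half X g hi b c a *: x c.
  by rewrite /LL subrK.
by rewrite (bilC _ _ gsym) bilDl 2!(bilC _ U gsym) bil_g0l // addr0.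
Qed.

Lemma DU_tan b a : (DU *m g *m X^T) b a = - (half * HLm b a).
Proof.
rewrite mx_bil rowK mxE.
have := congr1 (d_ b) (UX a); rewrite d_g raddf0 bil_U_LL => /eqP.
rewrite addr_eq0 => /eqP ->; congr (- _).
have -> : half * (2%:R * bil g U (LLab b a)) = (half + half) * bil g U (LLab b a) by ring.
by rewrite half2 mul1r.
Qed.

Lemma HLm_sym : HLm^T = HLm.
Proof. by apply/matrixP => a b; rewrite !mxE; congr (_ * bil _ _ _); exact: LLC. Qed.
Lemma Ptan_sym : Ptan^T = Ptan.
Proof. by rewrite PtanE trmxN trmx_mul3 trmxK gam_sym. Qed.

Lemma DUgX : DU *m g *m X^T = - (half *: HLm).
Proof. by apply/matrixP => a b; rewrite DU_tan !mxE. Qed.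
Lemma XgDU : X *m g *m DU^T = - (half *: HLm).
Proof. by apply: trmx_inj; rewrite trmx_mul3 trmxK gsym DUgX trmxN trmxZ HLm_sym. Qed.

(** Differentiating [g(U, x_a) = 0] turns the tangential part of [DU] into the second fundamental
    form, so both derivative terms of [pmx] equal minus half of [HLm]. *)
Lemma pE : pmx = - (Ptan + HLm).
Proof.
rewrite /pmx DUgX XgDU PtanE; apply/matrixP => a b; rewrite !mxlinE.
have -> : - (half * HLm a b) - half * HLm a b = - ((half + half) * HLm a b) by ring.
by rewrite half2; ring.
Qed.

Lemma tr_HL : \tr (hi *m HLm) = k%:R * aH.
Proof.
have -> : \tr (hi *m HLm) = 2%:R * bil g U (\sum_a \sum_b hi a b *: LLab b a).
  rewrite (bilC _ _ gsym) bil_suml mulr_sumr; apply: eq_bigr => a _.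
  rewrite mxE bil_suml mulr_sumr; apply: eq_bigr => b _.
  by rewrite bilZl mxE (bilC _ _ gsym) mulrCA.
by rewrite HU (bilC _ _ gsym) bilZl /aH; ring.
Qed.

Lemma tr_p : \tr (hi *m pmx) = - Jt - k%:R * aH.
Proof. by rewrite pE mulmxN mulmxDr mxtraceN mxtraceD tr_HL; rewrite /Jt; ring. Qed.

Definition nrm : 'rV[B]_n -> 'rV[B]_n :=
  locked_with lock_key (fun V => V - V *m g *m X^T *m hi *m X).
Lemma nrmE V : nrm V = V - V *m g *m X^T *m hi *m X.
Proof. by rewrite /nrm unlock. Qed.

Lemma nrm_bil (V W : 'rV[B]_n) : bil g V W = bil g (nrm V) (nrm W)
  + (V *m g *m X^T *m hi *m (W *m g *m X^T)^T) 0 0.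
Proof.
rewrite {2}/bil !nrmE linearB /= !trmx_mul !trmxK his gsym.
rewrite !(mulmxBl, mulmxBr, mulmxA).
have E (M : 'M[B]_(1, k)) : M *m X *m g *m X^T *m hi = M.
  by rewrite -(mulmxA M X) -(mulmxA M (X *m g)) -(mulmxA M) hhi mulmx1.
rewrite E /bil; move: (_ *m W^T) => w; rewrite !mxlinE.
by move: ((_ *m X *m g *m W^T) 0 0) => t; rewrite subrr subr0 subrK.
Qed.

Lemma tr_nrm (Y Z : 'M[B]_(k, n)) :
  \tr (hi *m (Y *m g *m Z^T)) =
  \sum_a \sum_b hi a b * bil g (nrm (row b Y)) (nrm (row a Z))
  + \tr (hi *m (Y *m g *m X^T) *m hi *m (Z *m g *m X^T)^T).
Proof.
rewrite tr_bil -mulmxA -mulmxA /mxtrace -big_split; apply: eq_bigr => a _ /=.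
rewrite mxE -big_split; apply: eq_bigr => b _ /=.
rewrite nrm_bil mulrDr; congr (_ + _ * _).
rewrite mulmxA [RHS]mxE -!row_mul [LHS]mxE [LHS]mxE; apply: eq_bigr => c _.
by rewrite [_^T c 0]mxE [row a _ _ _]mxE [_^T c a]mxE.
Qed.

Variables (gU del : 'M[B]_n) (NB : 'I_k -> 'M[B]_n) (A : 'rV[B]_n) (RU : 'M[B]_(k, n)).
Hypothesis d_gam : forall b Y Z,
  d_ b (bil gam Y Z) = bil gam (cdr b Y) Z + bil (NB b) Y Z + bil gam Y (cdr b Z).
Variables (WHH CH trB nn : B).
Local Notation q4 := (half * half).
Hypothesis curvature_term : \tr (hi *m (RU *m g *m X^T)) =
  - (q4 * WHH) + k%:R * bil gam U U - q4 * (Jt * aH).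
Hypothesis cotton_term : \tr (hi *m (X *m gU *m X^T))
  - \sum_a \sum_b hi a b * bil (NB b) (x a) U = - (half * CH).
Hypothesis bach_term : \tr (hi *m (X *m del *m X^T)) =
  q4 * \tr (hi *m (X *m gam *m gi *m gam *m X^T)) - q4 * (nn * trB).

Definition Psharp : 'M[B]_(k, n) := - (X *m gam *m gi).
Definition mixed a : 'rV[B]_n := nrm (row a Psharp) - 2%:R *: nrm (cdr a U).
Definition Q2r := Jt + half * k%:R * aH.
(** The coefficient of [r^2] in the zeroth-order part of the operator for [l = 2]: the trace of
    [pmx] plus [(c2 - 1) aH], with [c2 = k / 2 + 2]. *)
Definition sig2 := - Jt - k%:R * aH + (half * k%:R + 1) * aH.
Definition Q4r := - dS (fun a => d_ a Q2r)
  - 2%:R * \tr (hi *m (Ptan + HLm - (half * aH) *: h) *m hi *m (Ptan + HLm - (half * aH) *: h)^T)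
  + 2%:R * (\sum_a \sum_b hi a b * bil g (mixed a) (mixed b))
  + half * k%:R * (Q2r * Q2r) - 2%:R * WHH - 4%:R * CH - 2%:R * (nn * trB).

Definition qmx : 'M[B]_k :=
  X *m del *m X^T + X *m gU *m X^T + (DU *m gam *m X^T + X *m gam *m DU^T)
  + DU *m g *m DU^T + (DAm cdr A *m g *m X^T + X *m g *m (DAm cdr A)^T)
  + half *: (RU *m g *m X^T + X *m g *m RU^T).
Definition bsc := 16%:R * bil g U A + 4%:R * bil gam U U.
Definition cvec a := 4%:R * bil g (x a) A + 2%:R * bil g (cdr a U) U + 2%:R * bil gam (x a) U.
(** The coefficient of [r^4] in that zeroth-order part, the factor [half k] being [c2 - 2]. *)
Definition bracket := - dS cvec + 2%:R * \tr (hi *m qmx) - \tr (hi *m pmx *m hi *m pmx)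
  - aH * \tr (hi *m pmx) - half * k%:R * (aH * aH - bsc).

Lemma Psharp_g : Psharp *m g *m X^T = Ptan.
Proof. by rewrite PtanE mulNmx mulNmx -(mulmxA _ gi) (GiG ggi) mulmx1. Qed.

Lemma d_half a : d_ a half = 0. Proof. exact: (deriv_half (DM a) half2). Qed.
Lemma d_nat a m : d_ a m%:R = 0. Proof. by rewrite raddfMn /= (deriv1 (DM a)) mul0rn. Qed.

Lemma dSB w w' : dS (fun a => w a - w' a) = dS w - dS w'.
Proof.
apply/eqP; rewrite eq_sym subr_eq -divSD; apply/eqP; apply: divS_ext => a.
by rewrite subrK.
Qed.

(** The right side, multiplied by [m], is four times the fourth coefficient of the operator for the
    boundary value [1], where [4 F2 = m sig2]. Since [m] has been divided out beforehand, the case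
    [m = 0] is included and settles the critical dimension. *)
Lemma Q4_identity (m : B) : m = half * k%:R - 2%:R ->
  Q4r = dS (fun a => d_ a sig2)
  + sig2 * (2%:R * \tr (hi *m pmx) + 2%:R * aH + m * sig2) + 4%:R * bracket.
Proof.
move=> mE.
have BR := bracket_eq half2 gsym hhi d_g gU del A RU gam_sym d_gam HU.
move: BR; cbv zeta; rewrite -/qmx -/(bsc) -/cvec => BR.
(* [T1], [T2] and [T3] split the traces into normal and tangential parts. The normal parts are the
   three terms of the square norm of [mixed] in [TM], the tangential ones match [TS] and [TPP]. *)
have T1 : \tr (hi *m (DU *m g *m DU^T)) =
    \sum_a \sum_b hi a b * bil g (nrm (cdr b U)) (nrm (cdr a U)) + q4 * \tr (hi *m HLm *m hi *m HLm).
  rewrite tr_nrm DUgX; congr (_ + _).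
    by apply: eq_bigr => a _; apply: eq_bigr => b _; rewrite !rowK.
  rewrite trmxN trmxZ HLm_sym !(mulmxN, mulNmx) opprK -!(scalemxAl, scalemxAr) scalerA.
  by rewrite mxtraceZ.
have T2 : \tr (hi *m (DU *m gam *m X^T)) =
    - (\sum_a \sum_b hi a b * bil g (nrm (cdr b U)) (nrm (row a Psharp)))
    + half * \tr (hi *m HLm *m hi *m Ptan).
  have -> : DU *m gam *m X^T = - (DU *m g *m Psharp^T).
    rewrite /Psharp trmxN trmx_mul3 (Gi_sym gsym ggi) gam_sym mulmxN opprK.
    by rewrite !mulmxA -(mulmxA DU g) ggi mulmx1.
  rewrite mulmxN mxtraceN tr_nrm Psharp_g Ptan_sym DUgX opprD; congr (- _ + _).
    by apply: eq_bigr => a _; apply: eq_bigr => b _; rewrite rowK.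
  have -> : hi *m - (half *: HLm) *m hi *m Ptan = - (half *: (hi *m HLm *m hi *m Ptan)).
    by rewrite (mulmxN hi) -scalemxAr !mulNmx -!scalemxAl.
  by rewrite mxtraceN opprK mxtraceZ.
have T3 : \tr (hi *m (X *m gam *m gi *m gam *m X^T)) =
    \sum_a \sum_b hi a b * bil g (nrm (row b Psharp)) (nrm (row a Psharp))
    + \tr (hi *m Ptan *m hi *m Ptan).
  have -> : X *m gam *m gi *m gam *m X^T = Psharp *m g *m Psharp^T.
    rewrite /Psharp trmxN trmx_mul3 (Gi_sym gsym ggi) gam_sym mulmxN !mulNmx opprK.
    by rewrite -(mulmxA _ gi g) (GiG ggi) mulmx1 !mulmxA.
  by rewrite tr_nrm Psharp_g Ptan_sym.
have symS (V W : 'I_k -> 'rV[B]_n) : \sum_a \sum_b hi a b * bil g (V b) (W a) =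
    \sum_a \sum_b hi a b * bil g (V a) (W b).
  by rewrite exchange_big; apply: eq_bigr => a _; apply: eq_bigr => b _; rewrite (Gs his).
have TM : \sum_a \sum_b hi a b * bil g (mixed a) (mixed b) =
   \sum_a \sum_b hi a b * bil g (nrm (row b Psharp)) (nrm (row a Psharp))
   - 4%:R * (\sum_a \sum_b hi a b * bil g (nrm (cdr b U)) (nrm (row a Psharp)))
   + 4%:R * (\sum_a \sum_b hi a b * bil g (nrm (cdr b U)) (nrm (cdr a U))).
  have -> : 4%:R * (\sum_a \sum_b hi a b * bil g (nrm (cdr b U)) (nrm (row a Psharp))) =
     2%:R * (\sum_a \sum_b hi a b * bil g (nrm (cdr b U)) (nrm (row a Psharp)))
     + 2%:R * (\sum_a \sum_b hi a b * bil g (nrm (cdr a U)) (nrm (row b Psharp))).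
    by rewrite symS; ring.
  rewrite (symS (fun a => nrm (cdr a U)) (fun a => nrm (cdr a U))) opprD.
  rewrite !mulr_sumr -!sumrN -!big_split; apply: eq_bigr => a _ /=.
  rewrite !mulr_sumr -!sumrN -!big_split; apply: eq_bigr => b _ /=.
  rewrite /mixed; move: (nrm _) (nrm _) (nrm _) (nrm _) => p2 u1 p1 u2.
  rewrite !bilBl !bilZl (bilC u2 (_ - _) gsym) (bilC p1 (_ - _) gsym) !bilBl !bilZl.
  rewrite (bilC u1 p1 gsym) (bilC p2 p1 gsym); ring.
have TS : \tr (hi *m (Ptan + HLm - (half * aH) *: h) *m hi *m (Ptan + HLm - (half * aH) *: h)^T) =
   \tr (hi *m Ptan *m hi *m Ptan) + \tr (hi *m HLm *m hi *m HLm) + 2%:R * \tr (hi *m HLm *m hi *m Ptan)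
   - aH * (Jt + k%:R * aH) + q4 * (k%:R * (aH * aH)).
  rewrite trmxD trmxN trmxZ trmxD Ptan_sym HLm_sym hs.
  rewrite !(mulmxDl, mulmxDr, mulmxN, mulNmx) -!(scalemxAl, scalemxAr) -!(mulmxA _ hi h).
  rewrite -!(mulmxA hi h hi) !hhi (mulmx1C hhi) !mulmx1.
  rewrite !(mxtraceD, mxtraceN, mxtraceZ) mxtrace1.
  have -> : \tr (hi *m Ptan *m hi *m HLm) = \tr (hi *m HLm *m hi *m Ptan).
    by rewrite -mulmxA mxtrace_mulC mulmxA.
  rewrite -/Jt tr_HL; set t1 := \tr _; set t2 := \tr _; set t3 := \tr _.
  apply/eqP; rewrite -subr_eq0; apply/eqP.
  transitivity ((1 - (half + half)) * (aH * (Jt + k%:R * aH))); first ring.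
  by rewrite half2 subrr mul0r.
have TPP : \tr (hi *m pmx *m hi *m pmx) =
   \tr (hi *m Ptan *m hi *m Ptan) + \tr (hi *m HLm *m hi *m HLm) + 2%:R * \tr (hi *m HLm *m hi *m Ptan).
  rewrite pE !(mulmxN, mulNmx) opprK !(mulmxDl, mulmxDr) !mxtraceD.
  have -> : \tr (hi *m Ptan *m hi *m HLm) = \tr (hi *m HLm *m hi *m Ptan).
    by rewrite -mulmxA mxtrace_mulC mulmxA.
  ring.
have TL : dS (fun a => d_ a sig2) = - dS (fun a => d_ a Q2r) + dS (fun a => d_ a aH).
  have -> : dS (fun a => d_ a sig2) = dS (fun a => d_ a aH - d_ a Q2r).
    apply: divS_ext => a; rewrite -raddfB; congr (d_ a _); rewrite /sig2 /Q2r.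
    rewrite (_ : _ - (Jt + _) = - Jt - (half + half) * k%:R * aH + (half * k%:R + 1) * aH); last ring.
    by rewrite half2 mul1r.
  by rewrite dSB addrC.
have TA : dS (fun a => d_ a aH) = 4%:R * dS (fun a => d_ a (bil g U U)).
  rewrite -(divS_natZ d_ half X g hi 4); apply: divS_ext => a.
  by rewrite /aH DM d_nat mul0r add0r.
have BR2 : - dS cvec + 2%:R * \tr (hi *m qmx) = - (half * k%:R * bsc)
   - dS (fun a => d_ a (bil g U U)) - 2%:R * k%:R * bil gam U U
   + 2%:R * \tr (hi *m (DU *m g *m DU^T)) + 2%:R * \tr (hi *m (RU *m g *m X^T))
   + 2%:R * \tr (hi *m (X *m gU *m X^T)) + 2%:R * \tr (hi *m (DU *m gam *m X^T))
   + 2%:R * \tr (hi *m (X *m del *m X^T))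
   - 2%:R * \sum_a \sum_b hi a b * bil (NB b) (x a) U.
  have -> : - dS cvec + 2%:R * \tr (hi *m qmx) = - (half * k%:R * bsc) +
    (half * k%:R * bsc + 2%:R * \tr (hi *m qmx) - dS cvec) by ring.
  by rewrite BR; ring.
have CT : \tr (hi *m (X *m gU *m X^T)) = - (half * CH)
   + \sum_a \sum_b hi a b * bil (NB b) (x a) U by rewrite -cotton_term subrK.
rewrite /Q4r /bracket BR2 TL TA T1 T2 CT bach_term T3 curvature_term TM TS TPP tr_p.
rewrite /sig2 /Q2r mE.
set C := CH; set W := WHH; set nt := nn * trB.
move: (bil gam U U) bsc (\sum_a _) (\sum_a _) (\sum_a _) (\sum_a _) => g1 g2 s1 s2 s3 s4.
move: (\tr (hi *m HLm *m hi *m HLm)) => thh; move: (\tr (hi *m HLm *m hi *m Ptan)) => thp.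
move: (\tr (hi *m Ptan *m hi *m Ptan)) => tpp; move: (dS _) (dS _) => u1 u2.
(* With all geometric quantities generalized, only a polynomial identity modulo [half + half = 1]
   remains. *)
move: Jt aH (k%:R : B) half half2 => J a kk hh h2.
apply/eqP; rewrite -subr_eq0; apply/eqP.
transitivity ((hh + hh - 1) * (- 4%:R * tpp * hh - 2%:R * tpp - 4%:R * thh * hh
  - 2%:R * thh - 4%:R * thp + 4%:R * J * a * hh + 2%:R * J * a - a * a * kk * hh
  + 2%:R * a * a * kk - 4%:R * s4 * hh - 2%:R * s4 + 2%:R * J * a * kk * kk * hh
  + 4%:R * W * hh + 2%:R * W + 4%:R * C + 4%:R * nt * hh + 2%:R * nt
  + a * a * kk * kk * kk * hh)); first ring.
by rewrite h2 subrr mul0r.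
Qed.

Definition Gr (u w : B) : B := \sum_a \sum_b hi a b * (d_ b u * d_ a w).

Lemma GrC u w : Gr u w = Gr w u.
Proof.
rewrite /Gr exchange_big; apply: eq_bigr => a _; apply: eq_bigr => b _ /=.
by rewrite (Gs his) [d_ a u * _]mulrC.
Qed.

Lemma GrDl u u' w : Gr (u + u') w = Gr u w + Gr u' w.
Proof.
rewrite -big_split; apply: eq_bigr => a _; rewrite -big_split; apply: eq_bigr => b _ /=.
by rewrite raddfD mulrDl mulrDr.
Qed.

Lemma GrMl m u w : (forall b, d_ b m = 0) -> Gr (m * u) w = m * Gr u w.
Proof.
move=> dm; rewrite mulr_sumr; apply: eq_bigr => a _; rewrite mulr_sumr.
by apply: eq_bigr => b _; rewrite DM dm mul0r add0r; ring.
Qed.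

Lemma dS_mul u (w : 'I_k -> B) :
  dS (fun a => u * w a) = u * dS w + \sum_a \sum_b hi a b * (d_ b u * w a).
Proof.
rewrite mulr_sumr -big_split; apply: eq_bigr => a _; rewrite mulr_sumr -big_split.
apply: eq_bigr => b _ /=; rewrite DM.
have -> : \sum_c GS d_ half X g hi b c a * (u * w c) = u * \sum_c GS d_ half X g hi b c a * w c.
  by rewrite mulr_sumr; apply: eq_bigr => c _; exact: mulrCA.
ring.
Qed.

Lemma dS_cst m (w : 'I_k -> B) : (forall b, d_ b m = 0) -> dS (fun a => m * w a) = m * dS w.
Proof.
move=> dm; rewrite dS_mul big1 ?addr0 // => a _; rewrite big1 // => b _.
by rewrite dm mul0r mulr0.
Qed.

Definition tcoef := (k%:R - 2%:R) * Jt + half * (k%:R ^+ 2 - 2%:R * k%:R + 4%:R) * aH.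
Definition Tmx : 'M[B]_k := 4%:R *: Ptan + 4%:R *: HLm - tcoef *: h.

(** After substitution of [4 F2], the Laplacian of [F0] carries the factor
    [2 m sig2 + 2 (tr p + aH)], which is [- tcoef]. The cross terms between gradients are those of
    the same factor, so all of this fits under one divergence, that of [Tmx]. *)
Lemma P4_identity (m F0 F2 : B) : m = half * k%:R - 2%:R ->
  4%:R * F2 = dS (fun a => d_ a F0) + m * F0 * sig2 ->
  4%:R * (2%:R * (\tr (hi *m pmx) + aH) * F2 + dS (fun a => d_ a F2)
    - dS (fun a => \sum_y (pmx *m hi) a y * d_ y F0)
    + half * (\sum_y d_ y (\tr (hi *m pmx) + aH) * \sum_a hi a y * d_ a F0)
    + m * F0 * bracket + m * F2 * sig2) =
  dS (fun a => d_ a (dS (fun b => d_ b F0)))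
  + dS (fun a => \sum_y (Tmx *m hi) a y * d_ y F0) + m * Q4r * F0.
Proof.
move=> mE F2E; have dm b : d_ b m = 0.
  by rewrite mE raddfB /= DM d_half !d_nat mul0r mulr0 !addr0 subrr.
have d4 b : d_ b (4%:R : B) = 0 by exact: d_nat.
have E1 : 4%:R * dS (fun a => d_ a F2) = dS (fun a => d_ a (dS (fun b => d_ b F0)))
    + m * (sig2 * dS (fun a => d_ a F0) + 2%:R * Gr sig2 F0 + F0 * dS (fun a => d_ a sig2)).
  rewrite -(dS_cst _ d4) (divS_ext _ _ _ _ _ (w' := fun a => d_ a (dS (fun b => d_ b F0))
    + m * (sig2 * d_ a F0 + F0 * d_ a sig2))) => [|a].
    rewrite divSD (dS_cst _ dm) divSD !dS_mul -/(Gr sig2 F0) -/(Gr F0 sig2) (GrC F0); ring.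
  have -> : 4%:R * d_ a F2 = d_ a (4%:R * F2) by rewrite DM d4 mul0r add0r.
  by rewrite F2E raddfD /= !DM dm; ring.
have E2 : \sum_y d_ y (\tr (hi *m pmx) + aH) * \sum_a hi a y * d_ a F0 =
    Gr (\tr (hi *m pmx) + aH) F0.
  under eq_bigr do rewrite mulr_sumr.
  by rewrite exchange_big; apply: eq_bigr => a _; apply: eq_bigr => b _ /=; ring.
have tE : - tcoef = 2%:R * m * sig2 + 2%:R * (\tr (hi *m pmx) + aH).
  rewrite tr_p /sig2 /tcoef mE; move: Jt aH => J a; apply/eqP; rewrite -subr_eq0; apply/eqP.
  transitivity ((half + half - 1) * (J * k%:R - half * k%:R ^+ 2 * a + 2%:R * a * k%:R - 2%:R * a)); first ring.
  by rewrite half2 subrr mul0r.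
have E3 : dS (fun a => \sum_y (Tmx *m hi) a y * d_ y F0) =
    - 4%:R * dS (fun a => \sum_y (pmx *m hi) a y * d_ y F0)
    + (- tcoef * dS (fun a => d_ a F0) + Gr (- tcoef) F0).
  have -> : dS (fun a => \sum_y (Tmx *m hi) a y * d_ y F0) =
     dS (fun a => - 4%:R * (\sum_y (pmx *m hi) a y * d_ y F0) + - tcoef * d_ a F0).
    apply: divS_ext => a.
    have -> : Tmx *m hi = - 4%:R *: (pmx *m hi) - tcoef *: 1%:M.
      rewrite /Tmx pE mulmxBl -scalemxAl hhi mulNmx mulmxDl -!scalemxAl mulmxDl.
      by move: (Ptan *m hi) (HLm *m hi) => *; mxring.
    have -> : - tcoef * d_ a F0 = \sum_y (- tcoef * (1%:M : 'M[B]_k) a y) * d_ y F0.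
      rewrite (bigD1 a) //= mxE eqxx mulr1 big1 ?addr0 // => y ya.
      by rewrite mxE eq_sym (negbTE ya) mulr0 mul0r.
    rewrite mulr_sumr -big_split; apply: eq_bigr => y _ /=.
    by rewrite !mxlinE; ring.
  have dn4 b : d_ b (- 4%:R : B) = 0 by rewrite raddfN /= d4 oppr0.
  by rewrite divSD (dS_cst _ dn4) dS_mul.
have E4 : Gr (- tcoef) F0 = 2%:R * m * Gr sig2 F0 + 2%:R * Gr (\tr (hi *m pmx) + aH) F0.
  rewrite tE GrDl !GrMl // => b; first exact: d_nat.
  by rewrite DM d_nat dm; ring.
rewrite E3 E4 tE (Q4_identity mE).
have -> : 4%:R * (2%:R * (\tr (hi *m pmx) + aH) * F2 + dS (fun a => d_ a F2)
    - dS (fun a => \sum_y (pmx *m hi) a y * d_ y F0)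
    + half * (\sum_y d_ y (\tr (hi *m pmx) + aH) * \sum_a hi a y * d_ a F0)
    + m * F0 * bracket + m * F2 * sig2) =
  (2%:R * (\tr (hi *m pmx) + aH) + m * sig2) * (4%:R * F2) + 4%:R * dS (fun a => d_ a F2)
    - 4%:R * dS (fun a => \sum_y (pmx *m hi) a y * d_ y F0)
    + (half + half) * (2%:R * Gr (\tr (hi *m pmx) + aH) F0)
    + 4%:R * (m * F0 * bracket) by rewrite E2; ring.
by rewrite half2 F2E E1; ring.
Qed.

End extrinsic_Q_curvature.

(** * Contractions of the Weyl, Cotton and Bach tensors *)

Section curvature_contractions.
Context {B : comNzRingType} {k n : nat}.

Lemma bilE (T : 'M[B]_n) u v : bil T u v = \sum_i \sum_j T i j * u 0 i * v 0 j.
Proof.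
rewrite /bil mxE exchange_big; apply: eq_bigr => j _; rewrite !mxE mulr_suml.
by apply: eq_bigr => i _; ring.
Qed.

Lemma sum4_prod (T T' : 'M[B]_n) (u v y z : 'rV[B]_n) :
  \sum_i \sum_j \sum_l \sum_m (T i l * T' j m) * u 0 i * v 0 j * y 0 l * z 0 m =
  bil T u y * bil T' v z.
Proof.
rewrite !bilE mulr_suml; apply: eq_bigr => i _; rewrite mulr_suml exchange_big.
apply: eq_bigr => l _ /=; rewrite mulr_sumr; apply: eq_bigr => j _.
by rewrite mulr_sumr; apply: eq_bigr => m _; ring.
Qed.

Lemma sum4_R (G : 'M[B]_n) (K : 'I_n -> 'I_n -> 'M[B]_n) (u v y z : 'rV[B]_n) :
  \sum_i \sum_j \sum_l \sum_m (\sum_p G i p * K l m p j) * u 0 i * v 0 j * y 0 l * z 0 m =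
  bil (G *m \sum_l \sum_m (y 0 l * z 0 m) *: K l m) u v.
Proof.
rewrite bilE; apply: eq_bigr => i _; apply: eq_bigr => j _.
rewrite mxE !mulr_suml.
transitivity (\sum_p \sum_l \sum_m G i p * K l m p j * u 0 i * v 0 j * y 0 l * z 0 m).
  rewrite [RHS]exchange_big; apply: eq_bigr => l _ /=; rewrite [RHS]exchange_big.
  by apply: eq_bigr => m _ /=; rewrite !mulr_suml.
apply: eq_bigr => p _; rewrite summxE mulr_sumr !mulr_suml; apply: eq_bigr => l _.
by rewrite summxE mulr_sumr !mulr_suml; apply: eq_bigr => m _; rewrite mxE; ring.
Qed.

Variables (half : B) (X : 'M[B]_(k, n)) (g gi gam : 'M[B]_n) (hi : 'M[B]_k) (U : 'rV[B]_n).
Hypothesis half2 : half + half = 1.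
Local Notation x a := (row a X).
Local Notation h := (X *m g *m X^T).
Local Notation q4 := (half * half).
Hypothesis gsym : g^T = g.
Hypothesis hhi : h *m hi = 1%:M.
Hypothesis UX : forall a, bil g U (x a) = 0.
Local Notation V := (2%:R *: U).

Section weyl_contraction.
Variable K : 'I_n -> 'I_n -> 'M[B]_n.
Hypothesis KN : forall l m, K l m = - K m l.

Definition Wcoef i j l m : B := \sum_p g i p * K l m p j
  - ((- gam) i l * g j m - (- gam) j l * g i m - (- gam) i m * g j l + (- gam) j m * g i l).

Definition Wtr : B := \sum_a \sum_b hi a b *
  \sum_i \sum_j \sum_l \sum_m Wcoef i j l m * X a i * V 0 j * X b l * V 0 m.

(** Of the four Schouten terms in the Weyl tensor, those that pair [V] with a tangent vector through
    [g] vanish because [U] is normal; the others give the trace of [P] and [gam(U, U)]. The factor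
    [q4] turns the two arguments [H = 2 U] into [U]. *)
Lemma curvature_contraction (RU : 'M[B]_(k, n)) :
  (forall b, row b RU = U *m (\sum_i \sum_j (U 0 i * (x b) 0 j) *: K i j)^T) ->
  \tr (hi *m (RU *m g *m X^T)) =
  - (q4 * Wtr) + k%:R * bil gam U U - q4 * (Jt X hi gam * aH g U).
Proof.
move=> RUE.
have E a b : \sum_i \sum_j \sum_l \sum_m Wcoef i j l m * X a i * V 0 j * X b l * V 0 m =
  4%:R * (- (RU *m g *m X^T) b a + bil gam (x a) (x b) * bil g U U + bil gam U U * h a b).
  transitivity (\sum_i \sum_j \sum_l \sum_m
      (\sum_p g i p * K l m p j) * (x a) 0 i * V 0 j * (x b) 0 l * V 0 m
    - \sum_i \sum_j \sum_l \sum_m ((- gam) i l * g j m) * (x a) 0 i * V 0 j * (x b) 0 l * V 0 m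
    + \sum_i \sum_j \sum_l \sum_m ((- gam) j l * g i m) * V 0 j * (x a) 0 i * (x b) 0 l * V 0 m
    + \sum_i \sum_j \sum_l \sum_m ((- gam) i m * g j l) * (x a) 0 i * V 0 j * V 0 m * (x b) 0 l
    - \sum_i \sum_j \sum_l \sum_m ((- gam) j m * g i l) * V 0 j * (x a) 0 i * V 0 m * (x b) 0 l).
    rewrite -!sumrN -!big_split; apply: eq_bigr => i _; rewrite -!sumrN -!big_split.
    apply: eq_bigr => j _; rewrite -!sumrN -!big_split; apply: eq_bigr => l _.
    rewrite -!sumrN -!big_split; apply: eq_bigr => m _ /=.
    rewrite /Wcoef [(x a) 0 i]mxE [(x b) 0 l]mxE; ring.
  rewrite sum4_R sum4_prod.
  have -> : \sum_i \sum_j \sum_l \sum_m ((- gam) j l * g i m) * V 0 j * (x a) 0 i * (x b) 0 l * V 0 m =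
     bil (- gam) V (x b) * bil g (x a) V.
    by rewrite exchange_big -sum4_prod.
  have -> : \sum_i \sum_j \sum_l \sum_m ((- gam) i m * g j l) * (x a) 0 i * V 0 j * V 0 m * (x b) 0 l =
     bil (- gam) (x a) V * bil g V (x b).
    rewrite -sum4_prod; apply: eq_bigr => i _; apply: eq_bigr => j _; exact: exchange_big.
  have -> : \sum_i \sum_j \sum_l \sum_m ((- gam) j m * g i l) * V 0 j * (x a) 0 i * V 0 m * (x b) 0 l =
     bil (- gam) V V * bil g (x a) (x b).
    rewrite exchange_big -sum4_prod; apply: eq_bigr => i _; apply: eq_bigr => j _; exact: exchange_big.
  have vx c : bil g V (x c) = 0 by rewrite bilZl UX mulr0.
  have RE : bil (g *m \sum_l \sum_m ((x b) 0 l * V 0 m) *: K l m) (x a) V =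
     - (4%:R * (RU *m g *m X^T) b a).
    rewrite mx_bil RUE /bil -[in RHS](trmxK (_ *m g *m _)) [in RHS]mxE trmx_mul3 trmxK gsym.
    rewrite trmx_mul trmxK mulmxA.
    have -> : \sum_l \sum_m ((x b) 0 l * V 0 m) *: K l m =
       - (2%:R *: (\sum_i \sum_j (U 0 i * (x b) 0 j) *: K i j)).
      rewrite exchange_big scaler_sumr -sumrN; apply: eq_bigr => i _ /=.
      rewrite scaler_sumr -sumrN; apply: eq_bigr => j _ /=.
      by rewrite KN scalerN scalerA [V 0 i]mxE; congr (- (_ *: _)); ring.
    move: (\sum_i _) => S; rewrite !mulmxN !mulNmx trmxZ -!scalemxAr -!scalemxAl !mulmxA.
    by rewrite mxN_E !mxZ_E mulrA -natrM.
  rewrite RE !vx (bilC (x a) V gsym) vx !bilNT !bilZl -!mx_bil.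
  have gV T : bil T U V = 2%:R * bil T U U.
    by rewrite /bil trmxZ -scalemxAr mxE.
  rewrite !gV; ring.
have q x' : q4 * (4%:R * x') = x'.
  have -> : q4 * (4%:R * x') = (half + half) * ((half + half) * x') by ring.
  by rewrite half2 !mul1r.
have -> : q4 * Wtr = - \tr (hi *m (RU *m g *m X^T)) - Jt X hi gam * bil g U U
     + k%:R * bil gam U U.
  rewrite /Wtr; under eq_bigr do under eq_bigr do rewrite E.
  have -> : \tr (hi *m (RU *m g *m X^T)) = \sum_a \sum_b hi a b * (RU *m g *m X^T) b a.
    by apply: eq_bigr => a _; rewrite mxE.
  have -> : Jt X hi gam = - \sum_a \sum_b hi a b * bil gam (x a) (x b).
    rewrite /Jt PtanE mulmxN mxtraceN /mxtrace; congr (- _).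
    rewrite exchange_big; apply: eq_bigr => a _; rewrite mxE; apply: eq_bigr => b _.
    by rewrite mx_bil (Gis (frame_sym X gsym) hhi).
  have -> : k%:R * bil gam U U = (\sum_a \sum_b hi a b * h a b) * bil gam U U.
    congr (_ * _); rewrite -(mxtrace1 B k) -hhi mxtrace_mulC /mxtrace.
    apply: eq_bigr => a _; rewrite mxE; apply: eq_bigr => b _.
    by rewrite (Gs (frame_sym X gsym)).
  rewrite mulNr opprK !mulr_suml -!sumrN mulr_sumr -!big_split; apply: eq_bigr => a _ /=.
  rewrite !mulr_suml -!sumrN mulr_sumr -!big_split; apply: eq_bigr => b _ /=.
  by rewrite mulrCA q; ring.
rewrite /aH.
have -> : q4 * (Jt X hi gam * (4%:R * bil g U U)) = Jt X hi gam * bil g U U.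
  by rewrite mulrCA q.
ring.
Qed.
End weyl_contraction.

Section cotton_contraction.
Variable NBc : 'I_n -> 'M[B]_n.

Definition Ctr : B := \sum_a \sum_b hi a b *
  \sum_i \sum_j \sum_l (- NBc l i j - - NBc j i l) * X a i * X b j * V 0 l.

(** The derivative of [gam] along [U] and its derivative along the frame are the two halves of the
    Cotton tensor; [half] turns [H = 2 U] into [U]. *)
Lemma cotton_contraction :
  \tr (hi *m (X *m (\sum_l U 0 l *: NBc l) *m X^T))
  - \sum_a \sum_b hi a b * bil (\sum_l (x b) 0 l *: NBc l) (x a) U = - (half * Ctr).
Proof.
have S (Z u v : 'rV[B]_n) : bil (\sum_l Z 0 l *: NBc l) u v =
    \sum_i \sum_j \sum_l NBc l i j * u 0 i * v 0 j * Z 0 l.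
  rewrite bilE; apply: eq_bigr => i _; apply: eq_bigr => j _.
  rewrite summxE !mulr_suml; apply: eq_bigr => l _; rewrite mxE; ring.
have -> : \tr (hi *m (X *m (\sum_l U 0 l *: NBc l) *m X^T)) =
    \sum_a \sum_b hi a b * bil (\sum_l U 0 l *: NBc l) (x a) (x b).
  rewrite exchange_big; apply: eq_bigr => a _; rewrite mxE; apply: eq_bigr => b _.
  by rewrite mx_bil (Gis (frame_sym X gsym) hhi).
rewrite -sumrB /Ctr mulr_sumr -sumrN; apply: eq_bigr => a _.
rewrite -sumrB mulr_sumr -sumrN; apply: eq_bigr => b _; rewrite -mulrBr mulrCA -mulrN.
congr (_ * _); rewrite !S.
have -> : \sum_i \sum_j \sum_l NBc l i j * (x a) 0 i * U 0 j * (x b) 0 l =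
    \sum_i \sum_j \sum_l NBc j i l * (x a) 0 i * U 0 l * (x b) 0 j.
  by apply: eq_bigr => i _; exact: exchange_big.
rewrite -sumrB mulr_sumr -sumrN; apply: eq_bigr => i _; rewrite -sumrB mulr_sumr -sumrN.
apply: eq_bigr => j _; rewrite -sumrB mulr_sumr -sumrN; apply: eq_bigr => l _.
rewrite !mxE; transitivity ((half + half) * ((NBc l i j - NBc j i l) * X a i * X b j * U 0 l)).
  by rewrite half2 mul1r; ring.
ring.
Qed.
End cotton_contraction.

(** Tracing with the symmetric [hi] undoes the symmetrization in [del_bach]. The element [nn]
    inverts [n - 4]. *)
Lemma bach_contraction (del Bt : 'M[B]_n) (nn N4 : B) : nn * N4 = 1 ->
  (forall i j, 8%:R * N4 * del i j = 2%:R * N4 * (gam *m gi *m gam) i j - (Bt i j + Bt j i)) ->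
  \tr (hi *m (X *m del *m X^T)) =
  q4 * \tr (hi *m (X *m gam *m gi *m gam *m X^T)) - q4 * (nn * \tr (hi *m (X *m Bt *m X^T))).
Proof.
move=> nN dE; have his := Gi_sym (frame_sym X gsym) hhi.
have E : 8%:R * N4 *: del = 2%:R * N4 *: (gam *m gi *m gam) - (Bt + Bt^T).
  by apply/matrixP => i j; rewrite !mxlinE dE [Bt^T i j]mxE.
have tT (T : 'M[B]_n) : \tr (hi *m (X *m T^T *m X^T)) = \tr (hi *m (X *m T *m X^T)).
  by rewrite -[LHS]mxtrace_tr trmx_mul trmx_mul3 !trmxK his mxtrace_mulC.
have := congr1 (fun T => \tr (hi *m (X *m T *m X^T))) E.
rewrite !(mulmxBr, mulmxDr, mulmxBl, mulmxDl) -!scalemxAr -!scalemxAl -!scalemxAr.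
rewrite !mxtraceD !mxtraceZ mxtraceN mxtraceD tT !mulmxA.
set d := \tr _; set t := \tr _; set b := \tr _ => H.
have H' := congr1 (fun z => (half * half * half * nn) * z) H.
have h8 : half * half * half * 8%:R = 1 :> B.
  have -> : half * half * half * 8%:R = (half + half) * (half + half) * (half + half) by ring.
  by rewrite half2 !mul1r.
transitivity (half * half * half * 8%:R * (nn * N4) * d); first by rewrite h8 nN !mul1r.
transitivity (half * half * half * nn * (8%:R * N4 * d)); first ring.
rewrite H; transitivity ((half + half) * (q4 * (nn * N4) * t) - (half + half) * (q4 * (nn * b))).
  ring.
by rewrite half2 nN !mul1r mulr1.
Qed.

End curvature_contractions.

(** * The geometric formulas as elements of the ring *)

Section submanifold_frame.
Context {R : realType} {k n : nat} (V0 : odom R k) (e : R) (e0 : 0 < e).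
Context (W0 : odom R n) (e' : R) (e0' : 0 < e').
Local Notation A := (smf (obox V0 e0)).
Local Notation B := (smf V0).
Local Notation C := (smf (obox W0 e0')).
Local Notation C0 := (smf W0).
Local Notation half := (scst 2^-1).
Variable E : 'I_n -> A.
Hypothesis UV : forall y, obox V0 e0 y -> obox W0 e0' (\row_i emap E i y).
Hypothesis E1 : forall i, co 1 (E i) = 0.
Hypothesis E3 : forall i, co 3 (E i) = 0.
Variables (g gi : 'M[C]_n).
Hypothesis gsym : g^T = g.
Hypothesis ggi : g *m gi = 1%:M.
Hypothesis g1 : cmx 1 g = 0.
Hypothesis g3 : cmx 3 g = 0.
Local Notation D0 := (@sDa R _ W0).
Local Notation d_ := (@sDa R _ V0).
Local Notation g0 := (cmx 0 g).
Local Notation gi0 := (cmx 0 gi).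
Local Notation G0 := (Gam D0 half g0 gi0).
Local Notation io := (iot UV).
Local Notation X := (Xm E).
Local Notation U := (Ur E).
Local Notation gH := (gh UV g).
Local Notation gamH := (gamh UV g).
Variable hi : 'M[B]_k.
Hypothesis hhi : X *m gH *m X^T *m hi = 1%:M.
Hypothesis UX : X *m gH *m U^T = 0.

Definition cdr (b : 'I_k) (Z : 'rV[B]_n) : 'rV[B]_n := row b (cd UV g gi Z).
Definition nabU : 'M[B]_n := NB UV g gi U.

Lemma cdr_gh b Y Z : d_ b (bil gH Y Z) = bil gH (cdr b Y) Z + bil gH Y (cdr b Z).
Proof.
have /matrixP/(_ 0 0) := d_pair UV gi gsym b Y Z gH; rewrite [LHS]mxE => ->.
by rewrite covT_gh // mulmx0 mul0mx addr0 mxD_E.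
Qed.

Lemma cdr_gam b Y Z : d_ b (bil gamH Y Z) =
  bil gamH (cdr b Y) Z + bil (NB UV g gi (row b X)) Y Z + bil gamH Y (cdr b Z).
Proof.
have /matrixP/(_ 0 0) := d_pair UV gi gsym b Y Z gamH; rewrite [LHS]mxE => ->.
by rewrite covT_gam // !mxD_E.
Qed.

Lemma cdr_torsion a b : cdr b (row a X) = cdr a (row b X).
Proof. exact: cd_XC. Qed.

Lemma normal_U a : bil gH U (row a X) = 0.
Proof.
have /matrixP/(_ a 0) := UX; rewrite mx_bil bilC ?gh_sym // mxE.
by rewrite (_ : row 0 U = U) //; apply/rowP => i; rewrite mxE.
Qed.

Lemma nabU_E : nabU = gamU UV g - (GG UV g gi U)^T *m gamH - gamH *m GG UV g gi U.
Proof. by rewrite /nabU NB_E opprD addrA. Qed.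

Lemma DUm_cdr Z : DUm cdr Z = cd UV g gi Z.
Proof. by apply/row_matrixP => b; rewrite rowK. Qed.
Lemma DAm_cdr Z : DAm cdr Z = cd UV g gi Z.
Proof. by apply/row_matrixP => b; rewrite rowK. Qed.

Local Notation AR := (Ar UV g gi).
Local Notation Rmx := (RU UV g gi).

Lemma Hh2_pmx : cmx 2 (Hh UV g) = pmx X gH cdr gamH U.
Proof. by rewrite (Hh2 UV E1 E3 gsym ggi g1 g3) /pmx DUm_cdr. Qed.

Lemma Hh4_qmx : cmx 4 (Hh UV g) = qmx half X gH cdr gamH U nabU (delh UV g) AR Rmx.
Proof. by rewrite (Hh4 UV E1 E3 gsym ggi g1 g3) /qmx DUm_cdr DAm_cdr nabU_E. Qed.

Lemma Hc3_cvec a : cmx 3 (Hc UV g) a 0 = cvec X gH cdr gamH U AR a.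
Proof.
have lin3 (c1 c2 : B) (P Q T : 'M[B]_(k, 1)) :
    (c1 *: P + c2 *: Q + c2 *: T) a 0 = c1 * P a 0 + c2 * Q a 0 + c2 * T a 0 by rewrite !mxlinE.
rewrite (Hc3 UV E1 E3 gsym ggi g1 g3) lin3 3!mx_bil /cvec.
have r0 (Z : 'rV[B]_n) : row 0 Z = Z by apply/rowP => i; rewrite mxE.
by rewrite !r0.
Qed.

Lemma Ha2_aH : cmx 2 (Ha UV g) = (aH gH U)%:M.
Proof. by apply/matrixP => i j; rewrite !ord1 Ha2 // [RHS]mxE eqxx mulr1n mxE. Qed.

Lemma Ha4_bsc : cmx 4 (Ha UV g) = (bsc gH gamH U AR)%:M.
Proof.
apply/matrixP => i j; rewrite !ord1 (Ha4 UV E1 E3 gsym ggi g1 g3) [RHS]mxE eqxx mulr1n.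
by rewrite mxD_E !mxZ_E.
Qed.

Variables (GD : 'rV[R]_n -> 'M[R]_n) (phi : 'rV[R]_k -> 'rV[R]_n).
Hypothesis GDE : forall y, W0 y -> GD y = mev y g0.
Hypothesis phiE : forall x, V0 x -> phi x = \row_i X0 E i x.
Local Notation hH := (X *m gH *m X^T).
Local Notation Lm := (LL d_ half X gH hi cdr).
Local Notation nr := (nrm X gH hi).

Lemma phi_in x : V0 x -> W0 (phi x).
Proof. by move=> Vx; rewrite phiE //; exact: (X0_in UV Vx). Qed.

Lemma iotE f x : V0 x -> io f x = f (phi x).
Proof. by move=> Vx; rewrite /iot spullE // phiE. Qed.

Lemma mev_iot m p (T : 'M[C0]_(m, p)) x : V0 x -> mev x (map_mx io T) = mev (phi x) T.
Proof. by move=> Vx; apply/matrixP => i j; rewrite !mxE iotE. Qed.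

Lemma GD_gh x : V0 x -> GD (phi x) = mev x gH.
Proof. by move=> Vx; rewrite GDE ?mev_iot //; exact: phi_in. Qed.

Lemma jac_smf x : V0 x -> jac phi x = mev x X.
Proof.
move=> Vx; apply/matrixP => a i; rewrite !mxE; apply: pd_smf => // y Vy.
by rewrite phiE // mxE.
Qed.

Lemma mev3 m p q r x (P : 'M[B]_(m, p)) (Q : 'M[B]_(p, q)) (S : 'M[B]_(q, r)) : V0 x ->
  mev x (P *m Q *m S) = mev x P *m mev x Q *m mev x S.
Proof. by move=> Vx; rewrite !mevM. Qed.

Lemma pullback_smf x : V0 x -> pullback GD phi x = mev x hH.
Proof. by move=> Vx; rewrite /pullback mev3 // mevT -jac_smf // GD_gh. Qed.

Lemma inv_pullback_smf x : V0 x -> invmx (pullback GD phi x) = mev x hi.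
Proof. by move=> Vx; rewrite (invmx_smf pullback_smf hhi). Qed.

Lemma cov_along_smf a (V : 'rV[R]_k -> 'rV[R]_n) (Vs : 'rV[B]_n) x :
  (forall y, V0 y -> V y = mev y Vs) -> V0 x -> cov_along GD phi a V x = mev x (cdr a Vs).
Proof.
move=> VE Vx; rewrite /cdr (row_cd UV gi gsym); apply/rowP => i; rewrite mxE [RHS]mxE mxD_E smfD //.
congr (_ + _).
  by rewrite [map_mx _ _ _ _]mxE; apply: pd_smf => // y Vy; rewrite VE // mevE.
rewrite [(_ *m _) 0 i]mxE smf_sum // exchange_big; apply: eq_bigr => l _ /=.
rewrite smfM // [_^T _ _]mxE GG_E smf_sum // mulr_sumr; apply: eq_bigr => j _.
have W := phi_in Vx.
rewrite smfM // (christoffel_smf GDE (cmx0_inv ggi)) // jac_smf // VE // !mxE iotE //.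
by rewrite mulrC [X in _ * X]mulrC.
Qed.

Lemma normal_part_smf x v (Vs : 'rV[B]_n) : V0 x -> v = mev x Vs ->
  normal_part GD phi x v = mev x (nr Vs).
Proof.
move=> Vx ->; rewrite nrmE; have mevB (P Q : 'rV[B]_n) : mev x (P - Q) = mev x P - mev x Q.
  by apply/rowP => i; rewrite !mxE smfB.
by rewrite mevB !mevM // mevT -jac_smf // /normal_part inv_pullback_smf // GD_gh.
Qed.

Lemma second_ff_smf a b x : V0 x -> second_ff GD phi a b x = mev x (Lm a b).
Proof.
move=> Vx; rewrite (LL_proj (half2 V0)) //; [|exact: gh_sym|exact: cdr_gh|exact: cdr_torsion].
rewrite -nrmE; apply: normal_part_smf => //.
apply: cov_along_smf => // y Vy; rewrite jac_smf //.
by apply/rowP => i; rewrite !mxE.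
Qed.

Hypothesis k1 : (0 < k)%N.
Hypothesis HU : \sum_a \sum_b hi a b *: Lm b a = (2%:R * k%:R) *: U.

Lemma mean_curv_smf x : V0 x -> mean_curv GD phi x = mev x (2%:R *: U).
Proof.
move=> Vx; have k0 : k%:R != 0 :> R by rewrite pnatr_eq0 -lt0n.
rewrite /mean_curv; apply: (scalerI k0); rewrite scalerA divff // scale1r.
have -> : k%:R *: mev x (2%:R *: U) = mev x (\sum_a \sum_b hi a b *: Lm b a).
  apply/rowP => i; rewrite HU !mxE smfM // [in RHS]smfM // smfM // !smf_nat //.
  by rewrite mulrA [k%:R * _]mulrC.
have -> : mev x (\sum_a \sum_b hi a b *: Lm b a) = \sum_a \sum_b mev x hi a b *: mev x (Lm b a).
  rewrite -[LHS]/(map_mx (sev Vx) _) raddf_sum; apply: eq_bigr => a _.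
  by rewrite raddf_sum; apply: eq_bigr => b _; rewrite /= map_mxZ mxE.
rewrite exchange_big; apply: eq_bigr => b _; apply: eq_bigr => a _ /=.
rewrite inv_pullback_smf // second_ff_smf // !mxE.
by rewrite (Gis (frame_sym X (gh_sym UV gsym)) hhi).
Qed.

Hypothesis n3 : (3 <= n)%N.
Local Notation Q := (PQ (@sDa R _ (obox W0 e0')) half (sr W0 e0') g gi).
Hypothesis Q1 : forall i j, co 1 (Q (lshift 1 i) (lshift 1 j)) = 0.
Local Notation Pt := (Ptan X gamH).
Local Notation HLs := (HLm d_ half X gH hi cdr U).

Lemma schouten_smf i j y : W0 y -> schouten GD i j y = (- cmx 2 g) i j y.
Proof. by move=> Wy; exact: (schouten_P gsym ggi g1 Q1 i j n3 GDE Wy). Qed.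

Lemma inner_smf x (v w : 'rV[R]_n) (vs ws : 'rV[B]_n) : V0 x -> v = mev x vs -> w = mev x ws ->
  inner GD (phi x) v w = bil gH vs ws x.
Proof. by move=> Vx -> ->; rewrite /inner GD_gh // -mevT -mev3 // mevE. Qed.

Lemma schouten_mx_smf x : V0 x -> schouten_mx GD (phi x) = mev x (- gamH).
Proof.
move=> Vx; have Wx := phi_in Vx; apply/matrixP => i j; rewrite !mxE schouten_smf //.
by rewrite mxN_E !smfN // iotE.
Qed.

Lemma schouten_tan_smf x : V0 x -> schouten_tan GD phi x = mev x Pt.
Proof.
move=> Vx; rewrite /schouten_tan schouten_mx_smf // jac_smf // -mevT -mev3 // PtanE.
by rewrite mulmxN mulNmx.
Qed.

Lemma tr_schouten_smf x : V0 x -> tr_schouten GD phi x = Jt X hi gamH x.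
Proof.
by move=> Vx; rewrite /tr_schouten schouten_tan_smf // inv_pullback_smf // -mevM // -mev_tr.
Qed.

Lemma H_normsq_smf x : V0 x -> H_normsq GD phi x = aH gH U x.
Proof.
move=> Vx; rewrite /H_normsq (inner_smf Vx (mean_curv_smf Vx) (mean_curv_smf Vx)).
congr (smf_fun _ x); rewrite (bilZl gH 2%:R U) (bilC U (2%:R *: U) (gh_sym UV gsym)).
by rewrite (bilZl gH 2%:R U) /aH; move: (bil _ _ _) => t; ring.
Qed.

Lemma HL_smf x : V0 x -> HL GD phi x = mev x HLs.
Proof.
move=> Vx; apply/matrixP => a b; rewrite !mxE.
by rewrite (inner_smf Vx (mean_curv_smf Vx) (second_ff_smf _ _ Vx)) bilZl.
Qed.

Definition gih : 'M[B]_n := ghi UV gi.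

Lemma gh_gih : gH *m gih = 1%:M.
Proof. exact: gh_inv. Qed.

Local Notation Mix := (mixed X gH gih hi cdr gamH U).

Lemma inv_GD x : V0 x -> invmx (GD (phi x)) = mev x gih.
Proof.
move=> Vx; rewrite (invmx_smf GDE (cmx0_inv ggi)) ?(mev_iot (cmx 0 gi) Vx) //.
exact: phi_in.
Qed.

Lemma mixed_term_smf a x : V0 x -> mixed_term GD phi a x = mev x (Mix a).
Proof.
move=> Vx; rewrite /mixed_term /mixed.
rewrite (normal_part_smf (Vs := row a (Psharp X gih gamH)) Vx); last first.
  rewrite schouten_mx_smf // jac_smf // inv_GD // /Psharp.
  have -> : row a (mev x X) = mev x (row a X) by apply/rowP => i; rewrite !mxE.
  by rewrite -mev3 // -!row_mul mulmxN mulNmx.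
rewrite /normal_nabla (normal_part_smf (Vs := cdr a (2%:R *: U)) Vx); last first.
  by apply: cov_along_smf => // y; exact: mean_curv_smf.
have -> : nr (cdr a (2%:R *: U)) = 2%:R *: nr (cdr a U).
  have -> : cdr a (2%:R *: U) = 2%:R *: cdr a U.
    rewrite /cdr !(row_cd UV gi gsym) -scalemxAl scalerDr; congr (_ + _).
    by apply/rowP => i; rewrite !mxE /= sDM sD_nat mul0r add0r.
  by rewrite !nrmE scalerBr !scalemxAl.
by apply/rowP => i; rewrite !mxE smfB.
Qed.

Lemma sum2_smf (I J : finType) (F : I -> J -> B) (f : I -> J -> R) x : V0 x ->
  (forall a b, f a b = F a b x) -> \sum_a \sum_b f a b = (\sum_a \sum_b F a b) x.
Proof.
move=> Vx fF; rewrite smf_sum //; apply: eq_bigr => a _; rewrite smf_sum //.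
by apply: eq_bigr => b _.
Qed.

Lemma mixed_normsq_smf x : V0 x -> mixed_term_normsq GD phi x =
  (\sum_a \sum_b hi a b * bil gH (Mix a) (Mix b)) x.
Proof.
move=> Vx; apply: sum2_smf => // a b; rewrite inv_pullback_smf // smfM // mevE.
by rewrite (inner_smf Vx (mixed_term_smf _ Vx) (mixed_term_smf _ Vx)).
Qed.

Lemma Q2_formula_smf x : V0 x -> Q2_formula GD phi x = Q2r half X gH hi gamH U x.
Proof.
move=> Vx; rewrite /Q2_formula tr_schouten_smf // H_normsq_smf // /Q2r.
move: (Jt _ _ _) (aH _ _) => J a; by rewrite smfD // !smfM // scstE // smf_nat // [_ / 2]mulrC.
Qed.

Local Notation dS := (divS d_ half X gH hi).

Lemma divergence_dS (w : 'I_k -> 'rV[R]_k -> R) (ws : 'I_k -> B) x :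
  (forall a y, V0 y -> w a y = ws a y) -> V0 x ->
  divergence (pullback GD phi) w x = dS ws x.
Proof. by move=> wE Vx; rewrite (divergence_smf pullback_smf hhi wE). Qed.

Lemma laplacian_smf (f : 'rV[R]_k -> R) (fs : B) x :
  (forall y, V0 y -> f y = fs y) -> V0 x ->
  laplacian (pullback GD phi) f x = dS (fun a => d_ a fs) x.
Proof. by move=> fE Vx; apply: divergence_dS => // a y Vy; exact: pd_smf. Qed.

Lemma div_T_grad_smf T (Ts : 'M[B]_k) (f : 'rV[R]_k -> R) (fs : B) x :
  (forall y, V0 y -> T y = mev y Ts) ->
  (forall y, V0 y -> f y = fs y) -> V0 x ->
  div_T_grad (pullback GD phi) T f x = dS (fun a => \sum_y (Ts *m hi) a y * d_ y fs) x.
Proof.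
move=> TE fE Vx; apply: divergence_dS => // a y Vy.
rewrite smf_sum // exchange_big; apply: eq_bigr => c _ /=.
rewrite smfM // mxE smf_sum // mulr_suml; apply: eq_bigr => b _.
by rewrite smfM // TE // inv_pullback_smf // !mevE (pd_smf _ fE).
Qed.

Lemma T_formula_smf x : V0 x -> T_formula GD phi x =
  mev x (Tmx d_ half X gH hi cdr gamH U).
Proof.
move=> Vx; have tE : tcoef half X gH hi gamH U x = (k%:R - 2) * Jt X hi gamH x +
    2^-1 * (k%:R ^+ 2 - 2 * k%:R + 4) * aH gH U x.
  rewrite /tcoef; move: (Jt _ _ _) (aH _ _) => J t.
  rewrite smfD // (smfM _ J) // (smfM _ t) // (smfM (scst _)) // scstE // smfB // !smf_nat //.
  by rewrite smfD // smfB // smfX // (smfM 2%:R) // !smf_nat.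
rewrite /T_formula schouten_tan_smf // HL_smf // tr_schouten_smf // H_normsq_smf //.
rewrite pullback_smf // -tE /Tmx; move: (Pt) (HLs) (tcoef _ _ _ _ _ _) (hH) => P L t h'.
apply/matrixP => a b; rewrite mevE !mxlinE.
by rewrite smfB // smfD // !smfM // !mevE !smf_nat.
Qed.

Local Notation Kr := (fun l m => map_mx io (Rm D0 G0 l m)).
Local Notation NBr := (fun l => map_mx io (nab D0 half g0 gi0 l (cmx 2 g))).
Local Notation Bm := (map_mx io (\matrix_(i, j) bachs g0 gi0 (- cmx 2 g) i j)).
Local Notation WHH := (Wtr X gH gamH hi U Kr).
Local Notation CH := (Ctr X hi U NBr).
Local Notation trB := (\tr (hi *m (X *m Bm *m X^T))).

Lemma riemann_smf i j l m y : W0 y -> riemann GD i j l m y =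
  (\sum_p g0 i p * Rm D0 G0 l m p j) y.
Proof.
move=> Wy; rewrite /riemann smf_sum //; apply: eq_bigr => p _.
by rewrite smfM // GDE // mevE (riemann_up_smf GDE (cmx0_inv ggi)).
Qed.

Lemma weyl_smf i j l m x : V0 x -> weyl GD i j l m (phi x) = Wcoef gH gamH Kr i j l m x.
Proof.
move=> Vx; have Wx := phi_in Vx.
have Ex (t a b c d p q r s : B) : (t - (a * b - c * d - p * q + r * s)) x =
    t x - (a x * b x - c x * d x - p x * q x + r x * s x).
  by rewrite smfB // smfD // !smfB // !smfM.
rewrite /Wcoef Ex /weyl riemann_smf // !schouten_smf // GDE // !mxN_E !smfN // !mxE !iotE //.
congr (_ - _); rewrite smf_sum // smf_sum //; apply: eq_bigr => p _.
by rewrite !smfM // !mxE !iotE.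
Qed.

Lemma weyl_HH_smf x : V0 x -> weyl_HH GD phi x = WHH x.
Proof.
move=> Vx; apply: sum2_smf => // a b; rewrite inv_pullback_smf // smfM // mevE; congr (_ * _).
rewrite smf_sum //; apply: eq_bigr => i _; apply: sum2_smf => // j l.
rewrite smf_sum //; apply: eq_bigr => m _.
by rewrite !smfM // weyl_smf // jac_smf // mean_curv_smf // !mevE.
Qed.

Lemma cotton_H_smf x : V0 x -> cotton_H GD phi x = CH x.
Proof.
move=> Vx; have Wx := phi_in Vx.
apply: sum2_smf => // a b; rewrite inv_pullback_smf // smfM // mevE; congr (_ * _).
rewrite smf_sum //; apply: eq_bigr => i _; apply: sum2_smf => // j l.
rewrite !smfM // jac_smf // mean_curv_smf // !mevE; congr (_ * _ * _ * _).
rewrite (cotton_smf GDE (cmx0_inv ggi) schouten_smf) // /cotP /covP smfB // smfB // !smfN //.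
rewrite (nabN _ _ l (cmx 2 g)) (nabN _ _ j (cmx 2 g)).
move: (nab D0 half g0 gi0 l _) (nab D0 half g0 gi0 j _) => S1 S2.
by rewrite !mxN_E !smfN // !mxE !iotE.
Qed.

Lemma tr_bach_smf x : V0 x -> tr_bach GD phi x = trB x.
Proof.
move=> Vx; rewrite /tr_bach inv_pullback_smf // mev_tr // mevM // mev3 // mevT -jac_smf //.
congr (\tr (_ *m (_ *m _ *m _))); have Wx := phi_in Vx.
rewrite mev_iot //; apply/matrixP => i j; rewrite !mxE.
rewrite (bach_smf GDE (cmx0_inv ggi) schouten_smf) //; first exact: g0_sym.
by rewrite trmxN gam_sym.
Qed.

Lemma tensor_normsq_smf x T (Ts : 'M[B]_k) : V0 x -> T = mev x Ts ->
  tensor_normsq (pullback GD phi) x T = \tr (hi *m Ts *m hi *m Ts^T) x.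
Proof. by move=> Vx ->; rewrite /tensor_normsq inv_pullback_smf // mev_tr // !mevM // mevT. Qed.

Local Notation nn := (scst (n%:R - 4)^-1).
Local Notation Q4s := (Q4r d_ half X gH gih hi cdr gamH U WHH CH trB nn).

Lemma Q4_formula_smf x : V0 x -> Q4_formula GD phi x = Q4s x.
Proof.
move=> Vx; rewrite /Q4_formula weyl_HH_smf // cotton_H_smf // tr_bach_smf // mixed_normsq_smf //.
rewrite (laplacian_smf Q2_formula_smf) // Q2_formula_smf //.
rewrite (tensor_normsq_smf (Ts := Pt + HLs - (half * aH gH U) *: hH)) //; last first.
  rewrite schouten_tan_smf // HL_smf // H_normsq_smf // pullback_smf //.
  move: (Pt) (HLs) (aH _ _) (hH) => P L t h'; apply/matrixP => a b.
  by rewrite mevE !mxlinE !smfB // smfD // !smfM // scstE // !mevE.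
rewrite /Q4r; move: (WHH) (CH) (trB) (\sum_a \sum_b hi a b * bil gH (Mix a) (Mix b)) => w c t s3.
move: (Q2r _ _ _ _ _) => q; move: (dS _) (\tr _) => s1 s2.
rewrite !smfB // smfD // smfD // smfB // smfN // !smfM // !scstE // !smf_nat //.
by rewrite expr2 [_ / 2]mulrC; ring.
Qed.

Hypothesis n4 : n <> 4%N.
Hypothesis Q0 : forall a b j, (j < 4)%N -> co j (Q a b) = 0.

Let n40 : n%:R - 4 != 0 :> R.
Proof. by rewrite subr_eq0 eqr_nat; apply/eqP. Qed.

Let curvT : \tr (hi *m (Rmx *m gH *m X^T)) =
  - (half * half * WHH) + k%:R * bil gamH U U - half * half * (Jt X hi gamH * aH gH U).
Proof.
have KN l m : Kr l m = - Kr m l by rewrite RmN map_mxN.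
have RE b : row b Rmx = U *m (\sum_i \sum_j (U 0 i * (row b X) 0 j) *: Kr i j)^T.
  by rewrite rowK.
exact: (curvature_contraction gamH (half2 V0) (gh_sym UV gsym) hhi normal_U (K := Kr) KN RE).
Qed.

Let cotT : \tr (hi *m (X *m nabU *m X^T))
  - \sum_a \sum_b hi a b * bil (NB UV g gi (row b X)) (row a X) U = - (half * CH).
Proof. exact: (cotton_contraction U (half2 V0) (gh_sym UV gsym) hhi NBr). Qed.

Let bachT : \tr (hi *m (X *m delh UV g *m X^T)) =
  half * half * \tr (hi *m (X *m gamH *m gih *m gamH *m X^T)) - half * half * (nn * trB).
Proof.
apply: (@bach_contraction _ _ _ _ _ _ _ _ _ (half2 V0) _ hhi _ _ _ (n%:R - 4%:R)).
- exact: gh_sym.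
- have -> : n%:R - 4%:R = scst (n%:R - 4) :> B by rewrite rmorphB !rmorph_nat.
  by rewrite -rmorphM mulVf // rmorph1.
move=> i j; have := congr1 io (del_bach gsym ggi g1 g3 Q0 i j).
rewrite mulNmx mulmxN mulNmx opprK; set T := cmx 2 g *m gi0 *m cmx 2 g.
have -> : (gamH *m gih *m gamH) i j = io (T i j).
  by rewrite /T /gamh /gih /ghi -!map_mxM mxE.
have -> : delh UV g i j = io (cmx 4 g i j) by rewrite mxE.
have -> : Bm i j + Bm j i = io (bachs g0 gi0 (- cmx 2 g) i j + bachs g0 gi0 (- cmx 2 g) j i).
  by rewrite rmorphD !mxE.
rewrite rmorphB !rmorphM /= => H.
have e8 : io (8%:R * n%:R - 32%:R) = 8%:R * (n%:R - 4%:R) by rewrite rmorphB rmorphM /= !rmorph_nat; ring.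
have e2 : io (2%:R * n%:R - 8%:R) = 2%:R * (n%:R - 4%:R) by rewrite rmorphB rmorphM /= !rmorph_nat; ring.
by rewrite -e8 -e2.
Qed.

Lemma Q4_formula_expansion m x : m = half * k%:R - 2%:R -> V0 x ->
  Q4_formula GD phi x = (dS (fun a => d_ a (sig2 half X gH hi gamH U))
  + sig2 half X gH hi gamH U * (2%:R * \tr (hi *m pmx X gH cdr gamH U) + 2%:R * aH gH U
      + m * sig2 half X gH hi gamH U)
  + 4%:R * bracket d_ half X gH hi cdr gamH U nabU (delh UV g) AR Rmx) x.
Proof.
move=> mE Vx; rewrite Q4_formula_smf //; congr (smf_fun _ x).
exact: (Q4_identity (@sDaM R _ V0) (half2 V0) (gh_sym UV gsym) gh_gih hhi cdr_gh cdr_torsion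
  (gamh_sym UV gsym) HU normal_U AR cdr_gam curvT cotT bachT mE).
Qed.

Lemma P4_formula_expansion (c0 : R) (F0 F2 : B) x : c0 = k%:R / 2 - 2 ->
  V0 x -> 4%:R * F2 = dS (fun a => d_ a F0) + scst c0 * F0 * sig2 half X gH hi gamH U ->
  laplacian (pullback GD phi) (laplacian (pullback GD phi) F0) x
  + div_T_grad (pullback GD phi) (T_formula GD phi) F0 x + c0 * Q4_formula GD phi x * F0 x =
  (4%:R * (2%:R * (\tr (hi *m pmx X gH cdr gamH U) + aH gH U) * F2 + dS (fun a => d_ a F2)
    - dS (fun a => \sum_y (pmx X gH cdr gamH U *m hi) a y * d_ y F0)
    + half * (\sum_y d_ y (\tr (hi *m pmx X gH cdr gamH U) + aH gH U) * \sum_a hi a y * d_ a F0)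
    + scst c0 * F0 * bracket d_ half X gH hi cdr gamH U nabU (delh UV g) AR Rmx
    + scst c0 * F2 * sig2 half X gH hi gamH U)) x.
Proof.
move=> mE Vx F2E.
have mE' : scst c0 = half * k%:R - 2%:R :> B.
  by rewrite mE rmorphB rmorphM !rmorph_nat mulrC.
rewrite (P4_identity (@sDaM R _ V0) (half2 V0) (gh_sym UV gsym) gh_gih hhi cdr_gh cdr_torsion
  (gamh_sym UV gsym) HU normal_U AR cdr_gam curvT cotT bachT mE' F2E).
rewrite (laplacian_smf (fs := dS (fun a => d_ a F0))) //; last first.
  by move=> y Vy; exact: laplacian_smf.
rewrite (div_T_grad_smf T_formula_smf (fs := F0)) // Q4_formula_smf //.
have Ex (s t q : B) : s x + t x + c0 * q x * F0 x = (s + t + scst c0 * q * F0) x.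
  by rewrite smfD // smfD // smfM // smfM // scstE.
exact: Ex.
Qed.

End submanifold_frame.

Section block_coefficients.
Context {R : realType} {d : nat} {V0 : odom R d} {e : R} {e0 : 0 < e}.
Local Notation A := (smf (obox V0 e0)).

Lemma cmx_block {m1 m2 n1 n2} j (P : 'M[A]_(m1, n1)) (Q : 'M[A]_(m1, n2))
    (S : 'M[A]_(m2, n1)) (T : 'M[A]_(m2, n2)) :
  cmx j (block_mx P Q S T) = block_mx (cmx j P) (cmx j Q) (cmx j S) (cmx j T).
Proof. by rewrite /cmx unlock map_block_mx. Qed.

Lemma cmx_rZ {m n} j (M : 'M[A]_(m, n)) : cmx j.+1 (sr V0 e0 *: M) = cmx j M.
Proof. by apply/matrixP => a b; rewrite !(cmxE, mxE) co_Mr. Qed.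
Lemma cmx0_rZ {m n} (M : 'M[A]_(m, n)) : cmx 0 (sr V0 e0 *: M) = 0.
Proof. by apply/matrixP => a b; rewrite !(cmxE, mxE) co0_Mr. Qed.

Lemma cmx_row {m n} j i (M : 'M[A]_(m, n)) : cmx j (row i M) = row i (cmx j M).
Proof. by apply/matrixP => a b; rewrite !(cmxE, mxE). Qed.
Lemma cmx_col {m n} j i (M : 'M[A]_(m, n)) : cmx j (col i M) = col i (cmx j M).
Proof. by apply/matrixP => a b; rewrite !(cmxE, mxE). Qed.

Lemma cmx_sum {m n} (I : finType) j (F : I -> 'M[A]_(m, n)) :
  cmx j (\sum_i F i) = \sum_i cmx j (F i).
Proof.
apply/matrixP => a b; rewrite cmxE !summxE raddf_sum.
by apply: eq_bigr => i _; rewrite /= cmxE.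
Qed.

Lemma cmx_0 {m n} j : cmx j (0 : 'M[A]_(m, n)) = 0.
Proof. by apply/matrixP => a b; rewrite !(cmxE, mxE) raddf0. Qed.

Lemma cmx0Z {m n} f (M : 'M[A]_(m, n)) : cmx 0 (f *: M) = co 0 f *: cmx 0 M.
Proof. by apply/matrixP => a b; rewrite !(cmxE, mxE) co0M. Qed.
Lemma row_blockL {T : Type} {m p q} j (P : 'M[T]_(m, p)) (Q : 'M[T]_(m, q)) S S' :
  row (lshift 1 j) (block_mx P Q S S') = row_mx (row j P) (row j Q).
Proof. by rewrite /block_mx rowKu row_row_mx. Qed.
Lemma row_blockR {T : Type} {m p q} (P : 'M[T]_(m, p)) (Q : 'M[T]_(m, q))
    (S : 'M[T]_(1, p)) (S' : 'M[T]_(1, q)) : row ir (block_mx P Q S S') = row_mx S S'.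
Proof.
rewrite /block_mx rowKd; apply/rowP => j; rewrite mxE.
by rewrite (_ : ord0 = 0).
Qed.

End block_coefficients.

(** * Minimality at lowest order *)

Section minimality.
Context {R : realType} {k n : nat} (V0 : odom R k) (e : R) (e0 : 0 < e).
Context (W0 : odom R n) (e' : R) (e0' : 0 < e').
Local Notation A := (smf (obox V0 e0)).
Local Notation B := (smf V0).
Local Notation C := (smf (obox W0 e0')).
Local Notation C0 := (smf W0).
Local Notation half := (scst 2^-1).
Variable E : 'I_n -> A.
Hypothesis UV : forall y, obox V0 e0 y -> obox W0 e0' (\row_i emap E i y).
Hypothesis E1 : forall i, co 1 (E i) = 0.
Hypothesis E3 : forall i, co 3 (E i) = 0.
Variables (g gi : 'M[C]_n).
Hypothesis gsym : g^T = g.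
Hypothesis ggi : g *m gi = 1%:M.
Hypothesis g1 : cmx 1 g = 0.
Hypothesis g3 : cmx 3 g = 0.
Local Notation D0 := (@sDa R _ W0).
Local Notation DW := (@sDa R _ (obox W0 e0')).
Local Notation d_ := (@sDa R _ V0).
Local Notation g0 := (cmx 0 g).
Local Notation gi0 := (cmx 0 gi).
Local Notation G0 := (Gam D0 half g0 gi0).
Local Notation io := (iot UV).
Local Notation evm := (map_mx (ev UV)).
Local Notation X := (Xm E).
Local Notation U := (Ur E).
Local Notation gH := (gh UV g).
Local Notation gamH := (gamh UV g).
Local Notation srA := (sr V0 e0).
Local Notation srC := (sr W0 e0').
Variable hi : 'M[B]_k.
Hypothesis hhi : X *m gH *m X^T *m hi = 1%:M.
Hypothesis UX : X *m gH *m U^T = 0.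

(* r^2 h_+ in the coordinates (x, r) *)
Definition Hbar : 'M[A]_(k + 1) := block_mx (Hh UV g) (Hc UV g) (Hc UV g)^T (1%:M + Ha UV g).
Definition Jm : 'M[A]_(k + 1, n + 1) := block_mx (Ea E) 0 (Er E)^T^T 1%:M.
Definition Gbar : 'M[A]_(n + 1) := block_mx (evm g) 0 0 1%:M.

Lemma evm_sym : (evm g)^T = evm g.
Proof. by rewrite map_trmx gsym. Qed.

Lemma HbarE : Jm *m Gbar *m Jm^T = Hbar.
Proof.
rewrite /Jm /Gbar /Hbar trmxK tr_block_mx trmx0 trmx1 !mulmx_block.
rewrite !(mul0mx, mulmx0, mul1mx, mulmx1, addr0, add0r) [1%:M + _]addrC.
by congr block_mx; rewrite /Hc trmx_mul3 trmxK evm_sym.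
Qed.

Lemma cmx0_Hbar : cmx 0 Hbar = block_mx (X *m gH *m X^T) 0 0 1%:M.
Proof.
have [Hc0 _] := Hc_odd UV E1 E3 g1 g3.
rewrite cmx_block cmxD cmx_1 cmxT Hc0 trmx0 (Ha0 UV E1 E3 g1 g3) addr0.
by rewrite Hh0.
Qed.

Lemma cmx1_Hbar : cmx 1 Hbar = 0.
Proof.
have [Hh1 _] := Hh_even UV E1 E3 g1 g3.
have [Ha1 _] := Ha_even UV E1 E3 g1 g3.
rewrite cmx_block cmxD cmx_1 cmxT (Hc1 E1 E3 UX) Hh1 Ha1 trmx0 addr0.
by rewrite block_mx0.
Qed.

Lemma cmx2_Hbar : cmx 2 Hbar = block_mx (cmx 2 (Hh UV g)) 0 0 (cmx 2 (Ha UV g)).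
Proof.
have [_ Hc2] := Hc_odd UV E1 E3 g1 g3.
by rewrite cmx_block cmxD cmx_1 cmxT Hc2 trmx0 add0r.
Qed.

Lemma cmx3_Hbar : cmx 3 Hbar = block_mx 0 (cmx 3 (Hc UV g)) (cmx 3 (Hc UV g))^T 0.
Proof.
have [_ Hh3] := Hh_even UV E1 E3 g1 g3.
have [_ Ha3] := Ha_even UV E1 E3 g1 g3.
by rewrite cmx_block cmxD cmx_1 cmxT Hh3 Ha3 addr0.
Qed.

Lemma cmx4_Hbar : cmx 4 Hbar =
  block_mx (cmx 4 (Hh UV g)) (cmx 4 (Hc UV g)) (cmx 4 (Hc UV g))^T (cmx 4 (Ha UV g)).
Proof. by rewrite cmx_block cmxD cmx_1 cmxT add0r. Qed.

Variable N : 'M[A]_(k + 1).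
Hypothesis HN : Hbar *m N = 1%:M.

Local Notation Gg := (Gam (fun i : 'I_n => DW (lshift 1 i)) half g gi).
(** [SCm] and [SKm] are [r] times the blocks [PC] and [PK] of the Christoffel symbols of [g_+]. *)
Definition SCm : 'M[C]_n := srC *: PB DW half g gi - 1%:M.
Definition SKm : 'M[C]_n := (srC * half) *: map_mx (DW ir) g - g.

(* r times the Christoffel symbols of [gplus], smooth up to r = 0 *)
Definition SG (a : 'I_(n + 1)) : 'M[C]_(n + 1) :=
  match fintype.split a with
  | inl i => block_mx (srC *: Gg i) (col i SCm) (- row i SKm) 0
  | inr _ => block_mx SCm 0 0 (-1)%:M
  end.

Lemma SGL i : SG (lshift 1 i) = block_mx (srC *: Gg i) (col i SCm) (- row i SKm) 0.
Proof. by rewrite /SG (unsplitK (inl i)). Qed.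
Lemma SGR : SG ir = block_mx SCm 0 0 (-1)%:M.
Proof. by rewrite /SG (unsplitK (inr ord0)). Qed.

Lemma cmx_SCm : cmx 0 SCm = - 1%:M /\ cmx 1 SCm = 0.
Proof.
rewrite /SCm !cmxD !cmxN cmx0_rZ cmx_rZ !cmx_1 oppr0 add0r addr0; split => //.
by rewrite PBE cmx_cstZ cmx0M cmx_Dr g1 scaler0 mulmx0 scaler0.
Qed.

Lemma cmx_SKm : cmx 0 SKm = - g0 /\ cmx 1 SKm = 0.
Proof.
rewrite /SKm -scalerA !cmxD !cmxN cmx0_rZ cmx_rZ cmx_cstZ cmx_Dr g1 scaler0 scaler0 add0r.
by rewrite subr0.
Qed.

Lemma cmx_Gg0 i : cmx 0 (Gg i) = G0 i.
Proof. exact: Gg0. Qed.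

Lemma cmx0_SGL i : cmx 0 (SG (lshift 1 i)) = block_mx 0 (- col i 1%:M) (row i g0) 0.
Proof.
rewrite SGL cmx_block cmx0_rZ cmx_col cmxN cmx_row cmx_0 (proj1 cmx_SCm) (proj1 cmx_SKm).
by rewrite !linearN /= opprK.
Qed.
Lemma cmx1_SGL i : cmx 1 (SG (lshift 1 i)) = block_mx (G0 i) 0 0 0.
Proof.
rewrite SGL cmx_block cmx_rZ cmx_Gg0 cmx_col cmxN cmx_row cmx_0 (proj2 cmx_SCm) (proj2 cmx_SKm).
have -> : col i (0 : 'M[C0]_n) = 0 by apply/matrixP => a b; rewrite !mxE.
have -> : row i (0 : 'M[C0]_n) = 0 by apply/matrixP => a b; rewrite !mxE.
by rewrite oppr0.
Qed.
Lemma cmx_m1 j : cmx j ((-1)%:M : 'M[C]_1) = if j is 0 then (-1)%:M else 0.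
Proof.
have -> : (-1)%:M = - 1%:M :> 'M[C]_1 by rewrite raddfN.
by rewrite cmxN cmx_1; case: j => [|j]; rewrite ?oppr0 // raddfN.
Qed.
Lemma cmx0_SGR : cmx 0 (SG ir) = block_mx (- 1%:M) 0 0 (-1)%:M.
Proof. by rewrite SGR cmx_block !cmx_0 (proj1 cmx_SCm) cmx_m1. Qed.
Lemma cmx1_SGR : cmx 1 (SG ir) = 0.
Proof. by rewrite SGR cmx_block !cmx_0 (proj2 cmx_SCm) cmx_m1 block_mx0. Qed.

Lemma cmx0_ev m p (T : 'M[C]_(m, p)) : cmx 0 (evm T) = map_mx io (cmx 0 T).
Proof. by apply/matrixP => i j; rewrite !(cmxE, mxE) ev0. Qed.
Lemma cmx1_ev m p (T : 'M[C]_(m, p)) : cmx 1 (evm T) = map_mx io (cmx 1 T).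
Proof. by apply/matrixP => i j; rewrite !(cmxE, mxE) ev1. Qed.

Local Notation Pi := (Jm^T *m N *m Jm).
Definition Sff : 'rV[A]_(n + 1) :=
  \sum_a \sum_b N a b *: map_mx (@sDa R _ (obox V0 e0) a) (row b Jm).
(* [r * nTen] is k + 1 times the mean curvature vector of Y in g_+. *)
Definition Ten : 'rV[A]_(n + 1) := srA *: Sff + \sum_j row j Pi *m (evm (SG j))^T.
Definition nTen := Ten - Ten *m Gbar *m Pi.

Let J0 : cmx 0 Jm = block_mx X 0 0 1%:M.
Proof.
rewrite cmx_block trmxK cmx_0 cmx_1 cmx_Ea (proj1 (Er_odd E1 E3)).
by congr block_mx.
Qed.
Let J1 : cmx 1 Jm = block_mx 0 0 (2%:R *: U) 0.
Proof.
rewrite cmx_block trmxK cmx_0 cmx_1 (proj1 (Ea_even E1 E3)) cmx_Er.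
by congr block_mx.
Qed.
Let N0 : cmx 0 N = block_mx hi 0 0 1%:M.
Proof. exact: (N0E HN hhi cmx0_Hbar). Qed.
Let N1 : cmx 1 N = 0.
Proof. exact: (cmx1_inv HN cmx1_Hbar). Qed.

Lemma Pi0 : cmx 0 Pi = block_mx (X^T *m hi *m X) 0 0 1%:M.
Proof.
rewrite !cmx0M cmxT J0 N0 tr_block_mx !trmx0 trmx1 !mulmx_block.
by rewrite !(mul0mx, mulmx0, mul1mx, mulmx1, addr0, add0r).
Qed.

Lemma Pi1 : cmx 1 Pi = block_mx 0 (2%:R *: U)^T (2%:R *: U) 0.
Proof.
rewrite !cmx1M cmx0M !cmxT J0 J1 N0 N1 !tr_block_mx !trmx0 trmx1 mulmx0 add0r !mulmx_block.
rewrite !(mul0mx, mulmx0, mul1mx, mulmx1, addr0, add0r) add_block_mx.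
by rewrite !(addr0, add0r).
Qed.

Lemma sum_add1 (V : nmodType) m (F : 'I_(m + 1) -> V) :
  \sum_i F i = \sum_(i < m) F (lshift 1 i) + F ir.
Proof. by rewrite big_split_ord big_ord1. Qed.

Lemma lsub_Sff0 : lsubmx (cmx 0 Sff) =
  \sum_a \sum_b hi a b *: map_mx (d_ a) (row b X) + 2%:R *: U.
Proof.
rewrite /Sff cmx_sum; under eq_bigr do rewrite cmx_sum.
rewrite sum_add1 linearD /= linear_sum /=; congr (_ + _).
  apply: eq_bigr => a _; rewrite sum_add1 linearD /= linear_sum /= cmx0Z -cmxE N0.
  rewrite block_mxEur mxE scale0r linear0 addr0; apply: eq_bigr => b _.
  rewrite cmx0Z -cmxE N0 block_mxEul cmx_Dx cmx_row J0 row_blockL linearZ /=.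
  by congr (_ *: _); rewrite map_row_mx row_mxKl.
rewrite sum_add1 big1 ?add0r => [|b _]; last first.
  by rewrite cmx0Z -cmxE N0 block_mxEdl mxE scale0r.
rewrite cmx0Z -cmxE N0 block_mxEdr mxE scale1r cmx_Dr cmx_row J1 row_blockR scale1r.
by rewrite row_mxKl.
Qed.

Local Notation Pt0 := (X^T *m hi *m X).

(** The number [k] is the trace of the projection onto the tangent space of the submanifold; [-1] is
    the purely radial Christoffel symbol of [g_+], multiplied by [r]. *)
Lemma cmx0_Ten : cmx 0 Ten = row_mx 0 (k%:R - 1)%:M.
Proof.
rewrite /Ten cmxD cmx0_rZ add0r cmx_sum sum_add1.
have -> : \sum_(j < n) cmx 0 (row (lshift 1 j) Pi *m (evm (SG (lshift 1 j)))^T) =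
    \sum_(j < n) row_mx 0 (row j Pt0 *m (row j gH)^T).
  apply: eq_bigr => j _; rewrite cmx0M cmx_row cmxT cmx0_ev Pi0 cmx0_SGL row_blockL.
  rewrite map_block_mx tr_block_mx mul_row_block !map_mx0 !trmx0 !mulmx0 !linear0 mul0mx !addr0.
  by rewrite map_row.
rewrite cmx0M cmx_row cmxT cmx0_ev Pi0 cmx0_SGR row_blockR map_block_mx tr_block_mx mul_row_block.
rewrite !map_mx0 !trmx0 !mulmx0 !mul0mx !addr0 mul1mx.
have -> : \sum_(j < n) row_mx (0 : 'rV[B]_n) (row j Pt0 *m (row j gH)^T) = row_mx 0 (k%:R)%:M.
  rewrite -(mxtrace1 B k) -hhi.
  have -> : \tr (X *m gH *m X^T *m hi) = \sum_j (row j Pt0 *m (row j gH)^T) 0 0.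
    rewrite -(mulmxA X gH) -(mulmxA X) mxtrace_mulC -(mulmxA gH) -(mulmxA gH) mxtrace_mulC.
    rewrite -{1}(gh_sym UV gsym); apply: eq_bigr => j _.
    by rewrite mxE [RHS]mxE; apply: eq_bigr => i _; rewrite !mxE.
  apply/rowP; apply: ord_add1 => [i|]; rewrite summxE.
    by rewrite row_mxEl mxE big1 // => j _; rewrite row_mxEl mxE.
  rewrite row_mxEr mxE eqxx mulr1n; apply: eq_bigr => j _; by rewrite row_mxEr.
rewrite add_row_mx addr0 map_scalar_mx tr_scalar_mx /= rmorphN rmorph1; congr row_mx.
by rewrite add0r -raddfD.
Qed.

Lemma lsub_cmx1_Ten : lsubmx (cmx 1 Ten) =
  \sum_a \sum_b hi a b *: cdr UV g gi a (row b X) - 2%:R *: U.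
Proof.
rewrite /Ten cmxD cmx_rZ linearD /= lsub_Sff0 cmx_sum sum_add1.
have eL (j : 'I_n) : lsubmx (cmx 1 (row (lshift 1 j) Pi *m (evm (SG (lshift 1 j)))^T)) =
   row j Pt0 *m (map_mx io (G0 j))^T - (2%:R * U 0 j) *: row j 1%:M.
  rewrite cmx1M !cmx_row !cmxT cmx0_ev cmx1_ev Pi0 Pi1 cmx0_SGL cmx1_SGL !row_blockL.
  rewrite !map_block_mx !tr_block_mx !mul_row_block linearD /= !row_mxKl.
  rewrite !map_mx0 !trmx0 !mulmx0 !addr0 add0r; congr (_ + _).
  have -> : row j (2%:R *: U)^T = (2%:R * U 0 j)%:M.
    by apply/matrixP => a b; rewrite !ord1 !mxE eqxx mulr1n.
  rewrite mul_scalar_mx map_mxN raddfN /= scalerN; congr (- (_ *: _)).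
  by rewrite map_col map_mx1 tr_col trmx1.
have eR : lsubmx (cmx 1 (row ir Pi *m (evm (SG ir))^T)) = - (2%:R *: U).
  rewrite cmx1M !cmx_row !cmxT cmx0_ev cmx1_ev Pi0 Pi1 cmx0_SGR cmx1_SGR !row_blockR.
  rewrite map_mx0 trmx0 mulmx0 add0r map_block_mx tr_block_mx mul_row_block row_mxKl.
  by rewrite mul0mx addr0 map_mxN map_mx1 raddfN /= trmx1 mulmxN mulmx1.
rewrite linearD /= eR linear_sum /= (eq_bigr _ (fun j _ => eL j)) sumrB.
have -> : \sum_j (2%:R * U 0 j) *: row j (1%:M : 'M[B]_n) = 2%:R *: U.
  apply/rowP => i; rewrite summxE (bigD1 i) //= !mxE eqxx mulr1 big1 ?addr0 // => j ji.
  by rewrite !mxE (negbTE ji) mulr0.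
have -> : \sum_j row j Pt0 *m (map_mx io (G0 j))^T =
    \sum_a \sum_b hi a b *: (row b X *m (GG UV g gi (row a X))^T).
  apply/rowP => i; rewrite !summxE.
  have -> : \sum_a (\sum_b hi a b *: (row b X *m (GG UV g gi (row a X))^T)) 0 i =
    \sum_a \sum_b hi a b * \sum_m X b m * \sum_j X a j * Gh UV g gi j i m.
    apply: eq_bigr => a _; rewrite summxE; apply: eq_bigr => b _; rewrite mxE mxE; congr (_ * _).
    apply: eq_bigr => m _; rewrite [_^T m i]mxE GG_E [row b X 0 m]mxE; congr (_ * _).
    by apply: eq_bigr => j _; rewrite mxE.
  transitivity (\sum_j \sum_m \sum_b \sum_a X a j * hi a b * X b m * Gh UV g gi j i m).
    apply: eq_bigr => j _; rewrite mxE; apply: eq_bigr => m _.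
    rewrite [_^T m i]mxE [row j _ 0 m]mxE mxE !mulr_suml; apply: eq_bigr => b _.
    rewrite mxE !mulr_suml; apply: eq_bigr => a _.
    by rewrite [X^T j a]mxE.
  rewrite exchange_big; under eq_bigr do rewrite exchange_big.
  rewrite exchange_big; under eq_bigr do under eq_bigr do rewrite exchange_big.
  under eq_bigr do rewrite exchange_big.
  rewrite exchange_big; apply: eq_bigr => a _; apply: eq_bigr => b _ /=.
  rewrite mulr_sumr; apply: eq_bigr => m _; rewrite 2!mulr_sumr; apply: eq_bigr => j _.
  ring.
have -> : \sum_a \sum_b hi a b *: cdr UV g gi a (row b X) =
   \sum_a \sum_b hi a b *: map_mx (d_ a) (row b X) +
   \sum_a \sum_b hi a b *: (row b X *m (GG UV g gi (row a X))^T).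
  rewrite -big_split; apply: eq_bigr => a _; rewrite -big_split; apply: eq_bigr => b _ /=.
  by rewrite /cdr (row_cd UV gi gsym) scalerDr.
move: (\sum_a _) (\sum_a _) (2%:R *: U) => *; mxring.
Qed.

(** Its vanishing is the equation [k H = 2 k U]. To the [-2 U] of [lsub_cmx1_Ten] the normal
    projection adds [-2 (k - 1) U], taken from the radial component [k - 1] at order zero. *)
Lemma lsub_cmx1_nTen : lsubmx (cmx 1 nTen) =
  \sum_a \sum_b hi a b *: LL d_ half X gH hi (cdr UV g gi) a b - (2%:R * k%:R) *: U.
Proof.
have G1 : cmx 1 Gbar = 0 by rewrite cmx_block !cmx_0 cmx_1 cmx1_ev g1 map_mx0 block_mx0.
have G0' : cmx 0 Gbar = block_mx gH 0 0 1%:M by rewrite cmx_block !cmx_0 cmx_1 cmx0_ev.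
rewrite /nTen cmxD cmxN cmx1M (cmx1M Ten) cmx0M G1 mulmx0 add0r cmx0_Ten Pi0 Pi1 G0'.
set T1 := cmx 1 Ten; rewrite -[T1]hsubmxK !mul_row_block !(mul0mx, mulmx0, mulmx1, addr0, add0r).
rewrite linearB /= linearD /= !row_mxKl lsub_cmx1_Ten.
set S := \sum_a \sum_b hi a b *: cdr _ _ _ _ _.
have UX' : U *m gH *m X^T = 0.
  by apply: trmx_inj; rewrite trmx_mul3 trmxK (gh_sym UV gsym) UX trmx0.
rewrite mul_scalar_mx !mulmxBl -!scalemxAl !mulmxA UX' !mul0mx scaler0 subr0.
have -> : \sum_a \sum_b hi a b *: LL d_ half X gH hi (cdr UV g gi) a b =
    S - S *m gH *m X^T *m hi *m X.
  rewrite /S !mulmx_suml -sumrB; apply: eq_bigr => a _; rewrite !mulmx_suml -sumrB.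
  apply: eq_bigr => b _; rewrite LL_proj ?scalerBr ?scalemxAl //; try exact: half2.
  - exact: gh_sym.
  - exact: cdr_gh.
  - exact: cdr_torsion.
move: (S) (S *m _ *m _ *m _ *m _) => ? ?.
by apply/rowP => i; rewrite !mxlinE; ring.
Qed.

End minimality.

(** * Mean curvature of the extension *)

Section mean_curvature_of_extension.
Context {R : realType} {k n : nat} {M : manifold (R := R) n}.
Variables (gr : R -> riemannian_metric M) (phi : chart R M n).
Hypothesis aphi : atlas phi.
Variables (V0 : odom R k) (e : R) (e0 : 0 < e).
Variables (W0 : odom R n) (e' : R) (e0' : 0 < e').
Hypothesis Wphi : forall x, W0 x -> ccod phi x.
Local Notation A := (smf (obox V0 e0)).
Local Notation B := (smf V0).
Local Notation C := (smf (obox W0 e0')).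
Local Notation Ap := (smf (pbox V0 e0)).
Local Notation Cp := (smf (pbox W0 e0')).
Local Notation half := (scst 2^-1).
Variable E : 'I_n -> A.
Hypothesis UV : forall y, obox V0 e0 y -> obox W0 e0' (\row_i emap E i y).
Variables (g gi : 'M[C]_n).
Hypothesis ggi : g *m gi = 1%:M.
Hypothesis gsym : g^T = g.
Hypothesis gE : forall y, obox W0 e0' y -> 0 <= hgt y -> gr (hgt y) phi (base y) = mev y g.
Variable N : 'M[A]_(k + 1).
Hypothesis HN : Hbar UV g *m N = 1%:M.
Variable Y : 'rV[R]_(k + 1) -> 'rV[R]_(n + 1).
Hypothesis YE : forall y, obox V0 e0 y -> 0 <= hgt y -> Y y = \row_i emap E i y.

Local Notation resA := (@res R k V0 e e0).
Local Notation resC := (@res R n W0 e' e0').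
Local Notation wV := (sw V0 e0).
Local Notation wW := (sw W0 e0').
Local Notation Jr := (map_mx resA (Jm E)).
Local Notation Hr := (map_mx resA (Hbar UV g)).
Local Notation Nr := (map_mx resA N).
Local Notation evm := (map_mx (ev UV)).
Local Notation Gp := (gplus gr phi).

Lemma pboxY y : pbox V0 e0 y -> pbox W0 e0' (\row_i resA (emap E i) y).
Proof.
move=> Vy; have By := pbox_box Vy; case: (Vy) => _ /andP[h0 he].
have -> : \row_i resA (emap E i) y = \row_i emap E i y by apply/rowP => i; rewrite !mxE resE.
have := UV By; rewrite emap_pt // => -[]; rewrite base_pt hgt_pt gtr0_norm // => Wb h1.
by apply: pbox_pt => //; rewrite h0.
Qed.

Definition evp : Cp -> Ap := spull pboxY.
HB.instance Definition _ := GRing.RMorphism.on evp.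

Lemma Yp y : pbox V0 e0 y -> Y y = \row_i resA (emap E i) y.
Proof.
move=> Vy; have By := pbox_box Vy; case: (Vy) => _ /andP[h0 he].
by rewrite YE ?ltW //; apply/rowP => i; rewrite !mxE resE.
Qed.

Lemma evpE f y : pbox V0 e0 y -> evp f y = f (Y y).
Proof. by move=> Vy; rewrite /evp spullE // Yp. Qed.

Lemma Y_in y : pbox V0 e0 y -> pbox W0 e0' (Y y).
Proof. by move=> Vy; rewrite Yp //; exact: pboxY. Qed.

Lemma evp_res f : evp (resC f) = resA (ev UV f).
Proof.
apply: smf_ext => y Vy; have By := pbox_box Vy; have Wy := Y_in Vy.
rewrite evpE // !resE // evE // YE //; last by case: (Vy) => _ /andP[/ltW].
by rewrite emap_pt.
Qed.

Lemma hgt_Y y : pbox V0 e0 y -> hgt (Y y) = hgt y.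
Proof.
move=> Vy; have By := pbox_box Vy; rewrite YE //; last by case: (Vy) => _ /andP[/ltW].
by rewrite emap_pt // hgt_pt.
Qed.

Lemma evp_sw : evp wW = wV.
Proof. by apply: smf_ext => y Vy; rewrite evpE // !swE ?hgt_Y //; exact: Y_in. Qed.

Lemma mev_evp m p (T : 'M[Cp]_(m, p)) y : pbox V0 e0 y -> mev (Y y) T = mev y (map_mx evp T).
Proof. by move=> Vy; apply/matrixP => i j; rewrite !mxE evpE. Qed.

Lemma JmE a i : Jm E a i = sD a (emap E i).
Proof.
move: a; apply: ord_add1 => [a|]; move: i; apply: ord_add1 => [i|].
- by rewrite block_mxEul mxE emapL.
- by rewrite block_mxEur mxE emapR sD_coord lrshiftF.
- by rewrite block_mxEdl trmxK mxE emapL.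
by rewrite block_mxEdr mxE emapR sD_coord !eqxx.
Qed.

Lemma jac_Y y : pbox V0 e0 y -> jac Y y = mev y Jr.
Proof.
move=> Vy; apply/matrixP => a i; rewrite mxE mevE mxE JmE -sD_res.
by apply: pd_smf => // z Vz; rewrite Yp // mxE.
Qed.

Lemma gplus_Y y : pbox V0 e0 y -> Gp (Y y) = mev y (wV ^+ 2 *: map_mx resA (Gbar UV g)).
Proof.
move=> Vy; rewrite (gplus_smf gE) ?mev_evp //; last exact: Y_in.
rewrite /PGp map_mxZ rmorphXn /= evp_sw /Gbar !map_block_mx !map_mx0 !map_mx1; congr (mev _ (_ *: block_mx _ _ _ _)).
by apply/matrixP => i j; rewrite !mxE evp_res.
Qed.

Local Notation Hp := (wV ^+ 2 *: Hr).
Local Notation Np := (resA (sr V0 e0) ^+ 2 *: Nr).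

Lemma pullback_Y y : pbox V0 e0 y -> pullback Gp Y y = mev y Hp.
Proof.
move=> Vy; rewrite /pullback jac_Y // gplus_Y // -mevT -!mevM //; congr (mev y _).
by rewrite -scalemxAr -scalemxAl -(HbarE UV gsym) !map_mxM map_trmx.
Qed.

Lemma Hp_inv : Hp *m Np = 1%:M.
Proof.
rewrite -scalemxAl -scalemxAr scalerA -exprMn mulrC srw expr1n scale1r.
by rewrite -map_mxM HN map_mx1.
Qed.

Lemma inv_pullback_Y y : pbox V0 e0 y -> invmx (pullback Gp Y y) = mev y Np.
Proof. by move=> Vy; rewrite (invmx_smf pullback_Y Hp_inv). Qed.

Definition tens a b : 'rV[A]_(n + 1) := sr V0 e0 *: map_mx (@sDa R _ (obox V0 e0) a) (row b (Jm E))
  + \sum_j Jm E a j *: (row b (Jm E) *m (evm (SG g gi j))^T).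

Lemma TenE : \sum_a \sum_b N a b *: tens a b = Ten UV g gi N.
Proof.
rewrite /Ten /Sff scaler_sumr.
transitivity (\sum_a \sum_b N a b *: (sr V0 e0 *: map_mx (@sDa R _ (obox V0 e0) a) (row b (Jm E)))
   + \sum_a \sum_b N a b *: \sum_j Jm E a j *: (row b (Jm E) *m (evm (SG g gi j))^T)).
  rewrite -big_split; apply: eq_bigr => a _; rewrite -big_split; apply: eq_bigr => b _ /=.
  by rewrite -scalerDr.
congr (_ + _).
  apply: eq_bigr => a _; rewrite scaler_sumr; apply: eq_bigr => b _.
  by rewrite !scalerA mulrC.
under eq_bigr do under eq_bigr do rewrite scaler_sumr.
under eq_bigr do rewrite exchange_big.
rewrite exchange_big; apply: eq_bigr => j _ /=.
have -> : row j ((Jm E)^T *m N *m Jm E) = \sum_a \sum_b (N a b * Jm E a j) *: row b (Jm E).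
  rewrite exchange_big; apply/rowP => i; rewrite summxE mxE mxE; apply: eq_bigr => b _.
  rewrite summxE mxE mulr_suml; apply: eq_bigr => a _; rewrite !mxE.
  by rewrite [_ * N _ _]mulrC.
rewrite mulmx_suml; apply: eq_bigr => a _; rewrite mulmx_suml; apply: eq_bigr => b _.
by rewrite scalerA -scalemxAl.
Qed.

Lemma PGam_SG a : Gam (@sDa R _ (pbox W0 e0')) half (PGp (map_mx resC g) wW)
    (PGpi (resC (sr W0 e0')) (map_mx resC gi)) a = wW *: map_mx resC (SG g gi a).
Proof.
rewrite (Gam_PGp (@sDaM R _ _) (half2 _) (rg_inv ggi) (srw W0 e0') (Dx_sr W0 e0') (DZ_sr W0 e0')).
have PBr : PB (@sDa R _ (pbox W0 e0')) half (map_mx resC g) (map_mx resC gi) =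
    map_mx resC (PB (@sDa R _ (obox W0 e0')) half g gi).
  by rewrite -res_half (map_PB (@res_sD _ _ W0 e' e0')).
have PCr : PC (@sDa R _ (pbox W0 e0')) half (map_mx resC g) (map_mx resC gi) wW =
    wW *: map_mx resC (SCm g gi).
  rewrite PCE PBr /SCm map_mxB map_mxZ map_mx1 scalerBr scalerA [wW * _]mulrC srw scale1r.
  by rewrite scalemx1.
have PKr : PK (@sDa R _ (pbox W0 e0')) half (map_mx resC g) wW = wW *: map_mx resC (SKm g).
  rewrite PKE /SKm map_mxB map_mxZ scalerBr rmorphM scalerA mulrA [wW * _]mulrC srw mul1r.
  rewrite /= res_half.
  by congr (_ *: _ - _); apply/matrixP => i j; rewrite !mxE res_sD.
move: a; apply: ord_add1 => [i|].
  rewrite PGamL SGL map_block_mx scale_block_mx PCr PKr map_col map_mxN map_row map_mx0 scaler0.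
  rewrite scalerN; congr block_mx; last by apply/matrixP => a b; rewrite !mxE.
  - by rewrite map_mxZ scalerA [wW * _]mulrC srw scale1r (map_Gam (fun i => @res_sD _ _ W0 e' e0' (lshift 1 i))) /= res_half.
  - by apply/matrixP => a b; rewrite !mxE.
rewrite PGamR SGR map_block_mx scale_block_mx PCr !map_mx0 !scaler0 map_scalar_mx /=.
by rewrite (_ : resC (-1) = -1) ?scale_scalar_mx ?mulrN1 // raddfN -[1]/(1%R) /= (rmorph1 resC).
Qed.

Lemma christoffel_Y i j l y : pbox V0 e0 y ->
  christoffel Gp i j l (Y y) = (wV * resA (ev UV (SG g gi j i l))) y.
Proof.
move=> Vy; have Wy := Y_in Vy.
rewrite (christoffel_smf (gplus_smf gE) (PGp_inv (rg_inv ggi) (srw W0 e0'))) //.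
rewrite -evpE // -evp_sw -evp_res -rmorphM; congr (smf_fun _ y); congr evp.
by rewrite PGam_SG !mxE.
Qed.

Lemma cov_along_Y a b y : pbox V0 e0 y ->
  cov_along Gp Y a (fun z => row b (jac Y z)) y = mev y (wV *: map_mx resA (tens a b)).
Proof.
move=> Vy; apply/rowP => i; rewrite [LHS]mxE mevE mxZ_E [map_mx _ _ 0 i]mxE.
rewrite mxD_E mxZ_E raddfD /= mulrDr smfD //; congr (_ + _).
  rewrite rmorphM mulrA [wV * _]mulrC srw mul1r [map_mx _ _ 0 i]mxE [row b _ 0 i]mxE /= -sD_res.
  by apply: pd_smf => // z Vz; rewrite [row b (jac Y z) 0 i]mxE jac_Y // mevE mxE.
rewrite summxE rmorph_sum mulr_sumr smf_sum //; apply: eq_bigr => j _ /=.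
rewrite mxZ_E [(_ *m _) 0 i]mxE rmorphM rmorph_sum !mulr_sumr smf_sum //.
apply: eq_bigr => l _; rewrite christoffel_Y // jac_Y // [row b _ 0 l]mxE !mevE !mxE.
by rewrite rmorphM !smfM //; ring.
Qed.

Local Notation nT := (nTen UV g gi N).

Lemma normal_part_Y y (v : 'rV[A]_(n + 1)) c : pbox V0 e0 y ->
  normal_part Gp Y y (c *: mev y v) = c *: mev y (v - v *m Gbar UV g *m ((Jm E)^T *m N *m Jm E)).
Proof.
move=> Vy; rewrite /normal_part gplus_Y // jac_Y // inv_pullback_Y //.
rewrite !mevZ // !smfX // swE // resE ?srE //; try exact: pbox_box.
have h0 : hgt y != 0 by case: (Vy) => _ /andP[h _]; rewrite gt_eqF.
have Ex (u : 'rV[R]_(n + 1)) (G : 'M[R]_(n + 1)) (J : 'M[R]_(k + 1, n + 1)) (K : 'M[R]_(k + 1)) :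
    c *: u *m ((hgt y)^-1 ^+ 2 *: G) *m J^T *m (hgt y ^+ 2 *: K) *m J =
    c *: (u *m G *m (J^T *m K *m J)).
  rewrite -!(scalemxAl, scalemxAr) !scalerA !mulmxA; congr (_ *: _).
  by rewrite -mulrA -exprMn divff // expr1n mulr1.
have By := pbox_box Vy.
rewrite Ex -scalerBr !mev_res // -mevT -!mevM //; congr (_ *: _).
by apply/rowP => i; rewrite !mxE smfB.
Qed.

(** The inverse of [h_+] contributes [r^2] and the Christoffel symbols [1 / r]; the normal
    projection is insensitive to the conformal factor. Hence one factor [r]. *)
Lemma mean_curv_Y y : pbox V0 e0 y ->
  mean_curv Gp Y y = ((k + 1)%:R^-1 * hgt y) *: mev y nT.
Proof.
move=> Vy; rewrite /mean_curv -scalerA; congr (_ *: _).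
have By := pbox_box Vy; have h0 : hgt y != 0 by case: (Vy) => _ /andP[h _]; rewrite gt_eqF.
transitivity (\sum_a \sum_b (hgt y * N a b y) *:
    mev y (tens a b - tens a b *m Gbar UV g *m ((Jm E)^T *m N *m Jm E))).
  apply: eq_bigr => a _; apply: eq_bigr => b _.
  rewrite inv_pullback_Y // /second_ff cov_along_Y // !mevZ // !mev_res //.
  rewrite (normal_part_Y (tens a b) (wV y) Vy) scalerA.
  congr (_ *: _); rewrite swE // mxZ_E mevE smfX // resE // srE //.
  by field.
rewrite /nTen -TenE.
have -> : \sum_a \sum_b N a b *: tens a b -
    (\sum_a \sum_b N a b *: tens a b) *m Gbar UV g *m ((Jm E)^T *m N *m Jm E) =
    \sum_a \sum_b N a b *: (tens a b - tens a b *m Gbar UV g *m ((Jm E)^T *m N *m Jm E)).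
  rewrite !mulmx_suml -sumrB; apply: eq_bigr => a _; rewrite !mulmx_suml -sumrB.
  by apply: eq_bigr => b _; rewrite -!scalemxAl scalerBr.
rewrite -[mev y (\sum_a _)]/(map_mx (sev By) _) raddf_sum scaler_sumr; apply: eq_bigr => a _.
rewrite /= raddf_sum scaler_sumr; apply: eq_bigr => b _ /=.
by rewrite map_mxZ scalerA.
Qed.

Hypothesis Vpos : forall y, obox V0 e0 y -> 0 <= hgt y -> posdef (mev y (Gbar UV g)).

Lemma gbar_Y y : pbox V0 e0 y -> gbar gr phi (Y y) = mev y (Gbar UV g).
Proof.
move=> Vy; have By := pbox_box Vy; have Wy := Y_in Vy.
rewrite (gbar_smf gE) ?hgt_Y //; [|exact: pbox_box|by case: Vy => _ /andP[/ltW]].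
rewrite mev_block; last exact: (pbox_box Wy).
rewrite -[RHS]/(map_mx (sev By) _) map_block_mx !map_mx0 map_mx1.
congr block_mx; apply/matrixP => i j; rewrite mevE [RHS]mxE /= /sev [in RHS]mxE evE // YE //; last by case: Vy => _ /andP[/ltW].
by rewrite emap_pt.
Qed.

(** The argument of [einstein_Q] for vectors: the first nonzero coefficient of [nTen] would give a
    nonzero coefficient of twice that order in the square norm [q]. One order is spent on the factor
    [r] of [mean_curv_Y]. *)
Lemma minimal_nTen m : (forall x, V0 x -> exists K : R, \forall r \near (0 : R)^'+,
    `|Num.sqrt (inner (gbar gr phi) (Y (pt x r))
      (mean_curv Gp Y (pt x r)) (mean_curv Gp Y (pt x r)))| <= K * r ^+ m.+1) ->
  forall j, (j < m)%N -> cmx j nT = 0.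
Proof.
move=> mO; pose q : A := (nT *m Gbar UV g *m nT^T) 0 0.
elim/ltn_ind => j IH jm.
have IH' i : (i < j)%N -> cmx i nT = 0 by move=> ij; apply: IH => //; exact: ltn_trans jm.
have IHT i : (i < j)%N -> cmx i nT^T = 0 by move=> ij; rewrite cmxT IH' // trmx0.
have IHG i : (i < j)%N -> cmx i (Gbar UV g *m nT^T) = 0 by exact: (proj1 (cmx_low _ IHT)).
have E1 : co (j + j) q = (cmx j nT *m cmx 0 (Gbar UV g) *m (cmx j nT)^T) 0 0.
  rewrite -cmxE -mulmxA (cmx_dbl IH' IHG) (proj2 (cmx_low _ IHT)) cmxT mulmxA //.
have E0 x : V0 x -> co (j + j) q x = 0.
  move=> Vx; have [K HK] := mO x Vx.
  apply: (@co_eq0 _ _ _ _ _ (m + m) _ _ ((k + 1)%:R ^+ 2 * K ^+ 2)) => //; last first.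
    by rewrite !addnn ltn_double.
  near=> r; have r0 : 0 < r by near: r; exact: nbhs_right_gt.
  have re : r < e by near: r; exact: nbhs_right_lt.
  have Vy : pbox V0 e0 (pt x r) by apply: pbox_pt; rewrite // r0.
  have By := pbox_box Vy.
  have : `|Num.sqrt (inner (gbar gr phi) (Y (pt x r))
      (mean_curv Gp Y (pt x r)) (mean_curv Gp Y (pt x r)))| <= K * r ^+ m.+1 by near: r.
  have k0 : 0 < (k + 1)%:R^-1 :> R by rewrite invr_gt0 ltr0n addn1.
  have qE : q (pt x r) = (mev (pt x r) nT *m mev (pt x r) (Gbar UV g) *m (mev (pt x r) nT)^T) 0 0.
    by rewrite -mevT -!mevM // mevE.
  rewrite /inner gbar_Y // mean_curv_Y // hgt_pt trmxZ -!(scalemxAl, scalemxAr) scalerA mxE -qE.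
  have q0 : 0 <= q (pt x r).
    have [_ Pp] := Vpos By (ltW (eq_rect_r (fun z => is_true (0 < z)) r0 (hgt_pt x r))).
    rewrite qE; have [->|nz] := eqVneq (mev (pt x r) nT) 0; first by rewrite !mul0mx mxE.
    exact: ltW (Pp _ nz).
  rewrite -expr2 sqrtrM ?sqr_ge0 // sqrtr_sqr (gtr0_norm (mulr_gt0 k0 r0)).
  rewrite ger0_norm; last by rewrite mulr_ge0 ?sqrtr_ge0 // ltW // mulr_gt0.
  rewrite exprS mulrCA -(mulrA _ r) (mulrCA _ r) ler_pM2l // mulrC -ler_pdivlMr // invrK => h.
  rewrite ger0_norm // -[leLHS]sqr_sqrtr // exprD -exprMn -expr2 -exprMn.
  have -> : ((k + 1)%:R * K * r ^+ m) = K * r ^+ m * (k + 1)%:R by ring.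
  by rewrite lerXn2r // ?nnegrE ?sqrtr_ge0 // (le_trans _ h) ?sqrtr_ge0.
apply/matrixP => a b; rewrite mx0_E; apply: smf_ext => x Vx; rewrite smf0.
have Vy : obox V0 e0 (pt x 0) by apply: box_pt; rewrite // normr0.
have mc p p' (K : 'M[A]_(p, p')) : mev x (cmx 0 K) = mev (pt x 0) K.
  by apply/matrixP => i l; rewrite !mevE cmxE co0 sliceE.
have := E0 x Vx; rewrite E1 -(mevE x (_ *m _ *m _)) !mevM // mevT mc => z.
have [_ Pp] := Vpos Vy (eq_rect_r (fun z => is_true (0 <= z)) (lexx 0) (hgt_pt x 0)).
have [/matrixP/(_ a b)|/Pp] := eqVneq (mev x (cmx j nT)) 0; first by rewrite mevE mxE.
by rewrite z ltxx.
Unshelve. all: by end_near. Qed.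

End mean_curvature_of_extension.

(** * Geodesics *)

Section real_line.
Context {R : realType}.

(** Continuous induction, by the supremum of the good initial intervals. It will show that a
    geodesic with small velocity stays in a chart up to time one. *)
Lemma real_induction (Q : R -> Prop) :
  (forall s, 0 <= s <= 1 -> (forall t, 0 <= t < s -> Q t) ->
    exists2 d : R, 0 < d & forall t, s <= t < s + d -> Q t) ->
  forall t, 0 <= t <= 1 -> Q t.
Proof.
move=> step t0 /andP[t00 t01].
pose S := [set s | 0 <= s <= 1 /\ forall t, 0 <= t < s -> Q t].
have S0 : S 0.
  by split=> [|t /andP[a b]]; [rewrite lexx ler01|have := le_lt_trans a b; rewrite ltxx].
have Sb : has_ubound S by exists 1 => s [/andP[]].
have hs : has_sup S by split => //; exists 0.
set s0 := sup S.
have s0_ge : 0 <= s0 by exact: (ub_le_sup Sb S0).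
have s0_le : s0 <= 1 by apply: ge_sup => [|s [/andP[]]//]; exists 0.
have Qs t : 0 <= t < s0 -> Q t.
  move=> /andP[t1 t2]; have [] := @sup_adherent _ S (s0 - t) _ hs; first by rewrite subr_gt0.
  by move=> s [_ H] h; apply: H; rewrite t1; move: h; rewrite -/s0 opprB addrC subrK.
have [|d d0 dQ] := step s0 _ Qs; first by rewrite s0_ge.
have Q2 t : 0 <= t < s0 + d -> Q t.
  move=> /andP[t1 t2]; have [h|h] := ltP t s0; first by apply: Qs; rewrite t1.
  by apply: dQ; rewrite h.
apply: (Q2); rewrite t00 /=; apply: le_lt_trans t01 _.
have [h|h] := ltP s0 1; last by apply: le_lt_trans h _; rewrite ltrDl.
have [//|h2] := ltP 1 (s0 + d).
have : S (s0 + d / 2).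
  split; last first.
    by move=> t /andP[a b]; apply: Q2; rewrite a; apply: lt_le_trans b _; rewrite lerD2l; lra.
  by apply/andP; split; lra.
by move=> /(ub_le_sup Sb); rewrite -/s0; lra.
Qed.

Lemma mvt_bound (f df : R -> R) (s K : R) : 0 <= s ->
  (forall t, 0 <= t <= s -> is_derive t (1 : R) f (df t)) ->
  (forall t, 0 <= t <= s -> `|df t| <= K) -> `|f s - f 0| <= K * s.
Proof.
rewrite le_eqVlt => /orP[/eqP <- _ _|s0 fd dK]; first by rewrite subrr normr0 mulr0.
have [||t] := @MVT R f df 0 s s0.
- move=> t; rewrite in_itv /= => /andP[a b]; apply: fd.
  by rewrite !ltW.
- apply: derivable_within_continuous => t; rewrite in_itv /= => ts.
  by have [] := fd t ts.
move=> /[!in_itv]/= /andP[a b] ->; rewrite subr0 normrM (ger0_norm (ltW s0)).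
by rewrite ler_pM2r //; apply: dK; rewrite !ltW.
Qed.

Lemma derive_coord {n} (c : R -> 'rV[R]_n) t i : derivable c t (1 : R) ->
  is_derive t (1 : R) (fun s => c s 0 i) (derive1 c t 0 i).
Proof.
move=> dc; apply: DeriveDef; first exact: (proj1 (derivable_mxP c t (1 : R)) dc).
by rewrite derive1E derive_mx // mxE.
Qed.

End real_line.

Section geodesic_estimate.
Context {R : realType} {n : nat} {M : manifold (R := R) n} (g : riemannian_metric M).
Variables (phi : chart R M n) (aphi : atlas phi).
Variables (gamma : R -> M) (e : R) (e0 : 0 < e).
Local Notation c := (fun s : R => cto phi (gamma s)).
Local Notation c1 := (derive1 c).
Hypothesis geo : forall t : R, - e < t < 1 + e ->
  {for t, continuous gamma} /\ (cdom phi (gamma t) ->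
      [/\ \forall s \near t, derivable c s 1,
          derivable c1 t 1 &
          forall i, derive1 c1 t 0 i
            + \sum_j \sum_l christoffel (g phi) i j l (c t) * c1 t 0 j * c1 t 0 l = 0]).
Variables (X V : 'rV[R]_n) (rh K u : R).
Hypothesis g0 : cdom phi (gamma 0).
Hypothesis c0E : c 0 = X.
Hypothesis c10E : c1 0 = V.
Hypothesis u0 : 0 < u.
Hypothesis Vu : forall i, `|V 0 i| < u.
Hypothesis K0 : 0 <= K.
Hypothesis Ku : 8 * K * u <= 1.
Hypothesis urh : 2 * u <= rh.
Hypothesis box : forall z : 'rV[R]_n, (forall j, `|z 0 j - X 0 j| <= rh) ->
  ccod phi z /\ forall i, \sum_j \sum_l `|christoffel (g phi) i j l z| <= K.

(** The bootstrap condition. While it holds, the acceleration is at most [K (2 u)^2], and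
    [8 K u <= 1] makes this at most [u / 2]. The velocity is then bounded by [3 u / 2], strictly
    better than the [2 u] assumed, and the position improves likewise. *)
Definition geo_ok t := [/\ cdom phi (gamma t), forall i, `|c t 0 i - X 0 i| < rh &
  forall i, `|c1 t 0 i| < 2 * u].

Lemma geo_dom t : 0 <= t <= 1 -> - e < t < 1 + e.
Proof. by move=> /andP[a b]; have h := e0; apply/andP; split; lra. Qed.

Lemma geo_c1 t : 0 <= t <= 1 -> cdom phi (gamma t) -> forall i,
  is_derive t (1 : R) (fun s => c s 0 i) (c1 t 0 i).
Proof.
move=> t01 ct i; have [_ /(_ ct)[dc _ _]] := geo (geo_dom t01).
by apply: derive_coord; exact: nbhs_singleton dc.
Qed.

Lemma geo_c2 t : 0 <= t <= 1 -> cdom phi (gamma t) -> forall i,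
  is_derive t (1 : R) (fun s => c1 s 0 i) (derive1 c1 t 0 i).
Proof.
by move=> t01 ct i; have [_ /(_ ct)[_ dc _]] := geo (geo_dom t01); exact: derive_coord.
Qed.

Lemma geo_acc t : 0 <= t <= 1 -> geo_ok t -> forall i, `|derive1 c1 t 0 i| <= 4 * K * u ^+ 2.
Proof.
move=> t01 [ct cX cu] i; have [_ /(_ ct)[_ _ /(_ i)/eqP]] := geo (geo_dom t01).
rewrite addr_eq0 => /eqP ->; rewrite normrN.
have [|_ /(_ i) GK] := @box (c t); first by move=> j; exact: ltW.
have h j l : `|christoffel (g phi) i j l (c t) * c1 t 0 j * c1 t 0 l| <=
    `|christoffel (g phi) i j l (c t)| * (4 * u ^+ 2).
  rewrite -mulrA normrM ler_wpM2l // normrM.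
  have -> : 4 * u ^+ 2 = (2 * u) * (2 * u) by ring.
  by apply: ler_pM => //; exact: ltW.
apply: (@le_trans _ _ (\sum_j \sum_l `|christoffel (g phi) i j l (c t)| * (4 * u ^+ 2))).
  apply: le_trans (ler_norm_sum _ _ _) _; apply: ler_sum => j _.
  by apply: le_trans (ler_norm_sum _ _ _) _; apply: ler_sum => l _.
under eq_bigr do rewrite -mulr_suml; rewrite -mulr_suml.
have -> : 4 * K * u ^+ 2 = K * (4 * u ^+ 2) by ring.
by rewrite ler_wpM2r // mulr_ge0 // sqr_ge0.
Qed.

Lemma geo_velocity s : 0 <= s <= 1 -> (forall t, 0 <= t <= s -> geo_ok t) -> forall i,
  `|c1 s 0 i - V 0 i| <= 4 * K * u ^+ 2.
Proof.
move=> /andP[s0 s1] ok i; have t1 t : 0 <= t <= s -> 0 <= t <= 1.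
  by move=> /andP[-> /le_trans]; apply.
have B0 : 0 <= 4 * K * u ^+ 2 by rewrite mulr_ge0 ?sqr_ge0 // mulr_ge0.
apply: (@le_trans _ _ (4 * K * u ^+ 2 * s)); last by rewrite ler_piMr.
rewrite -c10E; apply: (mvt_bound (f := fun s => c1 s 0 i) (df := fun s => derive1 c1 s 0 i)) => //.
- by move=> t ts; apply: geo_c2; [exact: t1|have [] := ok t ts].
- by move=> t ts; apply: geo_acc; [exact: t1|exact: ok].
Qed.

Lemma geo_position s : 0 <= s <= 1 -> (forall t, 0 <= t <= s -> geo_ok t) -> forall i,
  `|c s 0 i - X 0 i - s * V 0 i| <= 4 * K * u ^+ 2.
Proof.
move=> /andP[s0 s1] ok i; have t1 t : 0 <= t <= s -> 0 <= t <= 1.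
  by move=> /andP[-> /le_trans]; apply.
have B0 : 0 <= 4 * K * u ^+ 2 by rewrite mulr_ge0 ?sqr_ge0 // mulr_ge0.
apply: (@le_trans _ _ (4 * K * u ^+ 2 * s)); last by rewrite ler_piMr.
have -> : c s 0 i - X 0 i - s * V 0 i = (c s 0 i - s * V 0 i) - (c 0 0 i - 0 * V 0 i).
  by rewrite c0E; ring.
apply: (mvt_bound (f := fun s => c s 0 i - s * V 0 i) (df := fun s => c1 s 0 i - V 0 i)) => //.
- move=> t ts; have dc := geo_c1 (t1 t ts) (let: And3 h _ _ := ok t ts in h) i.
  have dl : is_derive t (1 : R) (fun s : R => s * V 0 i) (V 0 i).
    by apply: is_derive_eq; rewrite /GRing.scale /=; ring.
  exact: is_deriveB.
move=> t ts; apply: geo_velocity; first exact: t1.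
move=> t' /andP[a b]; apply: ok; rewrite a; case/andP: ts => _; exact: le_trans.
Qed.

Let half_u : 4 * K * u ^+ 2 <= u / 2.
Proof. have := u0; have := Ku => h1 h2; rewrite expr2; nra. Qed.

Lemma geo_small s : 0 <= s <= 1 -> (forall t, 0 <= t <= s -> geo_ok t) ->
  (forall i, `|c s 0 i - X 0 i| <= 3 / 2 * u) /\ (forall i, `|c1 s 0 i| <= 3 / 2 * u).
Proof.
move=> s01 ok; have hu := half_u; split => i; last first.
  have := geo_velocity s01 ok i; have := Vu i => h1 h2.
  have -> : c1 s 0 i = (c1 s 0 i - V 0 i) + V 0 i by rewrite subrK.
  by apply: le_trans (ler_normD _ _) _; lra.
have := geo_position s01 ok i; have := Vu i => h1 h2.
have -> : c s 0 i - X 0 i = (c s 0 i - X 0 i - s * V 0 i) + s * V 0 i by rewrite subrK.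
apply: le_trans (ler_normD _ _) _.
have : `|s * V 0 i| <= u.
  case/andP: s01 => a b; rewrite normrM (ger0_norm a).
  by apply: le_trans (ltW h1); rewrite ler_piMl.
by lra.
Qed.

Lemma box_compact (b : R) : compact [set z : 'rV[R]_n | forall i, `|z 0 i - X 0 i| <= b].
Proof.
have -> : [set z : 'rV[R]_n | forall i, `|z 0 i - X 0 i| <= b] =
    [set z : 'rV[R]_n | forall i, (fun i => `[X 0 i - b, X 0 i + b]%classic) i (z ord0 i)].
  apply/seteqP; split => z /= h i; have := h i; rewrite in_itv /= ler_distl //.
apply: (@rV_compact R n (fun i => `[X 0 i - b, X 0 i + b]%classic)) => i.
exact: segment_compact.
Qed.

(** The geodesic cannot leave the chart at time [s]: the image of a compact coordinate box is closed
    because [M] is Hausdorff, and it contains the curve just before [s]. The improved bounds are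
    closed conditions and pass to the limit. *)
Lemma geo_step s : 0 <= s <= 1 -> (forall t, 0 <= t < s -> geo_ok t) -> geo_ok s.
Proof.
move=> s01 ok; have /andP[s0 s1] := s01.
move: s0; rewrite le_eqVlt => /orP[/eqP <-|s0].
  split => // i; first by rewrite c0E subrr normr0; have := u0; have := urh; lra.
  by rewrite c10E; have := Vu i; have := u0; lra.
have ok' t : 0 <= t < s -> forall t', 0 <= t' <= t -> geo_ok t'.
  by move=> /andP[_ b] t' /andP[a' b']; apply: ok; rewrite a' /=; exact: le_lt_trans b' b.
have in1 t : 0 <= t < s -> 0 <= t <= 1.
  by move=> /andP[-> b] /=; exact: ltW (lt_le_trans b s1).
have near0 : \forall t \near s^'-, 0 <= t < s.
  near=> t; apply/andP; split; last by near: t; exact: nbhs_left_lt.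
  by apply: ltW; near: t; exact: nbhs_left_gt.
pose Z := [set z : 'rV[R]_n | forall i, `|z 0 i - X 0 i| <= 3 / 2 * u].
have Zbox z : Z z -> ccod phi z.
  move=> Zz; have [|//] := @box z; move=> j; apply: le_trans (Zz j) _.
  by have := u0; have := urh; lra.
have Fcl : closed (cof phi @` Z).
  apply: compact_closed; first exact: mhausdorff.
  apply: continuous_compact; last exact: box_compact.
  by apply: continuous_in_subspaceT => z /set_mem/Zbox; exact: cof_cont.
have [gc _] := geo (geo_dom s01).
have [z Zz zs] : (cof phi @` Z) (gamma s).
  apply: (closed_cvg _ Fcl _ _ (cvg_at_left_filter gc)).
  apply: filterS near0 => t ts; exists (c t); last first.
    by rewrite ctoK //; have [] := ok t ts.
  exact: (proj1 (geo_small (in1 t ts) (ok' t ts))).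
have cs : cdom phi (gamma s) by rewrite -zs; apply: cof_dom; exact: Zbox.
split => // i.
  rewrite -zs cofK; last exact: Zbox.
  by apply: le_lt_trans (Zz i) _; have := u0; have := urh; lra.
suff : `|c1 s 0 i| <= 3 / 2 * u by have := u0; lra.
have c1c : {for s, continuous (fun s => c1 s 0 i)}.
  have [dd _] := geo_c2 s01 cs i.
  by apply: differentiable_continuous; exact/derivable1_diffP.
have ncl : closed [set x : R | `|x| <= 3 / 2 * u].
  exact: (@closed_comp _ _ (fun x : R => `|x|) [set y : R | y <= 3 / 2 * u] (fun x _ => @norm_continuous _ R x) (@closed_le _ _)).
apply: (closed_cvg _ ncl _ _ (cvg_at_left_filter c1c)).
apply: filterS near0 => t ts.
exact: (proj2 (geo_small (in1 t ts) (ok' t ts))).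
Unshelve. all: by end_near. Qed.

Lemma geo_open s : 0 <= s <= 1 -> geo_ok s -> \forall t \near s, geo_ok t.
Proof.
move=> s01 [cs cX cu]; have [gc _] := geo (geo_dom s01).
have n1 : \forall t \near s, cdom phi (gamma t).
  by apply: gc; apply: open_nbhs_nbhs; split => //; exact: cdom_open.
have n2 : \forall t \near s, forall i, `|c t 0 i - X 0 i| < rh.
  apply: (@filter_forall _ 'I_n (fun i t => `|c t 0 i - X 0 i| < rh) (nbhs s) _) => i.
  have cc : {for s, continuous (fun t => `|c t 0 i - X 0 i|)}.
    have [dd _] := geo_c1 s01 cs i.
    have cc : {for s, continuous (fun s => c s 0 i)}.
      by apply: differentiable_continuous; exact/derivable1_diffP.
    apply: (@continuous_comp _ _ _ (fun t => c t 0 i - X 0 i) (fun x : R => `|x|)).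
      by apply: continuousB => //; exact: cst_continuous.
    exact: norm_continuous.
  by apply: (cc [set x | x < rh]); apply: open_nbhs_nbhs; split; [exact: open_lt|exact: cX].
have n3 : \forall t \near s, forall i, `|c1 t 0 i| < 2 * u.
  apply: (@filter_forall _ 'I_n (fun i t => `|c1 t 0 i| < 2 * u) (nbhs s) _) => i.
  have cc : {for s, continuous (fun t => `|c1 t 0 i|)}.
    have [dd _] := geo_c2 s01 cs i.
    have cc : {for s, continuous (fun s => c1 s 0 i)}.
      by apply: differentiable_continuous; exact/derivable1_diffP.
    apply: (@continuous_comp _ _ _ (fun t => c1 t 0 i) (fun x : R => `|x|)) => //.
    exact: norm_continuous.
  by apply: (cc [set x | x < 2 * u]); apply: open_nbhs_nbhs; split; [exact: open_lt|exact: cu].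
by near=> t; split; near: t.
Unshelve. all: by end_near. Qed.

Lemma geodesic_bound : cdom phi (gamma 1) /\
  forall i, `|c 1 0 i - X 0 i - V 0 i| <= 4 * K * u ^+ 2.
Proof.
have ok t : 0 <= t <= 1 -> geo_ok t.
  move: t; apply: real_induction => s s01 ok; have oks := geo_step s01 ok.
  have /nbhs_ballP[d /= d0 dok] := geo_open s01 oks.
  exists d; first exact: d0.
  move=> t /andP[a b]; apply: dok; rewrite /ball/= distrC ger0_norm; last by rewrite subr_ge0.
  by rewrite ltrBlDl.
have [c1' _ _] := ok 1 (introT andP (conj ler01 (lexx 1))).
split => // i; have := @geo_position 1 (introT andP (conj ler01 (lexx 1))) ok i.
by rewrite mul1r.
Qed.

End geodesic_estimate.

(** * Local models *)

Section shrinking.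
Context {R : realType}.

(** One size for finitely many statements about small boxes, one for each matrix entry or
    coordinate. *)
Lemma min_choice (I : finType) (P : I -> R -> Prop) (e : R) : 0 < e ->
  (forall i, exists2 b1 : R, 0 < b1 & forall b, 0 < b -> b <= b1 -> P i b) ->
  exists2 b1 : R, 0 < b1 <= e & forall b, 0 < b -> b <= b1 -> forall i, P i b.
Proof.
move=> e0 H; have /choice[f fP] : forall i, exists b1 : R, 0 < b1 /\ forall b, 0 < b -> b <= b1 -> P i b.
  by move=> i; have [b1 ? ?] := H i; exists b1.
exists (\big[Num.min/e]_i f i).
  apply/andP; split; last exact: bigmin_le_id.
  by apply: lt_bigmin => // i _; have [] := fP i.
move=> b b0 bf i; apply: (fP i).2 => //; apply: le_trans bf _; exact: bigmin_le.
Qed.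

Context {d : nat} (x : 'rV[R]_d).

Lemma box_le (b b1 : R) (b0 : 0 < b) (b10 : 0 < b1) : b <= b1 ->
  forall y, obox (ocube x b0) b0 y -> obox (ocube x b10) b10 y.
Proof.
move=> bb y [yb yr]; split; last exact: lt_le_trans yr bb.
by move=> j; exact: lt_le_trans (yb j) bb.
Qed.

Lemma co_restr (b b1 : R) (b0 : 0 < b) (b10 : 0 < b1) (bb : b <= b1) m
    (F : smf (obox (ocube x b10) b10)) z : ocube x b0 z ->
  co m (sres (box_le (b0 := b0) b10 bb) F) z = co m F z.
Proof.
move=> zb; have zb1 : ocube x b10 z by move=> j; exact: lt_le_trans (zb j) bb.
rewrite (co_pd m (f := F)) // ?(co_pd m (f := F)) //.
by move=> y yb; rewrite sresE.
Qed.

Lemma smf_continuous {p} (V : odom R p) (f : smf V) y : V y -> {for y, continuous f}.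
Proof. by move=> Vy; have [+ _] := smf_smooth f 0; apply. Qed.

(** The adjugate over the determinant: a function without zeros is invertible in the ring. *)
Lemma smf_inverse {p} (V : odom R p) m (H : 'M[smf V]_m) :
  (forall y, V y -> mev y H \in unitmx) -> exists Hi, H *m Hi = 1%:M.
Proof.
move=> Hu; have d0 y : V y -> (\det H) y != 0.
  move=> Vy; have := Hu y Vy; rewrite unitmxE unitfE.
  by rewrite -[mev y H]/(map_mx (sev Vy) H) det_map_mx.
exists (sinv d0 *: \adj H).
by rewrite -scalemxAr mul_mx_adj scale_scalar_mx mulrC smulV.
Qed.

Lemma unit_near (b1 : R) (b10 : 0 < b1) m (H : 'M[smf (obox (ocube x b10) b10)]_m) :
  mev (pt x 0) H \in unitmx -> exists2 b2 : R, 0 < b2 <= b1 &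
    forall b (b0 : 0 < b), b <= b2 -> forall y, obox (ocube x b0) b0 y -> mev y H \in unitmx.
Proof.
have V0 : obox (ocube x b10) b10 (pt x 0).
  by apply: box_pt; rewrite ?normr0 //; exact: cube_opt.
have detE y (Vy : obox (ocube x b10) b10 y) : (mev y H \in unitmx) = ((\det H) y != 0).
  by rewrite unitmxE unitfE -[mev y H]/(map_mx (sev Vy) H) det_map_mx.
rewrite detE // => d0; have dc := smf_continuous (f := \det H) V0.
have : \forall y \near pt x 0, (\det H) y != 0.
  apply: (dc [set t | t != 0]); apply: open_nbhs_nbhs; split => //; exact: open_neq.
move=> /nbhs_obox[b2 b20 H2].
exists (Num.min b1 b2); first by rewrite lt_min b10 b20 ge_min lexx.
move=> b b0; rewrite le_min => /andP[bb1 bb2] y yb; rewrite detE; first exact: H2 yb.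
exact: (box_le b10 bb1 yb).
Qed.

End shrinking.

Section metric_model.
Context {R : realType} {n : nat} {M : manifold (R := R) n}.
Variables (g : riemannian_metric M) (phi : chart R M n).
Hypothesis aphi : atlas phi.
Hypothesis n0 : (0 < n)%N.

Lemma metric_model (e0 : R) (gr : R -> riemannian_metric M) z0 :
  even_poincare g e0 gr -> ccod phi z0 ->
  exists b (b0 : 0 < b) (G Gi : 'M[smf (obox (ocube z0 b0) b0)]_n),
  [/\ G^T = G, G *m Gi = 1%:M, cmx 1 G = 0 /\ cmx 3 G = 0,
      forall y, obox (ocube z0 b0) b0 y -> 0 <= hgt y -> gr (hgt y) phi (base y) = mev y G &
      forall x, ocube z0 b0 x -> ccod phi x].
Proof.
move=> [e00 ev _ _] cz.
pose f (ij : 'I_n * 'I_n) (y : 'rV[R]_(n + 1)) := gr (hgt y) phi (base y) ij.1 ij.2.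
have [b1 /andP[b10 _] H] := @min_choice R ('I_n * 'I_n)%type
  (fun ij b => forall b0 : 0 < b, exists2 F : smf (obox (ocube z0 b0) b0),
      (forall y, obox (ocube z0 b0) b0 y -> ccod phi (base y) /\ (0 <= hgt y -> f ij y = F y)) &
      forall j, odd j -> co j F = 0) _ e00
  (fun ij => let: ex_intro2 b1 h1 h2 := even_smf (@ccod_open _ _ _ phi) cz e00 (ev phi aphi ij.1 ij.2)
     in ex_intro2 _ _ b1 (proj1 (andP h1)) (fun b _ bb b0 => h2 b b0 bb)).
have /choice[F FP] : forall ij, exists F : smf (obox (ocube z0 b10) b10),
   (forall y, obox (ocube z0 b10) b10 y -> ccod phi (base y) /\ (0 <= hgt y -> f ij y = F y)) /\
      forall j, odd j -> co j F = 0.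
  by move=> ij; have [F ? ?] := H b1 b10 (lexx _) ij b10; exists F.
(* The extensions chosen for the entries [(i, j)] and [(j, i)] may differ for [r < 0]. Averaging
   restores the symmetry and leaves the values for [r >= 0] unchanged. *)
pose G1 : 'M[smf (obox (ocube z0 b10) b10)]_n := \matrix_(i, j) (scst 2^-1 * (F (i, j) + F (j, i))).
have G1s : G1^T = G1 by apply/matrixP => i j; rewrite !mxE addrC.
have G1E y : obox (ocube z0 b10) b10 y -> 0 <= hgt y -> gr (hgt y) phi (base y) = mev y G1.
  move=> yb y0; apply/matrixP => i j; rewrite !mxE smfM // scstE // smfD //.
  have [cy /(_ y0) <-] := (FP (i, j)).1 y yb; have [_ /(_ y0) <-] := (FP (j, i)).1 y yb.
  have /matrixP/(_ j i) := rmet_sym (gr (hgt y)) aphi cy; rewrite mxE /f /= => ->.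
  by field.
have V0 : obox (ocube z0 b10) b10 (pt z0 0).
  by apply: box_pt; rewrite ?normr0 //; exact: cube_opt.
have [|b2 /andP[b20 b21] U2] := @unit_near _ _ z0 b1 b10 _ G1.
  apply: posdef_unit; rewrite -G1E ?hgt_pt // base_pt; split; first exact: rmet_sym.
  by move=> v v0; exact: rmet_pos.
pose G := map_mx (sres (box_le (b0 := b20) b10 b21)) G1.
have GE y : obox (ocube z0 b20) b20 y -> mev y G = mev y G1.
  by move=> yb; apply/matrixP => i j; rewrite !mxE sresE.
have [|Gi GGi] := @smf_inverse _ _ _ _ G.
  by move=> y yb; rewrite GE //; exact: (U2 b2 b20).
have Godd m : odd m -> cmx m G = 0.
  move=> om; apply/matrixP => i j; rewrite cmxE mxE [RHS]mxE; apply: smf_ext => z zb.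
  rewrite smf0 co_restr // mxE co_cstM raddfD /= (FP (i, j)).2 // (FP (j, i)).2 // addr0.
  by rewrite mulr0 smf0.
exists b2, b20, G, Gi; split=> //.
- by rewrite map_trmx G1s.
- by split; exact: Godd.
- by move=> y yb y0; rewrite GE // G1E //; exact: (box_le b10 b21 yb).
move=> x xb; have xb1 : obox (ocube z0 b10) b10 (pt x 0).
  by apply: box_pt; rewrite ?normr0 // => j; exact: lt_le_trans (xb j) b21.
by have [] := (FP (Ordinal n0, Ordinal n0)).1 _ xb1; rewrite base_pt.
Qed.

Lemma christoffel_bound z0 : ccod phi z0 -> exists rh K : R, [/\ 0 < rh, 0 <= K &
  forall z : 'rV[R]_n, (forall j, `|z 0 j - z0 0 j| <= rh) ->
  ccod phi z /\ forall i, \sum_j \sum_l `|christoffel (g phi) i j l z| <= K].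
Proof.
move=> cz.
have [b1 /andP[b10 _] H] := @min_choice R ('I_n * 'I_n)%type
  (fun ij b => forall b0 : 0 < b, exists F : smf (ocube z0 b0),
      forall z, ocube z0 b0 z -> ccod phi z /\ g phi z ij.1 ij.2 = F z) 1 ltr01
  (fun ij => let: ex_intro2 b1 h1 h2 := smooth_smf (@ccod_open _ _ _ phi) cz (rmet_smooth g aphi ij.1 ij.2)
     in ex_intro2 _ _ b1 h1 (fun b _ bb b0 => h2 b b0 bb)).
have /choice[F FP] : forall ij, exists F : smf (ocube z0 b10),
   forall z, ocube z0 b10 z -> ccod phi z /\ g phi z ij.1 ij.2 = F z.
  by move=> ij; exact: (H b1 b10 (lexx _) ij b10).
have cc z : ocube z0 b10 z -> ccod phi z.
  by move=> zb; have [] := FP (Ordinal n0, Ordinal n0) z zb.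
pose G : 'M[smf (ocube z0 b10)]_n := \matrix_(i, j) F (i, j).
have GE z : ocube z0 b10 z -> g phi z = mev z G.
  by move=> zb; apply/matrixP => i j; rewrite !mxE; have [_ ->] := FP (i, j) z zb.
have [z zb|Gi GGi] := @smf_inverse _ _ (ocube z0 b10) _ G.
  rewrite -GE //; apply: posdef_unit; split; first by apply: rmet_sym => //; exact: cc.
  by move=> v v0; apply: rmet_pos => //; exact: cc.
pose Ga (t : 'I_n * 'I_n * 'I_n) := Gam (@sDa R _ (ocube z0 b10)) (scst 2^-1) G Gi t.1.2 t.1.1 t.2.
have z00 : ocube z0 b10 z0 by exact: cube_opt.
have Ga_near t : nbhs z0 [set z | `|Ga t z| < `|Ga t z0| + 1].
  have cG := smf_continuous (f := Ga t) z00.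
  have cN : {for z0, continuous (fun z => `|Ga t z|)}.
    by apply: (@continuous_comp _ _ _ (Ga t) (fun x : R => `|x|)) => //; exact: norm_continuous.
  by apply: (cN [set x | x < `|Ga t z0| + 1]); apply: open_nbhs_nbhs; split; [exact: open_lt|rewrite /= ltrDl].
have [b /andP[b0 bb1] Hb] := @min_choice R ('I_n * 'I_n * 'I_n)%type
  (fun t b => forall b0 : 0 < b, forall z, ocube z0 b0 z -> `|Ga t z| < `|Ga t z0| + 1) b1 b10
  (fun t => let: ex_intro2 b1 h1 h2 := nbhs_cube (Ga_near t)
     in ex_intro2 _ _ b1 h1 (fun b _ bb b0 => h2 b b0 bb)).
have b2 : b / 2 < b by lra.
exists (b / 2), (\sum_i \sum_j \sum_l (`|Ga (i, j, l) z0| + 1)); split.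
- by rewrite divr_gt0.
- by apply: sumr_ge0 => i _; apply: sumr_ge0 => j _; apply: sumr_ge0 => l _; rewrite addr_ge0.
move=> z zb; have zb0 : ocube z0 b0 z by move=> j; exact: le_lt_trans (zb j) b2.
have zb1 : ocube z0 b10 z by move=> j; exact: lt_le_trans (zb0 j) bb1.
split; first exact: cc.
move=> i; rewrite [leRHS](bigD1 i) //= -[leLHS]addr0; apply: lerD; last first.
  by apply: sumr_ge0 => i' _; apply: sumr_ge0 => j _; apply: sumr_ge0 => l _; rewrite addr_ge0.
apply: ler_sum => j _; apply: ler_sum => l _.
rewrite (christoffel_smf GE GGi) //; apply: ltW; exact: (Hb b b0 (lexx _) (i, j, l) b0 z zb0).
Qed.

End metric_model.

Section exponential_estimate.
Context {R : realType} {n : nat} {M : manifold (R := R) n} (g : riemannian_metric M).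
Hypothesis n0 : (0 < n)%N.

(** An error quadratic in the velocity is enough: for velocities of size [r^2] it is of order [r^4],
    so the coefficients up to [r^3] of the end point are those of the velocity. Neither uniqueness
    nor smooth dependence of geodesics has to be established. *)
Lemma exp_estimate (phi : chart R M n) X : atlas phi -> ccod phi X ->
  exists rh K : R, [/\ 0 < rh, 0 <= K &
   forall v q u, is_exp g (cof phi X) v q -> 0 < u -> (forall i, `|v phi 0 i| < u) ->
    8 * K * u <= 1 -> 2 * u <= rh ->
    cdom phi q /\ forall i, `|cto phi q 0 i - X 0 i - v phi 0 i| <= 4 * K * u ^+ 2].
Proof.
move=> aphi cX; have [rh [K [rh0 K0 box]]] := christoffel_bound g aphi n0 cX.
exists rh, K; split => // v q u [gamma [[e e0 geo] gp gq gv]] u0 vu Ku urh.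
have dX := cof_dom cX.
have g0 : cdom phi (gamma 0) by rewrite gp.
have geo' t : - e < t < 1 + e ->
  {for t, continuous gamma} /\ (cdom phi (gamma t) ->
      [/\ \forall s \near t, derivable (fun s : R => cto phi (gamma s)) s 1,
          derivable (derive1 (fun s : R => cto phi (gamma s))) t 1 &
          forall i, derive1 (derive1 (fun s : R => cto phi (gamma s))) t 0 i
            + \sum_j \sum_l christoffel (g phi) i j l (cto phi (gamma t)) *
               derive1 (fun s : R => cto phi (gamma s)) t 0 j *
               derive1 (fun s : R => cto phi (gamma s)) t 0 l = 0]).
  by move=> /geo[gc gg]; split => // ct; exact: (gg phi aphi ct).
have c0 : cto phi (gamma 0) = X by rewrite gp cofK.
have := geodesic_bound e0 geo' g0 c0 (gv phi aphi dX) u0 vu K0 Ku urh box.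
by rewrite gq.
Qed.

(** [is_exp] speaks of some geodesic; with zero velocity [exp_estimate] holds for every small [u],
    and this pins down the end point. *)
Lemma exp_zero p v q : is_exp g p v q -> (forall phi, atlas phi -> cdom phi p -> v phi = 0) -> q = p.
Proof.
move=> ex v0; have [phi aphi dp] := atlas_cover p.
have cX := cto_cod dp; have [rh [K [rh0 K0 H]]] := exp_estimate aphi cX.
rewrite ctoK // in H.
have vv : v phi = 0 by exact: v0.
have Hu u : 0 < u -> 8 * K * u <= 1 -> 2 * u <= rh -> cdom phi q /\
    forall i, `|cto phi q 0 i - cto phi p 0 i| <= 4 * K * u ^+ 2.
  move=> u0 Ku ur; have [|dq] := H v q u ex u0 _ Ku ur; first by move=> i; rewrite vv mxE normr0.
  by rewrite vv => bq; split => // i; have := bq i; rewrite mxE subr0.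
pose u1 := Num.min (rh / 2) (1 / (8 * K + 1)).
have K1 : 0 < 8 * K + 1 by lra.
have u10 : 0 < u1 by rewrite lt_min !divr_gt0.
have u1r : 2 * u1 <= rh.
  have h : u1 <= rh / 2 by rewrite ge_min lexx.
  lra.
have u1K : 8 * K * u1 <= 1.
  have : u1 <= 1 / (8 * K + 1) by rewrite ge_min lexx orbT.
  rewrite ler_pdivlMr // => h; have := ltW u10; nra.
have [dq _] := Hu u1 u10 u1K u1r.
have E : cto phi q = cto phi p.
  apply/rowP => i; apply/eqP; rewrite -subr_eq0 -normr_le0 leNgt; apply/negP => t0.
  set t := `|_| in t0.
  (* With this [u] the bound [4 K u^2] is at most [4 K u1 u], hence smaller than [t]. *)
  pose u := Num.min u1 (t / (4 * K * u1 + 1)).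
  have K2 : 0 < 4 * K * u1 + 1 by rewrite ltr_pwDr // !mulr_ge0 // ltW.
  have uu : 0 < u by rewrite lt_min u10 divr_gt0.
  have uu1 : u <= u1 by rewrite ge_min lexx.
  have [||_ /(_ i)] := Hu u uu; [|by apply: le_trans u1r; rewrite ler_pM2l|].
    by apply: le_trans u1K; rewrite ler_wpM2l // mulr_ge0.
  rewrite -/t; have : u <= t / (4 * K * u1 + 1) by rewrite ge_min lexx orbT.
  rewrite ler_pdivlMr // expr2 => h1 h2.
  have : 4 * K * (u * u) <= 4 * K * u1 * u.
    by rewrite -[4 * K * u1 * u]mulrA ler_wpM2l ?mulr_ge0 // ler_wpM2r // ltW.
  by lra.
by rewrite -(ctoK dq) E ctoK.
Qed.

End exponential_estimate.

Section congruence.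
Context {R : realType}.

Lemma posdef_congr {m p} (G : 'M[R]_p) (J : 'M[R]_(m, p)) :
  posdef G -> row_free J -> posdef (J *m G *m J^T).
Proof.
move=> [Gs Gp] Jf; split; first by rewrite trmx_mul3 trmxK Gs.
move=> v v0; have vJ : v *m J != 0.
  by apply: contra_neq v0 => vJ; apply: (row_free_inj Jf); rewrite vJ mul0mx.
by have := Gp _ vJ; rewrite trmx_mul !mulmxA.
Qed.

Lemma row_free_block {m p q} (X : 'M[R]_(m, p)) (Y : 'M[R]_(q, p)) :
  row_free X -> row_free (block_mx X 0 Y (1%:M : 'M[R]_q)).
Proof.
move=> Xf; rewrite -kermx_eq0; apply/negPn/negP => /rowV0Pn[v].
rewrite sub_kermx -[v]hsubmxK mul_row_block mulmx0 mulmx1 add0r -row_mx0 => /eqP/eq_row_mx[h1 h2].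
move: h1; rewrite h2 mul0mx addr0 => h1; rewrite -row_mx0; apply/negP; rewrite negbK.
apply/eqP; congr row_mx; by apply: (row_free_inj Xf); rewrite h1 mul0mx.
Qed.
End congruence.

(** * The extension in charts *)

Section extension_in_charts.
Context {R : realType} {k n : nat} {S : manifold (R := R) k} {M : manifold (R := R) n}.
Variables (g : riemannian_metric M) (gr : R -> riemannian_metric M) (iota : S -> M).
Variables (e1 : R) (U : chart R M n -> S -> R -> 'rV[R]_n) (E : S -> R -> M).
Hypothesis n0 : (0 < n)%N.
Hypothesis e10 : 0 < e1.
Hypothesis emb : embedding iota.
Hypothesis Ymin : even_minimal_extension g gr iota e1 U E.

Lemma extension_at0 p : E p 0 = iota p.
Proof.
have [[_ _ _ U0] ex _ _] := Ymin.
have h : 0 <= (0 : R) < e1 by rewrite lexx.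
apply: (exp_zero n0 (ex p 0 h)) => phi aphi dp; exact: U0.
Qed.

Section chart_pair.
Variables (psi : chart R S k) (phi : chart R M n).
Hypotheses (apsi : atlas psi) (aphi : atlas phi).

Definition in_chart b (x0 : 'rV[R]_k) (b0 : 0 < b) (F : 'I_n -> smf (obox (ocube x0 b0) b0)) :=
  forall y, obox (ocube x0 b0) b0 y -> ccod psi (base y) /\
    (0 <= hgt y -> cdom phi (E (cof psi (base y)) (hgt y)) /\
      cto phi (E (cof psi (base y)) (hgt y)) = \row_i F i y).

Lemma extension_chart x0 : ldom iota psi phi x0 ->
  exists2 b1 : R, 0 < b1 <= e1 & forall b (b0 : 0 < b), b <= b1 ->
    exists F : 'I_n -> smf (obox (ocube x0 b0) b0), in_chart F.
Proof.
move=> [cx dx]; have [_ _ sm _] := Ymin.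
have a0 : collar (ccod psi) e1 (pt x0 0) by rewrite /collar /= base_pt hgt_pt lexx.
have d0 : cdom phi (E (cof psi (base (pt x0 0))) (hgt (pt x0 0))).
  by rewrite base_pt hgt_pt extension_at0.
have [V [oV Va VP sV]] := sm psi apsi (pt x0 0) phi a0 aphi d0.
have loc j : exists2 b1 : R, 0 < b1 & forall b, 0 < b -> b <= b1 -> forall b0 : 0 < b,
   exists F : smf (obox (ocube x0 b0) b0), forall y, obox (ocube x0 b0) b0 y ->
    V y /\ (ccod psi (base y) /\ (0 <= hgt y < e1 ->
      cto phi (E (cof psi (base y)) (hgt y)) 0 j = F y)).
  have [V' [F [oV' Va' CF fF]]] := sV j (pt x0 0) (conj a0 Va).
  have [b1 b10 H] := nbhs_obox (filterI (open_nbhs_nbhs (conj oV Va)) (open_nbhs_nbhs (conj oV' Va'))).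
  have [b2 b20 H2] := nbhs_cube (open_nbhs_nbhs (conj (@ccod_open _ _ _ psi) cx)).
  exists (Num.min b1 b2); first by rewrite lt_min b10.
  move=> b _; rewrite le_min => /andP[bb1 bb2] b0; have HV := H b b0 bb1.
  exists (smk (fun N => class_C_sub (fun y yb => (HV y yb).2) (CF N))) => y yb.
  have [Vy Vy'] := HV y yb; have cy : ccod psi (base y) by apply: (H2 b b0 bb2); case: yb.
  split => //; split => // hy; rewrite smkE // -fF //; split => //; split => //.
have [b1 b1e H] := min_choice e10 loc.
exists b1 => // b b0 bb; have /choice[F FP] := fun j => H b b0 bb j b0.
exists F => y yb; split; first by have [_ []] := FP (Ordinal n0) y yb.
move=> y0; have ye : 0 <= hgt y < e1.
  rewrite y0 /=; case: yb => _; rewrite ger0_norm // => h; apply: lt_le_trans h _.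
  by apply: le_trans bb _; case/andP: b1e.
split; last by apply/rowP => j; rewrite mxE; have [_ [_ ->]] := FP j y yb.
by have [Vy [cy _]] := FP (Ordinal n0) y yb; apply: VP.
Qed.

Lemma ldom_open : open (ldom iota psi phi).
Proof.
rewrite openE => x xl; have [b /andP[b0 _] H] := extension_chart xl.
have [F FP] := H b b0 (lexx _).
have : nbhs x (cube x b) by apply: open_nbhs_nbhs; split; [exact: cube_open|exact: cube_opt].
apply: filterS => z zb.
have zB : obox (ocube x b0) b0 (pt z 0) by apply: box_pt; rewrite ?normr0.
have [] := FP _ zB; rewrite base_pt hgt_pt extension_at0 => cz /(_ (lexx _))[dz _].
by split.
Qed.

Section one_model.
Context {x0 : 'rV[R]_k} {b : R} {b0 : 0 < b} (F : 'I_n -> smf (obox (ocube x0 b0) b0)).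
Hypothesis FP : in_chart F.

Lemma model_ldom x : ocube x0 b0 x -> ldom iota psi phi x.
Proof.
move=> xb; have xB : obox (ocube x0 b0) b0 (pt x 0) by apply: box_pt; rewrite ?normr0.
by have [] := FP xB; rewrite base_pt hgt_pt extension_at0 => cz /(_ (lexx _))[dz _].
Qed.

Lemma model_lmap x : ocube x0 b0 x -> lmap iota psi phi x = \row_i X0 F i x.
Proof.
move=> xb; have xB : obox (ocube x0 b0) b0 (pt x 0) by apply: box_pt; rewrite ?normr0.
have [_] := FP xB; rewrite base_pt hgt_pt extension_at0 => /(_ (lexx _))[_ h].
by rewrite /lmap h; apply/rowP => i; rewrite !mxE /X0 co0 sliceE.
Qed.

Lemma model_jac x : ocube x0 b0 x -> jac (lmap iota psi phi) x = mev x (Xm F).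
Proof.
move=> xb; apply/matrixP => a i; rewrite !mxE; apply: pd_smf => // z zb.
by rewrite model_lmap // mxE.
Qed.

Lemma Xm_free x : ocube x0 b0 x -> row_free (mev x (Xm F)).
Proof.
move=> xb; rewrite -model_jac //; have [_ + _ _] := emb; apply => //; exact: model_ldom.
Qed.

Lemma mev_cmx0 m p (T : 'M[smf (obox (ocube x0 b0) b0)]_(m, p)) x : ocube x0 b0 x ->
  mev (pt x 0) T = mev x (cmx 0 T).
Proof. by move=> xb; apply/matrixP => i j; rewrite !mevE cmxE co0 sliceE. Qed.

Lemma Ymap_model y : obox (ocube x0 b0) b0 y -> 0 <= hgt y ->
  Ymap E psi phi y = \row_i emap F i y.
Proof. by move=> yb y0; have [_ /(_ y0)[_ h]] := FP yb; rewrite /Ymap h emap_pt. Qed.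

End one_model.

Variables (z0 : 'rV[R]_n) (bW : R) (bW0 : 0 < bW).
Variables (G Gi : 'M[smf (obox (ocube z0 bW0) bW0)]_n).
Hypothesis Wphi : forall x, ocube z0 bW0 x -> ccod phi x.
Hypothesis gE : forall y, obox (ocube z0 bW0) bW0 y -> 0 <= hgt y ->
  gr (hgt y) phi (base y) = mev y G.
Hypothesis Gs : G^T = G.

Lemma Gbar_posdef b (b0 : 0 < b) (V0 : odom R k) (F : 'I_n -> smf (obox V0 b0))
  (UV : forall y, obox V0 b0 y -> obox (ocube z0 bW0) bW0 (\row_i emap F i y)) y :
  obox V0 b0 y -> 0 <= hgt y -> posdef (mev y (Gbar UV G)).
Proof.
move=> yb y0; have Wy := UV y yb.
rewrite -[mev y _]/(map_mx (sev yb) _) map_block_mx !map_mx0 map_mx1.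
apply: posdef_block1.
have -> : map_mx (sev yb) (map_mx (ev UV) G) = mev (\row_i emap F i y) G.
  by apply/matrixP => i j; rewrite !mxE /= /sev evE // emap_pt.
rewrite -gE //; last by rewrite emap_pt // hgt_pt.
by split; [apply: rmet_sym|apply: rmet_pos] => //; apply: Wphi; case: Wy.
Qed.

Lemma local_model x0 : ldom iota psi phi x0 -> lmap iota psi phi x0 = z0 ->
  exists2 b1 : R, 0 < b1 <= e1 & forall b (b0 : 0 < b), b <= b1 ->
    exists (F : 'I_n -> smf (obox (ocube x0 b0) b0))
      (UV : forall y, obox (ocube x0 b0) b0 y -> obox (ocube z0 bW0) bW0 (\row_i emap F i y)) N,
      Hbar UV G *m N = 1%:M /\ in_chart F.
Proof.
move=> xl xz; have [b1 /andP[b10 b1e] H] := extension_chart xl.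
have [F FP] := H b1 b10 (lexx _).
have xB : obox (ocube x0 b10) b10 (pt x0 0) by apply: box_pt; rewrite ?normr0 //; exact: cube_opt.
have Fx i : F i (pt x0 0) = z0 0 i.
  have := model_lmap FP (cube_opt x0 b10); rewrite xz => /rowP/(_ i) ->.
  by rewrite mxE /X0 co0 sliceE //; exact: cube_opt.
have near_F i : exists2 b2 : R, 0 < b2 & forall b, 0 < b -> b <= b2 -> forall b0 : 0 < b,
    forall y, obox (ocube x0 b0) b0 y -> `|F i y - z0 0 i| < bW.
  have Fc := smf_continuous (f := F i) xB.
  have : \forall y \near pt x0 0, `|z0 0 i - F i y| < bW.
    by move/cvgrPdist_lt: Fc => /(_ bW bW0); rewrite Fx.
  move=> /nbhs_obox[b2 b20 H2]; exists b2 => // b _ bb b0 y yb; rewrite distrC.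
  exact: (H2 b b0 bb y yb).
have mb0 : 0 < Num.min b1 bW by rewrite lt_min b10.
have [b2 /andP[b20 b2m] H2] := min_choice mb0 near_F.
move: b2m; rewrite le_min => /andP[b21 b2W].
have b12 b : b <= b2 -> b <= b1 by move=> h; exact: le_trans h b21.
pose Fb b (b0 : 0 < b) (bb : b <= b2) i := sres (box_le (b0 := b0) b10 (b12 b bb)) (F i).
have UVb b (b0 : 0 < b) (bb : b <= b2) y : obox (ocube x0 b0) b0 y ->
    obox (ocube z0 bW0) bW0 (\row_i emap (Fb b b0 bb) i y).
  move=> yb; rewrite emap_pt //; apply: box_pt; last first.
    by case: yb => _ h; apply: lt_le_trans h _; exact: le_trans bb b2W.
  move=> i; rewrite mxE sresE //; exact: (H2 b b0 bb i b0).
have FPb b (b0 : 0 < b) (bb : b <= b2) : in_chart (Fb b b0 bb).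
  move=> y yb; have [cy cd] := FP _ (box_le b10 (b12 b bb) yb); split => // y0.
  have [dy ->] := cd y0; split => //; apply/rowP => i; by rewrite !mxE sresE.
(* On smaller boxes [Hbar] takes the same values, so that the radius of invertibility found by
   [unit_near] on one box serves all smaller ones. *)
have HbarE' b (b0 : 0 < b) (bb : b <= b2) y : obox (ocube x0 b0) b0 y ->
    mev y (Hbar (UVb b b0 bb) G) = mev y (Hbar (UVb b2 b20 (lexx _)) G).
  move=> yb; have yb2 : obox (ocube x0 b20) b20 y := box_le b20 bb yb.
  have eF i z : obox (ocube x0 b0) b0 z -> emap (Fb b2 b20 (lexx _)) i z = emap (Fb b b0 bb) i z.
    move=> zb; have zb2 : obox (ocube x0 b20) b20 z := box_le b20 bb zb.
    by move: i; apply: ord_add1 => [i|]; rewrite ?emapL ?emapR ?sresE ?srE.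
  rewrite -!(HbarE _ Gs) !mevM // !mevT.
  have -> : mev y (Jm (Fb b b0 bb)) = mev y (Jm (Fb b2 b20 (lexx _))).
    by apply/matrixP => a i; rewrite !mevE !JmE -(pd_smf _ (eF i)) // sDE.
  congr (_ *m _ *m _).
  rewrite -[LHS]/(map_mx (sev yb) _) -[RHS]/(map_mx (sev yb2) _) !map_block_mx !map_mx0 !map_mx1.
  congr block_mx; apply/matrixP => i j; rewrite !mxE /= /sev !evE //; congr (smf_fun _ (pt _ _)).
  by apply/rowP => l; rewrite !mxE !sresE.
have x0b := cube_opt x0 b20.
have [|b3 /andP[b30 b32] H3] := @unit_near _ _ x0 b2 b20 _ (Hbar (UVb b2 b20 (lexx _)) G).
  have xB2 : obox (ocube x0 b20) b20 (pt x0 0) by apply: box_pt; rewrite ?normr0.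
  apply: posdef_unit; rewrite -(HbarE _ Gs) !mevM // mevT; apply: posdef_congr.
    by apply: Gbar_posdef => //; rewrite hgt_pt.
  rewrite -[mev _ _]/(map_mx (sev xB2) _) map_block_mx !map_mx0 map_mx1; apply: row_free_block.
  rewrite -[map_mx _ _]/(mev (pt x0 0) _) mev_cmx0 // cmx_Ea; exact: (Xm_free (FPb b2 b20 (lexx _))).
exists b3; first by rewrite b30 (le_trans b32) // (le_trans b21).
move=> b b0 bb; have bb2 := le_trans bb b32.
have [y yb|N HN] := @smf_inverse _ _ (obox (ocube x0 b0) b0) _ (Hbar (UVb b b0 bb2) G).
  by rewrite HbarE' //; exact: (H3 b b0 bb).
by exists (Fb b b0 bb2), (UVb b b0 bb2), N; split; [exact: HN|exact: FPb].
Qed.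

End chart_pair.
End extension_in_charts.

(** * Taylor coefficients of the extension *)

Section local_expansion.
Context {R : realType} {k n : nat} {S : manifold (R := R) k} {M : manifold (R := R) n}.
Variables (g : riemannian_metric M) (e0 : R) (gr : R -> riemannian_metric M) (iota : S -> M).
Variables (e1 : R) (U : chart R M n -> S -> R -> 'rV[R]_n) (E : S -> R -> M).
Hypothesis n3 : (3 <= n)%N.
Hypothesis k1 : (1 <= k)%N.
Hypothesis e10 : 0 < e1.
Hypothesis emb : embedding iota.
Hypothesis gP : even_poincare g e0 gr.
Hypothesis Ymin : even_minimal_extension g gr iota e1 U E.
Variables (psi : chart R S k) (phi : chart R M n).
Hypotheses (apsi : atlas psi) (aphi : atlas phi).
Variables (z0 : 'rV[R]_n) (bW : R) (bW0 : 0 < bW).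
Local Notation W0 := (ocube z0 bW0).
Local Notation C := (smf (obox W0 bW0)).
Variables (G Gi : 'M[C]_n).
Hypothesis Gs : G^T = G.
Hypothesis GGi : G *m Gi = 1%:M.
Hypothesis G1 : cmx 1 G = 0.
Hypothesis G3 : cmx 3 G = 0.
Hypothesis gE : forall y, obox W0 bW0 y -> 0 <= hgt y -> gr (hgt y) phi (base y) = mev y G.
Hypothesis Wphi : forall x, W0 x -> ccod phi x.
Variables (x0 : 'rV[R]_k) (b : R) (b0 : 0 < b) (be1 : b <= e1).
Local Notation V0 := (ocube x0 b0).
Local Notation A := (smf (obox V0 b0)).
Local Notation B := (smf V0).
Local Notation half := (scst 2^-1).
Variable F : 'I_n -> A.
Hypothesis UV : forall y, obox V0 b0 y -> obox W0 bW0 (\row_i emap F i y).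
Variable N : 'M[A]_(k + 1).
Hypothesis HN : Hbar UV G *m N = 1%:M.
Hypothesis FP : in_chart E psi phi F.
Variable Us : 'I_n -> A.
Hypothesis UsE : forall i y, obox V0 b0 y -> 0 <= hgt y ->
  U phi (cof psi (base y)) (hgt y) 0 i = Us i y.
Hypothesis Uodd : forall i j, odd j -> co j (Us i) = 0.
Let n0 : (0 < n)%N. Proof. exact: leq_trans n3. Qed.
Local Notation lm := (lmap iota psi phi).

Lemma local_ldom x : V0 x -> ldom iota psi phi x.
Proof. exact: (model_ldom n0 e10 Ymin FP). Qed.

Lemma local_lmap x : V0 x -> lm x = \row_i X0 F i x.
Proof. exact: (model_lmap n0 e10 Ymin FP). Qed.

Lemma local_GD y : W0 y -> g phi y = mev y (cmx 0 G).
Proof.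
move=> Wy; have [_ _ g0 _] := gP; rewrite -g0 //; last exact: Wphi.
have yB : obox W0 bW0 (pt y 0) by apply: box_pt; rewrite ?normr0.
by have := gE yB; rewrite hgt_pt base_pt lexx => ->; rewrite // mev_cmx0.
Qed.

Lemma Us0 i x : V0 x -> co 0 (Us i) x = 0.
Proof.
move=> Vx; have [[_ _ _ U0] _ _ _] := Ymin; have [_ dx] := local_ldom Vx.
have xB : obox V0 b0 (pt x 0) by apply: box_pt; rewrite ?normr0.
by rewrite co0 sliceE // -UsE ?hgt_pt // base_pt U0 // mxE.
Qed.

(** The function [Us] has no terms of order zero and one, so [exp_estimate] applies with [u = c r^2]
    and leaves an error of order [r^4]. *)
Lemma geodesic_expansion i x j : V0 x -> (j < 4)%N ->
  co j (F i - Us i - scst (X0 F i x)) x = 0.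
Proof.
move=> Vx; have [[_ _ _ _] ex _ _] := Ymin; have [cx dx] := local_ldom Vx.
have cX := cto_cod dx; have [rh [K [rh0 K0 H]]] := exp_estimate g n0 aphi cX.
rewrite ctoK // in H.
(* One constant for all components; the added [1] makes the bound strict, as [exp_estimate]
   demands. *)
have [c cP] : exists c : R, 0 < c /\ \forall r \near (0 : R)^'+, forall i, `|Us i (pt x r)| < c * r ^+ 2.
  have /choice[f fP] : forall i, exists c : R, 0 < c /\ exists2 b' : R, 0 < b' &
      forall r : R, `|r| < b' -> `|Us i (pt x r)| <= c * `|r| ^+ 2.
    move=> i'; have [c c0 [b' /andP[b'0 _] T]] := taylor 2 (Us i') Vx; exists c; split => //.
    exists b' => // r rb; have [|_] := T x r _ rb; first by move=> l; rewrite subrr normr0.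
    by rewrite !big_ord_recl big_ord0 /= Us0 // Uodd // smf0 !mul0r !addr0 subr0.
  have s0 : 0 <= \sum_i f i by apply: sumr_ge0 => l _; apply: ltW; have [] := fP l.
  exists (1 + \sum_i f i); split; first by rewrite ltr_pwDl.
  apply: (@filter_forall _ 'I_n (fun i r => `|Us i (pt x r)| < (1 + \sum_i f i) * r ^+ 2) ((0 : R)^'+) _) => l.
  have [f0 [b' b'0 fb]] := fP l; near=> r.
  have r0 : 0 < r by near: r; exact: nbhs_right_gt.
  have rb : `|r| < b' by rewrite gtr0_norm //; near: r; exact: nbhs_right_lt.
  apply: le_lt_trans (fb r rb) _; rewrite gtr0_norm // ltr_pM2r ?exprn_gt0 //.
  rewrite ltr_pwDl // (bigD1 l) //= lerDl; apply: sumr_ge0 => l' _.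
  by apply: ltW; have [] := fP l'.
have [c0 cr] := cP.
have K1 : 0 < 8 * K * c + 1 by rewrite ltr_pwDr // !mulr_ge0 // ltW.
 apply: (co_eq0 (C := 4 * K * c ^+ 2)) => //.
near=> r; have r0 : 0 < r by near: r; exact: nbhs_right_gt.
have rb : r < b by near: r; exact: nbhs_right_lt.
have r1 : r < 1 by near: r; exact: nbhs_right_lt.
have rK : r < (8 * K * c + 1)^-1 by near: r; apply: nbhs_right_lt; rewrite invr_gt0.
have rr : r < rh / (2 * c).
  by near: r; apply: nbhs_right_lt; rewrite divr_gt0 // mulr_gt0.
have Uc i' : `|Us i' (pt x r)| < c * r ^+ 2 by move: i'; near: r.
have yB : obox V0 b0 (pt x r) by apply: box_pt; rewrite ?gtr0_norm.
have re1 : 0 <= r < e1 by rewrite ltW //= (lt_le_trans rb).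
have r2 : r ^+ 2 <= r by rewrite expr2 ler_piMr // ltW.
have UE i' : U phi (cof psi x) r 0 i' = Us i' (pt x r).
  by rewrite -UsE ?hgt_pt ?base_pt // ltW.
have [||||_ /(_ i)] := H _ _ (c * r ^+ 2) (ex (cof psi x) r re1).
- by rewrite mulr_gt0 // exprn_gt0.
- by move=> i'; rewrite UE.
- have : r * (8 * K * c + 1) < 1 by rewrite -ltr_pdivlMr // div1r.
  have : 8 * K * (c * r ^+ 2) <= 8 * K * (c * r).
    by rewrite ler_wpM2l ?mulr_ge0 // ler_wpM2l // ltW.
  by lra.
- have : r * (2 * c) < rh by rewrite -ltr_pdivlMr // mulr_gt0.
  have : c * r ^+ 2 <= c * r by rewrite ler_wpM2l // ltW.
  by lra.
have [_ ] := FP yB; rewrite hgt_pt base_pt => /(_ (ltW r0))[_ ->].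
have -> : cto phi (iota (cof psi x)) = \row_i X0 F i x by rewrite -local_lmap.
rewrite UE !mxE => h; rewrite !smfB // scstE //.
apply: le_trans (_ : 4 * K * (c * r ^+ 2) ^+ 2 <= _); last by rewrite le_eqVlt; apply/orP; left; apply/eqP; ring.
by apply: le_trans h; rewrite le_eqVlt; apply/orP; left; apply/eqP; congr `|_|; ring.
Unshelve. all: by end_near. Qed.

Lemma local_co i j : (0 < j < 4)%N -> co j (F i) = co j (Us i).
Proof.
move=> /andP[j0 j4]; apply: smf_ext => x Vx; apply/eqP; rewrite -subr_eq0; apply/eqP.
have := geodesic_expansion i Vx j4; rewrite !coB co_cst; case: j j0 j4 => // j _ _.
by rewrite subr0 smfB.
Qed.

Lemma local_E1 i : co 1 (F i) = 0. Proof. by rewrite local_co // Uodd. Qed.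
Lemma local_E3 i : co 3 (F i) = 0. Proof. by rewrite local_co // Uodd. Qed.

Lemma local_GH x : V0 x -> g phi (lm x) = mev x (gh UV G).
Proof. by move=> Vx; apply: (GD_gh UV local_GD local_lmap). Qed.

(** Normality of [U_r] refers to the metric at the foot point, which does not depend on [r]. For
    fixed [x] it is therefore a linear relation with constant coefficients [cf], and passes to the
    second Taylor coefficient. *)
Lemma local_UX : Xm F *m gh UV G *m (Ur F)^T = 0.
Proof.
apply/matrixP => a j; rewrite [RHS]mxE; apply: smf_ext => x Vx; rewrite smf0 ord1.
have [[_ nU _ _] _ _ _] := Ymin; have lx := local_ldom Vx.
pose cf i := (mev x (gh UV G) *m (mev x (Xm F))^T) i a.
pose f : A := \sum_i scst (cf i) * Us i.
have f0 : co 2 f x = 0.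
  apply: (@co_eq0 _ _ _ _ _ 3 _ _ 0) => //; near=> r; rewrite mul0r.
  have r0 : 0 < r by near: r; exact: nbhs_right_gt.
  have rb : r < b by near: r; exact: nbhs_right_lt.
  have yB : obox V0 b0 (pt x r) by apply: box_pt; rewrite ?gtr0_norm.
  have h : 0 <= r < e1 by rewrite ltW //= (lt_le_trans rb).
  have /matrixP/(_ 0 a) := nU psi phi x r apsi aphi lx h.
  rewrite local_GH // (model_jac n0 e10 Ymin FP) // -mulmxA mxE mxE => fz.
  rewrite (_ : f (pt x r) = 0) ?normr0 // -[RHS]fz smf_sum //; apply: eq_bigr => i _.
  by rewrite smfM // scstE // -UsE ?hgt_pt ?base_pt ?(ltW r0) // mulrC.
have <- : co 2 f x = (Xm F *m gh UV G *m (Ur F)^T) a 0 x; last exact: f0.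
rewrite raddf_sum smf_sum // -(mevE x (_ *m _ *m _)) !mevM // mevT.
have -> : (mev x (Xm F) *m mev x (gh UV G) *m (mev x (Ur F))^T) a 0 =
    \sum_i cf i * mev x (Ur F) 0 i.
  have gT : mev x (gh UV G) *m (mev x (Xm F))^T = (mev x (Xm F) *m mev x (gh UV G))^T.
    by rewrite trmx_mul -(mevT x (gh UV G)) gh_sym.
  rewrite mxE; apply: eq_bigr => i _.
  by rewrite /cf gT [(mev x (Ur F))^T i 0]mxE [(_ *m _)^T i a]mxE.
apply: eq_bigr => i _; rewrite /= co_cstM smfM // scstE // mevE mxE.
by rewrite (local_co i (j := 2)).
Unshelve. all: by end_near. Qed.

Lemma local_h_posdef x : V0 x -> posdef (mev x (Xm F *m gh UV G *m (Xm F)^T)).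
Proof.
move=> Vx; rewrite !mevM // mevT; apply: posdef_congr; last exact: (Xm_free n0 e10 emb Ymin apsi aphi FP).
rewrite -local_GH //; have [_ dx] := local_ldom Vx.
by split; [apply: rmet_sym|apply: rmet_pos] => //; exact: cto_cod.
Qed.

Lemma local_hi : exists hi, Xm F *m gh UV G *m (Xm F)^T *m hi = 1%:M.
Proof. by apply: smf_inverse => x Vx; apply: posdef_unit; exact: local_h_posdef. Qed.

Lemma local_Q m : odd n \/ m.+1 = n -> forall a c j, (j < m)%N ->
  co j (PQ (@sDa R _ (obox W0 bW0)) half (sr W0 bW0) G Gi a c) = 0.
Proof.
move=> nm; have [_ _ _ /(_ phi aphi m.+1 nm) bO] := gP.
exact: (einstein_Q aphi Wphi GGi Gs gE bO).
Qed.

Lemma local_Q1 i j :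
  co 1 (PQ (@sDa R _ (obox W0 bW0)) half (sr W0 bW0) G Gi (lshift 1 i) (lshift 1 j)) = 0.
Proof.
by apply: (local_Q (m := n.-1)) => //; rewrite ?prednK //; [right|rewrite ltn_predRL].
Qed.

Lemma local_Q0 : n <> 4%N -> forall a c j, (j < 4)%N ->
  co j (PQ (@sDa R _ (obox W0 bW0)) half (sr W0 bW0) G Gi a c) = 0.
Proof.
(* For even [n] the coefficients vanish below order [n - 1]; as [n] is then at least [6], orders up
   to three are covered. *)
move=> n4 a c j j4; have [on|en] := boolP (odd n).
  by apply: (local_Q (m := 4)) => //; left.
apply: (local_Q (m := n.-1)); first by right; rewrite prednK.
apply: leq_trans j4 _; move: n3 n4 en; case: (n) => [|[|[|[|[|[|m]]]]]] //.
Qed.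

Variable hi : 'M[B]_k.
Hypothesis hhi : Xm F *m gh UV G *m (Xm F)^T *m hi = 1%:M.

Lemma local_HU : \sum_a \sum_c hi a c *: LL (@sDa R _ V0) half (Xm F) (gh UV G) hi (cdr UV G Gi) c a
  = (2%:R * k%:R) *: Ur F.
Proof.
have [_ _ _ HY] := Ymin.
(* Only the coefficient of order one of [nTen] is wanted, so [m = 2] will do for odd [k]; for even
   [k] the given order [k + 2] forces [m = k + 1]. *)
have [m m1 mk] : exists2 m, (1 < m)%N & odd k \/ m.+1 = k.+2.
  have [ok|ek] := boolP (odd k); first by exists 2; [|left].
  by exists k.+1; [|right] => //; move: k1 ek; case: (k) => [|[|]].
have Hn : cmx 1 (nTen UV G Gi N) = 0.
  apply: (minimal_nTen GGi Gs gE HN (Ymap_model FP) (Gbar_posdef aphi Wphi gE UV) (m := m)) => //.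
  move=> x Vx; have [c Hc] := boundaryO_at (HY psi phi apsi aphi m.+1 mk) (local_ldom Vx).
  exists c; apply: filterS Hc => r; rewrite hgt_pt; exact.
have := lsub_cmx1_nTen local_E1 local_E3 Gs GGi G1 G3 hhi local_UX HN (gi := Gi).
rewrite Hn linear0 => /esym/eqP; rewrite subr_eq0 => /eqP <-.
have LC := LLC (@sDa R _ V0) half hi (gh_sym UV Gs) (cdr_torsion UV Gi Gs).
apply: eq_bigr => a _; apply: eq_bigr => c _.
exact: (congr1 (fun v => hi a c *: v) (LC c a)).
Qed.

Lemma local_hplus y : pbox V0 b0 y -> hplus gr E psi phi y =
  mev y (sw V0 b0 ^+ 2 *: map_mx (@res R k V0 b b0) (Hbar UV G)).
Proof. by move=> Vy; rewrite /hplus; apply: pullback_Y => //; exact: (Ymap_model FP). Qed.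

End local_expansion.

(** * The GJMS construction *)

Section one_variable_functions.
Context {R : realType} {d : nat} {V : odom R d} (f : smf V).
Hypothesis f0 : forall x, V x -> 0 < f x.

Lemma pd_comp1 (p : R -> R) (p' : R) i x : V x -> is_derive (f x) (1 : R) p p' ->
  pd i (p \o f) x = p' * pd i f x.
Proof.
move=> Vx dp; suff [_ <-] : is_derive x (delta_mx 0 i) (p \o f) (p' * pd i f x) by [].
apply: is_deriveE_line; have := @smf_derivable _ _ _ i f x Vx.
rewrite -{1}[x]addr0 -(scale0r (delta_mx 0 i)) => /is_derive_line.
rewrite scale0r addr0 => h1.
have h2 : is_derive (f (x + 0 *: delta_mx 0 i)) (1 : R) p p' by rewrite scale0r addr0.
exact: (@is_derive1_comp R p (fun s : R => f (x + s *: delta_mx 0 i)) 0 _ _ h2 h1).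
Qed.

Variable w : smf V.
Hypothesis fw : f * w = 1.

Lemma inv_val x : V x -> w x = (f x)^-1.
Proof.
move=> Vx; have := congr1 (fun h : smf V => h x) fw; rewrite smfM // smf1 // => h.
have fx := f0 Vx; by rewrite -[RHS]mulr1 -h mulrA mulVf ?mul1r // gt_eqF.
Qed.

Lemma sD_spow i a : sD i (spow f0 a) = scst a * (w * sD i f) * spow f0 a.
Proof.
apply: smf_ext => x Vx; rewrite !smfM // scstE // inv_val //.
have fx := f0 Vx.
rewrite -(@pd_smf _ _ _ i ((fun t => t `^ a) \o f) (spow f0 a)) //; last by move=> y Vy; rewrite spowE.
rewrite (pd_comp1 i Vx (is_derive1_powR a fx)) spowE // sDE //.
rewrite powRB; last by apply/implyP => _; rewrite gt_eqF.
by rewrite powRr1 ?ltW //; field; rewrite gt_eqF.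
Qed.

Lemma sD_sln i : sD i (sln f0) = w * sD i f.
Proof.
apply: smf_ext => x Vx; rewrite smfM // inv_val //.
rewrite -(@pd_smf _ _ _ i ((@ln R) \o f) (sln f0)) //; last by move=> y Vy; rewrite slnE.
by rewrite (pd_comp1 i Vx (is_derive1_ln (f0 Vx))) sDE.
Qed.
End one_variable_functions.

Section gjms_expansion.
Context {R : realType} {k : nat} (V0 : odom R k) (e : R) (e0 : 0 < e).
Local Notation A := (smf (obox V0 e0)).
Local Notation B := (smf V0).
Local Notation Ap := (smf (pbox V0 e0)).
Local Notation half := (scst 2^-1).
Local Notation D := (@sDa R _ (obox V0 e0)).
Local Notation Dp := (@sDa R _ (pbox V0 e0)).
Local Notation rA := (sr V0 e0).
Local Notation resA := (@res R k V0 e e0).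
Variables (H N : 'M[A]_(k + 1)).
Hypothesis Hsym : H^T = H.
Hypothesis HN : H *m N = 1%:M.
Variable hp : 'rV[R]_(k + 1) -> 'M[R]_(k + 1).
Hypothesis hpE : forall y, pbox V0 e0 y -> hp y = mev y (sw V0 e0 ^+ 2 *: map_mx resA H).
Variable s : A.
Hypothesis s0 : forall y, obox V0 e0 y -> 0 < s y.
Hypothesis s1 : forall x, V0 x -> s (pt x 0) = 1.
Variable rl : 'rV[R]_(k + 1) -> R.
Hypothesis rlE : forall y, pbox V0 e0 y -> rl y = hgt y * s y.

Let hgt0 y : pbox V0 e0 y -> 0 < hgt y.
Proof. by case=> _ /andP[]. Qed.
Let r0 y : pbox V0 e0 y -> 0 < resA rA y.
Proof. by move=> Vy; rewrite resE // srE ?hgt0 //; exact: pbox_box. Qed.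
Let rE y : pbox V0 e0 y -> resA rA y = hgt y.
Proof. by move=> Vy; rewrite resE // srE //; exact: pbox_box. Qed.

Local Notation Hr := (map_mx resA H).
Local Notation Nr := (map_mx resA N).
Local Notation wV := (sw V0 e0).

Let rHsym : Hr^T = Hr. Proof. by rewrite map_trmx Hsym. Qed.
Let rHN : Hr *m Nr = 1%:M. Proof. by rewrite -map_mxM HN map_mx1. Qed.
Let hp_inv : (wV ^+ 2 *: Hr) *m (resA rA ^+ 2 *: Nr) = 1%:M.
Proof. by rewrite -scalemxAl -scalemxAr scalerA -exprMn mulrC srw expr1n scale1r. Qed.
Let Lres c1 c2 F Q : resA (Lop D half rA H N (scst c1) (scst c2) F Q) =
  Lop Dp half (resA rA) Hr Nr (scst c1) (scst c2) (resA F) (resA Q).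
Proof.
rewrite (map_Lop (D' := Dp)) /= ?res_half; last by move=> i x; exact: res_sD.
by rewrite /res !sres_cst.
Qed.

Lemma laplacian_hp (u : 'rV[R]_(k + 1) -> R) (us : Ap) y :
  (forall z, pbox V0 e0 z -> u z = us z) -> pbox V0 e0 y ->
  laplacian hp u y = divG Dp half (wV ^+ 2 *: Hr) (resA rA ^+ 2 *: Nr) (fun b => Dp b us) y.
Proof.
move=> uE Vy; rewrite /laplacian (divergence_smf hpE hp_inv (ws := fun b => Dp b us)) //.
by move=> a z Vz; exact: pd_smf.
Qed.

Section subcritical.
Variables (m : R) (Fr : 'rV[R]_(k + 1) -> R) (Fs : A).
Hypothesis FE : forall y, pbox V0 e0 y -> Fr y = Fs y.
Definition Ft : A := spow s0 m * Fs.
Definition Lexp : A := Lop D half rA H N (scst (1 + 2 * m - k%:R)) (scst (k%:R - m)) Ft (scst m * Ft).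

Lemma gjms_smooth y : pbox V0 e0 y ->
  laplacian hp (fun z => rl z `^ m * Fr z) y + m * (k%:R - m) * (rl y `^ m * Fr y) =
  hgt y `^ m * Lexp y.
Proof.
move=> Vy; have uE z : pbox V0 e0 z -> rl z `^ m * Fr z = (spow r0 m * resA Ft) z.
  move=> Vz; have Bz := pbox_box Vz; rewrite smfM // spowE // rE // resE // smfM // spowE //.
  by rewrite rlE // FE // powRM ?mulrA // ltW ?hgt0 ?s0.
rewrite (laplacian_hp uE) // uE //.
have hP b : Dp b (spow r0 m) = scst m * (wV * Dp b (resA rA)) * spow r0 m.
  exact: (sD_spow r0 (srw V0 e0)).
have Dm b : Dp b (scst m) = 0 by exact: sD_cst.
have := gjms_conf (@sDaM R _ (pbox V0 e0)) (half2 _) rHsym rHN (srw V0 e0) (Dx_sr V0 e0) (DZ_sr V0 e0)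
  Dm (resA Ft) hP => /(congr1 (fun f : Ap => f y)).
rewrite smfD // (smfM (_ * (_ - _))) // (smfM (scst m)) // smfB // scstE // smf_nat // => ->.
rewrite (smfM (spow r0 m)) // spowE // rE //; congr (_ * _).
rewrite /Lexp -resE // Lres; congr (smf_fun (Lop _ _ _ _ _ _ _ _ _) y).
- by rewrite rmorphB rmorphD rmorphM rmorph1 !rmorph_nat.
- by rewrite rmorphB !rmorph_nat.
have -> : scst m = resA (scst m) :> Ap by rewrite /res sres_cst.
exact: esym (rmorphM resA _ _).
Qed.

Lemma near_pbox x : V0 x -> \forall r \near (0 : R)^'+, [/\ 0 < r, r < e & pbox V0 e0 (pt x r)].
Proof.
move=> Vx; near=> r; have h0 : 0 < r by near: r; exact: nbhs_right_gt.
have re : r < e by near: r; exact: nbhs_right_lt.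
by split => //; apply: pbox_pt => //; rewrite h0.
Unshelve. all: by end_near. Qed.

Lemma smf_bounded (f : A) x : V0 x -> exists2 c : R, 0 < c & \forall r \near (0 : R)^'+, `|f (pt x r)| <= c.
Proof.
move=> Vx; have [c c0 [b /andP[b0 _] T]] := taylor 0 f Vx; exists c => //.
near=> r; have h0 : 0 < r by near: r; exact: nbhs_right_gt.
have rb : `|r| < b by rewrite gtr0_norm //; near: r; exact: nbhs_right_lt.
have [|_] := T x r _ rb; first by move=> l; rewrite subrr normr0.
by rewrite big_ord0 subr0 expr0 mulr1.
Unshelve. all: by end_near. Qed.

Variable l : nat.
Hypothesis mE : m = k%:R / 2 - l%:R.
Local Notation q := (k%:R / 2 + l%:R).
Variable gx : 'rV[R]_(k + 1) -> R.
Hypothesis gxE : forall y, pbox V0 e0 y -> gx y = hgt y `^ m * Lexp y.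

Let powq (r : R) : 0 < r -> r `^ q = r `^ m * r ^+ (2 * l).
Proof.
move=> r0'; rewrite -powR_mulrn ?ltW // -powRD; last by apply/implyP => _; rewrite gt_eqF.
by congr (_ `^ _); rewrite mE natrM; ring.
Qed.

(** The bound is in powers of [rho = r s]; on a vertical line [s^q] is bounded, so it holds in
    powers of [r]. The exponents match because [q = m + 2 l]. *)
Lemma gjms_order x : V0 x ->
  (exists c : R, \forall r \near (0 : R)^'+, `|gx (pt x r)| <= c * rl (pt x r) `^ q) ->
  forall j, (j < 2 * l)%N -> co j Lexp x = 0.
Proof.
move=> Vx [c Hc]; have [c' c'0 Hc'] := smf_bounded (spow s0 q) Vx.
apply: (@co_eq0 _ _ _ _ _ (2 * l) _ _ (`|c| * c')) => //.
have np := near_pbox Vx; near=> r.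
have [h0 re Vy] : [/\ 0 < r, r < e & pbox V0 e0 (pt x r)] by near: r.
have By := pbox_box Vy.
have h1 : `|gx (pt x r)| <= c * rl (pt x r) `^ q by near: r.
have h2 : `|spow s0 q (pt x r)| <= c' by near: r.
move: h1; rewrite gxE // rlE // hgt_pt normrM (gtr0_norm (powR_gt0 _ h0)).
rewrite (powRM _ (ltW h0) (ltW (s0 By))) powq // -(mulrA (r `^ m)) mulrCA ler_pM2l ?powR_gt0 // => h1.
apply: le_trans h1 _; rewrite -mulrA; apply: (@le_trans _ _ (`|c| * (r ^+ (2 * l) * s (pt x r) `^ q))).
  apply: ler_wpM2r; last exact: ler_norm.
  by rewrite mulr_ge0 ?powR_ge0 // exprn_ge0 // ltW.
rewrite ler_wpM2l // mulrC ler_wpM2r ?exprn_ge0 ?(ltW h0) //.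
by apply: le_trans h2; rewrite spowE // ler_norm.
Unshelve. all: by end_near. Qed.

(** Multiplication by [s^(-q)] turns powers of [r] into powers of [rho]; since [s = 1] at [r = 0],
    it does not change the leading coefficient. *)
Lemma gjms_limit x c : V0 x -> (forall j, (j < 2 * l)%N -> co j Lexp x = 0) ->
  (fun r : R => rl (pt x r) `^ (- (k%:R / 2) - l%:R) * gx (pt x r)) @ 0^'+ --> c ->
  co (2 * l) Lexp x = c.
Proof.
move=> Vx L0 lim; pose L' := spow s0 (- q) * Lexp.
have s0E : co 0 (spow s0 (- q)) x = 1.
  have xB : obox V0 e0 (pt x 0) by apply: box_pt; rewrite ?normr0.
  by rewrite co0 sliceE // spowE // s1 // powR1.
have L'0 j : (j < 2 * l)%N -> co j L' x = 0.
  move=> jl; rewrite coM smf_sum // big1 // => i _; rewrite smfM // L0 ?mulr0 //.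
  by apply: leq_ltn_trans jl; exact: leq_subr.
have -> : co (2 * l) Lexp x = co (2 * l) L' x.
  rewrite [in RHS]coM smf_sum // big_ord_recl big1 ?addr0 => [|i _].
    by rewrite smfM // s0E mul1r subn0.
  rewrite smfM // L0 ?mulr0 // lift0; move: (2 * l)%N i => M' i.
  by rewrite ltn_subrL /=; apply: leq_ltn_trans (leq0n i) (ltn_ord i).
have lim' := co_cvg Vx L'0.
apply: (cvg_unique _ lim') => //.
apply: cvg_trans lim; apply: near_eq_cvg.
have np := near_pbox Vx; near=> r.
have [h0 re Vy] : [/\ 0 < r, r < e & pbox V0 e0 (pt x r)] by near: r.
have By := pbox_box Vy; have sp := s0 By.
rewrite gxE // rlE // hgt_pt (powRM _ (ltW h0) (ltW sp)) smfM // spowE //.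
have -> : - (k%:R / 2) - l%:R = - q :> R by ring.
rewrite powRN powq //.
have a0 := powR_gt0 m h0; have b0 : r ^+ (2 * l) != 0 by rewrite expf_neq0 // gt_eqF.
by field; rewrite b0 gt_eqF.
Unshelve. all: by end_near. Qed.
End subcritical.

Section critical.
Variables (Ar : 'rV[R]_(k + 1) -> R) (As : A).
Hypothesis AE : forall y, pbox V0 e0 y -> Ar y = As y.
Definition Lcrit : A := Lop D half rA H N (scst (1 - k%:R)) (scst k%:R) (sln s0 + As) 1.

Lemma critical_smooth y : pbox V0 e0 y ->
  laplacian hp (fun z => ln (rl z) + Ar z) y + k%:R = Lcrit y.
Proof.
move=> Vy; have uE z : pbox V0 e0 z -> ln (rl z) + Ar z = (sln r0 + resA (sln s0 + As)) z.
  move=> Vz; have Bz := pbox_box Vz; rewrite smfD // slnE // rE // resE // smfD // slnE //.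
  by rewrite rlE // AE // lnM ?addrA // posrE ?hgt0 ?s0.
rewrite (laplacian_hp uE) //.
have hP b : Dp b (sln r0) = wV * Dp b (resA rA) by exact: (sD_sln r0 (srw V0 e0)).
have := critical_conf (@sDaM R _ (pbox V0 e0)) (half2 _) rHsym rHN (srw V0 e0) (Dx_sr V0 e0) (DZ_sr V0 e0)
  (resA (sln s0 + As)) hP => /(congr1 (fun f : Ap => f y)).
rewrite smfD // smf_nat // => ->.
rewrite /Lcrit -resE // Lres; congr (smf_fun (Lop _ _ _ _ _ _ _ _ _) y).
- by rewrite rmorphB rmorph1 rmorph_nat.
- by rewrite rmorph_nat.
by rewrite rmorph1.
Qed.

Variable gx : 'rV[R]_(k + 1) -> R.
Hypothesis gxE : forall y, pbox V0 e0 y -> gx y = Lcrit y.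

Lemma critical_order x : V0 x ->
  (exists c : R, \forall r \near (0 : R)^'+, `|gx (pt x r)| <= c * rl (pt x r) ^+ k) ->
  forall j, (j < k)%N -> co j Lcrit x = 0.
Proof.
move=> Vx [c Hc]; have [c' c'0 Hc'] := smf_bounded (s ^+ k) Vx.
apply: (@co_eq0 _ _ _ _ _ k _ _ (`|c| * c')) => //.
have np := near_pbox Vx; near=> r.
have [h0 re Vy] : [/\ 0 < r, r < e & pbox V0 e0 (pt x r)] by near: r.
have By := pbox_box Vy.
have h1 : `|gx (pt x r)| <= c * rl (pt x r) ^+ k by near: r.
have h2 : `|(s ^+ k) (pt x r)| <= c' by near: r.
move: h1; rewrite gxE // rlE // hgt_pt exprMn => h1; apply: le_trans h1 _.
rewrite -mulrA; apply: (@le_trans _ _ (`|c| * (r ^+ k * s (pt x r) ^+ k))).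
  apply: ler_wpM2r; last exact: ler_norm.
  by rewrite mulr_ge0 // exprn_ge0 // ltW // s0.
rewrite ler_wpM2l // mulrC ler_wpM2r ?exprn_ge0 ?(ltW h0) //.
by apply: le_trans h2; rewrite smfX // ler_norm.
Unshelve. all: by end_near. Qed.

Lemma critical_limit x c : V0 x -> (forall j, (j < k)%N -> co j Lcrit x = 0) ->
  (fun r : R => rl (pt x r) ^- k * gx (pt x r)) @ 0^'+ --> c ->
  co k Lcrit x = c.
Proof.
move=> Vx L0 lim.
have xB : obox V0 e0 (pt x 0) by apply: box_pt; rewrite ?normr0.
have lim' : (fun r : R => s (pt x r) ^+ k * (rl (pt x r) ^- k * gx (pt x r))) @ 0^'+ --> 1 * c.
  apply: cvgM lim; have := @co_cvg _ _ _ _ _ 0 (s ^+ k) x Vx (fun j (h : (j < 0)%N) => match notF h with end).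
  rewrite co0 sliceE // smfX // s1 // expr1n => h; apply: cvg_trans h; apply: near_eq_cvg.
  have np := near_pbox Vx; near=> r.
  have [h0 re Vy] : [/\ 0 < r, r < e & pbox V0 e0 (pt x r)] by near: r.
  by rewrite expr0 invr1 mul1r smfX //; exact: pbox_box.
rewrite mul1r in lim'.
apply: (cvg_unique _ (co_cvg Vx L0)) => //.
apply: cvg_trans lim'; apply: near_eq_cvg.
have np := near_pbox Vx; near=> r.
have [h0 re Vy] : [/\ 0 < r, r < e & pbox V0 e0 (pt x r)] by near: r.
have By := pbox_box Vy; have sp := s0 By.
rewrite gxE // rlE // hgt_pt exprMn.
have a0 : r ^+ k != 0 by rewrite expf_neq0 // gt_eqF.
have b0 : s (pt x r) ^+ k != 0 by rewrite expf_neq0 // gt_eqF.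
by field; rewrite a0 b0.
Unshelve. all: by end_near. Qed.
End critical.
End gjms_expansion.

(** * Defining functions *)

Section defining_functions.
Context {R : realType} {k n : nat} {S : manifold (R := R) k} {M : manifold (R := R) n}.
Variables (g : riemannian_metric M) (e0 : R) (gr : R -> riemannian_metric M) (iota : S -> M).
Variables (e1 : R) (U : chart R M n -> S -> R -> 'rV[R]_n) (E : S -> R -> M).
Variable rho : S -> R -> R.
Hypothesis n3 : (3 <= n)%N.
Hypothesis k1 : (1 <= k)%N.
Hypothesis e10 : 0 < e1.
Hypothesis emb : embedding iota.
Hypothesis gP : even_poincare g e0 gr.
Hypothesis Ymin : even_minimal_extension g gr iota e1 U E.
Hypothesis rhoP : defining_function g gr iota e1 E rho.
Variables (psi : chart R S k) (phi : chart R M n).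
Hypotheses (apsi : atlas psi) (aphi : atlas phi).
Let n0 : (0 < n)%N. Proof. exact: leq_trans n3. Qed.

Section quotient.
Variables (z0 : 'rV[R]_n) (bW : R) (bW0 : 0 < bW).
Local Notation W0 := (ocube z0 bW0).
Local Notation C := (smf (obox W0 bW0)).
Variables (G : 'M[C]_n).
Hypothesis Gs : G^T = G.
Hypothesis G1 : cmx 1 G = 0.
Hypothesis G3 : cmx 3 G = 0.
Hypothesis gE : forall y, obox W0 bW0 y -> 0 <= hgt y -> gr (hgt y) phi (base y) = mev y G.
Hypothesis Wphi : forall x, W0 x -> ccod phi x.
Variables (x0 : 'rV[R]_k) (b : R) (b0 : 0 < b).
Local Notation V0 := (ocube x0 b0).
Local Notation A := (smf (obox V0 b0)).
Variable F : 'I_n -> A.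
Hypothesis UV : forall y, obox V0 b0 y -> obox W0 bW0 (\row_i emap F i y).
Hypothesis FP : in_chart E psi phi F.
Variable Us : 'I_n -> A.
Hypothesis UsE : forall i y, obox V0 b0 y -> 0 <= hgt y ->
  U phi (cof psi (base y)) (hgt y) 0 i = Us i y.
Hypothesis Uodd : forall i j, odd j -> co j (Us i) = 0.
Variable P : A.
Hypothesis PE : forall y, obox V0 b0 y -> 0 <= hgt y -> rho_loc rho psi y = P y.

(** The normalization of [rho] speaks of its square only: comparing one diagonal entry of the
    metrics gives [q^2 = 1] on the boundary. Positivity of [rho] for [r > 0] selects the sign. *)
Lemma defining_quotient : exists2 q : A, P = sr V0 b0 * q & forall x, V0 x -> q (pt x 0) = 1.
Proof.
have [_ rho0 rhop rholim] := rhoP.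
have box x : V0 x -> obox V0 b0 (pt x 0) by move=> Vx; apply: box_pt; rewrite ?normr0.
have P0 : co 0 P = 0.
  apply: smf_ext => x Vx; have xB := box x Vx; rewrite co0 sliceE // -PE ?hgt_pt ?lexx //.
  by rewrite /rho_loc hgt_pt rho0 smf0.
have [q Pq _] := hadamard P0; exists q => // x Vx; have xB := box x Vx.
(* As [k >= 1] there is a diagonal entry, and positive definiteness allows division by it. *)
pose i0 := Ordinal k1; have lx := local_ldom n3 e10 Ymin FP Vx.
have E1 := local_E1 n3 e10 Ymin aphi FP UsE Uodd.
have E3 := local_E3 n3 e10 Ymin aphi FP UsE Uodd.
pose h := mev x (Xm F *m gh UV G *m (Xm F)^T).
have hpos : 0 < h i0 i0.
  have [_ hp] := local_h_posdef n3 e10 emb gP Ymin apsi aphi gE Wphi UV FP Vx.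
  have d0 : delta_mx 0 i0 != 0 :> 'rV[R]_k.
    by apply/negP => /eqP/rowP/(_ i0); rewrite !mxE !eqxx => /eqP; rewrite oner_eq0.
  by have := hp _ d0; rewrite -rowE trmx_delta -colE /h; move: (mev _ _) => T; rewrite [_ 0 0]mxE [_ _ i0]mxE.
have lim := rholim psi phi x apsi aphi lx i0 i0.
pose Hq := Hbar UV G (lshift 1 i0) (lshift 1 i0).
have nb : \forall r \near (0 : R)^'+, [/\ 0 < r, r < e1 & r < b].
  by near=> r; split; near: r; [exact: nbhs_right_gt|exact: nbhs_right_lt|exact: nbhs_right_lt].
have c0 (f : A) : f (pt x r) @[r --> 0^'+] --> f (pt x 0).
  have := @co_cvg _ _ _ _ _ 0 f x Vx (fun j (h : (j < 0)%N) => match notF h with end).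
  rewrite co0 sliceE // => hl; apply: cvg_trans hl; apply: near_eq_cvg.
  by near=> r; rewrite expr0 invr1 mul1r.
have eqr (r : R) : 0 < r -> r < b -> P (pt x r) = r * q (pt x r).
  move=> r0 rb; have yb : obox V0 b0 (pt x r) by apply: box_pt; rewrite ?gtr0_norm.
  by rewrite Pq smfM // srE // hgt_pt.
have Hl : (q ^+ 2 * Hq) (pt x 0) = h i0 i0.
  apply: (cvg_unique _ (c0 _)) => //.
  have -> : h i0 i0 = pullback (g phi) (lmap iota psi phi) x i0 i0.
    rewrite /pullback (local_GH n3 e10 gP Ymin aphi gE Wphi UV FP Vx).
    by rewrite (model_jac n0 e10 Ymin FP) // /h !mevM // mevT.
  apply: cvg_trans lim; apply: near_eq_cvg; near=> r.
  have [r0 re rb] : [/\ 0 < r, r < e1 & r < b] by near: r.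
  have Vy : pbox V0 b0 (pt x r) by apply: pbox_pt; rewrite ?r0.
  have yb := pbox_box Vy.
  rewrite (local_hplus Gs gE UV FP Vy) mevE mxE smfM // smfX // [map_mx _ _ _ _]mxE resE // -/Hq.
  rewrite smfM // smfX //.
  have -> : rho (cof psi x) r = P (pt x r) by rewrite -PE ?hgt_pt ?(ltW r0) // /rho_loc base_pt hgt_pt.
  have := congr1 (fun f : smf _ => f (pt x r)) (srw V0 b0).
  rewrite smfM // smf1 // resE // srE // hgt_pt eqr // => hw.
  have -> (a c d w : R) : (a * c) ^+ 2 * (w ^+ 2 * d) = (a * w) ^+ 2 * (c ^+ 2 * d) by ring.
  by rewrite hw expr1n mul1r.
have Hq0 : Hq (pt x 0) = h i0 i0.
  rewrite -(sliceE Hq Vx) -co0; have := cmx0_Hbar UV E1 E3 G1 G3.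
  move=> /matrixP/(_ (lshift 1 i0) (lshift 1 i0)); rewrite [LHS]cmxE [RHS]block_mxEul => ->.
  by rewrite /h mevE.
have q0 : 0 <= q (pt x 0).
  apply: (cvgr_to_ge (c0 q)); near=> r.
  have [r0 re rb] : [/\ 0 < r, r < e1 & r < b] by near: r.
  have yb : obox V0 b0 (pt x r) by apply: box_pt; rewrite ?gtr0_norm.
  have := rhop (cof psi x) r; rewrite r0 re => /(_ isT).
  have -> : rho (cof psi x) r = P (pt x r) by rewrite -PE ?hgt_pt ?(ltW r0) // /rho_loc base_pt hgt_pt.
  by rewrite eqr // pmulr_rgt0 // => /ltW.
move: Hl; rewrite smfM // smfX // Hq0 => /eqP; rewrite -subr_eq0 -[X in _ - X]mul1r -mulrBl.
rewrite mulf_eq0 (gt_eqF hpos) orbF subr_eq0 sqrf_eq1 => /orP[/eqP //|/eqP qm].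
by move: q0; rewrite qm oppr_ge0 ler10.
Unshelve. all: by end_near. Qed.
End quotient.

Lemma U_model x0 : ldom iota psi phi x0 ->
  exists2 b1 : R, 0 < b1 <= e1 & forall b (b0 : 0 < b), b <= b1 ->
    exists2 Us : 'I_n -> smf (obox (ocube x0 b0) b0),
      (forall i y, obox (ocube x0 b0) b0 y -> 0 <= hgt y ->
        U phi (cof psi (base y)) (hgt y) 0 i = Us i y) &
      forall i j, odd j -> co j (Us i) = 0.
Proof.
move=> lx; have oL := ldom_open n0 e10 Ymin apsi aphi.
have [[_ _ ev _] _ _ _] := Ymin.
have [b1 b1e H] := @min_choice R 'I_n
  (fun i b => forall b0 : 0 < b, exists2 Us : smf (obox (ocube x0 b0) b0),
    (forall y, obox (ocube x0 b0) b0 y -> ldom iota psi phi (base y) /\ (0 <= hgt y ->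
      U phi (cof psi (base y)) (hgt y) 0 i = Us y)) & forall j, odd j -> co j Us = 0) _ e10
  (fun i => let: ex_intro2 b1 h1 h2 := even_smf oL lx e10 (ev psi phi apsi aphi i)
    in ex_intro2 _ _ b1 (andP h1).1 (fun b _ bb b0 => h2 b b0 bb)).
exists b1 => // b b0 bb.
have /choice[Us UsP] : forall i, exists Us : smf (obox (ocube x0 b0) b0),
    (forall y, obox (ocube x0 b0) b0 y -> 0 <= hgt y ->
      U phi (cof psi (base y)) (hgt y) 0 i = Us y) /\ forall j, odd j -> co j Us = 0.
  by move=> i; have [Us h1 h2] := H b b0 bb i b0; exists Us; split => // y /h1[].
by exists Us => i; have [] := UsP i.
Qed.

Lemma smooth_on_Y_model (f : S -> R -> R) x0 : smooth_on_Y e1 f -> ccod psi x0 ->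
  exists2 b1 : R, 0 < b1 <= e1 & forall b (b0 : 0 < b), b <= b1 ->
    exists Fs : smf (obox (ocube x0 b0) b0), forall y, obox (ocube x0 b0) b0 y -> 0 <= hgt y ->
      f (cof psi (base y)) (hgt y) = Fs y.
Proof.
move=> sf cx; have [b1 b1e H] := collar_smf (@ccod_open _ _ _ psi) cx e10 (sf psi apsi).
by exists b1 => // b b0 bb; have [Fs FsE] := H b b0 bb; exists Fs => y /FsE[].
Qed.

Lemma rho_model x0 : ldom iota psi phi x0 ->
  exists2 b1 : R, 0 < b1 <= e1 & forall b (b0 : 0 < b), b <= b1 ->
    exists s : smf (obox (ocube x0 b0) b0),
    [/\ forall y, obox (ocube x0 b0) b0 y -> 0 < s y,
        forall x, ocube x0 b0 x -> s (pt x 0) = 1 &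
        forall y, obox (ocube x0 b0) b0 y -> 0 <= hgt y -> rho_loc rho psi y = hgt y * s y].
Proof.
move=> lx; have [rsm _ _ _] := rhoP; have [cx dx] := lx.
have [bW [bW0 [G [Gi [Gs GGi [G1 G3] gE Wphi]]]]] :=
  metric_model aphi n0 gP (cto_cod dx).
have [b1 /andP[b10 b1e] H1] := local_model n0 e10 emb Ymin apsi aphi Wphi gE Gs lx erefl.
have [b2 /andP[b20 b2e] H2] := U_model lx.
have [b3 /andP[b30 b3e] H3] := smooth_on_Y_model rsm cx.
pose b := Num.min b1 (Num.min b2 b3).
have b0 : 0 < b by rewrite !lt_min b10 b20.
have [bb1 bb2 bb3] : [/\ b <= b1, b <= b2 & b <= b3].
  by split; rewrite /b !ge_min lexx ?orbT.
have [F [UV [N [HN FP]]]] := H1 b b0 bb1.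
have [Us UsE Uodd] := H2 b b0 bb2.
have [P PE] := H3 b b0 bb3.
have [q Pq q1] := defining_quotient Gs G1 G3 gE Wphi UV FP UsE Uodd PE.
have x0b := cube_opt x0 b0.
have xB : obox (ocube x0 b0) b0 (pt x0 0) by apply: box_pt; rewrite ?normr0.
have : \forall y \near pt x0 0, 0 < q y.
  have qc := smf_continuous (f := q) xB; apply: (qc [set t | 0 < t]); apply: open_nbhs_nbhs; split; first exact: open_gt.
  by rewrite /= q1.
move=> /nbhs_obox[b4 b40 H4]; exists (Num.min b b4).
  by rewrite lt_min b0 b40 /= ge_min (le_trans bb1 b1e).
move=> b' b'0; rewrite le_min => /andP[bb bb4]; exists (sres (box_le (b0 := b'0) b0 bb) q).
have sub := box_le (x := x0) (b0 := b'0) b0 bb.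
split=> [y yb|x xb|y yb y0]; first by rewrite sresE //; exact: (H4 b' b'0 bb4).
- rewrite sresE; last by apply: box_pt; rewrite ?normr0.
  by apply: q1 => j; exact: lt_le_trans (xb j) bb.
have yb0 := sub y yb; have := PE y yb0 y0; rewrite -/(rho_loc rho psi y) => ->.
by rewrite Pq smfM // srE // sresE.
Qed.
End defining_functions.

(** * The coefficients of order two and four in geometric terms *)

Section frame_gjms.
Context {R : realType} {k n : nat} (V0 : odom R k) (e : R) (e0 : 0 < e).
Context (W0 : odom R n) (e' : R) (e0' : 0 < e').
Local Notation A := (smf (obox V0 e0)).
Local Notation B := (smf V0).
Local Notation C := (smf (obox W0 e0')).
Local Notation half := (scst 2^-1).
Variable E : 'I_n -> A.
Hypothesis UV : forall y, obox V0 e0 y -> obox W0 e0' (\row_i emap E i y).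
Hypothesis E1 : forall i, co 1 (E i) = 0.
Hypothesis E3 : forall i, co 3 (E i) = 0.
Variables (g gi : 'M[C]_n).
Hypothesis gsym : g^T = g.
Hypothesis ggi : g *m gi = 1%:M.
Hypothesis g1 : cmx 1 g = 0.
Hypothesis g3 : cmx 3 g = 0.
Local Notation d_ := (@sDa R _ V0).
Local Notation X := (Xm E).
Local Notation U := (Ur E).
Local Notation gH := (gh UV g).
Local Notation gamH := (gamh UV g).
Variable hi : 'M[B]_k.
Local Notation h := (X *m gH *m X^T).
Hypothesis hhi : h *m hi = 1%:M.
Hypothesis UX : X *m gH *m U^T = 0.
Local Notation cdr := (cdr UV g gi).
Hypothesis HU : \sum_a \sum_b hi a b *: LL d_ half X gH hi cdr b a = (2%:R * k%:R) *: U.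
Local Notation H := (Hbar UV g).
Variable N : 'M[A]_(k + 1).
Hypothesis HN : H *m N = 1%:M.
Local Notation p := (pmx X gH cdr gamH U).
Local Notation aa := (aH gH U).
Local Notation sg := (sig2 half X gH hi gamH U).
Local Notation br := (bracket d_ half X gH hi cdr gamH U (nabU UV g gi) (delh UV g)
  (Ar UV g gi) (RU UV g gi)).
Local Notation dS := (divS d_ half X gH hi).
Local Notation LF c1 c2 F Q := (Lop (@sDa R _ (obox V0 e0)) half (sr V0 e0) H N (scst c1) (scst c2) F Q).

Let hs : h^T = h. Proof. exact: (frame_sym X (gh_sym UV gsym)). Qed.

Lemma dvE w : dv h hi w = dS w.
Proof. exact: esym (div_formula (@sDaM R _ V0) (half2 V0) hs hhi w). Qed.

Let trp : \tr (hi *m p) = - Jt X hi gamH - k%:R * aa.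
Proof.
have dg := cdr_gh UV gsym ggi; have nU := normal_U gsym UX.
exact: (@tr_p _ _ _ d_ _ (half2 V0) _ _ _ _ (gh_sym UV gsym) dg (cdr_torsion UV gi gsym) gamH _ HU nU).
Qed.

Let H0 : cmx 0 H = block_mx h 0 0 1%:M. Proof. exact: (cmx0_Hbar UV E1 E3 g1 g3). Qed.
Let H1 : cmx 1 H = 0. Proof. exact: (cmx1_Hbar E1 E3 g1 g3 UX). Qed.
Let H2 : cmx 2 H = block_mx p 0 0 aa%:M.
Proof. by rewrite (cmx2_Hbar UV E1 E3 g1 g3) (Hh2_pmx UV E1 E3 gsym ggi g1 g3) Ha2_aH. Qed.
Let cv : 'M[B]_(k, 1) := \col_a cvec X gH cdr gamH U (Ar UV g gi) a.
Let H3 : cmx 3 H = block_mx 0 cv cv^T 0.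
Proof.
rewrite (cmx3_Hbar UV E1 E3 g1 g3); have -> // : cmx 3 (Hc UV g) = cv.
by apply/matrixP => a j; rewrite ord1 (Hc3_cvec UV E1 E3 gsym ggi g1 g3) mxE.
Qed.
Local Notation q := (qmx half X gH cdr gamH U (nabU UV g gi) (delh UV g) (Ar UV g gi) (RU UV g gi)).
Let H4 : cmx 4 H = block_mx q (cmx 4 (Hc UV g)) (cmx 4 (Hc UV g))^T (bsc gH gamH U (Ar UV g gi))%:M.
Proof.
rewrite cmx4_Hbar (Hh4_qmx UV E1 E3 gsym ggi g1 g3).
by rewrite (Ha4_bsc UV E1 E3 gsym ggi g1 g3).
Qed.
Let ps : p^T = p.
Proof.
rewrite /pmx; have gs := gh_sym UV gsym; have gas := gamh_sym UV gsym.
by rewrite !linearD /= !trmx_mul3 !trmxK gs gas [X in _ + X]addrC.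
Qed.

Lemma order_one c1 c2 F Q : co 1 (LF c1 c2 F Q) = scst c1 * co 1 F.
Proof. exact: (L1 HN hhi H0 H1). Qed.

(** For [m = k / 2 - l] the constants of [Lop] are [c1 = 1 - 2 l] and [c2 = k / 2 + l]; the critical
    ones, [1 - k] and [k], agree with these when [k = 2 l]. The lemma thus serves both cases. *)
Lemma order_two c1 c2 F Q : c1 = -1 -> c2 = k%:R / 2 + 1 ->
  co 2 (LF c1 c2 F Q) = dS (fun x => d_ x (co 0 F)) - co 0 Q * Q2r half X gH hi gamH U.
Proof.
move=> c1E c2E; rewrite (L2 HN hhi H0 H1 H2) dvE trp.
have -> : scst c1 = -1 :> B by rewrite c1E rmorphN1.
have -> : scst c2 = half * k%:R + 1 :> B by rewrite c2E rmorphD rmorphM rmorph_nat rmorph1 mulrC.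
rewrite /Q2r; have hh := half2 V0; set J := Jt _ _ _; set s := dS _.
have -> : - J - k%:R * aa + (half * k%:R + 1 - 1) * aa = - (J + half * k%:R * aa) +
   ((half + half) - 1) * k%:R * aa by ring.
by rewrite hh; ring.
Qed.

(** The value [c1 = -3] forces the first coefficient of [F] to vanish. The premise relating [Q] to
    [F] holds for [Q = m F] as well as for [Q = 1], so that the critical dimension needs no separate
    computation. *)
Lemma order_four c1 c2 F Q : c1 = -3 -> c2 = k%:R / 2 + 2 ->
  (forall j, (j < 4)%N -> co j (LF c1 c2 F Q) = 0) -> (co 1 F = 0 -> co 1 Q = 0) ->
  4%:R * co 2 F = dS (fun a => d_ a (co 0 F)) + co 0 Q * sg /\
  co 4 (LF c1 c2 F Q) = 2%:R * (\tr (hi *m p) + aa) * co 2 F + dS (fun a => d_ a (co 2 F))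
    - dS (fun a => \sum_y (p *m hi) a y * d_ y (co 0 F))
    + half * (\sum_y d_ y (\tr (hi *m p) + aa) * \sum_a hi a y * d_ a (co 0 F))
    + co 0 Q * br + co 2 Q * sg.
Proof.
move=> c1E c2E L0 MF.
have e1 : scst c1 = - 3%:R :> B by rewrite c1E rmorphN rmorph_nat.
have e2 : scst c2 = half * k%:R + 2%:R :> B by rewrite c2E rmorphD rmorphM !rmorph_nat mulrC.
have sgE : \tr (hi *m p) + (scst c2 - 1) * aa = sg.
  by rewrite trp e2 /sig2; move: (Jt _ _ _) (aH _ _) => J a; ring.
have F1 : co 1 F = 0.
  have := L0 1 isT; rewrite order_one e1 => /eqP; rewrite mulNr oppr_eq0 => /eqP h3.
  by apply: (@smf_natI _ _ _ 2); rewrite mulr0.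
have Q1 := MF F1; split.
  have := L0 2 isT; rewrite (L2 HN hhi H0 H1 H2) dvE sgE e1 => z.
  by rewrite -[LHS]addr0 -[X in _ + X]z; move: (dS _) => s; ring.
rewrite (L4 HN hs hhi ps H0 H1 H2 H3 H4) // !dvE sgE; congr (_ + _ * _ + _).
rewrite e2 /bracket; have -> : dS (cv^~ 0) = dS (cvec X gH cdr gamH U (Ar UV g gi)).
  by apply: eq_bigr => a _; apply: eq_bigr => b _; congr (_ * (d_ b _ - _));
    [rewrite mxE|apply: eq_bigr => c _; rewrite mxE].
have -> : 2%:R - (half * k%:R + 2%:R) = - (half * k%:R) :> B by ring.
by rewrite mulNr.
Qed.

End frame_gjms.

Section local_data.
Context {R : realType} {k n : nat} {S : manifold (R := R) k} {M : manifold (R := R) n}.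
Variables (g : riemannian_metric M) (gr : R -> riemannian_metric M) (iota : S -> M).
Variables (e1 : R) (E : S -> R -> M) (rho : S -> R -> R).
Variables (psi : chart R S k) (phi : chart R M n) (x0 : 'rV[R]_k).
Local Notation half := (scst 2^-1).

(** Everything the computation at a point requires on one box, gathered so that the box can be
    chosen small enough for the solution of the boundary problem as well. *)
Record local_data (b : R) (b0 : 0 < b) := LocalData {
  ld_z : 'rV[R]_n; ld_bW : R; ld_bW0 : 0 < ld_bW;
  ld_G : 'M[smf (obox (ocube ld_z ld_bW0) ld_bW0)]_n;
  ld_Gi : 'M[smf (obox (ocube ld_z ld_bW0) ld_bW0)]_n;
  ld_F : 'I_n -> smf (obox (ocube x0 b0) b0);
  ld_UV : forall y, obox (ocube x0 b0) b0 y -> obox (ocube ld_z ld_bW0) ld_bW0 (\row_i emap ld_F i y);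
  ld_N : 'M[smf (obox (ocube x0 b0) b0)]_(k + 1);
  ld_hi : 'M[smf (ocube x0 b0)]_k;
  ld_s : smf (obox (ocube x0 b0) b0);
  ld_Gs : ld_G^T = ld_G;
  ld_GGi : ld_G *m ld_Gi = 1%:M;
  ld_G1 : cmx 1 ld_G = 0;
  ld_G3 : cmx 3 ld_G = 0;
  ld_GD : forall y, ocube ld_z ld_bW0 y -> g phi y = mev y (cmx 0 ld_G);
  ld_dom : forall x, ocube x0 b0 x -> ldom iota psi phi x;
  ld_map : forall x, ocube x0 b0 x -> lmap iota psi phi x = \row_i X0 ld_F i x;
  ld_E1 : forall i, co 1 (ld_F i) = 0;
  ld_E3 : forall i, co 3 (ld_F i) = 0;
  ld_UX : Xm ld_F *m gh ld_UV ld_G *m (Ur ld_F)^T = 0;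
  ld_hhi : Xm ld_F *m gh ld_UV ld_G *m (Xm ld_F)^T *m ld_hi = 1%:M;
  ld_HU : \sum_a \sum_c ld_hi a c *: LL (@sDa R _ (ocube x0 b0)) half (Xm ld_F)
    (gh ld_UV ld_G) ld_hi (cdr ld_UV ld_G ld_Gi) c a = (2%:R * k%:R) *: Ur ld_F;
  ld_HN : Hbar ld_UV ld_G *m ld_N = 1%:M;
  ld_hplus : forall y, pbox (ocube x0 b0) b0 y -> hplus gr E psi phi y =
    mev y (sw (ocube x0 b0) b0 ^+ 2 *: map_mx (@res R k (ocube x0 b0) b b0) (Hbar ld_UV ld_G));
  ld_s0 : forall y, obox (ocube x0 b0) b0 y -> 0 < ld_s y;
  ld_s1 : forall x, ocube x0 b0 x -> ld_s (pt x 0) = 1;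
  ld_rho : forall y, obox (ocube x0 b0) b0 y -> 0 <= hgt y -> rho_loc rho psi y = hgt y * ld_s y;
  ld_Q1 : forall i j, co 1 (PQ (@sDa R _ (obox (ocube ld_z ld_bW0) ld_bW0)) half
    (sr (ocube ld_z ld_bW0) ld_bW0) ld_G ld_Gi (lshift 1 i) (lshift 1 j)) = 0;
  ld_Q0 : n <> 4%N -> forall a c j, (j < 4)%N ->
    co j (PQ (@sDa R _ (obox (ocube ld_z ld_bW0) ld_bW0)) half
      (sr (ocube ld_z ld_bW0) ld_bW0) ld_G ld_Gi a c) = 0 }.

Lemma local_data_exists (e0 : R) U :
  (3 <= n)%N -> (1 <= k)%N -> 0 < e1 -> embedding iota -> even_poincare g e0 gr ->
  even_minimal_extension g gr iota e1 U E -> defining_function g gr iota e1 E rho ->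
  atlas psi -> atlas phi -> ldom iota psi phi x0 ->
  exists2 b1 : R, 0 < b1 <= e1 & forall b (b0 : 0 < b), b <= b1 -> inhabited (local_data b0).
Proof.
move=> n3 k1 e10 emb gP Ymin rhoP apsi aphi lx; have [cx dx] := lx.
have n0 : (0 < n)%N by exact: leq_trans n3.
have [bW [bW0 [G [Gi [Gs GGi [G1 G3] gE Wphi]]]]] := metric_model aphi n0 gP (cto_cod dx).
have [b1 /andP[b10 b1e] H1] := local_model n0 e10 emb Ymin apsi aphi Wphi gE Gs lx erefl.
have [b2 /andP[b20 b2e] H2] := U_model n3 e10 Ymin apsi aphi lx.
have [b3 /andP[b30 b3e] H3] := rho_model n3 k1 e10 emb gP Ymin rhoP apsi aphi lx.
exists (Num.min b1 (Num.min b2 b3)); first by rewrite !lt_min b10 b20 b30 ge_min b1e.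
move=> b b0; rewrite !le_min => /and3P[bb1 bb2 bb3].
have [F [UV [N [HN FP]]]] := H1 b b0 bb1.
have [Us UsE Uodd] := H2 b b0 bb2.
have [s [s0 s1 rhoE]] := H3 b b0 bb3.
have [hi hhi] := local_hi n3 e10 emb gP Ymin apsi aphi gE Wphi UV FP.
split; apply: (@LocalData b b0 _ bW bW0 G Gi F UV N hi s) => //.
- exact: (local_GD gP aphi gE Wphi).
- exact: (local_ldom n3 e10 Ymin FP).
- exact: (local_lmap n3 e10 Ymin FP).
- exact: (local_E1 n3 e10 Ymin aphi FP UsE Uodd).
- exact: (local_E3 n3 e10 Ymin aphi FP UsE Uodd).
- exact: (local_UX n3 e10 gP Ymin apsi aphi Gs gE Wphi UV FP UsE Uodd).
- exact: (local_HU n3 k1 e10 gP Ymin apsi aphi Gs GGi G1 G3 gE Wphi HN FP UsE Uodd hhi).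
- exact: (local_hplus Gs gE UV FP).
- exact: (local_Q1 n3 gP aphi Gs GGi gE Wphi).
exact: (local_Q0 n3 gP aphi Gs GGi gE Wphi).
Qed.
End local_data.
Arguments ld_GD {R k n S M g gr iota E rho psi phi x0 b b0} l [y] _.
Arguments ld_dom {R k n S M g gr iota E rho psi phi x0 b b0} l [x] _.
Arguments ld_map {R k n S M g gr iota E rho psi phi x0 b b0} l [x] _.
Arguments ld_hplus {R k n S M g gr iota E rho psi phi x0 b b0} l [y] _.
Arguments ld_s0 {R k n S M g gr iota E rho psi phi x0 b b0} l [y] _.
Arguments ld_s1 {R k n S M g gr iota E rho psi phi x0 b b0} l [x] _.
Arguments ld_rho {R k n S M g gr iota E rho psi phi x0 b b0} l [y] _ _.

Section local_formulas.
Context {R : realType} {k n : nat} {S : manifold (R := R) k} {M : manifold (R := R) n}.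
Variables (g : riemannian_metric M) (gr : R -> riemannian_metric M) (iota : S -> M).
Variables (e1 : R) (E : S -> R -> M) (rho : S -> R -> R).
Variables (psi : chart R S k) (phi : chart R M n).
Hypotheses (apsi : atlas psi) (aphi : atlas phi).
Hypotheses (n3 : (3 <= n)%N) (k1 : (1 <= k)%N).
Variables (x0 : 'rV[R]_k) (b : R) (b0 : 0 < b).
Variable d : local_data g gr iota E rho psi phi x0 b0.
Local Notation V0 := (ocube x0 b0).
Local Notation A := (smf (obox V0 b0)).
Local Notation B := (smf V0).
Local Notation half := (scst 2^-1).
Local Notation H := (Hbar (ld_UV d) (ld_G d)).
Local Notation N := (ld_N d).
Local Notation X := (Xm (ld_F d)).
Local Notation gH := (gh (ld_UV d) (ld_G d)).
Local Notation gamH := (gamh (ld_UV d) (ld_G d)).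
Local Notation lm := (lmap iota psi phi).
Local Notation h := (pullback (g phi) lm).
Local Notation dS := (divS (@sDa R _ V0) half X gH (ld_hi d)).
Local Notation sg := (sig2 half X gH (ld_hi d) gamH (Ur (ld_F d))).

Let Hsym : H^T = H.
Proof. by rewrite -(HbarE _ (ld_Gs d)) trmx_mul3 trmxK tr_block_mx !trmx0 trmx1 (evm_sym _ (ld_Gs d)). Qed.

Let rlE y : pbox V0 b0 y -> rho_loc rho psi y = hgt y * ld_s d y.
Proof.
move=> Vy; apply: (ld_rho d); first exact: pbox_box.
by case: Vy => _ /andP[/ltW].
Qed.

Let box x : V0 x -> obox V0 b0 (pt x 0).
Proof. by move=> Vx; apply: box_pt; rewrite ?normr0. Qed.

Let lapE (f : 'rV[R]_k -> R) (fs : B) x : (forall y, V0 y -> f y = fs y) -> V0 x ->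
  laplacian h f x = dS (fun a => sDa a fs) x.
Proof. exact: (laplacian_smf (ld_hhi d) (ld_GD d) (ld_map d)). Qed.

Let Q2E x : V0 x -> Q2_formula (g phi) lm x = Q2r half X gH (ld_hi d) gamH (Ur (ld_F d)) x.
Proof.
exact: (Q2_formula_smf (ld_Gs d) (ld_GGi d) (ld_G1 d) (ld_hhi d) (ld_GD d) (ld_map d) k1
  (ld_HU d) n3 (ld_Q1 d)).
Qed.

Let d00 a : sDa a (0 : B) = 0. Proof. exact: raddf0. Qed.
Let dS_const w : (forall a, w a = 0) -> dS w = 0.
Proof.
move=> w0; apply: big1 => a _; apply: big1 => c _; rewrite w0 big1 => [|e _]; last by rewrite w0 mulr0.
by rewrite d00 subr0 mulr0.
Qed.
Let dS_zero (f : B) : f = 0 -> dS (fun a => sDa a f) = 0.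
Proof. by move=> ->; exact: (dS_const d00). Qed.
Let e4 (t : B) x : V0 x -> (4%:R * t) x = 4 * t x.
Proof. by move=> Vx; rewrite smfM // smf_nat. Qed.

Section gjms_values.
Variables (l : nat) (f : S -> R) (Fr : S -> R -> R) (c : S -> R).
Hypothesis val : gjms_value gr iota e1 E rho l f Fr c.
Variable Fs : A.
Hypothesis FsE : forall y, obox V0 b0 y -> 0 <= hgt y -> Fr (cof psi (base y)) (hgt y) = Fs y.
Local Notation m := (k%:R / 2 - l%:R).
Local Notation Lx := (Lexp H N (ld_s0 d) m Fs).
Local Notation Fx := (Ft (ld_s0 d) m Fs).

Let gxE y : pbox V0 b0 y -> gjms_expr gr E rho l Fr psi phi y = hgt y `^ m * Lx y.
Proof.
move=> Vy; have FE z : pbox V0 b0 z -> Fr (cof psi (base z)) (hgt z) = Fs z.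
  by move=> Vz; apply: FsE; [exact: pbox_box|case: Vz => _ /andP[/ltW]].
rewrite -(gjms_smooth Hsym (ld_HN d) (ld_hplus d) (ld_s0 d) rlE m FE Vy) /gjms_expr.
by congr (_ + _ * _); field.
Qed.

Lemma gjms_value_low j : (j < 2 * l)%N -> co j Lx = 0.
Proof.
move=> jl; have [_ _ /(_ psi phi apsi aphi)[bO _]] := val.
apply: smf_ext => x Vx; rewrite smf0 //.
apply: (gjms_order rlE erefl gxE) => //; exact: (boundaryO_at bO (ld_dom d Vx)).
Qed.

Lemma gjms_value_top x : V0 x -> co (2 * l) Lx x = gjms_const l * c (cof psi x).
Proof.
move=> Vx; have [_ _ /(_ psi phi apsi aphi)[_ /(_ x (ld_dom d Vx)) lim]] := val.
apply: (gjms_limit (ld_s1 d) rlE erefl gxE Vx).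
  by move=> j jl; rewrite gjms_value_low // smf0.
by apply: cvg_trans lim; apply: near_eq_cvg; near=> r; rewrite /rho_loc base_pt hgt_pt.
Unshelve. all: by end_near. Qed.

Lemma gjms_value_boundary x : V0 x -> co 0 Fx x = f (cof psi x).
Proof.
move=> Vx; have [_ F0 _] := val; have xB := box Vx.
rewrite co0 sliceE // smfM // spowE // (ld_s1 d) // powR1 mul1r -FsE ?hgt_pt ?lexx //.
by rewrite base_pt F0.
Qed.
End gjms_values.

Lemma gjms_const1 : gjms_const 1 = -1 :> R.
Proof. by rewrite /gjms_const subnn muln0 expr1 expr0 fact0 expr1n !mulr1 invrN1. Qed.

Lemma gjms_const2 : gjms_const 2 = 4^-1 :> R.
Proof. rewrite /gjms_const (_ : (2 - 1)`! = 1)%N // muln1 expr1n mulr1 sqrrN expr1n mul1r.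
by rewrite -natrX. Qed.

Lemma P2_local f Fr c (Fs : A) x : gjms_value gr iota e1 E rho 1 f Fr c ->
  (forall y, obox V0 b0 y -> 0 <= hgt y -> Fr (cof psi (base y)) (hgt y) = Fs y) -> V0 x ->
  let fx := fun y => f (cof psi y) in
  c (cof psi x) = - laplacian h fx x + (k%:R - 2) / 2 * Q2_formula (g phi) lm x * fx x.
Proof.
move=> val FsE Vx fx; have := gjms_value_top val FsE Vx.
rewrite /Lexp (order_two (ld_E1 d) (ld_E3 d) (ld_Gs d) (ld_GGi d) (ld_G1 d) (ld_G3 d) (ld_hhi d)
  (ld_UX d) (ld_HU d) (ld_HN d)); [|by field|by field].
rewrite gjms_const1 mulN1r => /eqP; rewrite -eqr_oppLR => /eqP <-.
rewrite co_cstM smfB // smfM // smfM // scstE // -Q2E // (gjms_value_boundary val FsE Vx).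
rewrite -(lapE (f := fx)) //; last by move=> y Vy; rewrite (gjms_value_boundary val FsE Vy).
by rewrite /fx; field.
Qed.

Section critical_values.
Variables (Ar : S -> R -> R) (Q : S -> R).
Hypothesis A0 : forall p, Ar p 0 = 0.
Hypothesis bO : boundaryO (ldom iota psi phi) (critical_expr gr E rho Ar psi phi)
  (fun y => rho_loc rho psi y ^+ k).
Hypothesis lim : forall x, ldom iota psi phi x ->
  (fun r => rho (cof psi x) r ^- k * critical_expr gr E rho Ar psi phi (pt x r)) @ 0^'+
    --> gjms_const k./2 * Q (cof psi x).
Variable As : A.
Hypothesis AsE : forall y, obox V0 b0 y -> 0 <= hgt y -> Ar (cof psi (base y)) (hgt y) = As y.
Local Notation Lx := (Lcrit H N (ld_s0 d) As).

Let gxE y : pbox V0 b0 y -> critical_expr gr E rho Ar psi phi y = Lx y.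
Proof.
move=> Vy; have AE z : pbox V0 b0 z -> Ar (cof psi (base z)) (hgt z) = As z.
  by move=> Vz; apply: AsE; [exact: pbox_box|case: Vz => _ /andP[/ltW]].
by rewrite -(critical_smooth Hsym (ld_HN d) (ld_hplus d) (ld_s0 d) rlE AE Vy).
Qed.

Lemma critical_low j : (j < k)%N -> co j Lx = 0.
Proof.
move=> jl; apply: smf_ext => x Vx; rewrite smf0 //.
apply: (critical_order rlE gxE) => //; exact: (boundaryO_at bO (ld_dom d Vx)).
Qed.

Lemma critical_top j x : k = j -> V0 x -> co j Lx x = gjms_const j./2 * Q (cof psi x).
Proof.
move=> <- Vx; apply: (critical_limit (ld_s1 d) rlE gxE Vx).
  by move=> i ik; rewrite critical_low // smf0.
apply: cvg_trans (lim (ld_dom d Vx)).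
by apply: near_eq_cvg; near=> r; rewrite /rho_loc base_pt hgt_pt.
Unshelve. all: by end_near. Qed.

(** The logarithm of [s] vanishes on the boundary because [s = 1] there; the change of defining
    function is absorbed into [A]. *)
Lemma critical_boundary : co 0 (sln (ld_s0 d) + As) = 0.
Proof.
apply: smf_ext => x Vx; have xB := box Vx.
rewrite smf0 // co0 sliceE // smfD // slnE // (ld_s1 d) // ln1 add0r -AsE ?hgt_pt ?lexx //.
Qed.

Lemma critical_Q2_local x : k = 2%N -> V0 x -> Q (cof psi x) = Q2_formula (g phi) lm x.
Proof.
move=> k2 Vx; have := critical_top k2 Vx; rewrite /= gjms_const1 /Lcrit.
rewrite (order_two (ld_E1 d) (ld_E3 d) (ld_Gs d) (ld_GGi d) (ld_G1 d) (ld_G3 d) (ld_hhi d)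
  (ld_UX d) (ld_HU d) (ld_HN d)); [|by rewrite k2; ring|by rewrite k2; field].
rewrite (dS_zero critical_boundary).
by rewrite add0r co_1 mul1r smfN // -Q2E // mulN1r => /oppr_inj.
Qed.

Hypothesis n4 : n <> 4%N.

(** Here the boundary value is zero and [4 F2 = sig2], so the fourth coefficient is a quarter of the
    right side of [Q4_identity] at [m = 0]; the constant [1 / 4] of [gjms_const2] accounts for the
    quarter. *)
Lemma critical_Q4_local x : k = 4%N -> V0 x -> Q (cof psi x) = Q4_formula (g phi) lm x.
Proof.
move=> k4 Vx; have := critical_top k4 Vx; rewrite /= gjms_const2 /Lcrit.
have c1E : 1 - k%:R = -3 :> R by rewrite k4; ring.
have c2E : k%:R = k%:R / 2 + 2 :> R by rewrite k4; field.
have [||e2 ->] := order_four (ld_E1 d) (ld_E3 d) (ld_Gs d) (ld_GGi d) (ld_G1 d) (ld_G3 d) (ld_hhi d)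
  (ld_UX d) (ld_HU d) (ld_HN d) (F := sln (ld_s0 d) + As) (Q := 1) c1E c2E.
- by move=> j j4; apply: critical_low; rewrite k4.
- by rewrite co_1.
have F0 := critical_boundary; move: e2; rewrite (dS_zero F0) add0r co_1 mul1r => F2E.
set F2 := co 2 (sln _ + _) in F2E *.
rewrite F0 [X in _ - X](dS_const _) => [|a]; last by rewrite big1 // => y _; rewrite d00 mulr0.
rewrite subr0 (_ : \sum_y _ * \sum_a _ * sDa a 0 = 0); last first.
  by rewrite big1 // => y _; rewrite big1 ?mulr0 // => a _; rewrite d00 mulr0.
rewrite mulr0 addr0 !co_1 mul1r mul0r addr0.
have kR : k%:R = 4%:R :> R by rewrite k4.
(* In dimension [k = 4] the constant [m] is zero. *)
have m0 : 0 = half * k%:R - 2%:R :> B 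
  by apply: smf_ext => y Vy; rewrite smfB // smfM // scstE // !smf_nat // smf0 // kR; field.
have -> := Q4_formula_expansion (ld_Gs d) (ld_GGi d) (ld_G1 d) (ld_G3 d) (ld_hhi d) (ld_UX d)
  (ld_GD d) (ld_map d) k1 (ld_HU d) n3 (ld_Q1 d) n4 (ld_Q0 d n4) m0 Vx.
have -> : dS (fun a => sDa a sg) = 4%:R * dS (fun a => sDa a F2).
  rewrite -divS_natZ; apply: divS_ext => a.
  by rewrite -F2E /= sDM sD_nat mul0r add0r.
rewrite -F2E; set br := bracket _ _ _ _ _ _ _ _ _ _ _ _; set s2 := dS _; set tp := \tr _.
set aa := aH _ _ => z.
have -> : 4%:R * s2 + 4%:R * F2 * (2%:R * tp + 2%:R * aa + 0 * (4%:R * F2)) + 4%:R * br =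
  4%:R * (2%:R * (tp + aa) * F2 + s2 + br) by ring.
by rewrite (e4 _ Vx) z; field.
Qed.

End critical_values.

Lemma P4_local f Fr c (Fs : A) x : n <> 4%N -> gjms_value gr iota e1 E rho 2 f Fr c ->
  (forall y, obox V0 b0 y -> 0 <= hgt y -> Fr (cof psi (base y)) (hgt y) = Fs y) -> V0 x ->
  let fx := fun y => f (cof psi y) in
  c (cof psi x) = laplacian h (laplacian h fx) x
    + div_T_grad h (T_formula (g phi) lm) fx x
    + (k%:R - 4) / 2 * Q4_formula (g phi) lm x * fx x.
Proof.
move=> n4 val FsE Vx fx.
have := gjms_value_top val FsE Vx; rewrite gjms_const2.
set m := k%:R / 2 - 2%:R; set F := Ft (ld_s0 d) m Fs.
have c1E : 1 + 2 * m - k%:R = -3 by rewrite /m; field.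
have c2E : k%:R - m = k%:R / 2 + 2 by rewrite /m; field.
rewrite /Lexp; have [||e2 ->] := order_four (ld_E1 d) (ld_E3 d) (ld_Gs d) (ld_GGi d) (ld_G1 d) (ld_G3 d)
  (ld_hhi d) (ld_UX d) (ld_HU d) (ld_HN d) (F := F) (Q := scst m * F) c1E c2E.
- exact: (gjms_value_low val FsE).
- by move=> F1; rewrite co_cstM F1 mulr0.
move: e2; rewrite !co_cstM => e2.
have fE y : V0 y -> fx y = co 0 F y by move=> Vy; rewrite /fx (gjms_value_boundary val FsE Vy).
have := P4_formula_expansion (ld_Gs d) (ld_GGi d) (ld_G1 d) (ld_G3 d) (ld_hhi d) (ld_UX d)
  (ld_GD d) (ld_map d) k1 (ld_HU d) n3 (ld_Q1 d) n4 (ld_Q0 d n4) (erefl m) Vx e2.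
rewrite (e4 _ Vx) => hP z.
have -> : c (cof psi x) = 4 * (4^-1 * c (cof psi x)) by field.
rewrite -z -hP (fE x Vx).
have lE y : V0 y -> laplacian h fx y = laplacian h (co 0 F) y.
  by move=> Vy; rewrite (lapE fE Vy) (lapE (fs := co 0 F) (fun _ _ => erefl) Vy).
have lfE y : V0 y -> laplacian h (co 0 F) y = dS (fun a => sDa a (co 0 F)) y.
  by move=> Vy; rewrite (lapE (fs := co 0 F) (fun _ _ => erefl) Vy).
have TE := T_formula_smf (ld_Gs d) (ld_GGi d) (ld_G1 d) (ld_hhi d) (ld_GD d) (ld_map d) k1 (ld_HU d)
  n3 (ld_Q1 d).
rewrite (div_T_grad_smf (ld_hhi d) (ld_GD d) (ld_map d) TE fE Vx).
rewrite (div_T_grad_smf (ld_hhi d) (ld_GD d) (ld_map d) TE (fun _ _ => erefl) Vx).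
rewrite (lapE (fs := dS (fun a => sDa a (co 0 F)))) //.
rewrite [in RHS](lapE (fs := dS (fun a => sDa a (co 0 F)))) //; last first.
  by move=> y Vy; rewrite lE // lfE.
by congr (_ + _ + _ * _ * _); rewrite /m; field.
Qed.
End local_formulas.

(** * Constant functions and the values of the operators *)

Section constant_functions.
Context {R : realType} {k : nat} (S : manifold (R := R) k).

Lemma smooth_fun_cst (c : R) : smooth_fun (fun _ : S => c).
Proof.
move=> psi _ x cx; exists (ccod psi), (fun=> c); split => //; first exact: ccod_open.
by move=> N; apply: class_C_cst; exact: ccod_open.
Qed.

Lemma pd_cst_fun d (c : R) i (x : 'rV[R]_d) : pd i (fun=> c) x = 0.
Proof. exact: derive_cst. Qed.

Lemma divergence_zero d (G : 'rV[R]_d -> 'M[R]_d) (w : 'I_d -> 'rV[R]_d -> R) x :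
  (forall a y, w a y = 0) -> divergence G w x = 0.
Proof.
move=> w0; have -> : w = fun _ _ => 0 by apply/funext => a; apply/funext => y; exact: w0.
rewrite /divergence big1 // => a _; rewrite big1 // => c _.
rewrite pd_cst_fun big1 => [|e _]; last by rewrite mulr0.
by rewrite subr0 mulr0.
Qed.

Lemma laplacian_cst d (G : 'rV[R]_d -> 'M[R]_d) (c : R) x : laplacian G (fun=> c) x = 0.
Proof. by apply: divergence_zero => a y; exact: pd_cst_fun. Qed.

Lemma div_T_grad_cst d (G T : 'rV[R]_d -> 'M[R]_d) (c : R) x : div_T_grad G T (fun=> c) x = 0.
Proof.
apply: divergence_zero => a y; rewrite big1 // => i _; rewrite big1 // => j _.
by rewrite pd_cst_fun mulr0.
Qed.
End constant_functions.

Section formulas_at_a_point.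
Context {R : realType} {n k : nat} {M : manifold (R := R) n} {S : manifold (R := R) k}.
Variables (g : riemannian_metric M) (iota : S -> M) (e0 : R) (gr : R -> riemannian_metric M).
Variables (e1 : R) (U : chart R M n -> S -> R -> 'rV[R]_n) (E : S -> R -> M) (rho : S -> R -> R).
Hypothesis n3 : (3 <= n)%N.
Hypothesis k1 : (1 <= k)%N.
Hypothesis e10 : 0 < e1.
Hypothesis emb : embedding iota.
Hypothesis gP : even_poincare g e0 gr.
Hypothesis Ymin : even_minimal_extension g gr iota e1 U E.
Hypothesis rhoP : defining_function g gr iota e1 E rho.
Variables (psi : chart R S k) (phi : chart R M n) (x : 'rV[R]_k).
Hypotheses (apsi : atlas psi) (aphi : atlas phi) (lx : ldom iota psi phi x).
Local Notation lm := (lmap iota psi phi).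
Local Notation h := (pullback (g phi) lm).

(** The geometric data and the function [F] are smooth on boxes of unrelated sizes; both are taken
    on the smaller one. *)
Lemma common_model (F : S -> R -> R) : smooth_on_Y e1 F ->
  exists b (b0 : 0 < b) (_ : local_data g gr iota E rho psi phi x b0)
    (Fs : smf (obox (ocube x b0) b0)), forall y, obox (ocube x b0) b0 y -> 0 <= hgt y ->
      F (cof psi (base y)) (hgt y) = Fs y.
Proof.
move=> sF; have [b1 /andP[b10 _] H1] := local_data_exists n3 k1 e10 emb gP Ymin rhoP apsi aphi lx.
have [b2 /andP[b20 _] H2] := smooth_on_Y_model e10 apsi sF lx.1.
have b0 : 0 < Num.min b1 b2 by rewrite lt_min b10.
have [] := H1 _ b0 _; first by rewrite ge_min lexx.
have [|Fs FsE d] := H2 _ b0 _; first by rewrite ge_min lexx orbT.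
by exists (Num.min b1 b2), b0, d, Fs.
Qed.

Lemma P2_value f F c : gjms_value gr iota e1 E rho 1 f F c ->
  let fx := fun y => f (cof psi y) in
  c (cof psi x) = - laplacian h fx x + (k%:R - 2) / 2 * Q2_formula (g phi) lm x * fx x.
Proof.
move=> val; have [sF _ _] := val; have [b [b0 [d [Fs FsE]]]] := common_model sF.
exact: (P2_local apsi aphi n3 k1 d val FsE (cube_opt x b0)).
Qed.

Lemma P4_value f F c : n <> 4%N -> gjms_value gr iota e1 E rho 2 f F c ->
  let fx := fun y => f (cof psi y) in
  c (cof psi x) = laplacian h (laplacian h fx) x
    + div_T_grad h (T_formula (g phi) lm) fx x
    + (k%:R - 4) / 2 * Q4_formula (g phi) lm x * fx x.
Proof.
move=> n4 val; have [sF _ _] := val; have [b [b0 [d [Fs FsE]]]] := common_model sF.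
exact: (P4_local apsi aphi n3 k1 d n4 val FsE (cube_opt x b0)).
Qed.

(** For [k = 2] the critical construction applies; otherwise [Q] is read off from the operator on
    the constant [1], the factor [k / 2 - 1] being nonzero. *)
Lemma Q2_value P Q : gjms_operator gr iota e1 E rho 1 P -> gjms_Q gr iota e1 E rho 1 P Q ->
  Q (cof psi x) = Q2_formula (g phi) lm x.
Proof.
move=> PP; rewrite /gjms_Q; case: eqP => [k2|k2 QE].
  move=> [A [sA A0 /(_ psi phi apsi aphi)[bO lim]]]; have [b [b0 [d [As AsE]]]] := common_model sA.
  exact: (critical_Q2_local n3 k1 d A0 bO lim AsE (esym k2) (cube_opt x b0)).
have [F val] := PP _ (smooth_fun_cst 1); have := P2_value val; cbv zeta.
rewrite QE laplacian_cst oppr0 add0r mulr1.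
have -> : k%:R / 2 - 1 = (k%:R - 2) / 2 :> R by field.
by apply: mulfI; rewrite mulf_neq0 // ?invr_eq0 ?pnatr_eq0 // subr_eq0 eqr_nat; apply/eqP => kk; apply: k2; rewrite kk.
Qed.

Lemma Q4_value P Q : n <> 4%N ->
  gjms_operator gr iota e1 E rho 2 P -> gjms_Q gr iota e1 E rho 2 P Q ->
  Q (cof psi x) = Q4_formula (g phi) lm x.
Proof.
move=> n4 PP; rewrite /gjms_Q; case: eqP => [k4|k4 QE].
  move=> [A [sA A0 /(_ psi phi apsi aphi)[bO lim]]]; have [b [b0 [d [As AsE]]]] := common_model sA.
  exact: (critical_Q4_local n3 k1 d A0 bO lim AsE n4 (esym k4) (cube_opt x b0)).
have [F val] := PP _ (smooth_fun_cst 1); have := P4_value n4 val; cbv zeta.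
have -> : laplacian h (fun=> 1) = fun=> 0 by apply/funext => y; exact: laplacian_cst.
rewrite QE laplacian_cst div_T_grad_cst !add0r mulr1.
have -> : k%:R / 2 - 2 = (k%:R - 4) / 2 :> R by field.
by apply: mulfI; rewrite mulf_neq0 // ?invr_eq0 ?pnatr_eq0 // subr_eq0 eqr_nat; apply/eqP => kk; apply: k4; rewrite kk.
Qed.
End formulas_at_a_point.

Theorem theorem5p2 (R : realType) (n k : nat)
  (M : manifold (R := R) n) (S : manifold (R := R) k)
  (g : riemannian_metric M) (iota : S -> M)
  (e0 : R) (gr : R -> riemannian_metric M)
  (e1 : R) (U : chart R M n -> S -> R -> 'rV[R]_n) (E : S -> R -> M)
  (rho : S -> R -> R)
  (n_ge3 : (3 <= n)%N) (k_ge1 : (1 <= k)%N) (k_le : (k <= n - 1)%N)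
  (iota_emb : embedding iota)
  (gr_poincare : even_poincare g e0 gr)
  (e1_range : 0 < e1 <= e0)
  (Y_minimal : even_minimal_extension g gr iota e1 U E)
  (rho_def : defining_function g gr iota e1 E rho) :
  (forall (P2 : (S -> R) -> S -> R) (Q2 : S -> R),
     gjms_operator gr iota e1 E rho 1 P2 ->
     gjms_Q gr iota e1 E rho 1 P2 Q2 ->
     forall (psi : chart R S k) (phi : chart R M n) (x : 'rV[R]_k),
     atlas psi -> atlas phi -> ldom iota psi phi x ->
     let h := pullback (g phi) (lmap iota psi phi) in
     Q2 (cof psi x) = Q2_formula (g phi) (lmap iota psi phi) x /\
     (forall f : S -> R, smooth_fun f ->
        let fx := fun y => f (cof psi y) in
        P2 f (cof psi x) =
          - laplacian h fx x + (k%:R - 2) / 2 * Q2 (cof psi x) * fx x)) /\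
  (n <> 4%N ->
   forall (P4 : (S -> R) -> S -> R) (Q4 : S -> R),
     gjms_operator gr iota e1 E rho 2 P4 ->
     gjms_Q gr iota e1 E rho 2 P4 Q4 ->
     forall (psi : chart R S k) (phi : chart R M n) (x : 'rV[R]_k),
     atlas psi -> atlas phi -> ldom iota psi phi x ->
     let h := pullback (g phi) (lmap iota psi phi) in
     Q4 (cof psi x) = Q4_formula (g phi) (lmap iota psi phi) x /\
     (forall f : S -> R, smooth_fun f ->
        let fx := fun y => f (cof psi y) in
        P4 f (cof psi x) =
          laplacian h (laplacian h fx) x
          + div_T_grad h (T_formula (g phi) (lmap iota psi phi)) fx x
          + (k%:R - 4) / 2 * Q4 (cof psi x) * fx x)).
Proof.
case/andP: e1_range => e10 _; split.
  move=> P2 Q2 PP QP psi phi x apsi aphi lx h.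
  have QE := Q2_value n_ge3 k_ge1 e10 iota_emb gr_poincare Y_minimal rho_def apsi aphi lx PP QP.
  split=> // f sf fx; have [F val] := PP f sf; rewrite QE.
  exact: (P2_value n_ge3 k_ge1 e10 iota_emb gr_poincare Y_minimal rho_def apsi aphi lx val).
move=> n4 P4 Q4 PP QP psi phi x apsi aphi lx h.
have QE := Q4_value n_ge3 k_ge1 e10 iota_emb gr_poincare Y_minimal rho_def apsi aphi lx n4 PP QP.
split=> // f sf fx; have [F val] := PP f sf; rewrite QE.
exact: (P4_value n_ge3 k_ge1 e10 iota_emb gr_poincare Y_minimal rho_def apsi aphi lx n4 val).
Qed.
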